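(* Let $E$ be a solid TIBF of bounded type on $\mathbb{R}^d$. Let $\mathcal{V}=(v_n)_{n\in\mathbb{N}}$ and $\mathcal{W}=(w_n)_{n\in\mathbb{N}}$ be weight function systems on $\mathbb{R}^d$, each satisfying $(\mathrm{wM})$ (for $\mathcal{W}$: for every $n\in\mathbb{N}$ there exist $m\ge n$ and $C>0$ such that $w_n(x+y)\le C w_m(x)$ for all $x\in\mathbb{R}^d$ and $|y|\le1$; likewise for $\mathcal{V}$). Then $$\mathcal{O}_C'(\mathcal{K}^1_{\mathcal{V}},E_{\mathcal{W}})=\mathcal{O}_C'(\mathcal{D},E_{\mathcal{W}})$$ (where the left-hand side is regarded as a subspace of the right-hand side via the embedding $f\mapsto f|_{\mathcal{D}}$) if and only if $\mathcal{W}$ is $\mathcal{V}$-moderate, i.e., for each $n\in\mathbb{N}$ there exist $m\ge n$ and $C>0$ such that $w_n(x+y)\le C\,w_m(x)\,v_m(y)$ for all $x,y\in\mathbb{R}^d$.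
   Context: $\mathbb{N}=\{0,1,2,\dots\}$; $\mathcal{D}$ is the space of compactly supported smooth functions on $\mathbb{R}^d$, $\mathcal{D}'$ the space of distributions; $T_xf(t)=f(t-x)$; $\check f(t)=f(-t)$. Solid TIBF of bounded type: a Banach space $(E,\|\cdot\|_E)$ is a translation-invariant Banach function space (TIBF) of bounded type on $\mathbb{R}^d$ if $E$ is non-trivial, $E\subseteq L^1_{\mathrm{loc}}(\mathbb{R}^d)$ continuously, and: (A.1) $T_xE\subseteq E$ for all $x\in\mathbb{R}^d$; (A.2) there is $C_0>0$ with $\|T_xf\|_E\le C_0\|f\|_E$ for all $x\in\mathbb{R}^d$, $f\in E$; (A.3) $E$ is a Banach module over $L^1(\mathbb{R}^d)$ under convolution ($\|f*\varphi\|_E\le\|f\|_E\|\varphi\|_{L^1}$). It is solid if $f\in E$, $g\in L^1_{\mathrm{loc}}(\mathbb{R}^d)$ and $|g|\le|f|$ a.e. imply $g\in E$ and $\|g\|_E\le\|f\|_E$. A weight function is a locally bounded measurable function $\mathbb{R}^d\to[1,\infty)$; a weight function system is a sequence $\mathcal{W}=(w_n)_{n\in\mathbb{N}}$ of weight functions with $w_n\le w_{n+1}$ for all $n$. $E_{\mathcal{W}}:=\{f\in L^1_{\mathrm{loc}}(\mathbb{R}^d): f w_n\in E \text{ for all } n\in\mathbb{N}\}$ with the Fréchet topology given by the norms $\|fw_n\|_E$. $\mathcal{K}^1_{\mathcal{V}}$ is the Fréchet space of all $f\in\mathcal{D}'$ such that for every $n\in\mathbb{N}$ and $|\alpha|\le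 n$, $f^{(\alpha)}v_n\in L^1(\mathbb{R}^d)$, topologized by the norms $\max_{|\alpha|\le n}\|f^{(\alpha)}v_n\|_{L^1}$; $\mathcal{K}^1_{\check{\mathcal{V}}}$ is the same space built with $\check{\mathcal{V}}=(\check v_n)_n$. Convolutor spaces: $\mathcal{O}_C'(\mathcal{D},E_{\mathcal{W}}):=\{f\in\mathcal{D}': f*\varphi\in E_{\mathcal{W}}\text{ for all }\varphi\in\mathcal{D}\}$. For $f\in(\mathcal{K}^1_{\check{\mathcal{V}}})'$ and $\varphi\in\mathcal{K}^1_{\mathcal{V}}$ put $f*\varphi(x):=\langle f,T_x\check\varphi\rangle$, and $\mathcal{O}_C'(\mathcal{K}^1_{\mathcal{V}},E_{\mathcal{W}}):=\{f\in(\mathcal{K}^1_{\check{\mathcal{V}}})': f*\varphi\in E_{\mathcal{W}}\text{ for all }\varphi\in\mathcal{K}^1_{\mathcal{V}}\}$. Since $\mathcal{D}$ is dense in $\mathcal{K}^1_{\check{\mathcal{V}}}$, restriction $f\mapsto f|_{\mathcal{D}}$ embeds $\mathcal{O}_C'(\mathcal{K}^1_{\mathcal{V}},E_{\mathcal{W}})$ into $\mathcal{O}_C'(\mathcal{D},E_{\mathcal{W}})$. *)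

(* Defs.v *)
From HB Require Import structures.
From mathcomp Require Import all_boot all_order all_algebra.
From mathcomp Require Import all_classical all_reals all_analysis.
From mathcomp.real_closed Require Import complex.

Set Implicit Arguments.
Unset Strict Implicit.
Unset Printing Implicit Defensive.

Import Order.TTheory GRing.Theory Num.Theory.
Import numFieldNormedType.Exports.
Import Normc.

Local Open Scope classical_set_scope.
Local Open Scope ring_scope.
Local Open Scope complex_scope.

(* The product sigma-algebra on row vectors, generated by the coordinates (the
   Borel sigma-algebra when T is R), after the instance for [n.-tuple T]. *)
Definition measure_rV_display : measure_display -> measure_display.
Proof. exact. Qed.

Section measurable_rV.
Context {disp : measure_display} {T : measurableType disp}.
Variable n : nat.

Let coors : 'I_n -> 'rV[T]_n -> T := fun i x => x ord0 i.

Let rV_set0 : g_sigma_preimage coors set0.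
Proof. exact: sigma_algebra0. Qed.

Let rV_setC A : g_sigma_preimage coors A -> g_sigma_preimage coors (~` A).
Proof. exact: sigma_algebraC. Qed.

Let rV_bigcup (F : (set 'rV[T]_n)^nat) :
  (forall i, g_sigma_preimage coors (F i)) ->
  g_sigma_preimage coors (\bigcup_i F i).
Proof. exact: sigma_algebra_bigcup. Qed.

HB.instance Definition _ := @isMeasurable.Build (measure_rV_display disp)
  'rV[T]_n (g_sigma_preimage coors) rV_set0 rV_setC rV_bigcup.

End measurable_rV.

Lemma measurable_coord disp (T : measurableType disp) n (i : 'I_n) :
  measurable_fun [set: 'rV[T]_n] (fun x => x ord0 i).
Proof.
move=> _ Y mY; rewrite setTI; apply: sub_sigma_algebra => /=.
rewrite -bigcup_seq/=; exists i => /=; first by rewrite mem_index_enum.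
by exists Y => //; rewrite setTI.
Qed.

Lemma measurable_fun_rV disp1 disp2 (T1 : measurableType disp1)
    (T2 : measurableType disp2) n (f : T1 -> 'rV[T2]_n) :
  (forall i, measurable_fun [set: T1] (fun x => f x ord0 i)) ->
  measurable_fun [set: T1] f.
Proof.
move=> mf.
suff prefS : g_sigma_preimage (fun i => (fun v : 'rV[T2]_n => v ord0 i) \o f)
    `<=` measurable.
  rewrite g_sigma_preimage_comp in prefS.
  by move=> _ A mA; apply: prefS; exists A.
apply: smallest_sub; first exact: sigma_algebra_measurable.
case: n => [|n] in f mf *; first by rewrite big_ord0.
rewrite -bigcup_mkord_ord; apply: bigcup_sub => i Ii.
by move=> A [B mB <-]; exact: mf.
Qed.

Section rV_cons.
Context {R : realType}.
Variable n : nat.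

Definition rV_cons (p : measurableTypeR R * 'rV[R]_n) : 'rV[R]_n.+1 :=
  \row_i (if unlift ord0 i is Some j then p.2 ord0 j else p.1).

Definition rV_uncons (v : 'rV[R]_n.+1) : measurableTypeR R * 'rV[R]_n :=
  (v ord0 ord0, \row_j v ord0 (lift ord0 j)).

Lemma rV_consK : cancel rV_cons rV_uncons.
Proof.
case=> x v; rewrite /rV_uncons /rV_cons/= mxE unlift_none; congr pair.
by apply/rowP => j; rewrite !mxE liftK.
Qed.

Lemma measurable_rV_cons : measurable_fun setT rV_cons.
Proof.
apply: measurable_fun_rV => i; rewrite /rV_cons.
under eq_fun do rewrite mxE.
case: unliftP => [j _|_]; last exact: measurable_fst.
apply: (measurableT_comp (measurable_coord j)); exact: measurable_snd.
Qed.

Lemma measurable_rV_uncons : measurable_fun setT rV_uncons.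
Proof.
apply: measurable_fun_pair; first exact: measurable_coord.
apply: measurable_fun_rV => i; under eq_fun do rewrite mxE.
exact: measurable_coord.
Qed.

End rV_cons.

Section lebesgue_rV_step.
Context {R : realType}.
Variables (n : nat) (mu : {sigma_finite_measure set 'rV[R]_n -> \bar R}).

Definition lebesgue_rV_step : set 'rV[R]_n.+1 -> \bar R :=
  pushforward (lebesgue_measure \x mu)%E (@rV_cons R n).

Let step0 : lebesgue_rV_step set0 = 0%E.
Proof. by apply: measure0; exact: measurable_rV_cons. Qed.

Let step_ge0 A : (0 <= lebesgue_rV_step A)%E.
Proof. by apply: measure_ge0; exact: measurable_rV_cons. Qed.

Let step_sigma_additive : semi_sigma_additive lebesgue_rV_step.
Proof. 
by apply: measure_semi_sigma_additive; exact: measurable_rV_cons. Qed.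

HB.instance Definition _ := isMeasure.Build _ _ _ lebesgue_rV_step
  step0 step_ge0 step_sigma_additive.

Let step_sigma_finite : sigma_finite setT lebesgue_rV_step.
Proof.
have /sigma_finiteP[F [TF ndF Foo]] := sigma_finiteT (@lebesgue_measure R).
have /sigma_finiteP[G [TG ndG Goo]] := sigma_finiteT mu.
exists (fun k => (@rV_uncons R n) @^-1` (F k `*` G k)).
  rewrite -preimage_bigcup (_ : \bigcup_i _ = setT) ?preimage_setT//.
  apply/seteqP; split=> // -[x y] _.
  have [i _ Fix] : (\bigcup_i F i) x by rewrite -TF.
  have [j _ Gjy] : (\bigcup_i G i) y by rewrite -TG.
  exists (maxn i j) => //; split => /=.
    by move: x Fix; apply/subsetPset/ndF/leq_maxl.
  by move: y Gjy; apply/subsetPset/ndG/leq_maxr.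
move=> k; have [mF Fk] := Foo k; have [mG Gk] := Goo k; split.
  rewrite -[X in measurable X]setTI; apply: measurable_rV_uncons => //.
  exact: measurableX.
rewrite /lebesgue_rV_step /pushforward -comp_preimage.
rewrite (_ : _ \o _ = id) ?preimage_id; last exact/funext/rV_consK.
by rewrite product_measure1E// lte_mul_pinfty// ge0_fin_numE.
Qed.

HB.instance Definition _ :=
  Measure_isSigmaFinite.Build _ _ _ lebesgue_rV_step step_sigma_finite.

End lebesgue_rV_step.

(* Lebesgue measure on (the Borel sets of) R^n, as the n-fold product of the
   Lebesgue measure on R; it is the unit mass of the point when n = 0. *)
Fixpoint lebesgue_rV (R : realType) (n : nat) :
    {sigma_finite_measure set 'rV[R]_n -> \bar R} :=
  match n with
  | 0 => \d_(0 : 'rV[R]_0)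
  | n.+1 => lebesgue_rV_step (lebesgue_rV R n)
  end.

Section functions.
Context {R : realType} {d : nat}.
Local Notation Rd := 'rV[R]_d.
Local Notation mu := (lebesgue_rV R d).
Implicit Types (f g : Rd -> R[i]) (w : Rd -> R).

Definition translate (x : Rd) f : Rd -> R[i] := fun t => f (t - x).

Definition reflect {T : Type} (f : Rd -> T) : Rd -> T := fun t => f (- t).

Definition weighted w f : Rd -> R[i] := fun x => f x * (w x)%:C.

Definition enorm (x : Rd) : R := Num.sqrt (\sum_(i < d) x ord0 i ^+ 2).

(* [mu] lives on the Borel sets: a function is measurable for the completed
   sigma-algebra iff it agrees with a Borel function off a null set.  The
   integral of such a function against [mu] is that of its Borel version. *)
Definition lebesgue_measurable (w : Rd -> R) : Prop :=
  exists2 w', measurable_fun [set: Rd] w' & w = w' %[ae mu].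

Definition cmeasurable f : Prop :=
  lebesgue_measurable (fun x => complex.Re (f x)) /\
  lebesgue_measurable (fun x => complex.Im (f x)).

Definition cintegral f : R[i] :=
  (\int[mu]_x complex.Re (f x)) +i* (\int[mu]_x complex.Im (f x)).

Definition L1 f : Prop :=
  cmeasurable f /\ (\int[mu]_x (normc (f x))%:E < +oo)%E.

Definition L1norm f : R := \int[mu]_x normc (f x).

Definition L1loc f : Prop :=
  cmeasurable f /\
  forall K : set Rd, compact K -> (\int[mu]_(x in K) (normc (f x))%:E < +oo)%E.

Definition convolution f g : Rd -> R[i] :=
  fun x => cintegral (fun y => f (x - y) * g y).

Definition partial_deriv (i : 'I_d) f : Rd -> R[i] := fun x =>
  ('D_(delta_mx ord0 i) (fun y => complex.Re (f y)) x) +i*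
  ('D_(delta_mx ord0 i) (fun y => complex.Im (f y)) x).

Definition smooth f : Prop :=
  forall (s : seq 'I_d) (g := foldr partial_deriv f s),
  [/\ continuous (fun x => complex.Re (g x)), continuous (fun x => complex.Im (g x)) &
      forall (i : 'I_d) (x : Rd),
        derivable (fun y => complex.Re (g y)) x (delta_mx ord0 i) /\
        derivable (fun y => complex.Im (g y)) x (delta_mx ord0 i)].

Definition tsupport f : set Rd := closure [set x | f x != 0].

Definition test_function : set (Rd -> R[i]) :=
  [set f | smooth f /\ compact (tsupport f)].

Definition multiindex := 'I_d -> nat.

Definition mi_order (a : multiindex) : nat := (\sum_(i < d) a i)%N.

Definition mi_deriv (a : multiindex) f : Rd -> R[i] :=
  foldr (fun i => iter (a i) (partial_deriv i)) f (enum 'I_d).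

(* Maximum over all multi-indices of order at most n: the components of such a
   multi-index are at most n, so that it suffices to let the index range over a
   finite type. *)
Definition max_order (n : nat) (F : multiindex -> R) : R :=
  \big[Num.max/0]_(a : {ffun 'I_d -> 'I_n.+1}
                     | (mi_order (fun i => a i) <= n)%N) F (fun i => a i).

(* Functionals are total functions on [Rd -> R[i]]; only their values on the
   space under consideration matter. *)
Definition functional := (Rd -> R[i]) -> R[i].

Definition linear_on (X : set (Rd -> R[i])) (T : functional) : Prop :=
  forall (c : R[i]) f g, X f -> X g ->
    T (fun x => c * f x + g x) = c * T f + T g.

Definition sup_norm f : R := sup (range (fun x => normc (f x))).

Definition distribution (T : functional) : Prop :=
  linear_on test_function T /\
  forall K : set Rd, compact K -> exists (N : nat) (C : R),
    forall f, test_function f -> tsupport f `<=` K ->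
      normc (T f) <= C * max_order N (fun a => sup_norm (mi_deriv a f)).

Definition regular g : functional := fun p => cintegral (fun x => g x * p x).

Definition distr_deriv (a : multiindex) (T : functional) : functional :=
  fun p => (-1) ^+ mi_order a * T (mi_deriv a p).

(* f^(a) = g in the sense of distributions, locally integrable functions being
   identified with regular distributions. *)
Definition weak_deriv_of (a : multiindex) f g : Prop :=
  [/\ L1loc f, L1loc g &
      {in test_function, distr_deriv a (regular f) =1 regular g}].

(* f^(a), determined almost everywhere, when it is a function. *)
Definition weak_deriv (a : multiindex) f : Rd -> R[i] :=
  xget (fun=> 0) [set g | weak_deriv_of a f g].

Definition conv_functional (T : functional) (p : Rd -> R[i]) : Rd -> R[i] :=
  fun x => T (translate x (reflect p)).

(* A space E of classes of functions is given by the set of all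
   representatives of its elements, and its norm by a function on the
   representatives; the conditions [bfs_ae_mem] and [bfs_ae_norm] express
   invariance under almost everywhere equality. *)
Record banach_function_space (E : set (Rd -> R[i]))
    (nE : (Rd -> R[i]) -> R) : Prop := BanachFunctionSpace {
  bfs_L1loc : forall f, E f -> L1loc f ;
  bfs_ae_mem : forall f g, E f -> f = g %[ae mu] -> E g ;
  bfs_ae_norm : forall f g, E f -> f = g %[ae mu] -> nE g = nE f ;
  bfs_mem0 : E (fun=> 0) ;
  bfs_memD : forall f g, E f -> E g -> E (fun x => f x + g x) ;
  bfs_memZ : forall (c : R[i]) f, E f -> E (fun x => c * f x) ;
  bfs_norm_ge0 : forall f, E f -> 0 <= nE f ;
  bfs_norm_eq0 : forall f, E f -> nE f = 0 -> f = (fun=> 0) %[ae mu] ;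
  bfs_normD : forall f g, E f -> E g ->
    nE (fun x => f x + g x) <= nE f + nE g ;
  bfs_normZ : forall (c : R[i]) f, E f ->
    nE (fun x => c * f x) = normc c * nE f ;
  bfs_complete : forall u : (Rd -> R[i])^nat, (forall n, E (u n)) ->
    (forall e : R, 0 < e -> exists N : nat, forall m n : nat,
      (N <= m)%N -> (N <= n)%N -> nE (fun x => u m x - u n x) < e) ->
    exists2 f, E f & nE (fun x => u n x - f x) @[n --> \oo] --> (0 : R) ;
  bfs_continuous : forall K : set Rd, compact K -> exists C : R,
    forall f, E f -> (\int[mu]_(x in K) (normc (f x))%:E <= (C * nE f)%:E)%E
}.

Record TIBF_bounded_type (E : set (Rd -> R[i]))
    (nE : (Rd -> R[i]) -> R) : Prop := TIBFBoundedType {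
  tibf_bfs : banach_function_space E nE ;
  tibf_nontrivial : exists2 f, E f & ~ (f = (fun=> 0) %[ae mu]) ;
  tibf_A1 : forall x f, E f -> E (translate x f) ;
  tibf_A2 : exists2 C0 : R, 0 < C0 &
    forall x f, E f -> nE (translate x f) <= C0 * nE f ;
  tibf_A3 : forall f p, E f -> L1 p ->
    E (convolution f p) /\ nE (convolution f p) <= nE f * L1norm p
}.

Definition solid (E : set (Rd -> R[i])) (nE : (Rd -> R[i]) -> R) : Prop :=
  forall f g, E f -> L1loc g -> {ae mu, forall x, normc (g x) <= normc (f x)} ->
    E g /\ nE g <= nE f.

Definition weight_function w : Prop :=
  [/\ forall x, 1 <= w x,
      forall x : Rd, exists M : R, \forall y \near x, w y <= M &
      lebesgue_measurable w].

Definition weight_system (W : nat -> Rd -> R) : Prop :=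
  (forall n, weight_function (W n)) /\ (forall n x, W n x <= W n.+1 x).

Definition wM (W : nat -> Rd -> R) : Prop :=
  forall n, exists (m : nat) (C : R), [/\ (n <= m)%N, 0 < C &
    forall x y, enorm y <= 1 -> W n (x + y) <= C * W m x].

(* W is V-moderate. *)
Definition moderate (V W : nat -> Rd -> R) : Prop :=
  forall n, exists (m : nat) (C : R), [/\ (n <= m)%N, 0 < C &
    forall x y, W n (x + y) <= C * W m x * V m y].

Definition weighted_space (E : set (Rd -> R[i])) (W : nat -> Rd -> R) :
    set (Rd -> R[i]) :=
  [set f | L1loc f /\ forall n, E (weighted (W n) f)].

(* Already for n = 0 the condition says that f is an integrable function, so
   that the distributions in this space are given by functions (modulo almost
   everywhere equality). *)
Definition K1 (V : nat -> Rd -> R) : set (Rd -> R[i]) :=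
  [set f | L1loc f /\ forall (n : nat) (a : multiindex), (mi_order a <= n)%N ->
    exists2 g, weak_deriv_of a f g & L1 (weighted (V n) g)].

Definition K1norm (V : nat -> Rd -> R) (n : nat) f : R :=
  max_order n (fun a => L1norm (weighted (V n) (weak_deriv a f))).

Definition K1_dual (V : nat -> Rd -> R) : set functional :=
  [set T | linear_on (K1 V) T /\
    exists (n : nat) (C : R), forall f, K1 V f ->
      normc (T f) <= C * K1norm V n f].

Definition OC_D (E : set (Rd -> R[i])) (W : nat -> Rd -> R) : set functional :=
  [set T | distribution T /\
    forall p, test_function p -> weighted_space E W (conv_functional T p)].

Definition OC_K1 (V : nat -> Rd -> R) (E : set (Rd -> R[i]))
    (W : nat -> Rd -> R) : set functional :=
  [set T | K1_dual (fun n => reflect (V n)) T /\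
    forall p, K1 V p -> weighted_space E W (conv_functional T p)].

(* Functionals are compared through their values on test functions, hence
   without the constraint that T and S agree elsewhere. *)
Definition restrict_to_D (X : set functional) : set functional :=
  [set T : functional | exists2 S, X S & {in test_function, T =1 S}].

End functions.

(* Main.v *)
(* Moderateness is necessary: if it fails at n, choose x_k, y_k with
   w_n(x_k + y_k) > (k+1) 4^k w_(n+k)(x_k) v_(n+k)(y_k) and put
   a_k = 2^-k / w_(n+k)(x_k), b_k = 2^-k / v_(n+k)(y_k).  Then T = sum_k a_k delta_(x_k)
   is a convolutor on D and phi = sum_k b_k rho(. - y_k) is in K^1_V for a bump rho,
   but T * phi is at least a_k b_k near x_k + y_k, so that the norm of w_m (T * phi)
   in E, for w_m dominating the unit translates of w_n, is at least a multiple of k.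

   Moderateness is sufficient: for a convolutor T on D, a Baire argument bounds
   the norm of w_n (T * phi) in E by finitely many derivatives of phi, uniformly
   for phi supported in a fixed cube.  A partition of unity, the Sobolev embedding
   W^{d,1} in L^infty and moderateness turn this into bounds of T and of T * phi
   by the norms of K^1_V.  To extend T without proving that D is dense, put
   S(phi) = lim_j T(chi_j (phi * psi_j)) for cutoffs chi_j and mollifiers psi_j:
   since psi_N - psi_K is a sum of derivatives of kernels of small L^1 norm, the
   sequence is Cauchy as soon as one more derivative of phi is integrable. *)
From HB Require Import structures.
Require Import Defs.
From mathcomp Require Import all_boot all_order all_algebra.
From mathcomp Require Import all_classical all_reals all_analysis.
From mathcomp Require Import measurable_realfun ring lra.
From mathcomp.real_closed Require Import complex.
Set Implicit Arguments.
Unset Strict Implicit.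
Unset Printing Implicit Defensive.
Import Order.TTheory GRing.Theory Num.Theory.
Import numFieldNormedType.Exports.
Import Normc HBNNSimple.
Local Open Scope classical_set_scope.
Local Open Scope ring_scope.
Local Open Scope complex_scope.

(** * Lebesgue measure and integrals *)

(** Necessity rests on positivity: all terms of T * phi are nonnegative, so a single term bounds the
    sum from below, and the indicator of a cube has a positive norm in E that translations change by
    a bounded factor only. The factors 2^-k in a_k and b_k buy summability against every weight at
    once, since the k-th term is measured with index n + k; together they cost 4^-k, which the
    choice of x_k and y_k repays. As phi is not a test function, the given extension of T is
    evaluated on phi through its continuity. For sufficiency the obstacle is that a convolutor comes
    with no bound at all. Lattice pieces moved back to the origin are supported in one cube, so one
    bound serves all of them. Putting a piece back at k costs w_n(x) <= C w_m(x - k) v_m(k), which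
    is moderateness, and the Sobolev embedding replaces suprema by local integrals that add up over
    the lattice. The measure lives on Borel sets while functions are Borel only up to null sets, so
    integral identities pass through Borel representatives. *)

Section integral_general.
Context {disp : measure_display} {T : measurableType disp} {R : realType}.
Variable mu : {measure set T -> \bar R}.
Implicit Types f g : T -> \bar R.
Local Open Scope ereal_scope.

(** The integral of a nonnegative function is a supremum over the simple functions below it, and
    enlarging the function enlarges the index set. *)
Lemma ge0_le_integralT f g : (forall x, 0 <= f x) -> (forall x, f x <= g x) ->
  \int[mu]_x f x <= \int[mu]_x g x.
Proof.
move=> f0 fg; have g0 x : 0 <= g x by exact: le_trans (fg x).
rewrite !ge0_integralTE//; apply: le_ereal_sup => _ /= [h hf <-].
by exists h => // x; exact: le_trans (fg x).
Qed.

Lemma ge0_ae_le_integralT f g : (forall x, 0 <= f x) -> (forall x, 0 <= g x) ->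
  {ae mu, forall x, f x <= g x} -> \int[mu]_x f x <= \int[mu]_x g x.
Proof.
move=> f0 g0 [N [mN N0 fgN]].
rewrite !ge0_integralTE//; apply: ge_ereal_sup => _ /= [h hf <-].
(* Cutting [h] off on the null set keeps its integral and puts it below [g] everywhere. *)
pose h' := proj_nnsfun h (measurableC mN).
have h'E x : h' x = (h x * \1_(~` N) x)%R by [].
rewrite -(integralT_nnsfun mu h).
have -> : \int[mu]_x (h x)%:E = \int[mu]_x (h' x)%:E.
  apply: ae_eq_integral => //; [exact/measurable_EFinP|exact/measurable_EFinP|].
  exists N; split=> // x; apply: contra_notP => Nx _; congr EFin.
  by rewrite h'E indicE mem_set// mulr1.
rewrite integralT_nnsfun; apply: ereal_sup_ubound; exists h' => // x.
rewrite h'E indicE; case: (boolP (x \in ~` N)) => xN; last by rewrite mulr0.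
rewrite mulr1; apply: le_trans (hf x) _; apply: contrapT => nfg.
by move: xN; rewrite inE; apply; exact: fgN.
Qed.

Lemma ge0_ae_eq_integralT f g : (forall x, 0 <= f x) -> (forall x, 0 <= g x) ->
  {ae mu, forall x, f x = g x} -> \int[mu]_x f x = \int[mu]_x g x.
Proof.
move=> f0 g0 fg; apply/eqP; rewrite eq_le; apply/andP; split.
  by apply: ge0_ae_le_integralT => //; apply: filterS fg => x ->.
by apply: ge0_ae_le_integralT => //; apply: filterS fg => x ->.
Qed.

Lemma ae_eq_integralT f g : {ae mu, forall x, f x = g x} ->
  \int[mu]_x f x = \int[mu]_x g x.
Proof.
move=> fg; rewrite [LHS]integralE [RHS]integralE; congr (_ - _);
  apply: ge0_ae_eq_integralT => //; apply: filterS fg => x fgx; rewrite ?funeposE ?funenegE fgx//.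
Qed.

Lemma ge0_integral_preserving (phi : T -> T) f : measurable_fun setT phi ->
  (forall A, measurable A -> mu (phi @^-1` A) = mu A) ->
  measurable_fun setT f -> (forall x, 0 <= f x) ->
  \int[mu]_x f (phi x) = \int[mu]_x f x.
Proof.
move=> mphi pres mf f0.
have := ge0_integral_pushforward mphi mu measurableT mf (fun x _ => f0 x).
rewrite preimage_setT => <-.
by apply: eq_measure_integral => A mA _; exact: pres.
Qed.

End integral_general.

(** * Tonelli's theorem and invariance of Lebesgue measure on R^n *)

Section rV_integral.
Context {R : realType}.
Local Open Scope ereal_scope.

Lemma measurable_addr (a : R) :
  measurable_fun [set: measurableTypeR R] (fun t : R => (t + a)%R : measurableTypeR R).
Proof. exact: measurable_funD. Qed.

Lemma lebesgue_measureDr (a : R) (A : set R) : measurable A ->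
  pushforward (@lebesgue_measure R) (fun t : R => (t + a)%R : measurableTypeR R) A = lebesgue_measure A.
Proof.
have mD := measurable_addr a.
pose M := measure_function_pushforward__canonical__measure_function_Measure lebesgue_measure mD.
move=> mA; apply/esym/(@lebesgue_measure_unique R M) => //= _ [[b c]] _ <-.
rewrite /pushforward (_ : _ @^-1` _ = `](b - a)%R, (c - a)%R]%classic).
  by rewrite !lebesgue_measure_itv/= !lte_fin ltrD2r -!EFinB opprB addrA subrK.
by apply/seteqP; split => x /=; rewrite !in_itv/= ltrBlDr lerBrDr.
Qed.

Lemma ge0_integralDr (a : R) (f : measurableTypeR R -> \bar R) :
  measurable_fun setT f -> (forall x, 0 <= f x) ->
  \int[lebesgue_measure]_t f (t + a)%R = \int[lebesgue_measure]_t f t.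
Proof.
apply: (ge0_integral_preserving (measurable_addr a)).
exact: lebesgue_measureDr.
Qed.

Lemma ge0_integralNr (f : measurableTypeR R -> \bar R) :
  measurable_fun setT f -> (forall x, 0 <= f x) ->
  \int[lebesgue_measure]_t f (- t)%R = \int[lebesgue_measure]_t f t.
Proof.
apply: (@ge0_integral_preserving _ _ _ _ (-%R : measurableTypeR R -> measurableTypeR R)).
  exact: oppr_measurable.
exact: lebesgue_measureN.
Qed.

Lemma ge0_integral_rVS n (f : 'rV[R]_n.+1 -> \bar R) :
  measurable_fun setT f -> (forall x, 0 <= f x) ->
  \int[lebesgue_rV R n.+1]_x f x =
  \int[lebesgue_measure]_t \int[lebesgue_rV R n]_v f (rV_cons (t, v)).
Proof.
move=> mf f0.
have mfc : measurable_fun setT (f \o @rV_cons R n).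
  by apply: measurableT_comp => //; exact: measurable_rV_cons.
rewrite -(@fubini_tonelli1 _ _ _ _ _ lebesgue_measure (lebesgue_rV R n) (f \o @rV_cons R n))//; last first.
  by move=> x; exact: f0.
have := ge0_integral_pushforward (@measurable_rV_cons R n)
  (lebesgue_measure \x lebesgue_rV R n) measurableT mf (fun x _ => f0 x).
rewrite preimage_setT => <-; apply: eq_measure_integral => [|mc B mB _].
  exact: measurable_rV_cons.
by [].
Qed.

Lemma measurable_integral_rVS n (f : 'rV[R]_n.+1 -> \bar R) :
  measurable_fun setT f -> (forall x, 0 <= f x) ->
  measurable_fun [set: measurableTypeR R] (fun t => \int[lebesgue_rV R n]_v f (rV_cons (t, v))).
Proof.
move=> mf f0.
apply: (@measurable_fun_fubini_tonelli_F _ _ _ _ _ (lebesgue_rV R n) (f \o @rV_cons R n)); last by move=> x; exact: f0.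
by apply: measurableT_comp => //; exact: measurable_rV_cons.
Qed.

Lemma measurable_rVD n (a : 'rV[R]_n) :
  measurable_fun setT (fun x : 'rV[R]_n => (x + a)%R).
Proof.
apply: measurable_fun_rV => i; under eq_fun do rewrite mxE.
by apply: measurable_funD => //; exact: measurable_coord.
Qed.

Lemma measurable_rVN n : measurable_fun [set: 'rV[R]_n] (fun x => (- x)%R).
Proof.
apply: measurable_fun_rV => i; under eq_fun do rewrite mxE.
by apply: measurable_funN => //; exact: measurable_coord.
Qed.

Lemma rV_consD n (t s : R) (v w : 'rV[R]_n) :
  rV_cons ((t + s)%R : measurableTypeR R, (v + w)%R) = (rV_cons (t, v) + rV_cons (s, w))%R.
Proof. by apply/rowP => i; rewrite !mxE; case: unliftP => // j _; rewrite !mxE. Qed.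

Lemma rV_consN n (t : R) (v : 'rV[R]_n) :
  rV_cons ((- t)%R : measurableTypeR R, (- v)%R) = (- rV_cons (t, v))%R.
Proof. by apply/rowP => i; rewrite !mxE; case: unliftP => // j _; rewrite !mxE. Qed.

Lemma rV_unconsK n : cancel (@rV_uncons R n) (@rV_cons R n).
Proof.
move=> x; apply/rowP => i; rewrite !mxE /=.
by case: unliftP => [j ->|->//]; rewrite mxE.
Qed.

(** Induction on the dimension: Tonelli splits off the first coordinate, where invariance on the
    line applies. Dimension 0 is a single point. *)
Lemma ge0_integral_rVD n (a : 'rV[R]_n) (f : 'rV[R]_n -> \bar R) :
  measurable_fun setT f -> (forall x, 0 <= f x) ->
  \int[lebesgue_rV R n]_x f (x + a)%R = \int[lebesgue_rV R n]_x f x.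
Proof.
elim: n => [|n IH] in a f * => mf f0.
  by apply: eq_integral => x _; congr f; apply/rowP => -[].
have mfD : measurable_fun setT (fun x : 'rV[R]_n.+1 => f (x + a)%R).
  by apply: measurableT_comp => //; exact: measurable_rVD.
rewrite (ge0_integral_rVS mfD (fun x => f0 (x + a)%R)) (ge0_integral_rVS mf f0).
rewrite -[RHS](ge0_integralDr (rV_uncons a).1); last 2 first.
- exact: (measurable_integral_rVS mf).
- by move=> t; exact: integral_ge0.
apply: eq_integral => t _.
rewrite -(IH (rV_uncons a).2 (fun v => f (rV_cons ((t + (rV_uncons a).1)%R : measurableTypeR R, v)))); last 2 first.
- by apply: measurableT_comp => //; apply: measurableT_comp (@measurable_rV_cons R n) _; exact: measurable_pair1.
- by [].
by apply: eq_integral => v _; rewrite rV_consD -surjective_pairing rV_unconsK.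
Qed.

Lemma ge0_integral_rVN n (f : 'rV[R]_n -> \bar R) :
  measurable_fun setT f -> (forall x, 0 <= f x) ->
  \int[lebesgue_rV R n]_x f (- x)%R = \int[lebesgue_rV R n]_x f x.
Proof.
elim: n => [|n IH] in f * => mf f0.
  by apply: eq_integral => x _; congr f; apply/rowP => -[].
have mfN : measurable_fun setT (fun x : 'rV[R]_n.+1 => f (- x)%R).
  by apply: measurableT_comp => //; exact: measurable_rVN.
rewrite (ge0_integral_rVS mfN (fun x => f0 (- x)%R)) (ge0_integral_rVS mf f0).
rewrite -[RHS]ge0_integralNr; last 2 first.
- exact: (measurable_integral_rVS mf).
- by move=> t; exact: integral_ge0.
apply: eq_integral => t _.
rewrite -(IH (fun v => f (rV_cons ((- t)%R : measurableTypeR R, v)))); last 2 first.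
- by apply: measurableT_comp => //; apply: measurableT_comp (@measurable_rV_cons R n) _; exact: measurable_pair1.
- by [].
by apply: eq_integral => v _; rewrite -rV_consN.
Qed.

Lemma ge0_integral_rV_prod n (a : 'I_n -> R -> R) :
  (forall i, measurable_fun setT (a i)) -> (forall i t, 0 <= a i t)%R ->
  \int[lebesgue_rV R n]_x (\prod_i a i (x ord0 i))%:E =
  \prod_(i < n) \int[lebesgue_measure]_t (a i t)%:E.
Proof.
elim: n => [|n IH] in a * => ma a0.
  rewrite big_ord0; under eq_integral do rewrite big_ord0.
  by rewrite integral_cst//= mul1e diracE mem_set.
have mp m (b : 'I_m -> R -> R) : (forall i, measurable_fun setT (b i)) -> measurable_fun setT
   (fun x : 'rV[R]_m => \prod_i b i (x ord0 i))%R.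
  move=> mb; apply: measurable_prod => i _; apply: measurableT_comp => //.
  exact: measurable_coord.
rewrite ge0_integral_rVS//; last 2 first.
- by apply/measurable_EFinP; exact: mp.
- by move=> x; rewrite lee_fin; apply: prodr_ge0.
rewrite big_ord_recl -(IH (fun i => a (lift ord0 i)))//.
rewrite -ge0_integralZr//; last 3 first.
- apply/measurable_EFinP; exact: ma.
- by move=> t _; rewrite lee_fin.
- by apply: integral_ge0 => v _; rewrite lee_fin; apply: prodr_ge0.
apply: eq_integral => t _.
rewrite -ge0_integralZl//; last 3 first.
- by apply/measurable_EFinP; apply: (mp n (fun i => a (lift ord0 i))) => i; exact: ma.
- by move=> v _; rewrite lee_fin; apply: prodr_ge0.
- by rewrite lee_fin.
apply: eq_integral => v _; rewrite big_ord_recl [X in a _ X]mxE unlift_none /= EFinM.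
by congr (_ * EFin _); apply: eq_bigr => i _; rewrite mxE liftK.
Qed.

End rV_integral.

(** * The maximum norm, boxes and cubes *)

Section rV_norm.
Context {R : realType} {n : nat}.
Implicit Types x y : 'rV[R]_n.

Lemma coord_le_norm x i : `|x ord0 i| <= `|x|.
Proof.
rewrite -[leRHS]/(mx_norm x) mx_normrE.
by have := @le_bigmax _ R _ 0 (fun ij : 'I_1 * 'I_n => `|x ij.1 ij.2|) (ord0, i).
Qed.

Lemma rV_norm_le x (r : R) : 0 <= r -> (forall i, `|x ord0 i| <= r) -> `|x| <= r.
Proof.
move=> r0 xr; rewrite -[leLHS]/(mx_norm x) mx_normrE; apply: bigmax_le => // -[i j] _ /=.
by rewrite ord1.
Qed.

Lemma rV_norm_lt x (r : R) : 0 < r -> (forall i, `|x ord0 i| < r) -> `|x| < r.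
Proof.
move=> r0 xr; rewrite -[ltLHS]/(mx_norm x) mx_normrE; apply: bigmax_lt => // -[i j] _ /=.
by rewrite ord1.
Qed.

Lemma norm_delta_mx (i : 'I_n) : `|delta_mx ord0 i : 'rV[R]_n| = 1.
Proof.
apply/eqP; rewrite eq_le; apply/andP; split.
  by apply: rV_norm_le => // j; rewrite mxE eqxx/=; case: (j == i); rewrite ?normr1 ?normr0.
by have := coord_le_norm (delta_mx ord0 i) i; rewrite mxE !eqxx normr1.
Qed.

Lemma measurable_rV_box (c : 'rV[R]_n) (r : R) :
  measurable [set x : 'rV[R]_n | forall i, `|x ord0 i - c ord0 i| < r].
Proof.
rewrite (_ : [set _ | _] = \bigcap_(i in [set: 'I_n])
   ((fun x : 'rV[R]_n => x ord0 i) @^-1` (ball (c ord0 i) r))).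
  apply: fin_bigcap_measurable => // i _; rewrite -[X in measurable X]setTI.
  by apply: measurable_coord => //; exact: measurable_ball.
apply/seteqP; split => x /= h i; first by move=> _; rewrite /ball/= distrC.
by have := h i I; rewrite /ball/= distrC.
Qed.

(** The sigma-algebra is the one generated by the coordinates, so an open set is exhausted by the
    countably many boxes with rational centre and radius [q.2.+1%:R^-1] that it contains. *)
Lemma open_measurable_rV (U : set 'rV[R]_n) : open U -> measurable U.
Proof.
move=> oU.
pose box (q : 'rV[rat]_n * nat) := [set x : 'rV[R]_n | forall i, `|x ord0 i - ratr (q.1 ord0 i)| < q.2.+1%:R^-1].
pose F q := if `[< box q `<=` U >] then box q else set0.
rewrite (_ : U = \bigcup_q F q).
  apply: countable_bigcupT_measurable => // q; rewrite /F; case: ifP => // _.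
  have := measurable_rV_box (\row_i ratr (q.1 ord0 i)) q.2.+1%:R^-1.
  by congr measurable; apply/seteqP; split => x /= h i; have := h i; rewrite mxE.
apply/seteqP; split => [x Ux|x [q _]]; last first.
  by rewrite /F; case: ifP => // /asboolP qU xq; exact: qU.
have /nbhs_ballP[e/= e0 eU] : nbhs x U by exact: open_nbhs_nbhs.
have [k ke] : exists k : nat, k.+1%:R^-1 < e / 2.
  exists (Num.trunc (e / 2)^-1); rewrite invf_plt ?posrE ?divr_gt0//.
  exact: truncnS_gt.
have k0 : (0 : R) < k.+1%:R^-1 by rewrite invr_gt0.
have /choice[q hq] : forall i : 'I_n, exists q : rat, `|x ord0 i - ratr q| < k.+1%:R^-1.
  move=> i; have [|q] := @rat_in_itvoo R (x ord0 i - k.+1%:R^-1) (x ord0 i + k.+1%:R^-1).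
    by rewrite ltrD2l gtrN.
  rewrite in_itv/= => /andP[h1 h2]; exists q.
  by rewrite distrC ltr_distl h1.
exists (\row_i q i, k) => //; rewrite /F ifT; last first.
  apply/asboolP => y /= hy; apply: eU; rewrite -ball_normE /=.
  apply: rV_norm_lt => // i; rewrite !mxE.
  have := hy i; rewrite mxE => hyi; have := hq i.
  rewrite (splitr e) => hxi; apply: le_lt_trans (ler_distD (ratr (q i)) _ _) _.
  by rewrite ltrD// ?(lt_trans hxi)// distrC (lt_trans hyi).
by move=> i /=; rewrite mxE; exact: hq.
Qed.

Lemma continuous_measurable_rV (f : 'rV[R]_n -> R) : continuous f -> measurable_fun setT f.
Proof.
move=> cf; apply: (measurability _ (RGenOpens.measurableE R)) => _ [B [a [b ->]] <-].
by rewrite setTI; apply: open_measurable_rV; apply: open_comp => //; exact: interval_open.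
Qed.

(** The norm of a row vector is the maximum of its coordinates in absolute value, so closed balls
    about 0 are cubes and their measure is a product of lengths. The set is empty for negative
    [M]. *)
Definition cube (M : R) : set 'rV[R]_n := [set x | `|x| <= M].

Lemma compact_cube M : compact (cube M).
Proof.
apply: bounded_closed_compact.
  exists M; split; first exact: num_real.
  by move=> t Mt x /= /le_trans; apply; exact: ltW.
rewrite /cube (_ : [set x : 'rV[R]_n | _] = (fun x => `|x|) @^-1` [set t | t <= M])//.
by apply: preimage_closed; [move=> x _; exact: norm_continuous | exact: closed_le].
Qed.

Lemma compact_sub_cube (K : set 'rV[R]_n) : compact K -> exists2 M, 0 < M & K `<=` cube M.
Proof.
move=> /compact_bounded[M [_ hM]]; exists (Num.max M 0 + 1).
  by rewrite ltr_wpDl// le_max lexx orbT.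
by move=> x Kx; apply: hM => //; rewrite ltr_pwDr// le_max lexx.
Qed.

Lemma measurable_cube M : measurable (cube M).
Proof.
rewrite -[cube M]setCK; apply: measurableC; apply: open_measurable_rV.
rewrite openC; apply: compact_closed; [exact: norm_hausdorff|exact: compact_cube].
Qed.

Lemma lebesgue_rV_cube M : 0 <= M -> lebesgue_rV R n (cube M) = ((M *+ 2) ^+ n)%:E.
Proof.
move=> M0; rewrite -[cube M]setIT -integral_indic//; last exact: measurable_cube.
have -> : (\int[lebesgue_rV R n]_x (\1_(cube M) x)%:E =
  \int[lebesgue_rV R n]_x (\prod_i \1_`[(- M), M]%classic (x ord0 i))%:E)%E.
  apply: eq_integral => x _; congr EFin; rewrite indicE /cube.
  case: (boolP (x \in _)) => [|]; rewrite ?inE /=.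
    move=> xM; rewrite big1// => i _; rewrite indicE mem_set//= in_itv/= -ler_norml.
    exact: le_trans (coord_le_norm _ _) xM.
  move=> /negP; rewrite inE => xM.
  have [i hi] : exists i, ~ (`|x ord0 i| <= M).
    by apply/existsNP => h; apply: xM; exact: rV_norm_le.
  rewrite (bigD1 i)//= indicE memNset ?mul0r//=.
  by rewrite in_itv/= -ler_norml.
rewrite (@ge0_integral_rV_prod R n (fun=> \1_`[(- M), M]%classic)).
- rewrite big_const_ord.
  rewrite integral_indic//= setIT lebesgue_measure_itv/= lte_fin.
  have -> : (if - M < M then (M%:E - (- M)%:E)%E else 0%E) = (M *+ 2)%:E.
    case: ifPn; first by rewrite -EFinB opprK mulr2n.
    rewrite -leNgt => hM; have -> : M = 0 by lra.
    by rewrite mul0rn.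
  by elim: n => [|k IH] //=; rewrite IH exprS EFinM.
- by move=> _; exact: measurable_indic.
- by move=> _ t; rewrite indicE.
Qed.

End rV_norm.

(** * The modulus of complex numbers *)

Section complex_norm.
Context {R : rcfType}.
Implicit Types x y z : R[i].

Lemma normcE x : normc x = Num.sqrt (complex.Re x ^+ 2 + complex.Im x ^+ 2).
Proof. by case: x. Qed.

Lemma normc_ge0 x : 0 <= normc x.
Proof. by rewrite normcE sqrtr_ge0. Qed.

Lemma ler_normcD x y : normc (x + y) <= normc x + normc y.
Proof. exact: (@le_normcD R x y). Qed.

Lemma normc_opp x : normc (- x) = normc x.
Proof. by case: x => a b; rewrite !normcE/= !sqrrN. Qed.

Lemma normc_subC x y : normc (x - y) = normc (y - x).
Proof. by rewrite -normc_opp opprB. Qed.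

Lemma ler_normcB x y : normc (x - y) <= normc x + normc y.
Proof. by rewrite -(normc_opp y); exact: ler_normcD. Qed.

Lemma ler_dist_normc x y : `|normc x - normc y| <= normc (x - y).
Proof.
rewrite ler_norml; apply/andP; split.
  by have := ler_normcD (y - x) x; rewrite subrK normc_subC; lra.
by rewrite lerBlDr; have := ler_normcD (x - y) y; rewrite subrK.
Qed.

Lemma normc_real (a : R) : normc a%:C = `|a|.
Proof. by rewrite normcE/= expr0n addr0 sqrtr_sqr. Qed.

Lemma normc_Re x : `|complex.Re x| <= normc x.
Proof. by rewrite normcE -sqrtr_sqr ler_wsqrtr// lerDl sqr_ge0. Qed.

Lemma normc_Im x : `|complex.Im x| <= normc x.
Proof. by rewrite normcE -sqrtr_sqr ler_wsqrtr// lerDr sqr_ge0. Qed.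

Lemma normc_ReIm x : normc x <= `|complex.Re x| + `|complex.Im x|.
Proof.
rewrite normcE -[leRHS]ger0_norm ?addr_ge0//.
rewrite -[leRHS]sqrtr_sqr ler_wsqrtr// sqrrD !real_normK ?num_real//.
by rewrite -addrA lerD2l lerDr mulrn_wge0// mulr_ge0.
Qed.

Lemma normc_sum (I : Type) (r : seq I) (P : pred I) (F : I -> R[i]) :
  normc (\sum_(i <- r | P i) F i) <= \sum_(i <- r | P i) normc (F i).
Proof.
elim/big_ind2 : _ => //; first by rewrite normc0.
by move=> a b c e ab ce; apply: le_trans (ler_normcD _ _) _; exact: lerD.
Qed.

Lemma ReM x y : complex.Re (x * y) = complex.Re x * complex.Re y - complex.Im x * complex.Im y.
Proof. by case: x y => a b [c e]. Qed.

Lemma ImM x y : complex.Im (x * y) = complex.Re x * complex.Im y + complex.Im x * complex.Re y.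
Proof. by case: x y => a b [c e]. Qed.

Lemma ReD x y : complex.Re (x + y) = complex.Re x + complex.Re y.
Proof. by case: x y => a b [c e]. Qed.

Lemma ImD x y : complex.Im (x + y) = complex.Im x + complex.Im y.
Proof. by case: x y => a b [c e]. Qed.

Lemma ReN x : complex.Re (- x) = - complex.Re x. Proof. by case: x. Qed.
Lemma ImN x : complex.Im (- x) = - complex.Im x. Proof. by case: x. Qed.

Lemma ReB x y : complex.Re (x - y) = complex.Re x - complex.Re y.
Proof. by rewrite ReD ReN. Qed.

Lemma ImB x y : complex.Im (x - y) = complex.Im x - complex.Im y.
Proof. by rewrite ImD ImN. Qed.

Lemma complexE x : x = complex.Re x +i* complex.Im x. Proof. by case: x. Qed.

End complex_norm.

(** * Functions that are Borel up to a null set *)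

Section lebesgue_measurable_theory.
Context {R : realType} {d : nat}.
Local Notation Rd := 'rV[R]_d.
Local Notation mu := (lebesgue_rV R d).
Local Notation lm := (@lebesgue_measurable R d).
Implicit Types f g : Rd -> R.

Lemma aeE (T : Type) (f g : Rd -> T) : f = g %[ae mu] <-> {ae mu, forall x, f x = g x}.
Proof. by split; apply: filterS => x; [apply|move=> ? _]. Qed.

Lemma lebesgue_rV_indic (A : set Rd) : measurable A ->
  mu A = (\int[mu]_x (\1_A x)%:E)%E.
Proof. by move=> mA; rewrite integral_indic// setIT. Qed.

Lemma lebesgue_rVD (a : Rd) (A : set Rd) : measurable A ->
  mu ((fun x => x + a) @^-1` A) = mu A.
Proof.
move=> mA; have mB : measurable ((fun x => x + a) @^-1` A).
  by rewrite -[X in measurable X]setTI; exact: measurable_rVD.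
rewrite !lebesgue_rV_indic//.
rewrite -[RHS](@ge0_integral_rVD R d a (fun x => (\1_A x)%:E))//.
by apply/measurable_EFinP; exact: measurable_indic.
Qed.

Lemma lebesgue_rVN (A : set Rd) : measurable A -> mu (-%R @^-1` A) = mu A.
Proof.
move=> mA; have mB : measurable (-%R @^-1` A).
  by rewrite -[X in measurable X]setTI; exact: measurable_rVN.
rewrite !lebesgue_rV_indic//.
rewrite -[RHS](@ge0_integral_rVN R d (fun x => (\1_A x)%:E))//.
by apply/measurable_EFinP; exact: measurable_indic.
Qed.

Lemma ae_translate (a : Rd) (P : Rd -> Prop) :
  {ae mu, forall x, P x} -> {ae mu, forall x, P (x + a)}.
Proof.
move=> [N [mN N0 PN]]; exists ((fun x => x + a) @^-1` N); split.
- by rewrite -[X in measurable X]setTI; exact: measurable_rVD.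
- by rewrite -[RHS]N0; exact: lebesgue_rVD.
- by move=> x /= h; exact: PN.
Qed.

Lemma ae_reflect (P : Rd -> Prop) :
  {ae mu, forall x, P x} -> {ae mu, forall x, P (- x)}.
Proof.
move=> [N [mN N0 PN]]; exists (-%R @^-1` N); split.
- by rewrite -[X in measurable X]setTI; exact: measurable_rVN.
- by rewrite -[RHS]N0; exact: lebesgue_rVN.
- by move=> x /= h; exact: PN.
Qed.

Lemma lmP f : lm f <-> exists2 g, measurable_fun setT g & {ae mu, forall x, f x = g x}.
Proof. by split => -[g mg /aeE fg]; exists g => //; exact/aeE. Qed.

Lemma borel_lm f : measurable_fun setT f -> lm f.
Proof. by move=> mf; apply/lmP; exists f => //; exact: aeW. Qed.

Lemma continuous_lm f : continuous f -> lm f.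
Proof. by move=> /continuous_measurable_rV; exact: borel_lm. Qed.

Lemma ae_lm f g : {ae mu, forall x, f x = g x} -> lm f -> lm g.
Proof.
move=> fg /lmP[f' mf' ff']; apply/lmP; exists f' => //.
by apply: filterS2 fg ff' => x -> ->.
Qed.

Lemma lm_comp (h : R -> R) f : measurable_fun setT h -> lm f -> lm (fun x => h (f x)).
Proof.
move=> mh /lmP[f' mf' ff']; apply/lmP; exists (h \o f').
  exact: measurableT_comp.
by apply: filterS ff' => x /= ->.
Qed.

Lemma lmD f g : lm f -> lm g -> lm (fun x => f x + g x).
Proof.
move=> /lmP[f' mf' ff'] /lmP[g' mg' gg']; apply/lmP; exists (fun x => f' x + g' x).
  exact: measurable_funD.
by apply: filterS2 ff' gg' => x -> ->.
Qed.

Lemma lmM f g : lm f -> lm g -> lm (fun x => f x * g x).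
Proof.
move=> /lmP[f' mf' ff'] /lmP[g' mg' gg']; apply/lmP; exists (fun x => f' x * g' x).
  exact: measurable_funM.
by apply: filterS2 ff' gg' => x -> ->.
Qed.

Lemma lm_min f g : lm f -> lm g -> lm (fun x => Num.min (f x) (g x)).
Proof.
move=> /lmP[f' mf' ff'] /lmP[g' mg' gg']; apply/lmP; exists (fun x => Num.min (f' x) (g' x)).
  exact: measurable_minr.
by apply: filterS2 ff' gg' => x -> ->.
Qed.

Lemma lm_cst (c : R) : lm (fun=> c).
Proof. by apply: borel_lm; exact: measurable_cst. Qed.

Lemma lm_indic (A : set Rd) : measurable A -> lm (\1_A).
Proof. by move=> mA; apply: borel_lm; exact: measurable_indic. Qed.

Lemma lmN f : lm f -> lm (fun x => - f x).
Proof.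
by move=> lf; apply: (lm_comp (h := -%R)) => //; exact: oppr_measurable.
Qed.

Lemma lmB f g : lm f -> lm g -> lm (fun x => f x - g x).
Proof. by move=> lf lg; apply: lmD => //; exact: lmN. Qed.

Lemma lmZ (c : R) f : lm f -> lm (fun x => c * f x).
Proof. by move=> lf; apply: lmM => //; exact: lm_cst. Qed.

Lemma lm_norm f : lm f -> lm (fun x => `|f x|).
Proof. by move=> lf; apply: (lm_comp (h := Num.norm)) => //; exact: normr_measurable. Qed.

Lemma lm_sqrt f : lm f -> lm (fun x => Num.sqrt (f x)).
Proof.
move=> lf; apply: (lm_comp (h := Num.sqrt)) => //.
by apply: continuous_measurable_fun; exact: sqrt_continuous.
Qed.

Lemma lm_sum (I : Type) (r : seq I) (F : I -> Rd -> R) :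
  (forall i, lm (F i)) -> lm (fun x => \sum_(i <- r) F i x).
Proof.
move=> lF; elim: r => [|i r IH].
  by under eq_fun do rewrite big_nil; exact: lm_cst.
by under eq_fun do rewrite big_cons; exact: lmD.
Qed.

Lemma lm_translate (a : Rd) f : lm f -> lm (fun x => f (x + a)).
Proof.
move=> /lmP[f' mf' ff']; apply/lmP; exists (fun x => f' (x + a)).
  by apply: measurableT_comp => //; exact: measurable_rVD.
exact: ae_translate ff'.
Qed.

Lemma lm_reflect f : lm f -> lm (fun x => f (- x)).
Proof.
move=> /lmP[f' mf' ff']; apply/lmP; exists (fun x => f' (- x)).
  by apply: measurableT_comp => //; exact: measurable_rVN.
exact: ae_reflect ff'.
Qed.

Lemma lm_limit (u : nat -> Rd -> R) f : (forall n, lm (u n)) ->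
  (forall x, u n x @[n --> \oo] --> f x) -> lm f.
Proof.
move=> lu uf; have /choice[v hv] : forall n, exists v : Rd -> R, measurable_fun setT v /\
    {ae mu, forall x, u n x = v x}.
  by move=> n; have /lmP[v mv uv] := lu n; exists v.
have [N [mN N0 uvN]] := ae_foralln (fun n => (hv n).2).
(* One null set [N] serves the whole sequence: off [N] the Borel versions converge to [f], and on
   [N] everything is replaced by 0. *)
apply/lmP; exists (fun x => f x * \1_(~` N) x).
  apply: (@measurable_fun_cvg _ _ _ _ (fun n x => v n x * \1_(~` N) x)) => [n|x _].
    apply: measurable_funM; first exact: (hv n).1.
    by apply: measurable_indic; exact: measurableC.
  rewrite indicE; case: (boolP (x \in ~` N)) => xN.
    under eq_fun do rewrite mulr1; rewrite mulr1.
    suff <- : (fun n => u n x) = (fun n => v n x) by exact: uf.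
    apply/funext => n; apply: contrapT => uvx.
    by move: xN; rewrite inE; apply; apply: uvN => /(_ n).
  by under eq_fun do rewrite mulr0; rewrite mulr0; exact: cvg_cst.
exists N; split => // x /=; apply: contra_notP => xN.
by rewrite indicE mem_set// mulr1.
Qed.

Lemma cmeasurable_normc (f : Rd -> R[i]) : cmeasurable f -> lm (fun x => normc (f x)).
Proof.
move=> [l1 l2]; under eq_fun do rewrite normcE.
by apply: lm_sqrt; apply: lmD; rewrite ?expr2; [exact: (lmM l1 l1)|exact: (lmM l2 l2)].
Qed.

Lemma int_le f g : (forall x, 0 <= f x) -> (forall x, 0 <= g x) ->
  {ae mu, forall x, f x <= g x} -> (\int[mu]_x (f x)%:E <= \int[mu]_x (g x)%:E)%E.
Proof.
move=> f0 g0 fg; apply: ge0_ae_le_integralT => [x|x|]; rewrite ?lee_fin//.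
Qed.

Lemma int_ge0 f : (forall x, 0 <= f x) -> (0 <= \int[mu]_x (f x)%:E)%E.
Proof. by move=> f0; apply: integral_ge0 => x _; rewrite lee_fin. Qed.

Lemma lm_ge0 f : lm f -> (forall x, 0 <= f x) -> exists g, [/\ measurable_fun setT g,
  forall x, 0 <= g x & {ae mu, forall x, f x = g x}].
Proof.
move=> /lmP[g mg fg] f0; exists (fun x => `|g x|); split => //.
  by apply: measurableT_comp => //; exact: normr_measurable.
by apply: filterS fg => x fgx; rewrite -fgx ger0_norm.
Qed.

Lemma int_ae f g : {ae mu, forall x, f x = g x} ->
  (\int[mu]_x (f x)%:E = \int[mu]_x (g x)%:E)%E.
Proof. by move=> fg; apply: ae_eq_integralT; apply: filterS fg => x ->. Qed.

Lemma intD f g : lm f -> lm g -> (forall x, 0 <= f x) -> (forall x, 0 <= g x) ->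
  (\int[mu]_x (f x + g x)%:E = \int[mu]_x (f x)%:E + \int[mu]_x (g x)%:E)%E.
Proof.
move=> lf lg f0 g0; have [f' [mf' f'0 ff']] := lm_ge0 lf f0.
have [g' [mg' g'0 gg']] := lm_ge0 lg g0.
rewrite (int_ae ff') (int_ae gg').
rewrite (@int_ae (fun x => f x + g x) (fun x => f' x + g' x)); last first.
  by apply: filterS2 ff' gg' => x -> ->.
under eq_integral do rewrite EFinD.
by rewrite ge0_integralD//; try exact/measurable_EFinP; move=> x _; rewrite lee_fin.
Qed.

Lemma intZ (c : R) f : lm f -> 0 <= c -> (forall x, 0 <= f x) ->
  (\int[mu]_x (c * f x)%:E = c%:E * \int[mu]_x (f x)%:E)%E.
Proof.
move=> lf c0 f0; have [f' [mf' f'0 ff']] := lm_ge0 lf f0.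
rewrite (int_ae ff') (@int_ae (fun x => c * f x) (fun x => c * f' x)); last first.
  by apply: filterS ff' => x ->.
under eq_integral do rewrite EFinM.
by rewrite ge0_integralZl//; try exact/measurable_EFinP; move=> x _; rewrite lee_fin.
Qed.

Lemma int_sum (I : Type) (r : seq I) (F : I -> Rd -> R) :
  (forall i, lm (F i)) -> (forall i x, 0 <= F i x) ->
  (\int[mu]_x (\sum_(i <- r) F i x)%:E = \sum_(i <- r) \int[mu]_x (F i x)%:E)%E.
Proof.
move=> lF F0; elim: r => [|i r IH].
  by rewrite big_nil; under eq_integral do rewrite big_nil; rewrite integral0.
rewrite big_cons -IH -intD//; [|exact: lm_sum|by move=> x; exact: sumr_ge0].
by apply: eq_integral => x _; rewrite big_cons.
Qed.

Lemma int_translate (a : Rd) f : lm f -> (forall x, 0 <= f x) ->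
  (\int[mu]_x (f (x + a))%:E = \int[mu]_x (f x)%:E)%E.
Proof.
move=> lf f0; have [f' [mf' f'0 ff']] := lm_ge0 lf f0.
rewrite (int_ae ff') (int_ae (ae_translate a ff')).
rewrite (@ge0_integral_rVD R d a (fun x => (f' x)%:E))//; exact/measurable_EFinP.
Qed.

Lemma int_reflect f : lm f -> (forall x, 0 <= f x) ->
  (\int[mu]_x (f (- x))%:E = \int[mu]_x (f x)%:E)%E.
Proof.
move=> lf f0; have [f' [mf' f'0 ff']] := lm_ge0 lf f0.
rewrite (int_ae ff') (int_ae (ae_reflect ff')).
rewrite (@ge0_integral_rVN R d (fun x => (f' x)%:E))//; exact/measurable_EFinP.
Qed.

Lemma int_eq0 f : lm f -> (forall x, 0 <= f x) -> (\int[mu]_x (f x)%:E = 0)%E ->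
  {ae mu, forall x, f x = 0}.
Proof.
move=> lf f0; have [f' [mf' f'0 ff']] := lm_ge0 lf f0.
rewrite (int_ae ff') => If.
have := @ae_eq_integral_abs _ _ _ mu setT measurableT (fun x => (f' x)%:E).
move=> []; first exact/measurable_EFinP.
move=> + _; rewrite (eq_integral (fun x => (f' x)%:E)); last first.
  by move=> x _; rewrite gee0_abs// lee_fin.
move=> /(_ If); apply: filterS2 ff' => x -> /(_ I) [].
by [].
Qed.

End lebesgue_measurable_theory.

(** * Integrals of real functions *)

Section real_integral.
Context {R : realType} {d : nat}.
Local Notation Rd := 'rV[R]_d.
Local Notation mu := (lebesgue_rV R d).
Local Notation lm := (@lebesgue_measurable R d).
Implicit Types f g : Rd -> R.

Definition rL1 f : Prop := lm f /\ (\int[mu]_x `|f x|%:E < +oo)%E.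

Lemma rL1_borel f : rL1 f ->
  exists2 g, mu.-integrable setT (EFin \o g) & {ae mu, forall x, f x = g x}.
Proof.
move=> [/lmP[g mg fg] foo]; exists g => //; apply/integrableP; split.
  exact/measurable_EFinP.
rewrite (_ : (\int[mu]_x `|(EFin \o g) x|)%E = \int[mu]_x `|g x|%:E)%E//.
by rewrite -(@int_ae _ _ (fun x => `|f x|))//; apply: filterS fg => x ->.
Qed.

Lemma rint_ae f g : {ae mu, forall x, f x = g x} -> \int[mu]_x f x = \int[mu]_x g x.
Proof. by move=> fg; rewrite /Rintegral (int_ae fg). Qed.

Lemma rintD f g : rL1 f -> rL1 g ->
  \int[mu]_x (f x + g x) = \int[mu]_x f x + \int[mu]_x g x.
Proof.
move=> /rL1_borel[f' If ff'] /rL1_borel[g' Ig gg'].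
rewrite (rint_ae ff') (rint_ae gg') -RintegralD//; apply: rint_ae.
by apply: filterS2 ff' gg' => x -> ->.
Qed.

Lemma rintZ (c : R) f : rL1 f -> \int[mu]_x (c * f x) = c * \int[mu]_x f x.
Proof.
move=> /rL1_borel[f' If ff'].
rewrite (rint_ae ff') -RintegralZl//; apply: rint_ae.
by apply: filterS ff' => x ->.
Qed.

Lemma rint_norm f : rL1 f -> (`|\int[mu]_x f x|%:E <= \int[mu]_x `|f x|%:E)%E.
Proof.
move=> fL; have [f' If ff'] := rL1_borel fL.
rewrite (rint_ae ff').
apply: le_trans (_ : (\int[mu]_x `|f' x|)%:E <= _)%E.
  by rewrite lee_fin; exact: le_normr_Rintegral.
rewrite (@int_ae _ _ _ (fun x => `|f' x|)); last by apply: filterS ff' => x ->.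
rewrite /Rintegral fineK// ge0_fin_numE; last exact: int_ge0.
by move/integrableP : If => [_].
Qed.

Lemma rint_fin f : (forall x, 0 <= f x) -> (\int[mu]_x (f x)%:E < +oo)%E ->
  (\int[mu]_x f x)%:E = (\int[mu]_x (f x)%:E)%E.
Proof. by move=> f0 foo; rewrite /Rintegral fineK// ge0_fin_numE//; exact: int_ge0. Qed.

Lemma int_posneg f : (\int[mu]_x (f x)%:E = \int[mu]_x (Num.max (f x) 0)%:E -
  \int[mu]_x (Num.max (- f x) 0)%:E)%E.
Proof.
rewrite integralE; congr (_ - _)%E; apply: eq_integral => x _.
  by rewrite funeposE -EFin_max.
by rewrite funenegE -EFin_max.
Qed.

Lemma lm_max0 f : lm f -> lm (fun x => Num.max (f x) 0).
Proof.
move=> lf; apply: (lm_comp (h := fun t => Num.max t 0)) => //.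
by apply: measurable_maxr => //; exact: measurable_cst.
Qed.

(** Positive and negative parts are invariant separately, so the identity also covers divergent
    integrals with their default value. *)
Lemma rint_translate (a : Rd) f : lm f -> \int[mu]_x f (x + a) = \int[mu]_x f x.
Proof.
move=> lf; have lNf := lmN lf.
rewrite /Rintegral (int_posneg (fun x => f (x + a))) (int_posneg f).
rewrite (int_translate a (f := fun x => Num.max (f x) 0)) ?(int_translate a (f := fun x => Num.max (- f x) 0))//.
- exact: lm_max0 lNf.
- by move=> x; rewrite le_max lexx orbT.
- exact: lm_max0.
- by move=> x; rewrite le_max lexx orbT.
Qed.

Lemma rint_reflect f : lm f -> \int[mu]_x f (- x) = \int[mu]_x f x.
Proof.
move=> lf; have lNf := lmN lf.
rewrite /Rintegral (int_posneg (fun x => f (- x))) (int_posneg f).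
rewrite (int_reflect (f := fun x => Num.max (f x) 0)) ?(int_reflect (f := fun x => Num.max (- f x) 0))//.
- exact: lm_max0 lNf.
- by move=> x; rewrite le_max lexx orbT.
- exact: lm_max0.
- by move=> x; rewrite le_max lexx orbT.
Qed.

Lemma int_in (K : set Rd) f :
  (\int[mu]_(x in K) (f x)%:E = \int[mu]_x (f x * \1_K x)%:E)%E.
Proof.
rewrite integral_mkcond; apply: eq_integral => x _; rewrite patchE indicE.
by case: ifP => _; rewrite ?mulr1 ?mulr0.
Qed.

End real_integral.

(** * Complex integrals, integrable and locally integrable functions *)

Section complex_integral.
Context {R : realType} {d : nat}.
Local Notation Rd := 'rV[R]_d.
Local Notation mu := (lebesgue_rV R d).
Local Notation lm := (@lebesgue_measurable R d).
Implicit Types f g : Rd -> R[i].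

Lemma cmeasurableD f g : cmeasurable f -> cmeasurable g -> cmeasurable (fun x => f x + g x).
Proof.
move=> [f1 f2] [g1 g2]; split.
  by under eq_fun do rewrite ReD; exact: lmD.
by under eq_fun do rewrite ImD; exact: lmD.
Qed.

Lemma cmeasurableM f g : cmeasurable f -> cmeasurable g -> cmeasurable (fun x => f x * g x).
Proof.
move=> [f1 f2] [g1 g2]; split.
  by under eq_fun do rewrite ReM; apply: lmB; exact: lmM.
by under eq_fun do rewrite ImM; apply: lmD; exact: lmM.
Qed.

Lemma cmeasurable_cst c : cmeasurable (fun _ : Rd => c).
Proof. by split; exact: lm_cst. Qed.

Lemma cmeasurable_real (h : Rd -> R) : lm h -> cmeasurable (fun x => (h x)%:C).
Proof. by move=> lh; split => //=; exact: lm_cst. Qed.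

Lemma cmeasurableZ c f : cmeasurable f -> cmeasurable (fun x => c * f x).
Proof. by move=> mf; apply: cmeasurableM => //; exact: cmeasurable_cst. Qed.

Lemma cmeasurableN f : cmeasurable f -> cmeasurable (fun x => - f x).
Proof. by move=> /(cmeasurableZ (-1)); under eq_fun do rewrite mulN1r. Qed.

Lemma cmeasurableB f g : cmeasurable f -> cmeasurable g -> cmeasurable (fun x => f x - g x).
Proof. by move=> mf mg; apply: cmeasurableD => //; exact: cmeasurableN. Qed.

Lemma cmeasurable_translate a f : cmeasurable f -> cmeasurable (fun x => f (x + a)).
Proof. by move=> [f1 f2]; split; [exact: lm_translate f1|exact: lm_translate f2]. Qed.

Lemma cmeasurable_reflect f : cmeasurable f -> cmeasurable (fun x => f (- x)).
Proof. by move=> [f1 f2]; split; [exact: lm_reflect f1|exact: lm_reflect f2]. Qed.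

Lemma cmeasurable_ae f g : {ae mu, forall x, f x = g x} -> cmeasurable f -> cmeasurable g.
Proof.
by move=> fg [f1 f2]; split; [apply: ae_lm f1|apply: ae_lm f2];
  apply: filterS fg => x ->.
Qed.

Lemma cmeasurable_limit (u : nat -> Rd -> R[i]) f : (forall n, cmeasurable (u n)) ->
  (forall x, normc (u n x - f x) @[n --> \oo] --> (0 : R)) -> cmeasurable f.
Proof.
move=> mu_ uf; have cv (p : R[i] -> R) : (forall z, `|p z| <= normc z) ->
    {morph p : x y / x - y} -> forall x, p (u n x) @[n --> \oo] --> p (f x).
  move=> pz pB x; apply/cvgrPdist_le => e e0; have /cvgrPdist_le/(_ _ e0) := uf x.
  apply: filterS => n; rewrite sub0r normrN ger0_norm ?normc_ge0// => le.
  by rewrite distrC -pB; apply: le_trans (pz _) le.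
split.
  apply: (@lm_limit _ _ (fun n x => complex.Re (u n x))) => [n|]; first by case: (mu_ n).
  by apply: cv => [z|z y]; [exact: normc_Re|exact: ReB].
apply: (@lm_limit _ _ (fun n x => complex.Im (u n x))) => [n|]; first by case: (mu_ n).
by apply: cv => [z|z y]; [exact: normc_Im|exact: ImB].
Qed.

Lemma L1_ReIm f : L1 f -> rL1 (fun x => complex.Re (f x)) /\ rL1 (fun x => complex.Im (f x)).
Proof.
move=> [mf foo]; split; (split; [by case: mf|]); apply: le_lt_trans foo;
  apply: int_le => [x|x|]; rewrite ?normc_ge0//; apply: aeW => x.
  exact: normc_Re.
exact: normc_Im.
Qed.

Lemma L1_dom f (F : Rd -> R) : cmeasurable f -> (forall x, 0 <= F x) ->
  {ae mu, forall x, normc (f x) <= F x} -> (\int[mu]_x (F x)%:E < +oo)%E -> L1 f.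
Proof.
move=> mf F0 fF Foo; split => //; apply: le_lt_trans Foo; apply: int_le => // x.
exact: normc_ge0.
Qed.

Lemma L1D f g : L1 f -> L1 g -> L1 (fun x => f x + g x).
Proof.
move=> [mf foo] [mg goo]; apply: (@L1_dom _ (fun x => normc (f x) + normc (g x))).
- exact: cmeasurableD.
- by move=> x; rewrite addr_ge0// normc_ge0.
- by apply: aeW => x; exact: ler_normcD.
- rewrite intD; try exact: cmeasurable_normc; try by move=> x; exact: normc_ge0.
  by rewrite lte_add_pinfty.
Qed.

Lemma L1Z c f : L1 f -> L1 (fun x => c * f x).
Proof.
move=> [mf foo]; split; first exact: cmeasurableZ.
under eq_integral do rewrite normcM.
rewrite intZ ?normc_ge0//; [|exact: cmeasurable_normc|by move=> x; exact: normc_ge0].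
by rewrite lte_mul_pinfty// lee_fin normc_ge0.
Qed.

Lemma L1_ae f g : {ae mu, forall x, f x = g x} -> L1 f -> L1 g.
Proof.
move=> fg [mf foo]; split; first exact: cmeasurable_ae mf.
by rewrite -(@int_ae _ _ (fun x => normc (f x)))//; apply: filterS fg => x ->.
Qed.

Lemma cintD f g : L1 f -> L1 g ->
  cintegral (fun x => f x + g x) = cintegral f + cintegral g.
Proof.
move=> /L1_ReIm[f1 f2] /L1_ReIm[g1 g2]; rewrite /cintegral; congr Complex.
  by rewrite -rintD//; apply: eq_Rintegral => x _; rewrite ReD.
by rewrite -rintD//; apply: eq_Rintegral => x _; rewrite ImD.
Qed.

Lemma rL1Z (c : R) (h : Rd -> R) : rL1 h -> rL1 (fun x => c * h x).
Proof.
move=> [lh hoo]; split; first exact: lmZ.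
under eq_integral do rewrite normrM.
rewrite intZ//; last exact: lm_norm.
by rewrite lte_mul_pinfty// lee_fin.
Qed.

Lemma cintZ c f : L1 f -> cintegral (fun x => c * f x) = c * cintegral f.
Proof.
move=> /L1_ReIm[f1 f2]; rewrite /cintegral; case: c => a b; congr Complex.
  rewrite -!rintZ// -mulN1r -rintZ; last exact: rL1Z.
  rewrite -rintD; [|exact: rL1Z|by apply: rL1Z; exact: rL1Z].
  by apply: eq_Rintegral => x _; rewrite ReM/= mulN1r.
rewrite -!rintZ// -rintD; [|exact: rL1Z|exact: rL1Z].
by apply: eq_Rintegral => x _; rewrite ImM.
Qed.

Lemma cintN f : L1 f -> cintegral (fun x => - f x) = - cintegral f.
Proof. by move=> fL; rewrite -mulN1r -cintZ//; congr cintegral; apply/funext => x; rewrite mulN1r. Qed.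

Lemma cintB f g : L1 f -> L1 g ->
  cintegral (fun x => f x - g x) = cintegral f - cintegral g.
Proof.
move=> fL gL; rewrite cintD ?cintN//.
by have := L1Z (-1) gL; under eq_fun do rewrite mulN1r.
Qed.

(** The factor 2 comes from estimating real and imaginary parts separately; constants are immaterial
    in the later estimates. *)
Lemma cint_norm f : L1 f -> ((normc (cintegral f))%:E <= 2%:E * \int[mu]_x (normc (f x))%:E)%E.
Proof.
move=> fL; have [f1 f2] := L1_ReIm fL.
apply: le_trans (_ : (`|\int[mu]_x complex.Re (f x)|%:E + `|\int[mu]_x complex.Im (f x)|%:E <= _)%E).
  by rewrite -EFinD lee_fin; exact: normc_ReIm.
rewrite (_ : 2%:E = 1 + 1)%E// ge0_muleDl// mul1e.
apply: leeD; (apply: le_trans (rint_norm _) _ => //); apply: int_le => [x|x|]; rewrite ?normc_ge0//;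
  apply: aeW => x; [exact: normc_Re|exact: normc_Im].
Qed.

Lemma cint_translate a f : cmeasurable f -> cintegral (fun x => f (x + a)) = cintegral f.
Proof.
move=> [f1 f2]; rewrite /cintegral; congr Complex; first exact: (rint_translate a f1).
exact: (rint_translate a f2).
Qed.

Lemma cint_reflect f : cmeasurable f -> cintegral (fun x => f (- x)) = cintegral f.
Proof.
move=> [f1 f2]; rewrite /cintegral; congr Complex; first exact: (rint_reflect f1).
exact: (rint_reflect f2).
Qed.

Lemma cint0 : cintegral (fun _ : Rd => 0) = 0.
Proof. by rewrite /cintegral /= /Rintegral integral0. Qed.

Lemma cint_sum (I : Type) (r : seq I) (F : I -> Rd -> R[i]) : (forall i, L1 (F i)) ->
  L1 (fun x => \sum_(i <- r) F i x) /\
  cintegral (fun x => \sum_(i <- r) F i x) = \sum_(i <- r) cintegral (F i).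
Proof.
move=> FL; elim: r => [|i r [IH1 IH2]].
  rewrite big_nil; under eq_fun do rewrite big_nil.
  split; last exact: cint0.
  by split; [exact: cmeasurable_cst|under eq_integral do rewrite normc0; rewrite integral0].
rewrite big_cons -IH2; under eq_fun do rewrite big_cons.
by split; [exact: L1D|exact: cintD].
Qed.

Lemma L1locP f : L1loc f <-> cmeasurable f /\
  forall M, (\int[mu]_x (normc (f x) * \1_(cube M) x)%:E < +oo)%E.
Proof.
split=> -[mf foo]; split => //.
  by move=> M; rewrite -int_in; apply: foo; exact: compact_cube.
move=> K /compact_sub_cube[M M0 KM]; rewrite int_in; apply: le_lt_trans (foo M).
apply: int_le => [x|x|]; rewrite ?mulr_ge0 ?normc_ge0//; apply: aeW => x.
rewrite ler_wpM2l ?normc_ge0// !indicE ler_nat.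
by case: (boolP (x \in K)); rewrite ?inE => // /KM; rewrite -in_setE => ->.
Qed.

Lemma L1loc_dom f (F : Rd -> R) : cmeasurable f -> (forall x, 0 <= F x) ->
  {ae mu, forall x, normc (f x) <= F x} ->
  (forall M, (\int[mu]_x (F x * \1_(cube M) x)%:E < +oo)%E) -> L1loc f.
Proof.
move=> mf F0 fF Foo; apply/L1locP; split=> // M; apply: le_lt_trans (Foo M).
apply: int_le => [x|x|]; rewrite ?mulr_ge0 ?normc_ge0//.
by apply: filterS fF => x fFx; rewrite ler_wpM2r.
Qed.

Lemma L1_L1loc f : L1 f -> L1loc f.
Proof.
move=> [mf foo]; apply/L1locP; split=> // M; apply: le_lt_trans foo.
apply: int_le => [x|x|]; rewrite ?mulr_ge0 ?normc_ge0//; apply: aeW => x.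
by rewrite ler_piMr ?normc_ge0// indicE lern1 leq_b1.
Qed.

Lemma int_cube_lt (M C : R) : 0 <= C -> (\int[mu]_x (C * \1_(cube M) x)%:E < +oo)%E.
Proof.
move=> C0; have [M0|M0] := leP 0 M; last first.
  rewrite (_ : cube M = set0); last first.
    by apply/seteqP; split => x //; rewrite /cube/= leNgt (lt_le_trans M0).
  by under eq_integral do rewrite indic0 mulr0; rewrite integral0.
rewrite intZ//; last by apply: lm_indic; exact: measurable_cube.
rewrite -lebesgue_rV_indic; last exact: measurable_cube.
by rewrite lebesgue_rV_cube// lte_mul_pinfty// ltry.
Qed.

End complex_integral.
(** A remainder of second order in [t] contributes [B |t|] to the difference quotient. This lets
    derivatives be established by inequalities instead of limits. *)
Lemma derive_of_quadratic (R : realType) (V : normedModType R) (h : V -> R) (v x : V) (l r B : R) : 0 < r ->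
  (forall t : R, `|t| <= r -> `|h (x + t *: v) - h x - t * l| <= B * t ^+ 2) ->
  derivable h x v /\ 'D_v h x = l.
Proof.
move=> r0 hB.
suff c : (fun t => t^-1 *: ((h \o shift x) (t *: v) - h x)) @ 0^' --> l.
  by split; [apply/cvg_ex; exists l | exact: cvg_lim c].
apply/cvgrPdist_le => e e0.
have B0 : 0 <= B.
  have := hB r; rewrite (gtr0_norm r0) lexx => /(_ isT); rewrite -(pmulr_lge0 B (exprn_gt0 2 r0)).
  exact: le_trans.
have k0 : 0 < Num.min r (e / (B + 1)) by rewrite lt_min r0 divr_gt0// ltr_wpDl.
near=> t.
have t0 : t != 0 by near: t; exact: nbhs_dnbhs_neq.
have /andP[tr te] : (`|t| <= r) && (`|t| <= e / (B + 1)).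
  by rewrite -le_min; near: t; exact: dnbhs0_le.
have t0' : 0 < `|t| by rewrite normr_gt0.
have -> : l - t^-1 *: ((h \o shift x) (t *: v) - h x) = - t^-1 * (h (x + t *: v) - h x - t * l).
  rewrite /= [_ + x]addrC; change (l - t^-1 * (h (x + t *: v) - h x) = - t^-1 * (h (x + t *: v) - h x - t * l)).
  by field.
rewrite normrM normrN normfV ler_pdivrMl//; apply: le_trans (hB t tr) _.
rewrite -real_normK ?num_real// expr2 mulrCA ler_wpM2l//.
rewrite ler_pdivlMr ?ltr_wpDl// in te; apply: le_trans te.
by rewrite mulrC ler_wpM2l// lerDl.
Unshelve. all: by end_near.
Qed.

(** * Smooth functions *)

Section directional_derivative.
Context {R : realType} {d : nat}.
Local Notation Rd := 'rV[R]_d.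
Implicit Types (h k : Rd -> R) (x v : Rd) (t B : R).

(* Derivatives, basis vectors and smoothness are sealed ([locked] or wrapped in a
   [Variant]): unification otherwise unfolds them down to the filters of limits. *)
Definition dder h v : Rd -> R := locked (fun x => 'D_v h x).

Variant ddable h v x : Prop := DDable of derivable h x v.

Lemma dderE h v x : dder h v x = 'D_v h x.
Proof. by rewrite /dder -lock. Qed.

Lemma is_derive_line h v x : (forall y, ddable h v y) ->
  forall t, is_derive t 1 (fun s : R => h (x + s *: v)) (dder h v (x + t *: v)).
Proof.
move=> hv t; have e : (fun r : R => r^-1 *: (((fun s : R => h (x + s *: v)) \o shift t) (r *: (1 : R)) - h (x + t *: v)))
   = (fun r : R => r^-1 *: ((h \o shift (x + t *: v)) (r *: v) - h (x + t *: v))).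
  apply/funext => r /=; congr (_ *: (h _ - _)).
  by rewrite [r *: 1]mulr1 scalerDl addrCA.
apply: DeriveDef.
  by rewrite /derivable e; case: (hv (x + t *: v)).
by rewrite dderE /derive e.
Qed.

Lemma ddable_of_line h v x l : is_derive (0 : R) 1 (fun s : R => h (x + s *: v)) l ->
  ddable h v x /\ dder h v x = l.
Proof.
have e : (fun r : R => r^-1 *: (((fun s : R => h (x + s *: v)) \o shift 0) (r *: (1 : R)) - h (x + 0 *: v)))
   = (fun r : R => r^-1 *: ((h \o shift x) (r *: v) - h x)).
  apply/funext => r /=; rewrite addr0 scale0r addr0; congr (_ *: (h _ - _)).
  by rewrite [r *: 1]mulr1 addrC.
move=> [d1 d2]; rewrite /derivable e in d1; rewrite /derive e in d2.
by rewrite dderE; split.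
Qed.

Lemma line_MVT h v x t : (forall y, ddable h v y) -> 0 < t ->
  exists2 s, 0 < s < t & h (x + t *: v) - h x = t * dder h v (x + s *: v).
Proof.
move=> hv t0; have hl := is_derive_line x hv.
have [s] := MVT t0 (fun s _ => hl s) (derivable_within_continuous (fun s _ => @ex_derive _ _ _ _ _ _ _ (hl s))).
by rewrite in_itv/= => s0t; rewrite scale0r addr0 subr0 mulrC; exists s.
Qed.

Lemma line_MVTN h v x t : (forall y, ddable h v y) ->
  exists2 s, `|s| <= `|t| & h (x + t *: v) - h x = t * dder h v (x + s *: v).
Proof.
move=> hv; have [t0|t0|->] := ltgtP t 0; last first.
- by exists 0; rewrite ?lexx// scale0r addr0 subrr mul0r.
- by have [s /andP[s0 st] e] := line_MVT x hv t0; exists s => //; rewrite !gtr0_norm// ltW.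
(* For negative [t] the mean value theorem is run from the far endpoint [x + t *: v] with step
   [- t]. *)
have [|s /andP[s0 st] e] := @line_MVT h v (x + t *: v) (- t) hv; first by rewrite oppr_gt0.
exists (t + s); first by rewrite ler0_norm ?ltr0_norm//; lra.
move: e; rewrite -!addrA -!scalerDl subrr scale0r addr0 => e.
by apply: oppr_inj; rewrite opprB e mulNr.
Qed.

Lemma line_lipschitz h v x t (B : R) : (forall y, ddable h v y) ->
  (forall s, `|s| <= `|t| -> `|dder h v (x + s *: v)| <= B) ->
  `|h (x + t *: v) - h x| <= B * `|t|.
Proof.
move=> hv hB; have [s st ->] := @line_MVTN h v x t hv.
by rewrite normrM mulrC ler_wpM2r// hB.
Qed.

(** The mean value theorem twice in a row; the constant 1/2 of Taylor's formula is given away. *)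
Lemma line_taylor h v x t (B : R) : (forall y, ddable h v y) ->
  (forall y, ddable (dder h v) v y) ->
  (forall s, `|s| <= `|t| -> `|dder (dder h v) v (x + s *: v)| <= B) ->
  `|h (x + t *: v) - h x - t * dder h v x| <= B * t ^+ 2.
Proof.
move=> hv hv2 hB; have [s st ->] := @line_MVTN h v x t hv.
rewrite -mulrBr normrM; apply: le_trans (_ : `|t| * (B * `|s|) <= _).
  rewrite ler_wpM2l//; apply: (@line_lipschitz (dder h v) v x s B) => // r rs.
  by apply: hB; exact: le_trans st.
rewrite -real_normK ?num_real// mulrCA expr2 ler_wpM2l ?ler_wpM2l//.
by apply: le_trans (hB 0 _); rewrite ?normr0.
Qed.

Lemma ddable_of_quadratic h v x (l r B : R) : 0 < r ->
  (forall t, `|t| <= r -> `|h (x + t *: v) - h x - t * l| <= B * t ^+ 2) ->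
  ddable h v x /\ dder h v x = l.
Proof. by move=> r0 hB; rewrite dderE; have [? ?] := derive_of_quadratic r0 hB; split. Qed.

(** The second difference of [h] over the parallelogram with sides [t v] and [t w] is symmetric in
    [v] and [w]. Two mean value theorems write it as t^2 times one mixed derivative, or as t^2 times
    the other one, at points that tend to [x] with [t]; continuity concludes. *)
Lemma schwarz h (v w x : Rd) : (forall y, ddable h v y) -> (forall y, ddable h w y) ->
  (forall y, ddable (dder h v) w y) -> (forall y, ddable (dder h w) v y) ->
  continuous (dder (dder h v) w) -> continuous (dder (dder h w) v) ->
  dder (dder h v) w x = dder (dder h w) v x.
Proof.
have main (k : Rd -> R) (u z : Rd) (t : R) : (forall y, ddable k u y) -> (forall y, ddable k z y) ->
    (forall y, ddable (dder k u) z y) -> 0 < t -> exists a b : R,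
    [/\ 0 < a < t, 0 < b < t & k (x + t *: u + t *: z) - k (x + t *: z) - (k (x + t *: u) - k x)
     = t * (t * dder (dder k u) z (x + a *: u + b *: z))].
  move=> ku kz kuz t0.
  have hl (s : R) : is_derive s 1 (fun s : R => k (x + t *: z + s *: u) - k (x + s *: u))
      (dder k u (x + t *: z + s *: u) - dder k u (x + s *: u)).
    by apply: is_deriveB; exact: is_derive_line.
  have [a] := MVT t0 (fun s _ => hl s) (derivable_within_continuous (fun s _ => @ex_derive _ _ _ _ _ _ _ (hl s))).
  rewrite in_itv/= => a0t; rewrite !scale0r !addr0 subr0 => e.
  have [b b0t e2] := line_MVT (x + a *: u) kuz t0.
  exists a, b; split => //.
  rewrite -e2 [x + a *: u + t *: z]addrAC [RHS]mulrC -e [x + t *: u + _]addrAC; ring.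
move=> hv hw hvw hwv c1 c2; apply/eqP; rewrite -subr_eq0 -normr_le0; apply/ler_addgt0Pl => e e0.
rewrite addr0.
have /cvgrPdist_lt/(_ (e / 2) (divr_gt0 e0 (ltr0Sn _ _)))/nbhs_ballP[r1 /= r10 h1] := c1 x.
have /cvgrPdist_lt/(_ (e / 2) (divr_gt0 e0 (ltr0Sn _ _)))/nbhs_ballP[r2 /= r20 h2] := c2 x.
(* Small enough for the parallelogram to stay inside both balls on which the mixed derivatives vary
   by less than [e / 2]. *)
pose t := Num.min r1 r2 / (`|v| + `|w| + 1) : R.
have N0 : 0 < `|v| + `|w| + 1 by rewrite ltr_wpDl// addr_ge0.
have t0 : 0 < t by rewrite divr_gt0// lt_min r10.
have tr (a b : R) : 0 < a < t -> 0 < b < t -> `|a *: v + b *: w| < Num.min r1 r2.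
  move=> /andP[a0 at_] /andP[b0 bt]; apply: le_lt_trans (ler_normD _ _) _.
  rewrite !normrZ !gtr0_norm//; apply: (@le_lt_trans _ _ (t * (`|v| + `|w|))).
    by rewrite mulrDr lerD// ler_wpM2r// ltW.
  rewrite /t -mulrA gtr_pMr ?lt_min ?r10// mulrC ltr_pdivrMr// mul1r ltrDl//.
have [a [b [a0 b0 e1]]] := main h v w t hv hw hvw t0.
have [a' [b' [a0' b0' e2]]] := main h w v t hw hv hwv t0.
have E : dder (dder h v) w (x + a *: v + b *: w) = dder (dder h w) v (x + a' *: w + b' *: v).
  have tn : t != 0 by rewrite gt_eqF.
  suff : t * (t * dder (dder h v) w (x + a *: v + b *: w)) = t * (t * dder (dder h w) v (x + a' *: w + b' *: v)).
    by move=> /(mulfI tn)/(mulfI tn).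
  move: e1 e2; rewrite [x + t *: w + t *: v]addrAC.
  move: (h (x + t *: v + t *: w)) (h (x + t *: w)) (h (x + t *: v)) (h x) => p q r s <- <-.
  ring.
have b1 : ball x r1 (x + a *: v + b *: w).
  rewrite -ball_normE /= -addrA opprD addNKr normrN.
  by apply: lt_le_trans (tr _ _ a0 b0) _; rewrite ge_min lexx.
have b2 : ball x r2 (x + a' *: w + b' *: v).
  rewrite -ball_normE /= -addrA opprD addNKr normrN addrC.
  by apply: lt_le_trans (tr _ _ b0' a0') _; rewrite ge_min lexx orbT.
have := h1 _ b1; have := h2 _ b2; rewrite /= E => l2 l1.
rewrite (splitr e); apply: le_trans (ler_distD (dder (dder h w) v (x + a' *: w + b' *: v)) _ _) _.
by rewrite [X in _ + X]distrC; exact: ltW (ltrD l1 l2).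
Qed.

Lemma rV_continuousD h k : continuous h -> continuous k -> continuous (fun x => h x + k x).
Proof. by move=> ch ck x; exact: (cvgD (ch x) (ck x)). Qed.

Lemma rV_continuousB h k : continuous h -> continuous k -> continuous (fun x => h x - k x).
Proof. by move=> ch ck x; exact: (cvgB (ch x) (ck x)). Qed.

Lemma rV_continuousM h k : continuous h -> continuous k -> continuous (fun x => h x * k x).
Proof. by move=> ch ck x; exact: (cvgM (ch x) (ck x)). Qed.

Lemma rV_continuous_bound h :
  (forall x, exists2 C : R, 0 <= C & forall y : Rd, `|y - x| <= 1 -> `|h y - h x| <= C * `|y - x|) ->
  continuous h.
Proof.
move=> hC x.
apply/(@cvgrPdist_le R R^o Rd (nbhs x)) => e e0; have [C C0 hx] := hC x.
have r0 : 0 < Num.min 1 (e / (C + 1)) by rewrite lt_min ltr01 divr_gt0// ltr_wpDl.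
apply: filterS (nbhsx_ballx x _ r0) => y.
rewrite -ball_normE /= distrC lt_min => /andP[y1 ye].
rewrite distrC; apply: le_trans (hx y (ltW y1)) _.
rewrite ltr_pdivlMr ?ltr_wpDl// in ye; apply: le_trans (ltW ye).
by rewrite mulrC ler_wpM2l// lerDl.
Qed.

Lemma derive_prod h k x v : ddable h v x -> ddable k v x ->
  ddable (fun y => h y * k y) v x /\
  dder (fun y => h y * k y) v x = h x * dder k v x + k x * dder h v x.
Proof.
by move=> [dh] [dk]; rewrite !dderE; split; [split; exact: derivableM dh dk|exact: (deriveM dh dk)].
Qed.

Lemma derive_sum2 h k x v : ddable h v x -> ddable k v x ->
  ddable (fun y => h y + k y) v x /\ dder (fun y => h y + k y) v x = dder h v x + dder k v x.
Proof.
by move=> [dh] [dk]; rewrite !dderE; split; [split; exact: derivableD dh dk|exact: (deriveD dh dk)].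
Qed.

Lemma derive_diff h k x v : ddable h v x -> ddable k v x ->
  ddable (fun y => h y - k y) v x /\ dder (fun y => h y - k y) v x = dder h v x - dder k v x.
Proof.
by move=> [dh] [dk]; rewrite !dderE; split; [split; exact: derivableB dh dk|exact: (deriveB dh dk)].
Qed.

End directional_derivative.

(** * Smoothness, its closure properties and Taylor families *)

Section smooth_functions.
Context {R : realType} {d : nat}.
Local Notation Rd := 'rV[R]_d.
Implicit Types (f g : Rd -> R[i]) (x y a : Rd) (t B C M r : R) (i j : 'I_d).

Definition uvec (i : 'I_d) : Rd := locked (delta_mx ord0 i).

Local Notation e_ i := (uvec i).

Lemma uvecE i : uvec i = delta_mx ord0 i.
Proof. by rewrite /uvec -lock. Qed.

Lemma uvec_coord i j : uvec i ord0 j = (j == i)%:R.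
Proof. by rewrite uvecE mxE eqxx. Qed.

Lemma norm_uvec i : `|uvec i| = 1.
Proof. by rewrite uvecE; exact: norm_delta_mx. Qed.

Lemma ReCM t (z : R[i]) : complex.Re (t%:C * z) = t * complex.Re z.
Proof. by rewrite ReM/= mul0r subr0. Qed.

Lemma ImCM t (z : R[i]) : complex.Im (t%:C * z) = t * complex.Im z.
Proof. by rewrite ImM/= mul0r addr0. Qed.

Variant is_smooth f : Prop := IsSmooth of smooth f.

Definition pder : 'I_d -> (Rd -> R[i]) -> Rd -> R[i] := locked (@partial_deriv R d).

Local Notation dp := pder.

Lemma pderE : pder = @partial_deriv R d.
Proof. by rewrite /pder -lock. Qed.

Lemma partialE f i x : dp i f x = dder (fun y => complex.Re (f y)) (e_ i) x +i* dder (fun y => complex.Im (f y)) (e_ i) x.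
Proof. by rewrite pderE !dderE uvecE. Qed.

Lemma Re_partial f i : (fun x => complex.Re (dp i f x)) = dder (fun y => complex.Re (f y)) (e_ i).
Proof. by apply/funext => x; rewrite partialE. Qed.

Lemma Im_partial f i : (fun x => complex.Im (dp i f x)) = dder (fun y => complex.Im (f y)) (e_ i).
Proof. by apply/funext => x; rewrite partialE. Qed.

Lemma partial_of_quadratic f x i l (r B : R) : 0 < r ->
  (forall t, `|t| <= r -> normc (f (x + t *: e_ i) - f x - t%:C * l) <= B * t ^+ 2) ->
  [/\ ddable (fun y => complex.Re (f y)) (e_ i) x,
      ddable (fun y => complex.Im (f y)) (e_ i) x & dp i f x = l].
Proof.
move=> r0 hB.
have [t|h1 h1'] := @ddable_of_quadratic R d (fun y => complex.Re (f y)) (e_ i) x (complex.Re l) r B r0.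
  by move=> /hB; apply: le_trans; rewrite -ReCM -!ReB; exact: normc_Re.
have [t|h2 h2'] := @ddable_of_quadratic R d (fun y => complex.Im (f y)) (e_ i) x (complex.Im l) r B r0.
  by move=> /hB; apply: le_trans; rewrite -ImCM -!ImB; exact: normc_Im.
by rewrite partialE h1' h2' -complexE; split.
Qed.

Definition nice f := [/\ continuous (fun x => complex.Re (f x)), continuous (fun x => complex.Im (f x)) &
  forall i x, ddable (fun y => complex.Re (f y)) (e_ i) x /\ ddable (fun y => complex.Im (f y)) (e_ i) x].

Lemma smooth_nice f : is_smooth f -> nice f.
Proof.
case=> /(_ [::])[c1 c2 df]; split=> // i x; have [? ?] := df i x.
by rewrite uvecE; split; split.
Qed.

Lemma smooth_continuous f : is_smooth f ->
  continuous (fun x => complex.Re (f x)) /\ continuous (fun x => complex.Im (f x)).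
Proof. by case/smooth_nice. Qed.

Lemma smooth_derivable f i x : is_smooth f ->
  ddable (fun y => complex.Re (f y)) (e_ i) x /\ ddable (fun y => complex.Im (f y)) (e_ i) x.
Proof. by case/smooth_nice. Qed.

Lemma smooth_partial f i : is_smooth f -> is_smooth (dp i f).
Proof. by case=> sf; split=> s; have := sf (rcons s i); rewrite pderE /= foldr_rcons. Qed.

Lemma smooth_foldr f s : is_smooth f -> is_smooth (foldr dp f s).
Proof. by move=> sf; elim: s => [//|i s IH]; exact: smooth_partial IH. Qed.

(** Smoothness speaks of all iterated derivatives, so it holds on any class that consists of [nice]
    functions and is stable under partial derivatives. Closure under products, inverses and series
    is obtained by choosing the class. *)
Lemma smooth_coind (P : (Rd -> R[i]) -> Prop) : (forall f, P f -> nice f) ->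
  (forall f i, P f -> P (dp i f)) -> forall f, P f -> is_smooth f.
Proof.
move=> P1 P2 f Pf; split=> s g.
suff /P1[c1 c2 dg] : P g.
  by split=> // i x; have [[d1] [d2]] := dg i x; rewrite uvecE in d1 d2.
rewrite /g {g}; elim: s => [//|i s IH]; rewrite /= -pderE; apply: P2; rewrite pderE; exact: IH.
Qed.

Lemma niceD f g : nice f -> nice g -> nice (fun x => f x + g x) /\
  forall i, dp i (fun x => f x + g x) = (fun x => dp i f x + dp i g x).
Proof.
move=> [cf1 cf2 df] [cg1 cg2 dg].
have eR : (fun x => complex.Re (f x + g x)) = (fun x => complex.Re (f x) + complex.Re (g x)).
  by apply/funext => x; rewrite ReD.
have eI : (fun x => complex.Im (f x + g x)) = (fun x => complex.Im (f x) + complex.Im (g x)).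
  by apply/funext => x; rewrite ImD.
split.
  rewrite /nice eR eI; split; [exact: rV_continuousD|exact: rV_continuousD|move=> i x].
  have [f1 f2] := df i x; have [g1 g2] := dg i x.
  by have [? _] := derive_sum2 f1 g1; have [? _] := derive_sum2 f2 g2.
move=> i; apply/funext => x; have [f1 f2] := df i x; have [g1 g2] := dg i x.
by rewrite !partialE eR eI (derive_sum2 f1 g1).2 (derive_sum2 f2 g2).2.
Qed.

Lemma niceM f g : nice f -> nice g -> nice (fun x => f x * g x) /\
  forall i, dp i (fun x => f x * g x) = (fun x => dp i f x * g x + f x * dp i g x).
Proof.
move=> [cf1 cf2 df] [cg1 cg2 dg].
have eR : (fun x => complex.Re (f x * g x)) =
    (fun x => complex.Re (f x) * complex.Re (g x) - complex.Im (f x) * complex.Im (g x)).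
  by apply/funext => x; rewrite ReM.
have eI : (fun x => complex.Im (f x * g x)) =
    (fun x => complex.Re (f x) * complex.Im (g x) + complex.Im (f x) * complex.Re (g x)).
  by apply/funext => x; rewrite ImM.
split.
  rewrite /nice eR eI; split.
  - by apply: rV_continuousB; exact: rV_continuousM.
  - by apply: rV_continuousD; exact: rV_continuousM.
  - move=> i x; have [f1 f2] := df i x; have [g1 g2] := dg i x; split.
      exact: (derive_diff (derive_prod f1 g1).1 (derive_prod f2 g2).1).1.
    exact: (derive_sum2 (derive_prod f1 g2).1 (derive_prod f2 g1).1).1.
move=> i; apply/funext => x; have [f1 f2] := df i x; have [g1 g2] := dg i x.
rewrite [LHS]partialE eR eI (derive_diff (derive_prod f1 g1).1 (derive_prod f2 g2).1).2
  (derive_sum2 (derive_prod f1 g2).1 (derive_prod f2 g1).1).2.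
rewrite (derive_prod f1 g1).2 (derive_prod f2 g2).2 (derive_prod f1 g2).2 (derive_prod f2 g1).2.
rewrite [RHS]complexE ReD ImD !ReM !ImM !partialE /=; congr Complex; ring.
Qed.

Lemma partialD f g i : is_smooth f -> is_smooth g ->
  dp i (fun x => f x + g x) = (fun x => dp i f x + dp i g x).
Proof. by move=> /smooth_nice nf /smooth_nice ng; case: (niceD nf ng). Qed.

Lemma partialM f g i : is_smooth f -> is_smooth g ->
  dp i (fun x => f x * g x) = (fun x => dp i f x * g x + f x * dp i g x).
Proof. by move=> /smooth_nice nf /smooth_nice ng; case: (niceM nf ng). Qed.

Lemma partial_cst c i : dp i (fun=> c) = (fun=> 0).
Proof. by apply/funext => x; rewrite partialE !dderE !derive_cst. Qed.

Section smooth_algebra.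
Variable G : (Rd -> R[i]) -> Prop.

(** Leibniz' rule leaves the set of products of generators but not the algebra that they generate.
    The generators need derivatives only inside this algebra, which allows for inverses and for the
    functions [flat_exp]. *)
Inductive algebra_span : (Rd -> R[i]) -> Prop :=
| Span_gen f : G f -> algebra_span f
| Span_add f g : algebra_span f -> algebra_span g -> algebra_span (fun x => f x + g x)
| Span_mul f g : algebra_span f -> algebra_span g -> algebra_span (fun x => f x * g x).

Hypothesis G_nice : forall f, G f -> nice f.
Hypothesis G_partial : forall f i, G f -> algebra_span (dp i f).

Lemma algebra_span_nice f : algebra_span f -> nice f.
Proof.
elim=> [{}f /G_nice//|{}f g _ nf _ ng|{}f g _ nf _ ng].
  by case: (niceD nf ng).
by case: (niceM nf ng).
Qed.

Lemma algebra_span_partial f i : algebra_span f -> algebra_span (dp i f).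
Proof.
elim=> [{}f /(G_partial i)//|{}f g sf spf sg spg|{}f g sf spf sg spg].
  by have [_ ->] := niceD (algebra_span_nice sf) (algebra_span_nice sg); exact: Span_add.
have [_ ->] := niceM (algebra_span_nice sf) (algebra_span_nice sg).
by apply: Span_add; exact: Span_mul.
Qed.

Lemma algebra_span_smooth f : algebra_span f -> is_smooth f.
Proof. by apply: smooth_coind => [g|g i]; [exact: algebra_span_nice|exact: algebra_span_partial]. Qed.

End smooth_algebra.

Lemma smooth_algebra_smooth f : algebra_span is_smooth f -> is_smooth f.
Proof.
apply: algebra_span_smooth => [g|g i sg]; first exact: smooth_nice.
exact/Span_gen/smooth_partial.
Qed.

Lemma smoothD f g : is_smooth f -> is_smooth g -> is_smooth (fun x => f x + g x).
Proof. by move=> sf sg; apply/smooth_algebra_smooth/Span_add; exact: Span_gen. Qed.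

Lemma smoothM f g : is_smooth f -> is_smooth g -> is_smooth (fun x => f x * g x).
Proof. by move=> sf sg; apply/smooth_algebra_smooth/Span_mul; exact: Span_gen. Qed.

Lemma smooth_cst c : is_smooth (fun _ : Rd => c).
Proof.
apply: (@smooth_coind (fun f => exists c, f = fun=> c)); last by exists c.
  move=> _ [{}c ->]; split=> [x|x|i x]; [exact: cst_continuous|exact: cst_continuous|].
  by split; split; exact: derivable_cst.
by move=> _ i [{}c ->]; exists 0; exact: partial_cst.
Qed.

Lemma smoothZ c f : is_smooth f -> is_smooth (fun x => c * f x).
Proof. exact: smoothM (smooth_cst c). Qed.

Lemma partialZ c f i : is_smooth f -> dp i (fun x => c * f x) = (fun x => c * dp i f x).
Proof.
move=> sf; rewrite (partialM i (smooth_cst c) sf) partial_cst.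
by apply/funext => x; rewrite mul0r add0r.
Qed.

Lemma smoothN f : is_smooth f -> is_smooth (fun x => - f x).
Proof.
have -> : (fun x => - f x) = (fun x => -1 * f x) by apply/funext => x; rewrite mulN1r.
exact: smoothZ.
Qed.

Lemma partialN f i : is_smooth f -> dp i (fun x => - f x) = (fun x => - dp i f x).
Proof.
have -> : (fun x => - f x) = (fun x => -1 * f x) by apply/funext => x; rewrite mulN1r.
by move=> sf; rewrite partialZ//; apply/funext => x; rewrite mulN1r.
Qed.

Lemma smoothB f g : is_smooth f -> is_smooth g -> is_smooth (fun x => f x - g x).
Proof. by move=> sf sg; exact: smoothD sf (smoothN sg). Qed.

Lemma partialB f g i : is_smooth f -> is_smooth g ->
  dp i (fun x => f x - g x) = (fun x => dp i f x - dp i g x).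
Proof. by move=> sf sg; rewrite (partialD i sf (smoothN sg)) partialN. Qed.

Lemma smooth_sum (I : Type) (r : seq I) (F : I -> Rd -> R[i]) : (forall k, is_smooth (F k)) ->
  is_smooth (fun x => \sum_(k <- r) F k x) /\
  forall i, dp i (fun x => \sum_(k <- r) F k x) = (fun x => \sum_(k <- r) dp i (F k) x).
Proof.
move=> sF; elim: r => [|k r [IH1 IH2]].
  under eq_fun do rewrite big_nil; split=> [|i]; first exact: smooth_cst.
  by rewrite partial_cst; apply/funext => x; rewrite big_nil.
under eq_fun do rewrite big_cons; split=> [|i]; first exact: smoothD (sF k) IH1.
by rewrite (partialD i (sF k) IH1) IH2; apply/funext => x; rewrite big_cons.
Qed.

Lemma continuous_cube_bounded (h : Rd -> R) M : continuous h ->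
  exists2 B, 0 <= B & forall x, `|x| <= M -> `|h x| <= B.
Proof.
move=> ch; have [M0|M0] := leP 0 M; last first.
  by exists 0 => // x xM; have := lt_le_trans M0 (le_trans (normr_ge0 x) xM); rewrite ltxx.
have cub0 : cube M (0 : Rd) by rewrite /cube/= normr0.
have cnh : continuous (fun x => `|h x|).
  by move=> x; apply: (@continuous_comp _ _ _ h Num.norm); [exact: ch|exact: norm_continuous].
have [c _ hc] := EVT_max_rV (ex_intro _ _ cub0) (@compact_cube R d M) (continuous_subspaceT cnh).
by exists `|h c| => // x xM; apply: hc; rewrite inE.
Qed.

Lemma smooth_cube_bounded f M : is_smooth f ->
  exists2 B, 0 <= B & forall x, `|x| <= M -> normc (f x) <= B.
Proof.
move=> /smooth_continuous[c1 c2].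
have [B1 B10 h1] := continuous_cube_bounded M c1; have [B2 B20 h2] := continuous_cube_bounded M c2.
exists (B1 + B2); first exact: addr_ge0.
by move=> x xM; apply: le_trans (normc_ReIm _) _; rewrite lerD ?h1 ?h2.
Qed.

Lemma norm_addZ_delta x t i : `|x + t *: e_ i| <= `|x| + `|t|.
Proof. by apply: le_trans (ler_normD _ _) _; rewrite normrZ norm_uvec mulr1. Qed.

Lemma smooth_taylor_bound f i x t B : is_smooth f ->
  (forall s, `|s| <= `|t| -> normc (dp i (dp i f) (x + s *: e_ i)) <= B) ->
  normc (f (x + t *: e_ i) - f x - t%:C * dp i f x) <= 2 * B * t ^+ 2.
Proof.
move=> sf hB; apply: le_trans (normc_ReIm _) _; rewrite !ReB !ImB ReCM ImCM !partialE /=.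
have -> : 2 * B * t ^+ 2 = B * t ^+ 2 + B * t ^+ 2 by ring.
have d1 y := smooth_derivable i y sf.
have d2 y := smooth_derivable i y (smooth_partial i sf); rewrite Re_partial Im_partial in d2.
apply: lerD.
  apply: (@line_taylor _ _ (fun y => complex.Re (f y)) (e_ i) x t B) => [y|y|s st].
  - by case: (d1 y).
  - by case: (d2 y).
  - by apply: le_trans (hB s st); rewrite -2!Re_partial normc_Re.
apply: (@line_taylor _ _ (fun y => complex.Im (f y)) (e_ i) x t B) => [y|y|s st].
- by case: (d1 y).
- by case: (d2 y).
- by apply: le_trans (hB s st); rewrite -2!Im_partial normc_Im.
Qed.

Lemma smooth_lipschitz_bound f i x t B : is_smooth f ->
  (forall s, `|s| <= `|t| -> normc (dp i f (x + s *: e_ i)) <= B) ->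
  normc (f (x + t *: e_ i) - f x) <= 2 * B * `|t|.
Proof.
move=> sf hB; apply: le_trans (normc_ReIm _) _; rewrite !ReB !ImB /=.
have -> : 2 * B * `|t| = B * `|t| + B * `|t| by ring.
have d1 y := smooth_derivable i y sf.
apply: lerD.
  apply: (@line_lipschitz _ _ (fun y => complex.Re (f y)) (e_ i) x t B) => [y|s st].
    by case: (d1 y).
  by apply: le_trans (hB s st); rewrite -Re_partial normc_Re.
apply: (@line_lipschitz _ _ (fun y => complex.Im (f y)) (e_ i) x t B) => [y|s st].
  by case: (d1 y).
by apply: le_trans (hB s st); rewrite -Im_partial normc_Im.
Qed.

Definition taylor f g i := forall M, exists B, forall x t, `|x| <= M -> `|t| <= 1 ->
  normc (f (x + t *: e_ i) - f x - t%:C * g x) <= B * t ^+ 2.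

Lemma smooth_taylor f i : is_smooth f -> taylor f (dp i f) i.
Proof.
move=> sf M; have [B B0 hB] := smooth_cube_bounded (M + 1) (smooth_partial i (smooth_partial i sf)).
exists (2 * B) => x t xM t1; apply: smooth_taylor_bound => // s st; apply: hB.
by apply: le_trans (norm_addZ_delta _ _ _) _; rewrite lerD// (le_trans st).
Qed.

Lemma taylor_partial f g i x : taylor f g i ->
  [/\ ddable (fun y => complex.Re (f y)) (e_ i) x,
      ddable (fun y => complex.Im (f y)) (e_ i) x & dp i f x = g x].
Proof.
move=> /(_ `|x|)[B hB]; apply: (@partial_of_quadratic f x i (g x) 1 B) => // t t1.
exact: hB.
Qed.

(** The path from [x] to [y] changes one coordinate at a time: [z k] has the first [k] coordinates
    of [y] and the others of [x]. For the maximum norm all the corners stay in the cube of radius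
    [M]. *)
Lemma coord_path_bound (f : Rd -> R[i]) (C M : R) x y :
  (forall i z t, `|z| <= M -> `|t| <= `|y - x| -> normc (f (z + t *: e_ i) - f z) <= C * `|t|) ->
  0 <= C -> `|x| <= M -> `|y| <= M -> normc (f y - f x) <= d%:R * C * `|y - x|.
Proof.
move=> hf C0 xM yM.
pose z (k : nat) : Rd := \row_i (if (i < k)%N then y ord0 i else x ord0 i).
have zM k : `|z k| <= M.
  apply: rV_norm_le => [|i]; first exact: le_trans (normr_ge0 x) xM.
  by rewrite mxE; case: ifP => _; exact: le_trans (coord_le_norm _ _) _.
have z0 : z 0%N = x by apply/rowP => i; rewrite mxE.
have zd : z d = y by apply/rowP => i; rewrite mxE ltn_ord.
have zS (k : 'I_d) : z k.+1 = z k + (y ord0 k - x ord0 k) *: e_ k.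
  apply/rowP => i; rewrite !mxE uvec_coord ltnS leq_eqVlt.
  have [->|ik] := eqVneq i k; first by rewrite eqxx ltnn/= mulr1 addrC subrK.
  by rewrite -[_ == _ :> nat]/(i == k) (negbTE ik) mulr0 addr0.
have -> : f y - f x = \sum_(k < d) (f (z k.+1) - f (z k)).
  by rewrite -(big_mkord xpredT (fun k => f (z k.+1) - f (z k))) telescope_sumr// z0 zd.
apply: le_trans (normc_sum _ _ _) _.
have -> : d%:R * C * `|y - x| = \sum_(k < d) C * `|y - x|.
  by rewrite sumr_const card_ord -mulrA mulr_natl.
apply: ler_sum => k _; rewrite zS.
have yx : `|y ord0 k - x ord0 k| <= `|y - x| by have := coord_le_norm (y - x) k; rewrite !mxE.
by apply: le_trans (hf _ _ _ (zM k) yx) _; rewrite ler_wpM2l.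
Qed.

(* Candidate derivatives, indexed by words: a function given by a series or by an
   integral is shown to be smooth from locally uniform quadratic remainders, with
   no interchange of limits. *)
Definition taylor_family (G : seq 'I_d -> Rd -> R[i]) :=
  (forall s M, exists B, forall x, `|x| <= M -> normc (G s x) <= B) /\
  (forall s i, taylor (G s) (G (i :: s)) i).

(** A quadratic remainder and a local bound on the candidate derivative give a Lipschitz estimate
    along each coordinate direction, and hence, along coordinate paths, in every direction. *)
Lemma taylor_family_continuous G s : taylor_family G ->
  continuous (fun x => complex.Re (G s x)) /\ continuous (fun x => complex.Im (G s x)).
Proof.
move=> [hb ht].
have main x : exists2 C : R, 0 <= C & forall y, `|y - x| <= 1 -> normc (G s y - G s x) <= C * `|y - x|.
  have /choice[B hB] : forall i, exists C, forall z t, `|z| <= `|x| + 1 -> `|t| <= 1 ->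
      normc (G s (z + t *: e_ i) - G s z) <= C * `|t|.
    move=> i; have [B1 h1] := hb (i :: s) (`|x| + 1); have [B2 h2] := ht s i (`|x| + 1).
    exists (`|B1| + `|B2|) => z t zM t1.
    rewrite -[G s _ - _](subrK (t%:C * G (i :: s) z)).
    apply: le_trans (ler_normcD _ _) _; rewrite addrC mulrDl lerD//.
      rewrite normcM normc_real mulrC ler_wpM2r//.
      by apply: le_trans (h1 z zM) _; exact: ler_norm.
    apply: le_trans (h2 z t zM t1) _; rewrite -real_normK ?num_real// expr2 mulrA ler_wpM2r//.
    rewrite -[leRHS]mulr1; apply: le_trans (_ : `|B2| * `|t| <= _); last by rewrite ler_wpM2l.
    by rewrite ler_wpM2r// ler_norm.
  exists (d%:R * \sum_i `|B i|); first by rewrite mulr_ge0// sumr_ge0.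
  move=> y yx; apply: (@coord_path_bound (G s) (\sum_i `|B i|) (`|x| + 1)) => //.
  - move=> i z t zM ty; apply: le_trans (hB i z t zM (le_trans ty yx)) _.
    rewrite ler_wpM2r// (bigD1 i)//=; apply: le_trans (ler_norm _) _.
    by rewrite lerDl sumr_ge0.
  - exact: sumr_ge0.
  - by rewrite lerDl.
  - by rewrite -(subrK x y) addrC; apply: le_trans (ler_normD _ _) _; rewrite lerD2l.
have cont (p : R[i] -> R) : (forall z, `|p z| <= normc z) -> {morph p : u v / u - v} ->
    continuous (fun x => p (G s x)).
  move=> pz pB; apply: rV_continuous_bound => x; have [C C0 hC] := main x; exists C => // y y1.
  by rewrite -pB; apply: le_trans (pz _) (hC y y1).
by split; apply: cont; [exact: normc_Re|exact: ReB|exact: normc_Im|exact: ImB].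
Qed.

Lemma taylor_family_smooth G : taylor_family G ->
  (forall s, is_smooth (G s)) /\ forall s i, dp i (G s) = G (i :: s).
Proof.
move=> tG; have dG s i : dp i (G s) = G (i :: s).
  by apply/funext => x; have [_ _ ->] := taylor_partial x (tG.2 s i).
split=> // s; apply: (@smooth_coind (fun f => exists s, f = G s)); last by exists s.
  move=> _ [{}s ->]; have [? ?] := taylor_family_continuous s tG; split=> // i x.
  by have [? ? _] := taylor_partial x (tG.2 s i).
by move=> _ i [{}s ->]; exists (i :: s).
Qed.

Lemma taylor_family_foldr G s : taylor_family G -> foldr dp (G [::]) s = G s.
Proof. by move=> /taylor_family_smooth[_ dG]; elim: s => //= i s ->. Qed.

Lemma translate_partial f a i : is_smooth f -> dp i (fun x => f (x + a)) = (fun x => dp i f (x + a)).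
Proof.
move=> sf; apply/funext => x; have [B hB] := smooth_taylor i sf `|x + a|.
have [t t1|_ _ //] := @partial_of_quadratic (fun x => f (x + a)) x i (dp i f (x + a)) 1 B ltr01.
by rewrite [x + _ + a]addrAC; exact: hB.
Qed.

Lemma smooth_translate f a : is_smooth f -> is_smooth (fun x => f (x + a)).
Proof.
move=> sf; have := @taylor_family_smooth (fun s x => foldr dp f s (x + a)).
case=> [|/(_ [::])//]; split=> [s M|s i M].
  have [B _ hB] := smooth_cube_bounded (M + `|a|) (smooth_foldr s sf).
  exists B => x xM; apply: hB; apply: le_trans (ler_normD _ _) _; exact: lerD.
have [B hB] := smooth_taylor i (smooth_foldr s sf) (M + `|a|).
exists B => x t xM t1; rewrite [x + _ + a]addrAC; apply: (hB (x + a) t _ t1).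
by apply: le_trans (ler_normD _ _) _; exact: lerD.
Qed.

Lemma reflect_nice f i x : is_smooth f ->
  [/\ ddable (fun y => complex.Re (f (- y))) (e_ i) x,
      ddable (fun y => complex.Im (f (- y))) (e_ i) x &
      dp i (fun x => f (- x)) x = - dp i f (- x)].
Proof.
move=> sf; have [B hB] := smooth_taylor i sf `|- x|.
apply: (@partial_of_quadratic (fun x => f (- x)) x i (- dp i f (- x)) 1 B ltr01) => t t1.
have := hB (- x) (- t) (lexx _); rewrite sqrrN normrN => /(_ t1).
by rewrite opprD scaleNr rmorphN/= mulNr mulrN.
Qed.

Lemma reflect_partial f i : is_smooth f -> dp i (fun x => f (- x)) = (fun x => - dp i f (- x)).
Proof. by move=> sf; apply/funext => x; case: (reflect_nice i x sf). Qed.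

Lemma smooth_reflect f : is_smooth f -> is_smooth (fun x => f (- x)).
Proof.
move=> sf; apply: (@smooth_coind (fun g => exists2 f, is_smooth f & g = (fun x => f (- x)))); last by exists f.
  move=> _ [{sf}f sf ->]; have [c1 c2] := smooth_continuous sf; split=> [x|x|i x].
  - by apply: (@continuous_comp _ _ _ (-%R : Rd -> Rd) (fun x => complex.Re (f x))); [exact: opp_continuous|exact: c1].
  - by apply: (@continuous_comp _ _ _ (-%R : Rd -> Rd) (fun x => complex.Im (f x))); [exact: opp_continuous|exact: c2].
  by have [? ? _] := reflect_nice i x sf.
move=> _ i [{sf}f sf ->]; exists (fun x => - dp i f x); first exact: smoothN (smooth_partial i sf).
exact: reflect_partial.
Qed.

Lemma partial_comm f i j : is_smooth f -> dp i (dp j f) = dp j (dp i f).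
Proof.
move=> sf; apply/funext => x.
have si := smooth_partial i sf; have sj := smooth_partial j sf.
have [c1 c2] := smooth_continuous (smooth_partial i sj).
have [c3 c4] := smooth_continuous (smooth_partial j si).
rewrite Re_partial (Re_partial f j) in c1; rewrite Im_partial (Im_partial f j) in c2.
rewrite Re_partial (Re_partial f i) in c3; rewrite Im_partial (Im_partial f i) in c4.
have di y := smooth_derivable i y sf; have dj y := smooth_derivable j y sf.
have dij y := smooth_derivable i y sj; rewrite Re_partial Im_partial in dij.
have dji y := smooth_derivable j y si; rewrite Re_partial Im_partial in dji.
have eR := schwarz x (fun y => (dj y).1) (fun y => (di y).1) (fun y => (dij y).1) (fun y => (dji y).1) c1 c3.
have eI := schwarz x (fun y => (dj y).2) (fun y => (di y).2) (fun y => (dij y).2) (fun y => (dji y).2) c2 c4.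
rewrite (partialE (dp j f)) (partialE (dp i f)) (Re_partial f j) (Re_partial f i).
by rewrite (Im_partial f j) (Im_partial f i) eR eI.
Qed.

(** By the symmetry of second derivatives any letter of a word can be pulled to the front; induction
    on the first letter of [s] then suffices. *)
Lemma foldr_partial_perm f (s t : seq 'I_d) : is_smooth f -> perm_eq s t -> foldr dp f s = foldr dp f t.
Proof.
move=> sf; have front s1 i s2 : foldr dp f (s1 ++ i :: s2) = dp i (foldr dp f (s1 ++ s2)).
  elim: s1 => [//|k s1 IH]; rewrite /= IH; exact: partial_comm (smooth_foldr _ sf).
elim: s t => [|i s IH] t st.
  by have := perm_size st; case: t {st}.
have it : i \in t by rewrite -(perm_mem st) mem_head.
case/splitPr: it st => t1 t2 st.
rewrite front /= (IH (t1 ++ t2))//.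
by move: st; rewrite perm_sym -cat1s perm_catCA /= perm_cons perm_sym.
Qed.

Definition mi_word (a : 'I_d -> nat) : seq 'I_d := flatten [seq nseq (a i) i | i <- enum 'I_d].

Lemma mi_derivE (a : multiindex) f : mi_deriv a f = foldr dp f (mi_word a).
Proof.
rewrite /mi_deriv /mi_word -pderE; elim: (enum _) => //= i s ->.
by rewrite foldr_cat; elim: (a i) => //= k ->.
Qed.

Lemma size_mi_word (a : 'I_d -> nat) : size (mi_word a) = mi_order a.
Proof.
rewrite /mi_word size_flatten /shape -map_comp sumnE big_map big_enum /=.
by apply: eq_bigr => i _; rewrite size_nseq.
Qed.

Lemma foldr_partial_mi f s : is_smooth f ->
  foldr dp f s = mi_deriv (fun i => count_mem i s) f /\ mi_order (fun i => count_mem i s) = size s.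
Proof.
have H : perm_eq s (mi_word (fun i => count_mem i s)).
  apply/allP => k _ /=; apply/eqP; rewrite /mi_word count_flatten -map_comp sumnE big_map big_enum /=.
  rewrite (bigD1 k)//= count_nseq /= eqxx mul1n big1 ?addn0// => j jk.
  by rewrite count_nseq /= (negbTE jk).
move=> sf; rewrite mi_derivE -size_mi_word -(perm_size H); split; last by [].
exact: foldr_partial_perm.
Qed.

End smooth_functions.

(** * Sums of derivatives, supports and test functions *)

Section derivative_sums.
Context {R : realType} {d : nat}.
Local Notation Rd := 'rV[R]_d.
Implicit Types (f g : Rd -> R[i]) (x y a : Rd) (t B C M : R) (i j : 'I_d) (N : nat).
Local Notation dp := pder.
Local Notation e_ i := (uvec i).

(* A derivative is counted once for each word of directions that yields it. *)
Fixpoint dsum N f x : R :=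
  if N is N'.+1 then normc (f x) + \sum_(i < d) dsum N' (dp i f) x else normc (f x).

Lemma dsum_ge0 N f x : 0 <= dsum N f x.
Proof.
by elim: N f => [|N IH] f /=; rewrite ?addr_ge0 ?normc_ge0// sumr_ge0.
Qed.

Lemma normc_le_dsum N f x : normc (f x) <= dsum N f x.
Proof. by case: N => [|N] //=; rewrite lerDl sumr_ge0// => i _; exact: dsum_ge0. Qed.

Lemma dsum_partial N i f x : dsum N (dp i f) x <= dsum N.+1 f x.
Proof.
rewrite /= (bigD1 i)//= addrCA lerDl addr_ge0 ?normc_ge0// sumr_ge0// => j _; exact: dsum_ge0.
Qed.

Lemma dsum_leS N f x : dsum N f x <= dsum N.+1 f x.
Proof.
elim: N f => [|N IH] f; first exact: normc_le_dsum.
rewrite [leRHS]/= [leLHS]/= lerD2l; apply: ler_sum => i _; exact: IH.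
Qed.

Lemma dsum_le N K f x : (N <= K)%N -> dsum N f x <= dsum K f x.
Proof.
move=> /subnK <-; elim: (K - N)%N => // k IH; rewrite addSn.
exact: le_trans IH (dsum_leS _ _ _).
Qed.

Lemma dsum_foldr N f s x : dsum N (foldr dp f s) x <= dsum (size s + N) f x.
Proof.
elim: s N => [|i s IH] N //; rewrite [size _]/= addSnnS.
by apply: le_trans (IH N.+1); exact: dsum_partial.
Qed.

Lemma normc_foldr_le N f s x : (size s <= N)%N -> normc (foldr dp f s x) <= dsum N f x.
Proof.
move=> sN; apply: le_trans (dsum_le _ _ sN); rewrite -[size s]addn0.
exact: (dsum_foldr 0).
Qed.

(** The number 1 + d + ... + d^N of words of length at most [N], that is, of terms of [dsum N]. *)
Fixpoint wordcount N : R := if N is N'.+1 then 1 + d%:R * wordcount N' else 1.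

Lemma wordcount_ge1 N : 1 <= wordcount N.
Proof.
elim: N => //= N IH; rewrite lerDl mulr_ge0//; exact: le_trans IH.
Qed.

Lemma wordcount_ge0 N : 0 <= wordcount N.
Proof. exact: le_trans ler01 (wordcount_ge1 N). Qed.

Lemma dsum_bound N f x B :
  (forall s, (size s <= N)%N -> normc (foldr dp f s x) <= B) -> dsum N f x <= wordcount N * B.
Proof.
elim: N f => [|N IH] f hB; first by rewrite mul1r; exact: (hB [::]).
rewrite /= mulrDl mul1r lerD//; first exact: (hB [::]).
apply: le_trans (_ : \sum_(i < d) wordcount N * B <= _).
  apply: ler_sum => i _; apply: IH => s sN.
  by rewrite -foldr_rcons; apply: hB; rewrite size_rcons.
by rewrite sumr_const card_ord -mulrA mulr_natl.
Qed.

Lemma dsumD N f g x : is_smooth f -> is_smooth g ->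
  dsum N (fun x => f x + g x) x <= dsum N f x + dsum N g x.
Proof.
elim: N f g => [|N IH] f g sf sg; first exact: ler_normcD.
rewrite /= addrACA lerD//; first exact: ler_normcD.
rewrite -big_split; apply: ler_sum => i _ /=; rewrite (partialD i sf sg).
by apply: IH; exact: smooth_partial.
Qed.

Lemma dsumZ N c f x : is_smooth f -> dsum N (fun x => c * f x) x = normc c * dsum N f x.
Proof.
elim: N f => [|N IH] f sf; first by rewrite /= normcM.
rewrite /= normcM mulrDr mulr_sumr; congr (_ + _); apply: eq_bigr => i _.
by rewrite (partialZ c i sf); apply: IH; exact: smooth_partial.
Qed.

Lemma dsumB N f g x : is_smooth f -> is_smooth g ->
  dsum N (fun x => f x - g x) x <= dsum N f x + dsum N g x.
Proof.
move=> sf sg; apply: le_trans (dsumD _ _ sf (smoothN sg)) _; rewrite lerD2l.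
have -> : (fun x => - g x) = (fun x => -1 * g x) by apply/funext => z; rewrite mulN1r.
by rewrite dsumZ// normc_opp normc1 mul1r.
Qed.

Lemma dsum_zero N x : dsum N (fun _ : Rd => 0) x = 0.
Proof.
elim: N => [|N IH]; first exact: normc0.
have -> : dsum N.+1 (fun _ : Rd => 0) x = normc (0 : R[i]) + \sum_(i < d) dsum N (dp i (fun=> 0)) x by [].
by rewrite big1 ?addr0 => [|i _]; [exact: normc0|rewrite partial_cst].
Qed.

Lemma dsum_sum N (I : Type) (r : seq I) (F : I -> Rd -> R[i]) x : (forall k, is_smooth (F k)) ->
  dsum N (fun x => \sum_(k <- r) F k x) x <= \sum_(k <- r) dsum N (F k) x.
Proof.
move=> sF; elim: r => [|k r IH].
  by rewrite big_nil; under [X in dsum _ X _]eq_fun do rewrite big_nil; rewrite dsum_zero.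
rewrite big_cons; under [X in dsum _ X _]eq_fun do rewrite big_cons.
by apply: le_trans (dsumD _ _ (sF k) (smooth_sum r sF).1) _; rewrite lerD2l.
Qed.

(** Each order contributes the undifferentiated product and the two terms of Leibniz' rule, each
    within the bound of the previous order: 1 + 2 3^N <= 3^(N+1). *)
Lemma dsumM N f g x : is_smooth f -> is_smooth g ->
  dsum N (fun x => f x * g x) x <= 3 ^+ N * (dsum N f x * dsum N g x).
Proof.
elim: N f g => [|N IH] f g sf sg; first by rewrite /= normcM mul1r.
have f1 := dsum_ge0 N.+1 f x; have g1 := dsum_ge0 N.+1 g x.
rewrite [leLHS]/=; set A := dsum N.+1 f x in f1 *; set B := dsum N.+1 g x in g1 *.
apply: le_trans (_ : A * B + (3 ^+ N * (A * B) + 3 ^+ N * (A * B)) <= _); last first.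
  rewrite exprS; have : 1 * (A * B) <= 3 ^+ N * (A * B).
    by rewrite ler_wpM2r ?mulr_ge0// exprn_ege1// ler1n.
  set P := 3 ^+ N * (A * B); rewrite -mulrA -/P; lra.
apply: lerD.
  by rewrite normcM ler_pM ?normc_ge0//; exact: normc_le_dsum.
apply: le_trans (_ : \sum_(i < d) (3 ^+ N * (dsum N (dp i f) x * B) + 3 ^+ N * (A * dsum N (dp i g) x)) <= _).
  apply: ler_sum => i _; rewrite (partialM i sf sg).
  have si := smooth_partial i sf; have sj := smooth_partial i sg.
  apply: le_trans (dsumD _ _ (smoothM si sg) (smoothM sf sj)) _; apply: lerD.
    apply: le_trans (IH _ _ si sg) _; rewrite ler_wpM2l ?exprn_ge0// ler_wpM2l ?dsum_ge0//.
    exact: dsum_leS.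
  apply: le_trans (IH _ _ sf sj) _; rewrite ler_wpM2l ?exprn_ge0// ler_wpM2r ?dsum_ge0//.
  exact: dsum_leS.
rewrite big_split -!mulr_sumr -mulr_suml.
have hf : \sum_(i < d) dsum N (dp i f) x <= A by rewrite /A /= lerDr normc_ge0.
have hg : \sum_(i < d) dsum N (dp i g) x <= B by rewrite /B /= lerDr normc_ge0.
by apply: lerD; rewrite ler_wpM2l ?exprn_ge0//; [rewrite ler_wpM2r|rewrite ler_wpM2l].
Qed.

Lemma dsum_translate N f a x : is_smooth f -> dsum N (fun x => f (x + a)) x = dsum N f (x + a).
Proof.
elim: N f => [|N IH] f sf //=; congr (_ + _); apply: eq_bigr => i _.
by rewrite (translate_partial a i sf); apply: IH; exact: smooth_partial.
Qed.

Lemma dsum_opp N f x : is_smooth f -> dsum N (fun x => - f x) x = dsum N f x.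
Proof.
move=> sf; have -> : (fun x => - f x) = (fun x => -1 * f x) by apply/funext => z; rewrite mulN1r.
by rewrite dsumZ// normc_opp normc1 mul1r.
Qed.

Lemma dsum_reflect N f x : is_smooth f -> dsum N (fun x => f (- x)) x = dsum N f (- x).
Proof.
elim: N f => [|N IH] f sf //=; congr (_ + _); apply: eq_bigr => i _.
have sdf := smooth_partial i sf.
rewrite (reflect_partial i sf) dsum_opp; last exact: smooth_reflect.
exact: IH.
Qed.

Lemma continuous_normc f : continuous (fun x => complex.Re (f x)) ->
  continuous (fun x => complex.Im (f x)) -> continuous (fun x => normc (f x)).
Proof.
move=> c1 c2; have -> : (fun x => normc (f x)) =
    (fun x => Num.sqrt (complex.Re (f x) * complex.Re (f x) + complex.Im (f x) * complex.Im (f x))).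
  by apply/funext => x; rewrite normcE !expr2.
have cc := rV_continuousD (rV_continuousM c1 c1) (rV_continuousM c2 c2).
by move=> x; apply: (continuous_comp (cc x)); exact: sqrt_continuous.
Qed.

Lemma smooth_continuous_normc f : is_smooth f -> continuous (fun x => normc (f x)).
Proof. by move=> /smooth_continuous[]; exact: continuous_normc. Qed.

Lemma continuous_rsum (I : Type) (r : seq I) (F : I -> Rd -> R) : (forall k, continuous (F k)) ->
  continuous (fun x => \sum_(k <- r) F k x).
Proof.
move=> cF; elim: r => [|k r IH].
  by under eq_fun do rewrite big_nil; exact: cst_continuous.
by under eq_fun do rewrite big_cons; exact: rV_continuousD (cF k) IH.
Qed.

Lemma dsum_continuous N f : is_smooth f -> continuous (dsum N f).
Proof.
elim: N f => [|N IH] f sf; first exact: smooth_continuous_normc.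
apply: (rV_continuousD (smooth_continuous_normc sf)).
by apply: continuous_rsum => i; apply: IH; exact: smooth_partial.
Qed.

Definition vanish_off M f := forall x, M < `|x| -> f x = 0.

Variant is_test f : Prop := IsTest of is_smooth f & exists M, vanish_off M f.

Lemma test_smooth f : is_test f -> is_smooth f. Proof. by case. Qed.

Lemma vanish_off_tsupport M f : vanish_off M f -> tsupport f `<=` cube M.
Proof.
move=> vf; have cc : closed (@cube R d M).
  by apply: compact_closed; [exact: norm_hausdorff|exact: compact_cube].
rewrite /tsupport (closure_id (cube M)).1//.
by apply: closure_subset => x /=; rewrite /cube /= leNgt; apply: contra_neqN => /vf.
Qed.

Lemma is_testP f : test_function f <-> is_test f.
Proof.
split=> [[sf /compact_sub_cube[M _ hM]]|[[sf] [M vf]]].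
  split=> //; exists M => x Mx; apply/eqP; apply: contraPT (Mx) => fx.
  by apply/negP; rewrite -leNgt; apply: hM; exact: subset_closure.
split=> //; apply: (@subclosed_compact _ _ (cube M)).
- exact: closed_closure.
- exact: compact_cube.
- exact: vanish_off_tsupport.
Qed.

(** Outside the closed cube [f] vanishes in a neighbourhood, here of radius half the distance
    [|x| - M], so that 0 is the derivative with remainder 0. *)
Lemma vanish_off_partial M f i : vanish_off M f -> vanish_off M (dp i f).
Proof.
move=> vf x Mx; have r0 : 0 < (`|x| - M) / 2 by rewrite divr_gt0// subr_gt0.
have [t tr|_ _ //] := @partial_of_quadratic R d f x i 0 ((`|x| - M) / 2) 0 r0.
rewrite !vf//; last first.
  have : `|x| <= `|x + t *: e_ i| + `|t|.
    rewrite -{1}(addrK (t *: e_ i) x); apply: le_trans (ler_normB _ _) _.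
    by rewrite normrZ norm_uvec mulr1.
  lra.
by rewrite mulr0 !subr0 normc0 mul0r.
Qed.

Lemma vanish_off_foldr M f s : vanish_off M f -> vanish_off M (foldr dp f s).
Proof. by move=> vf; elim: s => [//|i s IH]; exact: vanish_off_partial. Qed.

Lemma vanish_off_dsum N M f x : vanish_off M f -> M < `|x| -> dsum N f x = 0.
Proof.
move=> + Mx; elim: N f => [|N IH] f vf /=; rewrite (vf x Mx) normc0// add0r big1// => i _.
by apply: IH; exact: vanish_off_partial.
Qed.

Lemma vanish_off_le M M' f : M <= M' -> vanish_off M f -> vanish_off M' f.
Proof. by move=> MM vf x /(le_lt_trans MM); exact: vf. Qed.

Lemma vanish_offD M f g : vanish_off M f -> vanish_off M g -> vanish_off M (fun x => f x + g x).
Proof. by move=> vf vg x Mx; rewrite vf// vg// addr0. Qed.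

Lemma vanish_offB M f g : vanish_off M f -> vanish_off M g -> vanish_off M (fun x => f x - g x).
Proof. by move=> vf vg x Mx; rewrite vf// vg// subr0. Qed.

Lemma vanish_offM M f g : vanish_off M f -> vanish_off M (fun x => f x * g x).
Proof. by move=> vf x Mx; rewrite vf// mul0r. Qed.

Lemma vanish_off_translate M f a : vanish_off M f -> vanish_off (M + `|a|) (fun x => f (x + a)).
Proof.
move=> vf x Mx; apply: vf; have : `|x| <= `|x + a| + `|a|.
  by rewrite -{1}(addrK a x); exact: ler_normB.
lra.
Qed.

Lemma vanish_off_reflect M f : vanish_off M f -> vanish_off M (fun x => f (- x)).
Proof. by move=> vf x Mx; apply: vf; rewrite normrN. Qed.

Lemma testD f g : is_test f -> is_test g -> is_test (fun x => f x + g x).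
Proof.
move=> [sf [M vf]] [sg [M' vg]]; split; first exact: smoothD.
exists (Num.max M M'); apply: vanish_offD.
  by apply: vanish_off_le vf; rewrite le_max lexx.
by apply: vanish_off_le vg; rewrite le_max lexx orbT.
Qed.

Lemma testM f g : is_test f -> is_smooth g -> is_test (fun x => f x * g x).
Proof.
by move=> [sf [M vf]] sg; split; [exact: smoothM|exists M; exact: vanish_offM].
Qed.

Lemma testZ c f : is_test f -> is_test (fun x => c * f x).
Proof.
move=> tf; have -> : (fun x => c * f x) = (fun x => f x * c) by apply/funext => x; rewrite mulrC.
by apply: testM => //; exact: smooth_cst.
Qed.

Lemma testN f : is_test f -> is_test (fun x => - f x).
Proof.
have -> : (fun x => - f x) = (fun x => -1 * f x) by apply/funext => z; rewrite mulN1r.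
exact: testZ.
Qed.

Lemma testB f g : is_test f -> is_test g -> is_test (fun x => f x - g x).
Proof. by move=> tf tg; exact: testD tf (testN tg). Qed.

Lemma test_zero : is_test (fun=> 0).
Proof. by split; [exact: smooth_cst|exists 0]. Qed.

Lemma test_sum (I : Type) (r : seq I) (F : I -> Rd -> R[i]) : (forall k, is_test (F k)) ->
  is_test (fun x => \sum_(k <- r) F k x).
Proof.
move=> tF; elim: r => [|k r IH].
  by under eq_fun do rewrite big_nil; exact: test_zero.
by under eq_fun do rewrite big_cons; exact: testD (tF k) IH.
Qed.

Lemma test_partial f i : is_test f -> is_test (dp i f).
Proof. by case=> sf [M vf]; split; [exact: smooth_partial|exists M; exact: vanish_off_partial]. Qed.

Lemma test_foldr f s : is_test f -> is_test (foldr dp f s).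
Proof. by move=> tf; elim: s => [//|i s IH]; exact: test_partial. Qed.

Lemma test_translate f a : is_test f -> is_test (fun x => f (x + a)).
Proof.
by case=> sf [M vf]; split; [exact: smooth_translate|exists (M + `|a|); exact: vanish_off_translate].
Qed.

Lemma test_reflect f : is_test f -> is_test (fun x => f (- x)).
Proof. by case=> sf [M vf]; split; [exact: smooth_reflect|exists M; exact: vanish_off_reflect]. Qed.

Lemma test_dsum_bounded N f : is_test f -> exists2 B, 0 <= B & forall x, dsum N f x <= B.
Proof.
case=> sf [M vf]; have [B B0 hB] := continuous_cube_bounded M (dsum_continuous (N := N) sf).
exists B => // x; have [xM|Mx] := leP `|x| M; last by rewrite (vanish_off_dsum N vf Mx).
by apply: le_trans (hB x xM); exact: ler_norm.
Qed.

(** Translation and partial derivatives commute, so the remainder along a word is the remainder of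
    the differentiated function, which involves two more derivatives. *)
Lemma dsum_taylor N f i B t x : is_smooth f -> (forall x, dsum N.+2 f x <= B) ->
  dsum N (fun y => f (y + t *: e_ i) - f y - t%:C * dp i f y) x <= wordcount N * (2 * B * t ^+ 2).
Proof.
move=> sf hB.
have step g : is_smooth g -> forall j, dp j (fun y => g (y + t *: e_ i) - g y - t%:C * dp i g y) =
    (fun y => dp j g (y + t *: e_ i) - dp j g y - t%:C * dp i (dp j g) y).
  move=> sg j; have s1 := smooth_translate (t *: e_ i) sg; have s2 := smooth_partial i sg.
  rewrite (partialB j (smoothB s1 sg) (smoothZ _ s2)) (partialB j s1 sg) (partialZ _ j s2).
  by rewrite (translate_partial _ j sg) (partial_comm i j sg).
apply: dsum_bound => s sN.
have -> : foldr dp (fun y => f (y + t *: e_ i) - f y - t%:C * dp i f y) s =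
    (fun y => foldr dp f s (y + t *: e_ i) - foldr dp f s y - t%:C * dp i (foldr dp f s) y).
  by elim: s {sN} => [//|j s IH]; rewrite /= IH step//; exact: smooth_foldr.
apply: smooth_taylor_bound => [|r _]; first exact: smooth_foldr.
apply: le_trans (hB (x + r *: e_ i)); rewrite -[dp i (dp i _)]/(foldr dp f [:: i, i & s]).
exact: normc_foldr_le.
Qed.

Lemma smooth_lipschitz f B x a : is_smooth f -> (forall x, dsum 1 f x <= B) ->
  normc (f (x + a) - f x) <= d%:R * (2 * B) * `|a|.
Proof.
move=> sf hB; have B0 : 0 <= B by exact: le_trans (dsum_ge0 _ _ 0) (hB 0).
have e : `|a| = `|(x + a) - x| by rewrite addrAC subrr add0r.
rewrite e; apply: (@coord_path_bound _ _ f (2 * B) (`|x| + `|a|)).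
- move=> i z t _ _; apply: smooth_lipschitz_bound => // s _.
  by apply: le_trans (hB (z + s *: e_ i)); apply: le_trans (dsum_partial 0 i f _); exact: normc_le_dsum.
- by rewrite mulr_ge0.
- by rewrite lerDl.
- exact: ler_normD.
Qed.

Lemma sup_norm_le f B : (forall x, normc (f x) <= B) -> sup_norm f <= B.
Proof.
move=> hB; apply: ge_sup; first by exists (normc (f 0)), 0.
by move=> _ [x _ <-].
Qed.

Lemma max_order_le N (F : multiindex -> R) B : 0 <= B ->
  (forall a : multiindex, (@mi_order d a <= N)%N -> F a <= B) -> max_order N F <= B.
Proof. by move=> B0 hB; apply: bigmax_le => // a aN; exact: hB. Qed.

Lemma le_max_order N (F : multiindex -> R) (a : multiindex) :
  (@mi_order d a <= N)%N -> F a <= max_order N F.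
Proof.
move=> aN; pose b : {ffun 'I_d -> 'I_N.+1} := [ffun i => inord (a i)].
have ba : (fun i => b i : nat) = a.
  apply/funext => i; rewrite ffunE inordK// ltnS; apply: leq_trans aN.
  by rewrite /mi_order (bigD1 i)//= leq_addr.
have := @le_bigmax_cond _ _ _ 0 b (fun b : {ffun 'I_d -> 'I_N.+1} => (mi_order (fun i => b i) <= N)%N)
  (fun b => F (fun i => b i)).
by rewrite ba; exact.
Qed.

Lemma max_order_ge0 N (F : @multiindex d -> R) : 0 <= max_order N F.
Proof. by apply: bigmax_ge_id. Qed.

Lemma distribution_bound (T : functional) M : Defs.distribution T -> exists N C, 0 <= C /\
  forall f B, is_smooth f -> vanish_off M f -> (forall x, dsum N f x <= B) -> normc (T f) <= C * B.
Proof.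
move=> [_ /(_ (cube M) (@compact_cube _ _ M))[N [C hC]]]; exists N, `|C|; split=> // f B sf vf hB.
have B0 : 0 <= B by exact: le_trans (dsum_ge0 _ _ 0) (hB 0).
apply: le_trans (hC f _ (vanish_off_tsupport vf)) _.
  by apply/is_testP; split=> //; exists M.
apply: le_trans (ler_wpM2r (max_order_ge0 _ _) (ler_norm C)) _.
rewrite ler_wpM2l//; apply: max_order_le => // a aN; apply: sup_norm_le => x.
rewrite mi_derivE; apply: le_trans (hB x); apply: normc_foldr_le.
by rewrite size_mi_word.
Qed.

End derivative_sums.

(** * A smooth step on the line *)

Section smooth_step.
Context {R : realType}.
Implicit Types (t u : R) (k : nat) (h : R -> R).

Lemma is_derive_continuous h (h' : R -> R) : (forall t, is_derive t 1 h (h' t)) -> continuous h.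
Proof.
move=> hd t; apply: differentiable_continuous; apply/derivable1_diffP.
by have := hd t => -[].
Qed.

(** The powers of 1/t in front of exp(-1/t) are kept as an index because these functions span a
    space closed under differentiation. *)
Definition flat_exp k t : R := if 0 < t then t^-1 ^+ k * expR (- t^-1) else 0.

Lemma flat_exp_ge0 k t : 0 <= flat_exp k t.
Proof.
rewrite /flat_exp; case: ifP => // t0.
by rewrite mulr_ge0 ?expR_ge0// exprn_ge0// invr_ge0 ltW.
Qed.

Lemma flat_exp_gt0 t : 0 < t -> 0 < flat_exp 0 t.
Proof. by move=> t0; rewrite /flat_exp t0 mul1r expR_gt0. Qed.

Lemma flat_exp_npos k t : t <= 0 -> flat_exp k t = 0.
Proof. by move=> t0; rewrite /flat_exp ltNge t0. Qed.

Lemma expR_decay k u : 0 < u -> u ^+ k * expR (- u) <= (k.+2)`!%:R * u^-1 ^+ 2.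
Proof.
move=> u0; have hu := expR_ge1Dxn k.+1 (ltW u0).
have f0 : (0 : R) < (k.+2)`!%:R by rewrite ltr0n fact_gt0.
have : u ^+ k.+2 <= (k.+2)`!%:R * expR u.
  by rewrite mulrC -ler_pdivrMr//; apply: le_trans hu; rewrite lerDr.
rewrite expRN exprVn ler_pdivrMr ?expR_gt0//.
rewrite -addn2 exprD => hP; rewrite mulrAC -[leLHS](mulfK (_ : u ^+ 2 != 0)) ?expf_neq0 ?gt_eqF//.
by rewrite ler_wpM2r// invr_ge0 exprn_ge0// ltW.
Qed.

(** The quadratic bound is exactly what gives derivative 0 at the origin. It comes from exp(u) >=
    u^(k+2) / (k+2)! with u = 1/t. *)
Lemma flat_exp_le k t : flat_exp k t <= (k.+2)`!%:R * t ^+ 2.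
Proof.
rewrite /flat_exp; case: ifP => t0; last by rewrite mulr_ge0// sqr_ge0.
by have := @expR_decay k t^-1; rewrite invr_gt0 invrK; exact.
Qed.

Lemma is_derive_flat_exp k t :
  is_derive t 1 (flat_exp k) (flat_exp k.+2 t - k%:R * flat_exp k.+1 t).
Proof.
have [t0|t0|->] := ltgtP t 0.
- rewrite !flat_exp_npos ?ltW// mulr0 subr0.
  have h0 : is_derive t 1 (cst (0 : R)) (0 : R) by exact: is_derive_cst.
  apply: near_eq_is_derive h0.
  near=> y; rewrite flat_exp_npos//; apply: ltW; near: y.
  by apply: (@open_nbhs_nbhs _ t [set y : R | y < 0]); split => //; exact: open_lt.
- apply: (@near_eq_is_derive _ _ _ (fun y : R => y^-1 ^+ k * expR (- y^-1))).
    near=> y; rewrite /flat_exp ifT//; near: y.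
    by apply: (@open_nbhs_nbhs _ t [set y : R | 0 < y]); split => //; exact: open_gt.
  have tn : t != 0 by rewrite gt_eqF.
  have h1 : is_derive t 1 (fun y : R => y^-1) (- t ^- 2 *: 1) by exact: is_deriveV.
  have h2 : is_derive t 1 (fun y : R => - y^-1) (- (- t ^- 2 *: 1)) by exact: is_deriveN.
  have h3 : is_derive t 1 (expR \o (fun y : R => - y^-1)) (expR (- t^-1) * (- (- t ^- 2 *: 1))).
    by apply: is_derive1_comp; exact: is_derive_expR.
  have h4 : is_derive t 1 ((fun y : R => y^-1) ^+ k) ((k%:R * t^-1 ^+ k.-1) *: (- t ^- 2 *: 1)).
    exact: is_deriveX.
  have h5 := is_deriveM h4 h3.
  have e : ((fun y : R => y^-1) ^+ k) * (expR \o (fun y : R => - y^-1)) = (fun y : R => y^-1 ^+ k * expR (- y^-1)).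
    by apply/funext => y; rewrite fctE exprfctE.
  rewrite e in h5; apply: is_derive_eq h5 _.
  rewrite /flat_exp t0 exprfctE /= /GRing.scale/= !mulr1 opprK.
  case: k {h4 e} => [|k]; first by rewrite !mul0r !mulr0 addr0 subr0 mul1r mulrC exprVn.
  by rewrite /= -exprVn !exprS expr0; ring.
- rewrite !flat_exp_npos// mulr0 subr0.
  have [r _|d1 d2] := @derive_of_quadratic R R^o (flat_exp k) 1 0 0 1 (k.+2)`!%:R ltr01; last by split.
  rewrite add0r [r *: 1]mulr1 (@flat_exp_npos k 0 (lexx 0)) subr0 mulr0 subr0 ger0_norm ?flat_exp_ge0//.
  exact: flat_exp_le.
Unshelve. all: by end_near.
Qed.

Definition step_den t : R := flat_exp 0 t + flat_exp 0 (1 - t).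

Lemma step_den_gt0 t : 0 < step_den t.
Proof.
rewrite /step_den; have [t0|t0] := ltP 0 t.
  by rewrite ltr_pwDl ?flat_exp_gt0// flat_exp_ge0.
by rewrite ltr_wpDl ?flat_exp_ge0// flat_exp_gt0//; lra.
Qed.

Definition smooth_step t : R := flat_exp 0 t / step_den t.

(** The quotient rule for [smooth_step] after cancellation: in this form nonnegativity, and
    vanishing outside the open unit interval, are visible. *)
Definition dstep t : R := (flat_exp 2 t * flat_exp 0 (1 - t) + flat_exp 0 t * flat_exp 2 (1 - t)) *
  ((step_den t)^-1 * (step_den t)^-1).

Lemma smooth_step_le0 t : t <= 0 -> smooth_step t = 0.
Proof. by move=> t0; rewrite /smooth_step flat_exp_npos// mul0r. Qed.

Lemma smooth_step_ge1 t : 1 <= t -> smooth_step t = 1.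
Proof.
move=> t1; rewrite /smooth_step /step_den (@flat_exp_npos 0 (1 - t)) ?subr_le0// addr0 divff//.
by rewrite gt_eqF// flat_exp_gt0// (lt_le_trans ltr01).
Qed.

Lemma smooth_step_ge0 t : 0 <= smooth_step t.
Proof. by rewrite divr_ge0 ?flat_exp_ge0// ltW// step_den_gt0. Qed.

Lemma smooth_step_le1 t : smooth_step t <= 1.
Proof. by rewrite ler_pdivrMr ?step_den_gt0// mul1r lerDl flat_exp_ge0. Qed.

Lemma dstep_ge0 t : 0 <= dstep t.
Proof.
by rewrite mulr_ge0 ?addr_ge0 ?mulr_ge0 ?flat_exp_ge0 ?invr_ge0// ltW// step_den_gt0.
Qed.

Lemma dstep_out t : t <= 0 \/ 1 <= t -> dstep t = 0.
Proof.
rewrite /dstep => -[t0|t1].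
  by rewrite (flat_exp_npos 2 t0) (flat_exp_npos 0 t0) !mul0r addr0 mul0r.
have t1' : 1 - t <= 0 by rewrite subr_le0.
by rewrite (flat_exp_npos 2 t1') (flat_exp_npos 0 t1') !mulr0 addr0 mul0r.
Qed.

Lemma is_derive_affine h h' (r c : R) : (forall t, is_derive t 1 h (h' t)) ->
  forall t, is_derive t 1 (fun t : R => h (r * t + c)) (r * h' (r * t + c)).
Proof.
move=> hd t; rewrite mulrC.
apply: (@is_derive1_comp _ h (fun t : R => r * t + c)).
rewrite -[X in is_derive _ _ _ X]addr0; apply: is_deriveD.
have := @is_deriveZ _ _ _ (id : R -> R) r t 1 1 (is_derive_id _ _).
by rewrite [r *: 1]mulr1.
Qed.

Lemma is_derive_flat_exp_rev k t :
  is_derive t 1 (fun t => flat_exp k (1 - t)) (- (flat_exp k.+2 (1 - t) - k%:R * flat_exp k.+1 (1 - t))).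
Proof.
have := is_derive_affine (-1) 1 (is_derive_flat_exp k) t.
by rewrite !mulN1r (addrC (- t)) (_ : (fun t : R => flat_exp k (-1 * t + 1)) = (fun t => flat_exp k (1 - t)))//;
  apply/funext => s; rewrite mulN1r addrC.
Qed.

Lemma is_derive_step_den t : is_derive t 1 step_den (flat_exp 2 t - flat_exp 2 (1 - t)).
Proof.
have := is_deriveD (is_derive_flat_exp 0 t) (is_derive_flat_exp_rev 0 t).
by rewrite !mul0r !subr0.
Qed.

Lemma is_derive_smooth_step t : is_derive t 1 smooth_step (dstep t).
Proof.
have Dn : step_den t != 0 by rewrite gt_eqF// step_den_gt0.
have h := is_deriveM (is_derive_flat_exp 0 t) (is_deriveV Dn (is_derive_step_den t)).
apply: is_derive_eq h _; rewrite /dstep mul0r subr0 /GRing.scale /=.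
have -> : flat_exp 0 (1 - t) = step_den t - flat_exp 0 t by rewrite /step_den addrAC subrr add0r.
by field.
Qed.

Lemma dstep_continuous : continuous dstep.
Proof.
have c k : continuous (flat_exp k) by exact: is_derive_continuous (is_derive_flat_exp k).
have c' k : continuous (fun t => flat_exp k (1 - t)) by exact: is_derive_continuous (is_derive_flat_exp_rev k).
have cD : continuous step_den by exact: is_derive_continuous is_derive_step_den.
have cV : continuous (fun t => (step_den t)^-1).
  by move=> t; apply: cvgV; [rewrite gt_eqF// step_den_gt0|exact: cD].
move=> t; apply: cvgM; last exact: (cvgM (cV t) (cV t)).
exact: (cvgD (cvgM (c 2 t) (c' 0 t)) (cvgM (c 0 t) (c' 2 t))).
Qed.

(** The kernel has the explicit primitive [smooth_step (r * t)], so its mass is the increment of a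
    step from 0 to 1, attained on the interval from 0 to 1/r. *)
Lemma integral_dstep (r : R) : 0 < r ->
  (\int[lebesgue_measure]_t (r * dstep (r * t))%:E = 1)%E.
Proof.
move=> r0; have ri0 : 0 < r^-1 by rewrite invr_gt0.
have hd t : is_derive t 1 (fun t => smooth_step (r * t)) (r * dstep (r * t)).
  have := is_derive_affine r 0 is_derive_smooth_step t; rewrite addr0.
  by under [X in is_derive _ _ X _]eq_fun do rewrite addr0.
have cF := is_derive_continuous hd.
have -> : (\int[lebesgue_measure]_t (r * dstep (r * t))%:E =
   \int[lebesgue_measure]_(t in `[0%R, (r^-1)%R]) (r * dstep (r * t))%:E)%E.
  rewrite [RHS]integral_mkcond; apply: eq_integral => t _; rewrite patchE.
  case: ifPn => //; rewrite notin_setE/= in_itv/= => /negP; rewrite negb_and -!ltNge => /orP h.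
  rewrite dstep_out ?mulr0//; case: h => h; first by left; rewrite pmulr_rle0// ltW.
  by right; rewrite mulrC -ler_pdivrMr// mul1r ltW.
rewrite (@continuous_FTC2 _ _ (fun t => smooth_step (r * t)))//.
- by rewrite mulfV ?gt_eqF// smooth_step_ge1// mulr0 smooth_step_le0// sube0.
- apply: continuous_subspaceT => t; apply: cvgM; first exact: cvg_cst.
  apply: (@continuous_comp _ _ _ (fun t : R => r * t) dstep); last exact: dstep_continuous.
  exact: mulrl_continuous.
- split.
  + by move=> t _; have := hd t => -[].
  + by apply: cvg_at_right_filter; exact: cF.
  + by apply: cvg_at_left_filter; exact: cF.
- by move=> t _; rewrite derive1E; apply: derive_val; exact: hd.
Qed.

End smooth_step.

(** * Smooth functions built from functions of one coordinate *)

Section coordinate_functions.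
Context {R : realType} {d : nat}.
Local Notation Rd := 'rV[R]_d.
Implicit Types (f g : Rd -> R[i]) (x y a : Rd) (t B C M r c : R) (i j : 'I_d) (N : nat) (h : R -> R).
Local Notation dp := pder.
Local Notation e_ i := (uvec i).

Definition coord_fun h i r c x : R[i] := (h (r * x ord0 i + c))%:C.

Lemma nice_real (H : Rd -> R) : continuous H -> (forall i x, ddable H (e_ i) x) ->
  nice (fun x => (H x)%:C) /\ forall i, dp i (fun x => (H x)%:C) = (fun x => (dder H (e_ i) x)%:C).
Proof.
move=> cH dH; split.
  split=> [//||i x]; first by move=> x; exact: cst_continuous.
  by split => //=; split; exact: derivable_cst.
by move=> i; apply/funext => x; rewrite partialE /= [X in _ +i* X]dderE derive_cst.
Qed.

Lemma coord_fun_nice h h' i r c : (forall t, is_derive t 1 h (h' t)) ->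
  nice (coord_fun h i r c) /\
  forall j, dp j (coord_fun h i r c) = (fun x => (r * (i == j)%:R)%:C * coord_fun h' i r c x).
Proof.
move=> hd; have hl j x : ddable (fun x => h (r * x ord0 i + c)) (e_ j) x /\
    dder (fun x => h (r * x ord0 i + c)) (e_ j) x = r * (i == j)%:R * h' (r * x ord0 i + c).
  apply: ddable_of_line.
  have := is_derive_affine (r * (i == j)%:R) (r * x ord0 i + c) hd 0; rewrite mulr0 add0r.
  rewrite (_ : (fun t : R => h (r * (i == j)%:R * t + (r * x ord0 i + c))) =
    (fun s : R => h (r * (x + s *: e_ j) ord0 i + c)))//.
  by apply/funext => t; congr h; rewrite !mxE uvec_coord; ring.
have ch : continuous (fun x : Rd => h (r * x ord0 i + c)).
  move=> x; apply: (@continuous_comp _ _ _ (fun x : Rd => r * x ord0 i + c) h); last first.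
    exact: is_derive_continuous hd _.
  apply: rV_continuousD (@cst_continuous _ _ c) x.
  exact: rV_continuousM (@cst_continuous _ _ r) (@coord_continuous R 1 d ord0 i).
have [n p] := nice_real ch (fun j x => (hl j x).1); split=> // j.
by rewrite p; apply/funext => x; rewrite (hl j x).2 rmorphM.
Qed.

(** Smoothness on the line is encoded through functions on R^d of one coordinate. The affine
    substitutions are built in, so that translating, scaling and reflecting the argument preserve it
    at once. *)
Definition smooth1 h := forall i r c, is_smooth (coord_fun h i r c).

Lemma smooth1_flat_exp k : smooth1 (flat_exp k).
Proof.
move=> i r c; pose G f := is_smooth f \/ exists k, f = coord_fun (flat_exp k) i r c.
apply: (@algebra_span_smooth R d G); last by apply: Span_gen; right; exists k.
  move=> f [/smooth_nice//|[{}k ->]].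
  by have [] := coord_fun_nice i r c (is_derive_flat_exp k).
move=> f j [sf|[{}k ->]]; first by apply: Span_gen; left; exact: smooth_partial.
have [_ ->] := coord_fun_nice i r c (is_derive_flat_exp k).
have -> : (fun x : Rd => (r * (i == j)%:R)%:C *
    coord_fun (fun t => flat_exp k.+2 t - k%:R * flat_exp k.+1 t) i r c x) =
  (fun x => (r * (i == j)%:R)%:C * coord_fun (flat_exp k.+2) i r c x +
   (- (r * (i == j)%:R * k%:R))%:C * coord_fun (flat_exp k.+1) i r c x).
  by apply/funext => x; rewrite /coord_fun -!rmorphM -rmorphD /=; congr (_ %:C); ring.
apply: Span_add; apply: Span_mul; apply: Span_gen.
- by left; exact: smooth_cst.
- by right; exists k.+2.
- by left; exact: smooth_cst.
- by right; exists k.+1.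
Qed.

Lemma smooth1M h1 h2 : smooth1 h1 -> smooth1 h2 -> smooth1 (fun t => h1 t * h2 t).
Proof.
move=> s1 s2 i r c; have := smoothM (s1 i r c) (s2 i r c).
by congr is_smooth; apply/funext => x; rewrite /coord_fun rmorphM.
Qed.

Lemma smooth1D h1 h2 : smooth1 h1 -> smooth1 h2 -> smooth1 (fun t => h1 t + h2 t).
Proof.
move=> s1 s2 i r c; have := smoothD (s1 i r c) (s2 i r c).
by congr is_smooth; apply/funext => x; rewrite /coord_fun rmorphD.
Qed.

Lemma smooth1_affine h (q b : R) : smooth1 h -> smooth1 (fun t => h (q * t + b)).
Proof.
move=> s1 i r c; have := s1 i (q * r) (q * c + b).
by congr is_smooth; apply/funext => x; rewrite /coord_fun mulrDr mulrA addrA.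
Qed.

Lemma smooth1_cst (b : R) : smooth1 (fun=> b).
Proof. by move=> i r c; exact: smooth_cst. Qed.

Lemma smooth1_rev h : smooth1 h -> smooth1 (fun t => h (1 - t)).
Proof.
move=> /(smooth1_affine (-1) 1) h1.
by have -> : (fun t => h (1 - t)) = (fun t => h (-1 * t + 1)) by apply/funext => t; rewrite mulN1r addrC.
Qed.

(** The derivative of 1/H is - H' (1/H)(1/H), which lies in the algebra generated by the smooth
    functions and 1/H. *)
Lemma smooth_inv (H : Rd -> R) : is_smooth (fun x => (H x)%:C) -> (forall x, 0 < H x) ->
  is_smooth (fun x => ((H x)^-1)%:C).
Proof.
move=> sH H0; have Hn x : H x != 0 by rewrite gt_eqF.
have [cH _] := smooth_continuous sH.
have dH i x := (smooth_derivable i x sH).1.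
have [_ pH] := nice_real cH dH.
have dV i x : ddable (fun x => (H x)^-1) (e_ i) x /\
    dder (fun x => (H x)^-1) (e_ i) x = - dder H (e_ i) x * (H x)^-1 * (H x)^-1.
  have [dHx] := dH i x; rewrite !dderE; split; first by split; exact: derivableV.
  rewrite deriveV//; change (- H x ^- 2 * 'D_(e_ i) H x = - 'D_(e_ i) H x / H x / H x).
  by field.
have cV : continuous (fun x => (H x)^-1) by move=> x; exact: cvgV (Hn x) (cH x).
have [nV pV] := nice_real cV (fun i x => (dV i x).1).
pose G f := is_smooth f \/ f = (fun x => ((H x)^-1)%:C).
apply: (@algebra_span_smooth R d G); last by apply: Span_gen; right.
  by move=> f [/smooth_nice//|->].
move=> f i [sf|->]; first by apply: Span_gen; left; exact: smooth_partial.
rewrite pV; have -> : (fun x : Rd => (dder (fun x => (H x)^-1) (e_ i) x)%:C) =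
    (fun x => - dp i (fun x => (H x)%:C) x * ((H x)^-1)%:C * ((H x)^-1)%:C).
  by apply/funext => x; rewrite (dV i x).2 pH !rmorphM rmorphN.
apply: Span_mul; last by apply: Span_gen; right.
apply: Span_mul; last by apply: Span_gen; right.
by apply: Span_gen; left; apply: smoothN; exact: smooth_partial.
Qed.

Lemma smooth1V h : smooth1 h -> (forall t, 0 < h t) -> smooth1 (fun t => (h t)^-1).
Proof. by move=> sh h0 i r c; apply: smooth_inv; [exact: sh|]. Qed.

Lemma smooth1_step : smooth1 smooth_step /\ smooth1 dstep.
Proof.
have sD : smooth1 (fun t => (step_den t)^-1).
  apply: smooth1V; last exact: step_den_gt0.
  by apply: smooth1D; [exact: smooth1_flat_exp|apply: smooth1_rev; exact: smooth1_flat_exp].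
split; first by apply: smooth1M => //; exact: smooth1_flat_exp.
apply: smooth1M; last exact: smooth1M.
apply: smooth1D; apply: smooth1M; try exact: smooth1_flat_exp;
  by apply: smooth1_rev; exact: smooth1_flat_exp.
Qed.

Definition prod_fun (h : 'I_d -> R -> R) x : R[i] := (\prod_i h i (x ord0 i))%:C.

Lemma smooth_prod (I : Type) (s : seq I) (F : I -> Rd -> R[i]) : (forall k, is_smooth (F k)) ->
  is_smooth (fun x => \prod_(k <- s) F k x).
Proof.
move=> sF; elim: s => [|k s IH].
  by under eq_fun do rewrite big_nil; exact: smooth_cst.
by under eq_fun do rewrite big_cons; exact: smoothM (sF k) IH.
Qed.

Lemma smooth_prod_fun (h : 'I_d -> R -> R) : (forall i, smooth1 (h i)) -> is_smooth (prod_fun h).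
Proof.
move=> sh; have : is_smooth (fun x => \prod_i coord_fun (h i) i 1 0 x).
  by apply: smooth_prod => i; exact: sh.
congr is_smooth; apply/funext => x; rewrite /prod_fun rmorph_prod.
by apply: eq_bigr => i _; rewrite /coord_fun mul1r addr0.
Qed.

Lemma partial_prod_fun (h : 'I_d -> R -> R) (h' : R -> R) i : (forall i, smooth1 (h i)) -> (forall t, is_derive t 1 (h i) (h' t)) ->
  dp i (prod_fun h) = prod_fun (fun j => if j == i then h' else h j).
Proof.
move=> sh hd; have sp := smooth_prod_fun sh.
have [cH _] := smooth_continuous sp; have dH j x := (smooth_derivable j x sp).1.
have [_ ->] := nice_real cH dH; apply/funext => x; congr (_ %:C).
have [|_ ->] := @ddable_of_line R d (fun x => \prod_i h i (x ord0 i)) (e_ i) x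
  (\prod_j (if j == i then h' else h j) (x ord0 j)); last by [].
have E s : \prod_j h j ((x + s *: e_ i) ord0 j) = h i (1 * s + x ord0 i) * \prod_(j | j != i) h j (x ord0 j).
  rewrite (bigD1 i)//=; congr (_ * _); first by congr (h i _); rewrite !mxE uvec_coord eqxx mulr1 mul1r addrC.
  by apply: eq_bigr => j ji; congr (h j _); rewrite !mxE uvec_coord (negbTE ji) mulr0 addr0.
under [X in is_derive _ _ X _]eq_fun do rewrite E.
have -> : \prod_j (if j == i then h' else h j) (x ord0 j) = h' (x ord0 i) * \prod_(j | j != i) h j (x ord0 j).
  by rewrite (bigD1 i)//= eqxx; congr (_ * _); apply: eq_bigr => j /negbTE ->.
have := is_derive_affine 1 (x ord0 i) hd 0; rewrite mulr0 add0r mul1r => h1.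
set P := \prod_(_ | _) _; have := is_deriveM h1 (is_derive_cst P (0 : R) (1 : R)).
move=> h2; apply: is_derive_eq h2 _; rewrite scaler0 add0r; exact: mulrC.
Qed.

Lemma vanish_off_prod_fun M (h : 'I_d -> R -> R) : (forall i t, M < `|t| -> h i t = 0) -> 0 <= M -> vanish_off M (prod_fun h).
Proof.
move=> h0 M0 x Mx; rewrite /prod_fun.
have [i hi] : exists i, M < `|x ord0 i|.
  apply: contrapT => /forallNP hx; move: Mx; rewrite ltNge => /negP; apply.
  by apply: rV_norm_le => // i; rewrite leNgt; apply/negP; exact: hx.
by rewrite (bigD1 i)//= h0// mul0r.
Qed.

End coordinate_functions.

(** * Partition of unity and mollifiers *)

Section partition_of_unity.
Context {R : realType} {d : nat}.
Local Notation Rd := 'rV[R]_d.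
Local Notation mu := (lebesgue_rV R d).
Implicit Types (x y a : Rd) (t B C r c : R) (i j : 'I_d) (N M : nat).

Lemma telescope_shift (f : R -> R) t n :
  \sum_(j < n) (f (t - j%:R + 1) - f (t - j%:R)) = f (t + 1) - f (t - n%:R + 1).
Proof.
elim: n => [|n IH]; first by rewrite big_ord0 subr0 subrr.
rewrite big_ord_recr /= IH -[n.+1%:R]natr1; have -> : t - (n%:R + 1) + 1 = t - n%:R by ring.
ring.
Qed.

(* Summing translates of [clamp] telescopes, which bounds the number of integer
   translates of an interval that meet a point. *)
Definition clamp t : R := Num.max 0 (Num.min t 1).

Lemma clamp_le t u : t <= u -> clamp t <= clamp u.
Proof. by move=> tu; rewrite /clamp ge_max !le_max lexx/= le_min !ge_min tu lexx !orbT. Qed.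

Lemma clamp_ge0 t : 0 <= clamp t.
Proof. by rewrite le_max lexx. Qed.

Lemma clamp_le1 t : clamp t <= 1.
Proof. by rewrite ge_max ler01 ge_min lexx orbT. Qed.

Lemma integer_overlap t n : \sum_(j < n) (`|t - j%:R| <= 1)%R%:R <= (3 : R).
Proof.
have tel s : \sum_(j < n) (clamp (s - j%:R + 1) - clamp (s - j%:R)) <= 1.
  by rewrite telescope_shift; have := clamp_le1 (s + 1); have := clamp_ge0 (s - n%:R + 1); lra.
(* With s = t - j, the indicator of |s| <= 1 is at most [clamp (s + 2) - clamp (s - 1)]. This is a
   sum of three unit increments, and each of them telescopes over [j] to at most 1. *)
apply: le_trans (_ : \sum_(j < n) (clamp (t + 1 - j%:R + 1) - clamp (t + 1 - j%:R)) +
  (\sum_(j < n) (clamp (t - j%:R + 1) - clamp (t - j%:R)) +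
   \sum_(j < n) (clamp (t - 1 - j%:R + 1) - clamp (t - 1 - j%:R))) <= _); last first.
  by have := tel (t + 1); have := tel t; have := tel (t - 1); lra.
rewrite -!big_split; apply: ler_sum => j _ /=.
have -> : t + 1 - j%:R = t - j%:R + 1 by ring.
have -> : t - 1 - j%:R + 1 = t - j%:R by ring.
have -> : t - 1 - j%:R = t - j%:R - 1 by ring.
move: (t - j%:R) => s; have h : clamp (s - 1) <= clamp (s + 1 + 1) by apply: clamp_le; lra.
have [s1|_] := boolP (`|s| <= 1); last by rewrite /=; lra.
have {s1} /andP[s1 s2] : -1 <= s <= 1 by rewrite -ler_norml.
have -> : clamp (s + 1 + 1) = 1 by rewrite /clamp min_r ?max_r//; lra.
have -> : clamp (s - 1) = 0 by rewrite /clamp max_l// ge_min; apply/orP; left; lra.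
by rewrite /=; lra.
Qed.

(** The integer points of the cube of radius [M]; the index runs from 0 to 2M and is shifted by
    [M]. *)
Definition lattice M (k : {ffun 'I_d -> 'I_(M.*2.+1)}) : Rd := \row_i ((k i)%:R - M%:R).

(** As a difference of two translates of one step, its integer translates telescope, so that they
    form a partition of unity without any normalisation. *)
Definition tent t : R := smooth_step (t + 1) - smooth_step t.

Definition theta : Rd -> R[i] := prod_fun (fun=> tent).

(** Partial sums of a partition of unity serve as cutoffs because finite overlap bounds their
    derivatives independently of [M]; the same [theta] also cuts functions into pieces. *)
Definition cutoff M x : R[i] := \sum_k theta (x - lattice (M := M) k).

Lemma tent_out t : 1 < `|t| -> tent t = 0.
Proof.
rewrite ltNge ler_norml negb_and -!ltNge /tent => /orP[t1|t1].
  by rewrite !smooth_step_le0 ?subrr//; lra.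
by rewrite !smooth_step_ge1 ?subrr//; lra.
Qed.

Lemma smooth1_tent : smooth1 (d := d) tent.
Proof.
apply: smooth1D.
  rewrite (_ : (fun t => smooth_step (t + 1)) = (fun t => smooth_step (1 * t + 1))).
    exact: (smooth1_affine _ _ smooth1_step.1).
  by apply/funext => t; rewrite mul1r.
rewrite (_ : (fun t => - smooth_step t) = (fun t => -1 * smooth_step t)).
  exact: smooth1M (smooth1_cst _) smooth1_step.1.
by apply/funext => t; rewrite mulN1r.
Qed.

Lemma theta_vanish : vanish_off 1 theta.
Proof. by apply: vanish_off_prod_fun => // i t; exact: tent_out. Qed.

Lemma smooth_theta : is_smooth theta.
Proof. by apply: smooth_prod_fun => i; exact: smooth1_tent. Qed.

Lemma test_theta : is_test theta.
Proof. by split; [exact: smooth_theta|exists 1; exact: theta_vanish]. Qed.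

Lemma norm_lattice M k : `|lattice (M := M) k| <= M%:R.
Proof.
apply: rV_norm_le => // i; rewrite mxE ler_norml lerBrDr addNr ler0n/= lerBlDr -natrD ler_nat.
by rewrite addnn -ltnS.
Qed.

Lemma theta_latticeE M k x : theta (x - lattice (M := M) k) =
  (\prod_i tent (x ord0 i + M%:R - (k i)%:R))%:C.
Proof.
congr (_ %:C); apply: eq_bigr => i _; congr tent; rewrite !mxE; ring.
Qed.

Lemma cutoff_one M x : `|x| <= M%:R -> cutoff M x = 1.
Proof.
move=> xM; rewrite /cutoff; under eq_bigr do rewrite theta_latticeE.
(* The lattice sum of products is a product of [d] sums, one for each coordinate, and each of them
   telescopes to 1 - 0. *)
rewrite -rmorph_sum -(bigA_distr_bigA (fun i (j : 'I_(M.*2.+1)) => tent (x ord0 i + M%:R - j%:R))).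
rewrite big1// => i _; rewrite telescope_shift.
have /andP[x1 x2] : - M%:R <= x ord0 i <= M%:R.
  by rewrite -ler_norml; exact: le_trans (coord_le_norm _ _) xM.
rewrite smooth_step_ge1 ?smooth_step_le0 ?subr0//; last by lra.
have : (M.*2.+1)%:R = M%:R + M%:R + 1 :> R by rewrite -natr1 -addnn natrD.
lra.
Qed.

Lemma lattice_overlap M x : \sum_k (`|x - lattice (M := M) k| <= 1)%R%:R <= (3 : R) ^+ d.
Proof.
have -> : \sum_k (`|x - lattice (M := M) k| <= 1)%R%:R =
    \sum_(k : {ffun 'I_d -> 'I_(M.*2.+1)}) \prod_i (`|x ord0 i + M%:R - (k i)%:R| <= 1)%R%:R :> R.
  apply: eq_bigr => k _; have E i : (x - lattice k) ord0 i = x ord0 i + M%:R - (k i)%:R.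
    by rewrite !mxE; ring.
  have [xk|/negP xk] := boolP (`|x - lattice k| <= 1).
    by rewrite big1// => i _; rewrite -E (le_trans (coord_le_norm _ _) xk).
  have [i hi] : exists i, ~ (`|x ord0 i + M%:R - (k i)%:R| <= 1).
    by apply/existsNP => h; apply: xk; apply: rV_norm_le => // i; rewrite E.
  by rewrite (bigD1 i)//= (negbTE (introN idP hi)) mul0r.
rewrite -(bigA_distr_bigA (fun i (j : 'I_(M.*2.+1)) => (`|x ord0 i + M%:R - j%:R| <= 1)%R%:R : R)).
rewrite -[leRHS](_ : \prod_(i < d) 3 = _); last by rewrite prodr_const card_ord.
by apply: ler_prod => i _; rewrite sumr_ge0//=; exact: integer_overlap.
Qed.

Lemma test_cutoff M : is_test (cutoff M) /\ vanish_off (M%:R + 1) (cutoff M).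
Proof.
have v k : vanish_off (M%:R + 1) (fun x => theta (x - lattice (M := M) k)).
  move=> x Mx; apply: theta_vanish; have := norm_lattice k.
  have : `|x| <= `|x - lattice k| + `|lattice k| by rewrite -{1}(subrK (lattice k) x); exact: ler_normD.
  lra.
split; last by move=> x Mx; rewrite /cutoff big1// => k _; exact: (v k x Mx).
by apply: test_sum => k; exact: test_translate test_theta.
Qed.

Lemma dsum_theta_le N : exists2 C : R, 0 <= C & forall M k x,
  dsum N (fun x => theta (x - lattice (M := M) k)) x <= C * (`|x - lattice k| <= 1)%R%:R.
Proof.
have [C C0 hC] := test_dsum_bounded N test_theta; exists C => // M k x.
rewrite (dsum_translate _ (- lattice k) x smooth_theta).
have [_|xk] := leP `|x - lattice k| 1; first by rewrite mulr1; exact: hC.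
by rewrite mulr0 (vanish_off_dsum N theta_vanish xk).
Qed.

(** At most 3^d lattice translates of the unit cube meet a point, whatever [M] is. *)
Lemma dsum_cutoff_le N : exists2 C : R, 0 <= C & forall M x, dsum N (cutoff M) x <= C.
Proof.
have [C C0 hC] := dsum_theta_le N; exists (C * 3 ^+ d); first by rewrite mulr_ge0// exprn_ge0.
move=> M x; apply: le_trans (dsum_sum _ _ _ (fun k => smooth_translate (- lattice (M := M) k) smooth_theta)) _.
apply: le_trans (_ : \sum_k C * (`|x - lattice (M := M) k| <= 1)%R%:R <= _).
  by apply: ler_sum => k _; exact: hC.
by rewrite -mulr_sumr ler_wpM2l// lattice_overlap.
Qed.

(** The derivative of [smooth_step (N.+1%:R * t)], of mass 1 and vanishing off the interval from 0
    to 1/(N+1). The mollifier is one-sided so as to have this primitive, from which differences of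
    mollifiers become derivatives. *)
Definition mol1 N t : R := N.+1%:R * dstep (N.+1%:R * t).

Definition mollifier N : Rd -> R[i] := prod_fun (fun=> mol1 N).

Lemma mol1_ge0 N t : 0 <= mol1 N t.
Proof. by rewrite mulr_ge0// dstep_ge0. Qed.

Lemma natS_gt0 N : (0 : R) < N.+1%:R. Proof. by rewrite ltr0n. Qed.

Lemma mol1_out N t : N.+1%:R^-1 < `|t| -> mol1 N t = 0.
Proof.
move=> ht; rewrite /mol1 dstep_out ?mulr0//.
have [t0|t0] := leP t 0; first by left; rewrite pmulr_rle0// natS_gt0.
right; rewrite gtr0_norm// in ht; rewrite mulrC -ler_pdivrMr ?natS_gt0// mul1r; exact: ltW.
Qed.

Lemma smooth1_mol1 N : smooth1 (d := d) (mol1 N).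
Proof.
apply: smooth1M; first exact: smooth1_cst.
rewrite (_ : (fun t => dstep (N.+1%:R * t)) = (fun t => dstep (N.+1%:R * t + 0))).
  exact: (smooth1_affine _ _ smooth1_step.2).
by apply/funext => t; rewrite addr0.
Qed.

Lemma mollifier_vanish N : vanish_off N.+1%:R^-1 (mollifier N).
Proof. by apply: vanish_off_prod_fun => [i t|]; [exact: mol1_out|rewrite invr_ge0]. Qed.

Lemma test_mollifier N : is_test (mollifier N).
Proof.
split; last by exists N.+1%:R^-1; exact: mollifier_vanish.
by apply: smooth_prod_fun => i; exact: smooth1_mol1.
Qed.

Lemma mollifier_real N x : mollifier N x = (normc (mollifier N x))%:C.
Proof.
rewrite /mollifier /prod_fun normc_real ger0_norm//.
by apply: prodr_ge0 => i _; exact: mol1_ge0.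
Qed.

Lemma normc_prod_fun (h : 'I_d -> R -> R) x : normc (prod_fun h x) = \prod_i `|h i (x ord0 i)|.
Proof. by rewrite /prod_fun normc_real normr_prod. Qed.

Lemma mol1_continuous N : continuous (mol1 N).
Proof.
move=> t; apply: cvgM; first exact: cvg_cst.
apply: (@continuous_comp _ _ _ (fun t : R => N.+1%:R * t) dstep); last exact: dstep_continuous.
exact: mulrl_continuous.
Qed.

Lemma int_normc_prod_fun (h : 'I_d -> R -> R) : (forall i, continuous (h i)) ->
  (\int[mu]_x (normc (prod_fun h x))%:E = \prod_(i < d) \int[lebesgue_measure]_t `|h i t|%:E)%E.
Proof.
move=> ch; under eq_integral do rewrite normc_prod_fun.
rewrite (@ge0_integral_rV_prod R d (fun i t => `|h i t|))// => i.
by apply: measurableT_comp; [exact: normr_measurable|exact: continuous_measurable_fun].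
Qed.

Lemma int_mollifier N : (\int[mu]_x (normc (mollifier N x))%:E = 1)%E.
Proof.
rewrite int_normc_prod_fun => [|i]; last exact: mol1_continuous.
rewrite big1// => i _; rewrite -(integral_dstep (natS_gt0 N)); apply: eq_integral => t _.
by rewrite ger0_norm// mol1_ge0.
Qed.

Definition step_diff N K t : R := smooth_step (N.+1%:R * t) - smooth_step (K.+1%:R * t).

(* Exchanging the mollifier at scale N for the one at scale K coordinate by
   coordinate makes their difference the sum of the i-th derivatives of [eta N K i]. *)
Definition eta N K i : Rd -> R[i] :=
  prod_fun (fun m => if (m < i)%N then mol1 K else if m == i then step_diff N K else mol1 N).

Lemma is_derive_step_diff N K t : is_derive t 1 (step_diff N K) (mol1 N t - mol1 K t).
Proof.
have hd (r : R) : is_derive t 1 (fun t => smooth_step (r * t)) (r * dstep (r * t)).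
  have := is_derive_affine r 0 is_derive_smooth_step t; rewrite addr0.
  by under [X in is_derive _ _ X _]eq_fun do rewrite addr0.
exact: is_deriveB.
Qed.

Lemma smooth1_step_diff N K : smooth1 (d := d) (step_diff N K).
Proof.
have s1 (r : R) : smooth1 (d := d) (fun t => smooth_step (r * t)).
  rewrite (_ : (fun t => smooth_step (r * t)) = (fun t => smooth_step (r * t + 0))).
    exact: (smooth1_affine _ _ smooth1_step.1).
  by apply/funext => t; rewrite addr0.
apply: smooth1D; first exact: s1.
rewrite (_ : (fun t => - smooth_step (K.+1%:R * t)) = (fun t => -1 * smooth_step (K.+1%:R * t))).
  exact: smooth1M (smooth1_cst _) (s1 K.+1%:R).
by apply/funext => t; rewrite mulN1r.
Qed.

Lemma smooth1_eta N K i m :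
  smooth1 (d := d) (if (m < i)%N then mol1 K else if m == i then step_diff N K else mol1 N).
Proof.
by case: ifP => _; [|case: ifP => _]; [exact: smooth1_mol1|exact: smooth1_step_diff|exact: smooth1_mol1].
Qed.

Lemma step_diff_out N K t : (t <= 0) \/ (N.+1%:R^-1 <= t /\ K.+1%:R^-1 <= t) -> step_diff N K t = 0.
Proof.
rewrite /step_diff => -[t0|[t1 t2]].
  by rewrite !smooth_step_le0 ?subrr// pmulr_rle0// natS_gt0.
rewrite !smooth_step_ge1 ?subrr//; [rewrite mulrC -ler_pdivrMr ?natS_gt0// mul1r//|].
by rewrite mulrC -ler_pdivrMr ?natS_gt0// mul1r.
Qed.

Lemma natSV_le1 N : N.+1%:R^-1 <= (1 : R).
Proof. by rewrite invf_le1 ?natS_gt0// ler1n. Qed.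

Lemma eta_vanish N K i : vanish_off 1 (eta N K i).
Proof.
apply: vanish_off_prod_fun => // m t t1.
case: ifP => _; first by apply: mol1_out; exact: le_lt_trans (natSV_le1 _) t1.
case: ifP => _; last by apply: mol1_out; exact: le_lt_trans (natSV_le1 _) t1.
apply: step_diff_out; have [t0|t0] := leP t 0; first by left.
rewrite gtr0_norm// in t1; right.
by split; apply: le_trans (natSV_le1 _) (ltW t1).
Qed.

Lemma test_eta N K i : is_test (eta N K i).
Proof.
split; last by exists 1; exact: eta_vanish.
by apply: smooth_prod_fun => m; exact: smooth1_eta.
Qed.

Lemma mollifier_diff N K x : mollifier N x - mollifier K x = \sum_i pder i (eta N K i) x.
Proof.
pose P (i : nat) : R[i] := (\prod_(m < d) (if (m < i)%N then mol1 K else mol1 N) (x ord0 m))%:C.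
have P0 : mollifier N x = P 0%N by [].
have Pd : mollifier K x = P d.
  by congr (_ %:C); apply: eq_bigr => m _; rewrite ltn_ord.
have -> : mollifier N x - mollifier K x = \sum_(i < d) (P i - P i.+1).
  rewrite P0 Pd -(big_mkord xpredT (fun k : nat => P k - P k.+1)).
  rewrite (eq_bigr (fun k => (- P k.+1) - (- P k))) => [|k _]; last by rewrite opprK addrC.
  by rewrite telescope_sumr// opprK addrC.
apply: eq_bigr => i _; rewrite /eta.
set h := fun m : 'I_d => if (m < i)%N then mol1 K else if m == i then step_diff N K else mol1 N.
have -> : pder i (prod_fun h) = prod_fun (fun j => if j == i then fun t => mol1 N t - mol1 K t else h j).
  apply: partial_prod_fun => [m|t]; first exact: smooth1_eta.
  by rewrite /h ltnn eqxx; exact: is_derive_step_diff.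
rewrite {}/h.
rewrite /P /prod_fun -rmorphB; congr (_ %:C).
rewrite (bigD1 i)//= [X in _ - X](bigD1 i)//= [RHS](bigD1 i)//= !eqxx ltnn ltnSn mulrBl.
congr (_ * _ - _ * _); apply: eq_bigr => m mi; rewrite (negbTE mi)//.
by rewrite ltnS leq_eqVlt -[_ == _ :> nat]/(m == i) (negbTE mi).
Qed.

(** All factors have mass 1 except the i-th, a difference of two steps. That one is bounded by 1 and
    vanishes outside the interval from 0 to 1/(N+1), because the step at scale [K] is the steeper
    one. *)
Lemma int_eta (N K : nat) i : (N <= K)%N ->
  (\int[mu]_x (normc (eta N K i x))%:E <= (N.+1%:R^-1)%:E)%E.
Proof.
move=> NK; have cd : continuous (step_diff N K) by exact: is_derive_continuous (is_derive_step_diff N K).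
rewrite int_normc_prod_fun => [|m]; last first.
  by case: ifP => _; [exact: mol1_continuous|case: ifP => _; [exact: cd|exact: mol1_continuous]].
have I1 L : (\int[lebesgue_measure]_t `|mol1 L t|%:E = 1)%E.
  rewrite -(integral_dstep (natS_gt0 L)); apply: eq_integral => t _.
  by rewrite ger0_norm// mol1_ge0.
rewrite (bigD1 i)//= big1 => [|m mi]; last first.
  by rewrite (negbTE mi); case: ifP => _; exact: I1.
rewrite mule1 ltnn eqxx.
have KN : K.+1%:R^-1 <= N.+1%:R^-1 :> R by rewrite lef_pV2 ?posrE ?natS_gt0// ler_nat.
have -> : (N.+1%:R^-1)%:E = (\int[lebesgue_measure]_t (\1_(`[(0 : R), N.+1%:R^-1]%classic) t)%:E)%E.
  rewrite integral_indic//= setIT lebesgue_measure_itv/= lte_fin invr_gt0 natS_gt0.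
  by rewrite -EFinB subr0.
apply: ge0_le_integralT => t; first by rewrite lee_fin.
rewrite lee_fin indicE; case: (boolP (t \in _)) => [_|].
  have -> : (true%:R : R) = 1 by [].
  rewrite ler_norml; have := smooth_step_le1 (N.+1%:R * t); have := smooth_step_ge0 (N.+1%:R * t).
  have := smooth_step_le1 (K.+1%:R * t); have := smooth_step_ge0 (K.+1%:R * t).
  by rewrite /step_diff => *; apply/andP; split; lra.
rewrite notin_setE/= in_itv/= => /negP; rewrite negb_and -!ltNge => /orP h.
rewrite step_diff_out ?normr0//; case: h => h; first by left; exact: ltW.
by right; rewrite ltW//; split=> //; exact: le_trans KN (ltW h).
Qed.

End partition_of_unity.

(** * Weak derivatives *)

Section du_bois_reymond.
Context {R : realType} {d : nat}.
Local Notation Rd := 'rV[R]_d.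
Local Notation mu := (lebesgue_rV R d).
Local Notation lm := (@lebesgue_measurable R d).

Lemma int_dominated (u : nat -> Rd -> R) (F : Rd -> R) : (forall n, lm (u n)) -> lm F ->
  (forall n x, 0 <= u n x) -> (forall n, {ae mu, forall x, u n x <= F x}) ->
  (forall x, 0 <= F x) -> (\int[mu]_x (F x)%:E < +oo)%E ->
  {ae mu, forall x, u n x @[n --> \oo] --> (0 : R)} ->
  (\int[mu]_x (u n x)%:E)%E @[n --> \oo] --> 0%E.
Proof.
move=> lu lF u0 uF F0 Foo ucv.
have /choice[v hv] : forall n, exists v : Rd -> R, [/\ measurable_fun setT v, forall x, 0 <= v x &
    {ae mu, forall x, u n x = v x}] by move=> n; exact: lm_ge0.
have [G [mG G0 FG]] := lm_ge0 lF F0.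
have uv : {ae mu, forall x, forall n, u n x = v n x} by apply: ae_foralln => n; case: (hv n).
have uFn : {ae mu, forall x, forall n, u n x <= F x} by apply: ae_foralln.
have [] := @dominated_convergence _ _ _ mu setT measurableT (fun n x => (v n x)%:E) (cst 0%E)
  (fun x => (G x)%:E).
- by move=> n; apply/measurable_EFinP; case: (hv n).
- exact: measurable_cst.
- apply: filterS2 uv ucv => x uvx ux _; apply: cvg_EFin; first by apply: nearW.
  by rewrite (_ : fine \o _ = fun n => u n x)//; apply/funext => n /=; rewrite uvx.
- apply/integrableP; split; first exact/measurable_EFinP.
  rewrite (_ : (\int[mu]_x `|(G x)%:E|)%E = \int[mu]_x (F x)%:E)%E//.
  rewrite (int_ae FG); apply: eq_integral => x _.
  by rewrite gee0_abs// lee_fin.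
- apply: filterS3 uv uFn FG => x uvx uFx FGx n _ /=.
  rewrite lee_fin ger0_norm; last by case: (hv n).
  by rewrite -FGx -uvx.
move=> _ _; rewrite integral0 => h.
suff -> : (fun n => \int[mu]_x (u n x)%:E)%E = (fun n => \int[mu]_x (v n x)%:E)%E by [].
by apply/funext => n; apply: int_ae; case: (hv n).
Qed.

(** Lower orthants generate the Borel sets, are stable under intersection, and their indicators are
    pointwise limits of products of smooth steps. *)
Definition ray (b : Rd) : set Rd := [set x | forall i, x ord0 i < b ord0 i].

Lemma measurable_ray b : measurable (ray b).
Proof.
rewrite (_ : ray b = \bigcap_(i in [set: 'I_d]) [set x : Rd | x ord0 i < b ord0 i]); last first.
  by apply/seteqP; split => [x h i _|x h i]; exact: h.
rewrite bigcap_mkcond -[X in measurable X]setCK setC_bigcap; apply: measurableC.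
apply: fin_bigcup_measurable => // i _; apply: measurableC; rewrite mem_set//.
rewrite (_ : [set x : Rd | _] = (fun x => x ord0 i) @^-1` `]-oo, b ord0 i[); last first.
  by apply/seteqP; split => x /=; rewrite in_itv.
by rewrite -[X in measurable X]setTI; exact: measurable_coord.
Qed.

Lemma measurable_rays : (@measurable _ Rd) = <<s range ray >>.
Proof.
apply/seteqP; split => [A mA|]; last first.
  apply: smallest_sub; first exact: sigma_algebra_measurable.
  by move=> _ [b _ <-]; exact: measurable_ray.
suff: measurable_fun [set: g_sigma_algebraType (range ray)] (id : _ -> Rd).
  by move=> /(_ measurableT A mA); rewrite setTI.
apply: measurable_fun_rV => i.
apply: (measurability (@RGenInftyO.G R)); first exact: RGenInftyO.measurableE.
move=> _ [_ [t ->] <-]; rewrite setTI.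
rewrite (_ : _ @^-1` _ = \bigcup_n ray (\row_j (if j == i then t else n%:R))).
  by apply: bigcup_measurable => n _; apply: sub_sigma_algebra; exists (\row_j (if j == i then t else n%:R)).
apply/seteqP; split => x /=; rewrite in_itv/=.
  move=> xt; exists (Num.bound `|x|) => // j; rewrite mxE; case: eqP => [->//|_].
  apply: le_lt_trans (ler_norm _) _; apply: le_lt_trans (coord_le_norm _ _) _.
  exact: archi_boundP.
by move=> [n _ /(_ i)]; rewrite mxE eqxx.
Qed.

Lemma setI_closed_rays : setI_closed (range ray).
Proof.
move=> _ _ [b _ <-] [c _ <-]; exists (\row_i Num.min (b ord0 i) (c ord0 i)) => //.
apply/seteqP; split => x /=.
  by move=> h; split => i; have := h i; rewrite mxE lt_min => /andP[].
by move=> [h1 h2] i; rewrite mxE lt_min h1 h2.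
Qed.

Section rays_unique.
Variable g : Rd -> R.

(** The measure with density [g]. The assumptions on [g] are arguments of the definition so that the
    structure of a measure can be attached to it. *)
Definition density_measure of measurable_fun setT g & (forall x, 0 <= g x) :=
  fun A : set Rd => (\int[mu]_(x in A) (g x)%:E)%E.

Hypotheses (mg : measurable_fun setT g) (g0 : forall x, 0 <= g x).
Local Notation dm := (density_measure mg g0).

Let density0 : dm set0 = 0%E. Proof. exact: integral_set0. Qed.

Let density_ge0 A : (0 <= dm A)%E.
Proof. by apply: integral_ge0 => x _; rewrite lee_fin. Qed.

Let density_additive : semi_sigma_additive dm.
Proof.
by apply: semi_sigma_additive_nng_induced => [|x]; [exact/measurable_EFinP|rewrite lee_fin].
Qed.

HB.instance Definition _ := isMeasure.Build _ _ _ dm density0 density_ge0 density_additive.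

End rays_unique.

Lemma density_unique (p q : Rd -> R) : measurable_fun setT p -> measurable_fun setT q ->
  (forall x, 0 <= p x) -> (forall x, 0 <= q x) ->
  (forall b, \int[mu]_(x in ray b) (p x)%:E = \int[mu]_(x in ray b) (q x)%:E)%E ->
  (forall A, \int[mu]_(x in A) (p x)%:E < +oo)%E ->
  forall A, measurable A -> (\int[mu]_(x in A) (p x)%:E = \int[mu]_(x in A) (q x)%:E)%E.
Proof.
move=> mp mq p0 q0 pq poo.
pose m1 : {measure set Rd -> \bar R} := density_measure mp p0.
pose m2 : {measure set Rd -> \bar R} := density_measure mq q0.
suff H A : measurable A -> m1 A = m2 A by [].
move: A; apply: (measure_unique (range ray) (fun n => ray (\row_i n%:R)) measurable_rays
  setI_closed_rays) => [n||_ [b _ <-]|n].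
- by exists (\row_i n%:R).
- apply/seteqP; split => // x _; exists (Num.bound `|x|) => // j; rewrite mxE.
  apply: le_lt_trans (ler_norm _) _; apply: le_lt_trans (coord_le_norm _ _) _.
  exact: archi_boundP.
- exact: pq.
- exact: poo.
Qed.

(** The finite measures with the positive and the negative part of [g] as densities agree on
    orthants, hence on all Borel sets, so the two densities agree almost everywhere. *)
Lemma rays_eq0 (g : Rd -> R) : rL1 g -> (forall b, \int[mu]_x (g x * \1_(ray b) x) = 0) ->
  {ae mu, forall x, g x = 0}.
Proof.
move=> gL int0; have [h Ih gh] := rL1_borel gL; have [mh hoo] := integrableP _ _ _ Ih.
have {}mh : measurable_fun setT h by exact/measurable_EFinP.
pose hp x := Num.max (h x) 0; pose hn x := Num.max (- h x) 0.
have mp : measurable_fun setT hp by apply: measurable_maxr.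
have mn : measurable_fun setT hn.
  by apply: measurable_maxr => //; exact: measurable_funN.
have hp0 x : 0 <= hp x by rewrite le_max lexx orbT.
have hn0 x : 0 <= hn x by rewrite le_max lexx orbT.
have hE x : h x = hp x - hn x.
  by rewrite /hp /hn; case: (lerP (h x) 0); case: (lerP (- h x) 0) => *; lra.
have bdp x : hp x <= `|h x| by rewrite ge_max ler_norm normr_ge0.
have bdn x : hn x <= `|h x| by rewrite ge_max -normrN ler_norm normr_ge0.
have foo (k : Rd -> R) (A : set Rd) : measurable_fun setT k -> (forall x, 0 <= k x) ->
    (forall x, k x <= `|h x|) ->
    (\int[mu]_(x in A) (k x)%:E < +oo)%E.
  move=> mk k0 kh; apply: le_lt_trans hoo; rewrite int_in; apply: ge0_le_integralT => x.
    by rewrite lee_fin mulr_ge0.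
  rewrite abse_EFin lee_fin; apply: le_trans (kh x).
  by rewrite ler_piMr// indicE; case: (_ \in _).
have E A : measurable A -> (\int[mu]_(x in A) (hp x)%:E = \int[mu]_(x in A) (hn x)%:E)%E.
  apply: density_unique => //; last by move=> B; exact: foo.
  move=> b.
  have := int0 b; rewrite (@rint_ae _ _ _ (fun x => h x * \1_(ray b) x)); last first.
    by apply: filterS gh => x ->.
  have mI : measurable_fun setT (\1_(ray b) : Rd -> R) by apply: measurable_indic; exact: measurable_ray.
  have e1 : \int[mu]_x (h x * \1_(ray b) x) =
      \int[mu]_x (hp x * \1_(ray b) x + (-1) * (hn x * \1_(ray b) x)).
    by congr Rintegral; apply/funext => x; rewrite hE; ring.
  have L (k : Rd -> R) : measurable_fun setT k -> (forall x, 0 <= k x) ->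
      (forall x, k x <= `|h x|) -> rL1 (fun x => k x * \1_(ray b) x).
    move=> mk k0 kh; split; first by apply: borel_lm; exact: measurable_funM.
    under eq_integral => x _ do rewrite ger0_norm ?mulr_ge0//.
    by rewrite -int_in; exact: foo.
  rewrite e1 rintD; [|exact: L|by apply: rL1Z; exact: L].
  rewrite rintZ; last exact: L.
  have F (k : Rd -> R) : measurable_fun setT k -> (forall x, 0 <= k x) ->
      (forall x, k x <= `|h x|) -> (\int[mu]_(x in ray b) (k x)%:E =
      (\int[mu]_x (k x * \1_(ray b) x))%:E)%E.
    move=> mk k0 kh; rewrite rint_fin; [exact: int_in|by move=> x; apply: mulr_ge0|].
    by rewrite -int_in; exact: foo.
  by rewrite !F// => /eqP; rewrite mulN1r subr_eq0 => /eqP ->.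
have A : ae_eq mu setT (fun x => (hp x)%:E) (fun x => (hn x)%:E).
  apply: integral_ae_eq => //; last by move=> A _ mA; exact: E.
    apply/integrableP; split; first exact/measurable_EFinP.
    under eq_integral => x _ do rewrite gee0_abs ?lee_fin//.
    exact: foo.
  exact/measurable_EFinP.
apply: filterS2 gh A => x -> /(_ I)[pn].
by rewrite hE pn subrr.
Qed.

End du_bois_reymond.

(** * Weak derivatives and the spaces K^1 *)

Section weak_derivatives.
Context {R : realType} {d : nat}.
Local Notation Rd := 'rV[R]_d.
Local Notation mu := (lebesgue_rV R d).
Local Notation lm := (@lebesgue_measurable R d).
Implicit Types (f g h p : Rd -> R[i]).

Lemma smooth_cmeasurable f : is_smooth f -> cmeasurable f.
Proof. by move=> /smooth_continuous[c1 c2]; split; exact: continuous_lm. Qed.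

Lemma L1loc_cmeasurable h : L1loc h -> cmeasurable h. Proof. by case. Qed.

Lemma L1_cmeasurable h : L1 h -> cmeasurable h. Proof. by case. Qed.

Lemma L1loc_mul_bounded h p (M B : R) : L1loc h -> cmeasurable p -> 0 <= B ->
  (forall x, normc (p x) <= B) -> vanish_off M p -> L1 (fun x => h x * p x).
Proof.
move=> /L1locP[mh hoo] mp B0 pB pM.
have mn : lm (fun x => normc (h x) * \1_(cube M) x).
  by apply: lmM; [exact: cmeasurable_normc|apply: lm_indic; exact: measurable_cube].
apply: (@L1_dom _ _ _ (fun x => B * (normc (h x) * \1_(cube M) x))).
- exact: cmeasurableM.
- by move=> x; rewrite !mulr_ge0 ?normc_ge0.
- apply: aeW => x; rewrite normcM indicE.
  have [xM|xM] := leP `|x| M.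
    by rewrite mem_set// mulr1 mulrC ler_wpM2r ?normc_ge0.
  by rewrite pM// (_ : normc 0 = 0) ?mulr0 ?mulr_ge0 ?normc_ge0//; exact: normc0.
rewrite intZ//; last by move=> x; rewrite mulr_ge0 ?normc_ge0.
by rewrite lte_mul_pinfty// ?lee_fin// ge0_fin_numE ?lee_fin.
Qed.

Lemma smooth_L1loc f : is_smooth f -> L1loc f.
Proof.
move=> sf; have mf := smooth_cmeasurable sf; apply/L1locP; split=> // M.
have [B B0 fB] := smooth_cube_bounded M sf; apply: le_lt_trans (int_cube_lt M B0).
apply: int_le => [x|x|]; rewrite ?mulr_ge0 ?normc_ge0//.
apply: aeW => x; rewrite indicE; case: (boolP (x \in _)); rewrite ?mulr0// !mulr1 inE.
exact: fB.
Qed.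

Lemma test_bounded f : is_test f -> exists2 B, 0 <= B & forall x, normc (f x) <= B.
Proof. exact: (test_dsum_bounded 0). Qed.

Lemma L1loc_mul_test h p : L1loc h -> is_test p -> L1 (fun x => h x * p x).
Proof.
move=> hL tp; have [B B0 pB] := test_bounded tp; case: tp => sp [M pM].
exact: (L1loc_mul_bounded hL (smooth_cmeasurable sp) B0 pB pM).
Qed.

Lemma test_L1 p : is_test p -> L1 p.
Proof.
move=> tp; have := L1loc_mul_test (smooth_L1loc (smooth_cst 1)) tp.
by apply: L1_ae; apply: aeW => x; rewrite mul1r.
Qed.

Definition ray_step (b : Rd) (n : nat) : Rd -> R[i] :=
  prod_fun (fun i t => smooth_step (- n.+1%:R * t + n.+1%:R * b ord0 i)).

Lemma smooth_ray_step b n : is_smooth (ray_step b n).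
Proof. by apply: smooth_prod_fun => i; apply: smooth1_affine; exact: smooth1_step.1. Qed.

Lemma ray_step_le1 b n x : normc (ray_step b n x) <= 1.
Proof.
rewrite normc_prod_fun; apply: prodr_ile1 => i _.
by rewrite normr_ge0 ger0_norm ?smooth_step_ge0// smooth_step_le1.
Qed.

Lemma ray_step_cvg b x : exists N, forall n, (N <= n)%N -> ray_step b n x = (\1_(ray b) x)%:C.
Proof.
(* The convergence is eventual equality: the value at [x] is 1 as soon as every b_i - x_i is at
   least 1/(n+1), and it is 0 for every [n] if some x_i >= b_i. *)
exists (\max_(i < d) Num.bound (b ord0 i - x ord0 i)^-1)%N => n Nn.
rewrite /ray_step /prod_fun indicE; congr (_ %:C).
have [xb|xb] := boolP (x \in _).
  rewrite big1// => i _; apply: smooth_step_ge1; rewrite mulNr addrC -mulrBr.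
  have bx : 0 < b ord0 i - x ord0 i by rewrite subr_gt0; move: xb; rewrite inE; exact.
  rewrite -ler_pdivrMr// mul1r; apply/ltW/(lt_le_trans (archi_boundP _)).
    by rewrite invr_ge0 ltW.
  by rewrite ler_nat; apply: leq_trans (leqnSn n); apply: leq_trans Nn; exact: leq_bigmax.
have [i bx] : exists i, b ord0 i <= x ord0 i.
  apply: contrapT => /forallNP h; move: xb; rewrite notin_setE; apply => i.
  by rewrite ltNge; apply/negP/h.
rewrite (bigD1 i)//= smooth_step_le0 ?mul0r// mulNr addrC -mulrBr pmulr_rle0 ?ltr0n//.
by rewrite subr_le0.
Qed.

Lemma cint_ray_step h b : L1 h -> (forall n, cintegral (fun x => h x * ray_step b n x) = 0) ->
  cintegral (fun x => h x * (\1_(ray b) x)%:C) = 0.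
Proof.
move=> hL h0; have mh := L1_cmeasurable hL.
have m1 : cmeasurable (fun x : Rd => (\1_(ray b) x)%:C : R[i]).
  by apply: cmeasurable_real; apply: lm_indic; exact: measurable_ray.
have B1 (x : Rd) : normc ((\1_(ray b) x)%:C : R[i]) <= 1.
  by rewrite normc_real indicE; case: (_ \in _); rewrite ?normr1 ?normr0.
have dom p : cmeasurable p -> (forall x, normc (p x) <= 1) -> L1 (fun x => h x * p x).
  move=> mp p1; apply: (@L1_dom _ _ _ (fun x => normc (h x))).
  - exact: cmeasurableM.
  - by move=> x; exact: normc_ge0.
  - by apply: aeW => x; rewrite normcM ler_piMr ?normc_ge0.
  - by case: hL.
have L := dom _ m1 B1.
have Ln n : L1 (fun x => h x * ray_step b n x).
  by apply: dom; [exact/smooth_cmeasurable/smooth_ray_step|exact: ray_step_le1].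
pose u n x : R := normc (h x * (\1_(ray b) x)%:C - h x * ray_step b n x).
have ucv : (\int[mu]_x (u n x)%:E)%E @[n --> \oo] --> 0%E.
  apply: (@int_dominated _ _ _ (fun x => 2 * normc (h x))).
  - by move=> n; apply: cmeasurable_normc; apply: cmeasurableB; [case: L|case: (Ln n)].
  - by apply: lmZ; exact: cmeasurable_normc.
  - by move=> n x; exact: normc_ge0.
  - move=> n; apply: aeW => x; apply: le_trans (ler_normcB _ _) _; rewrite !normcM mulrDl !mul1r.
    by rewrite lerD// ler_piMr ?normc_ge0// ray_step_le1.
  - by move=> x; rewrite mulr_ge0 ?normc_ge0.
  - rewrite intZ//; last 2 first.
    + exact: cmeasurable_normc.
    + by move=> x; exact: normc_ge0.
    by apply: lte_mul_pinfty => //; case: hL.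
  apply: aeW => x; have [N hN] := ray_step_cvg b x.
  apply/cvgrPdist_le => e e0; exists N => // n /= Nn.
  by rewrite /u hN// subrr sub0r normrN (_ : normc 0 = 0) ?normr0 ?ltW//; exact: normc0.
have bound n : ((normc (cintegral (fun x => h x * (\1_(ray b) x)%:C)))%:E <=
    2%:E * \int[mu]_x (u n x)%:E)%E.
  rewrite -[cintegral _]subr0 -(h0 n) -cintB//; apply: cint_norm.
  exact: (L1D L (L1_ae (aeW _ (fun x => mulN1r _)) (L1Z (-1) (Ln n)))).
have cv2 : (2%:E * \int[mu]_x (u n x)%:E)%E @[n --> \oo] --> 0%E.
  by rewrite -[X in _ --> X](mule0 2%:E); apply: cvgeZl.
have : ((normc (cintegral (fun x => h x * (\1_(ray b) x)%:C)))%:E <= 0)%E.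
  by rewrite -(cvg_lim _ cv2)//; apply: lime_ge; [apply: cvgP cv2|exact: nearW].
by rewrite lee_fin => z0; apply: eq0_normc; apply/eqP; rewrite eq_le z0 normc_ge0.
Qed.

(** A cutoff makes [h] integrable. Testing against the cutoff times smooth steps shows that its
    integrals over orthants vanish, so uniqueness of measures applies to real and imaginary parts,
    and no mollification of [h] enters. *)
Lemma du_bois_reymond h : L1loc h ->
  (forall p, is_test p -> cintegral (fun x => h x * p x) = 0) ->
  {ae mu, forall x, h x = 0}.
Proof.
move=> hL h0.
suff H (M : nat) : {ae mu, forall x, h x * cutoff M x = 0}.
  have := ae_foralln H; apply: filterS => x hx.
  have := hx (Num.bound `|x|); rewrite cutoff_one ?mulr1//.
  by apply/ltW/archi_boundP.
have [tM _] := @test_cutoff R d M; have kL := L1loc_mul_test hL tM.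
have kr b : cintegral (fun x => (h x * cutoff M x) * (\1_(ray b) x)%:C) = 0.
  apply: cint_ray_step => // n; rewrite -(h0 _ (testM tM (smooth_ray_step b n))).
  by congr cintegral; apply/funext => x; rewrite mulrA.
have [Lr Li] := L1_ReIm kL.
have hr : {ae mu, forall x, complex.Re (h x * cutoff M x) = 0}.
  apply: rays_eq0 => // b; have /(congr1 (fun z => complex.Re z)) /= <- := kr b.
  by congr Rintegral; apply/funext => x; rewrite mulrC [RHS](f_equal _ (mulrC _ _)) ReCM.
have hi : {ae mu, forall x, complex.Im (h x * cutoff M x) = 0}.
  apply: rays_eq0 => // b; have /(congr1 (fun z => complex.Im z)) /= <- := kr b.
  by congr Rintegral; apply/funext => x; rewrite mulrC [RHS](f_equal _ (mulrC _ _)) ImCM.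
by apply: filterS2 hr hi => x; rewrite [X in _ -> _ -> X = _]complexE => -> ->.
Qed.

Lemma int_le_cube (F : Rd -> R) (M B : R) : (forall x, 0 <= F x) -> 0 <= B -> 0 <= M ->
  (forall x, `|x| <= M -> F x <= B) -> (forall x, M < `|x| -> F x = 0) ->
  (\int[mu]_x (F x)%:E <= (B * (M *+ 2) ^+ d)%:E)%E.
Proof.
move=> F0 B0 M0 FB Fv; rewrite EFinM -lebesgue_rV_cube// lebesgue_rV_indic; last exact: measurable_cube.
rewrite -intZ//; last by apply: lm_indic; exact: measurable_cube.
apply: int_le => // [x|]; first by rewrite mulr_ge0.
apply: aeW => x; rewrite indicE; have [xM|xM] := leP `|x| M.
  by rewrite mem_set// mulr1 FB.
by rewrite Fv// mulr_ge0.
Qed.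

Lemma vanish_off_norm M p : vanish_off M p -> vanish_off `|M| p.
Proof. by apply: vanish_off_le; exact: ler_norm. Qed.

(* Translation invariance makes the integral of the difference quotients of a
   test function vanish, and these converge uniformly to the derivative. *)
Lemma cint_partial0 g i : is_test g -> cintegral (pder i g) = 0.
Proof.
move=> tg; case: (tg) => sg [M' /vanish_off_norm gM]; set M := `|M'| in gM.
have M0 : 0 <= M by exact: normr_ge0.
have [B0 hB0] := smooth_taylor i sg (M + 1); set B := `|B0|.
have hB x t : `|x| <= M + 1 -> `|t| <= 1 ->
    normc (g (x + t *: uvec i) - g x - t%:C * pder i g x) <= B * t ^+ 2.
  by move=> xM t1; apply: le_trans (hB0 _ _ xM t1) _; rewrite ler_wpM2r ?sqr_ge0 ?ler_norm.
(* The remainder is at most [B t^2] and lives on the cube of radius [M + 1]; [K] collects the volume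
   of that cube and the factor 2 of [cint_norm]. *)
set z := cintegral _; pose K := 2 * (B * ((M + 1) *+ 2) ^+ d).
have K0 : 0 <= K by rewrite !mulr_ge0 ?normr_ge0// exprn_ge0// mulrn_wge0// addr_ge0.
have zt t : 0 < t <= 1 -> normc z <= K * t.
  move=> /andP[t0 t1]; have tn : `|t| <= 1 by rewrite gtr0_norm.
  pose r x := g (x + t *: uvec i) - g x - t%:C * pder i g x.
  have La : L1 (fun x => g (x + t *: uvec i)) by exact/test_L1/test_translate.
  have Lg := test_L1 tg; have Lp : L1 (pder i g) by exact/test_L1/test_partial.
  have Lab : L1 (fun x => g (x + t *: uvec i) - g x).
    by exact: (test_L1 (testB (test_translate _ tg) tg)).
  have Lr : L1 r.
    by apply: test_L1; apply: testB; [exact: testB (test_translate _ tg) tg|exact/testZ/test_partial].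
  have rz : cintegral r = - (t%:C * z).
    rewrite /r cintB//; last exact: L1Z.
    rewrite cintB// (cint_translate _ (L1_cmeasurable Lg)) subrr sub0r; congr (- _).
    by rewrite cintZ.
  have := cint_norm Lr; rewrite rz normc_opp normcM normc_real gtr0_norm// => h.
  have rv x : M + 1 < `|x| -> normc (r x) = 0.
    move=> xM; have x1 : M < `|x| by apply: le_lt_trans xM; rewrite lerDl.
    have x2 : M < `|x + t *: uvec i|.
      have := ler_normB (x + t *: uvec i) (t *: uvec i); rewrite addrK.
      by rewrite normrZ norm_uvec mulr1; lra.
    rewrite /r (gM _ x1) (gM _ x2) (vanish_off_partial i gM x1) mulr0 !subr0; exact: normc0.
  have {}h : t * normc z <= 2 * (B * t ^+ 2 * ((M + 1) *+ 2) ^+ d).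
    rewrite -lee_fin; apply: le_trans h _; rewrite [X in (_ <= X)%E]EFinM.
    apply: lee_pmul => //; first by apply: int_ge0 => x; exact: normc_ge0.
    apply: int_le_cube => //.
    - by move=> x; exact: normc_ge0.
    - by rewrite mulr_ge0 ?normr_ge0 ?sqr_ge0.
    - by rewrite addr_ge0.
    - by move=> x xM; exact: hB.
  rewrite -(ler_pM2l t0); apply: le_trans h _; rewrite /K le_eqVlt; apply/orP; left.
  by apply/eqP; ring.
apply: eq0_normc; apply/eqP; rewrite eq_le normc_ge0 andbT.
apply/ler_addgt0Pl => e e0; rewrite addr0.
pose t := Num.min 1 (e / (K + 1)).
have K1 : 0 < K + 1 by rewrite ltr_wpDl.
have t01 : 0 < t <= 1 by rewrite /t lt_min ltr01 divr_gt0//= ge_min lexx.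
apply: le_trans (zt t t01) _; apply: le_trans (_ : (K + 1) * t <= _).
  by rewrite ler_wpM2r ?lerDl//; case/andP: t01 => /ltW.
by rewrite mulrC -ler_pdivlMr// /t ge_min lexx orbT.
Qed.

Lemma integration_by_parts f p i : is_smooth f -> is_test p ->
  cintegral (fun x => pder i f x * p x) = - cintegral (fun x => f x * pder i p x).
Proof.
move=> sf tp; have sp := test_smooth tp.
have tfp : is_test (fun x => f x * p x).
  by have := testM tp sf; under eq_fun do rewrite mulrC.
have := cint_partial0 i tfp; rewrite partialM// cintD => [/eqP||].
- by rewrite addr_eq0 => /eqP.
- by apply: L1loc_mul_test => //; exact/smooth_L1loc/smooth_partial.
- by apply: L1loc_mul_test; [exact: smooth_L1loc|exact: test_partial].
Qed.

Lemma integration_by_parts_foldr f p s : is_smooth f -> is_test p ->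
  cintegral (fun x => foldr pder f s x * p x) =
  (-1) ^+ size s * cintegral (fun x => f x * foldr pder p s x).
Proof.
move=> sf tp.
(* Moving the derivatives over one at a time reverses the word, so it is reversed beforehand by
   symmetry of derivatives. *)
have sr : perm_eq s (rev s) by rewrite perm_sym perm_rev.
rewrite (foldr_partial_perm (test_smooth tp) sr) {sr}.
elim: s p tp => [|i s IH] p tp /=; first by rewrite expr0 mul1r.
rewrite integration_by_parts//; last exact: smooth_foldr.
rewrite IH; last exact: test_partial.
by rewrite rev_cons foldr_rcons exprS mulN1r mulNr.
Qed.

Lemma weak_deriv_ofP a f g : weak_deriv_of a f g <-> [/\ L1loc f, L1loc g &
  forall p, is_test p -> (-1) ^+ mi_order a * cintegral (fun x => f x * foldr pder p (mi_word a) x) =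
    cintegral (fun x => g x * p x)].
Proof.
split=> -[fL gL h]; split=> // p.
  move=> /is_testP tp; have := h p; rewrite inE => /(_ tp).
  by rewrite /distr_deriv /regular mi_derivE.
by rewrite inE => /is_testP /h; rewrite /distr_deriv /regular mi_derivE.
Qed.

Lemma smooth_weak_deriv a f : is_smooth f -> weak_deriv_of a f (foldr pder f (mi_word a)).
Proof.
move=> sf; apply/weak_deriv_ofP; split; try exact/smooth_L1loc/smooth_foldr; first exact: smooth_L1loc.
move=> p tp; rewrite integration_by_parts_foldr// size_mi_word.
by [].
Qed.

Lemma weak_deriv_unique a f g h : weak_deriv_of a f g -> weak_deriv_of a f h ->
  {ae mu, forall x, g x = h x}.
Proof.
move=> /weak_deriv_ofP[_ gL hg] /weak_deriv_ofP[_ hL hh].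
suff : {ae mu, forall x, g x - h x = 0} by apply: filterS => x /eqP; rewrite subr_eq0 => /eqP.
have Lgh : L1loc (fun x => g x - h x).
  apply: (@L1loc_dom _ _ _ (fun x => normc (g x) + normc (h x))).
  - by apply: cmeasurableB; exact: L1loc_cmeasurable.
  - by move=> x; rewrite addr_ge0 ?normc_ge0.
  - by apply: aeW => x; exact: ler_normcB.
  move=> M; move/L1locP: gL => -[mg] /(_ M) gM; move/L1locP: hL => -[mh] /(_ M) hM.
  under eq_integral do rewrite mulrDl.
  have mI : lm (\1_(cube M)) by apply: lm_indic; exact: measurable_cube.
  rewrite intD; first by rewrite lte_add_pinfty.
  - by apply: lmM => //; exact: cmeasurable_normc.
  - by apply: lmM => //; exact: cmeasurable_normc.
  - by move=> x; rewrite mulr_ge0 ?normc_ge0.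
  - by move=> x; rewrite mulr_ge0 ?normc_ge0.
apply: du_bois_reymond => // p tp.
under eq_fun do rewrite mulrBl.
by rewrite cintB; [rewrite -hg// -hh// subrr|exact: L1loc_mul_test|exact: L1loc_mul_test].
Qed.

Lemma weak_derivP a f g : weak_deriv_of a f g ->
  weak_deriv_of a f (weak_deriv a f) /\ {ae mu, forall x, weak_deriv a f x = g x}.
Proof.
move=> fg; have h : weak_deriv_of a f (weak_deriv a f) by exact: (@xgetI _ _ _ g).
by split=> //; exact: weak_deriv_unique h fg.
Qed.

Section weighted_sobolev.
Variable V : nat -> Rd -> R.
Hypothesis wV : weight_system V.

Lemma weight_ge1 n x : 1 <= V n x. Proof. by have [/(_ n)[]] := wV. Qed.

Lemma weight_ge0 n x : 0 <= V n x. Proof. by apply: le_trans (weight_ge1 n x). Qed.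

Lemma weight_lm n : lm (V n). Proof. by have [/(_ n)[]] := wV. Qed.

Lemma weight_mono n m x : (n <= m)%N -> V n x <= V m x.
Proof. by move=> /subnK <-; elim: (m - n)%N => //= k /le_trans; apply; exact: wV.2. Qed.

Lemma normc_weighted n f x : normc (weighted (V n) f x) = normc (f x) * V n x.
Proof. by rewrite /weighted normcM normc_real ger0_norm ?weight_ge0. Qed.

Lemma weighted_cmeasurable n f : cmeasurable f -> cmeasurable (weighted (V n) f).
Proof. by move=> mf; apply: cmeasurableM => //; exact/cmeasurable_real/weight_lm. Qed.

Lemma K1_weak_deriv f a n : K1 V f -> weak_deriv_of a f (weak_deriv a f) /\
  L1 (weighted (V n) (weak_deriv a f)).
Proof.
(* [K1] pairs the weight [V n] only with derivatives of order at most [n]; the index is raised to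
   reach the order of [a], then lowered by monotonicity of the weights. *)
move=> [fL fK]; have [g fg gL] := fK (maxn n (mi_order a)) a (leq_maxr _ _).
have [fw wg] := weak_derivP fg; split=> //.
apply: (@L1_dom _ _ _ (fun x => normc (weighted (V (maxn n (mi_order a))) g x))).
- by apply: weighted_cmeasurable; case: fw => _ /L1loc_cmeasurable.
- by move=> x; exact: normc_ge0.
- apply: filterS wg => x wgx; rewrite !normc_weighted wgx ler_wpM2l ?normc_ge0//.
  exact/weight_mono/leq_maxl.
- by case: gL.
Qed.

Lemma L1normE g : L1 g -> (L1norm g)%:E = (\int[mu]_x (normc (g x))%:E)%E.
Proof. by move=> [_ goo]; apply: rint_fin => // x; exact: normc_ge0. Qed.

Lemma K1norm_deriv f (a : multiindex) n : K1 V f -> (mi_order a <= n)%N ->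
  (\int[mu]_x (normc (weak_deriv a f x) * V n x)%:E <= (K1norm V n f)%:E)%E.
Proof.
move=> fK an; have [_ L] := K1_weak_deriv a n fK.
rewrite (_ : (\int[mu]_x (normc (weak_deriv a f x) * V n x)%:E)%E =
  (L1norm (weighted (V n) (weak_deriv a f)))%:E); last first.
  by rewrite L1normE//; apply: eq_integral => x _; rewrite normc_weighted.
by rewrite lee_fin; exact: (@le_max_order R d n (fun a => L1norm (weighted (V n) (weak_deriv a f)))).
Qed.

Lemma smooth_K1 f : is_smooth f ->
  (forall n s, (\int[mu]_x (normc (foldr pder f s x) * V n x)%:E < +oo)%E) -> K1 V f.
Proof.
move=> sf foo; split; first exact: smooth_L1loc.
move=> n a _; exists (foldr pder f (mi_word a)); first exact: smooth_weak_deriv.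
split; first by apply/weighted_cmeasurable/smooth_cmeasurable/smooth_foldr.
by under eq_integral do rewrite normc_weighted.
Qed.

Lemma smooth_K1norm f n (B : R) : is_smooth f -> K1 V f -> 0 <= B ->
  (forall s, (size s <= n)%N -> (\int[mu]_x (normc (foldr pder f s x) * V n x)%:E <= B%:E)%E) ->
  K1norm V n f <= B.
Proof.
move=> sf fK B0 fB; apply: max_order_le => // a an.
have [fw L] := K1_weak_deriv a n fK; rewrite -lee_fin L1normE//.
have := fB (mi_word a); rewrite size_mi_word => /(_ an); apply: le_trans.
rewrite (@int_ae _ _ _ (fun x => normc (foldr pder f (mi_word a) x) * V n x))//.
have := weak_deriv_unique fw (smooth_weak_deriv a sf).
by apply: filterS => x wx; rewrite normc_weighted wx.
Qed.

End weighted_sobolev.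

End weak_derivatives.

(** * Behaviour of the weights under bounded translations *)

Section weight_growth.
Context {R : realType} {d : nat}.
Local Notation Rd := 'rV[R]_d.
Implicit Types W : nat -> Rd -> R.

(** [wM] is stated for the Euclidean norm, the proof works with the maximum norm. The radius 1/(d+1)
    instead of 1/d also makes sense for d = 0. *)
Lemma enorm_le1 (y : Rd) : `|y| <= d.+1%:R^-1 -> enorm y <= 1.
Proof.
move=> yd; rewrite /enorm -sqrtr1; apply: ler_wsqrtr.
apply: le_trans (_ : \sum_(i < d) (d.+1%:R^-1 : R) <= _).
  apply: ler_sum => i _; rewrite -real_normK ?num_real//.
  have a : `|y ord0 i| <= d.+1%:R^-1 by apply: le_trans yd; exact: coord_le_norm.
  apply: le_trans (_ : d.+1%:R^-1 * `|y ord0 i| <= _); first by rewrite expr2 ler_wpM2r.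
  rewrite ler_piMr ?invr_ge0 ?ler0n//; apply: le_trans a _.
  by rewrite invf_le1 ?ltr0n// ler1n.
rewrite sumr_const card_ord -[_ *+ d]mulr_natl ler_pdivrMr ?ltr0n// mul1r ler_nat.
exact: leqnSn.
Qed.

(** A translation by [y] is made of [k] translations by [y / k], each short enough for [wM]; the
    index and the constant accumulate over the [k] applications. *)
Lemma wM_large W n (M : R) : wM W -> exists (m : nat) (C : R), [/\ (n <= m)%N, 0 < C &
  forall x y, `|y| <= M -> W n (x + y) <= C * W m x].
Proof.
move=> wW; pose r : R := d.+1%:R^-1; have r0 : 0 < r by rewrite invr_gt0 ltr0n.
have H k : exists (m : nat) (C : R), [/\ (n <= m)%N, 0 < C &
    forall x y, `|y| <= k%:R * r -> W n (x + y) <= C * W m x].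
  elim: k => [|k [m [C [nm C0 IH]]]].
    exists n, 1; split=> // x y; rewrite mul0r normr_le0 => /eqP ->.
    by rewrite addr0 mul1r.
  have [p [D [mp D0 hD]]] := wW m; exists p, (C * D); split; [exact: leq_trans mp|exact: mulr_gt0|].
  move=> x y yk; have k0 : (0 : R) < k.+1%:R by rewrite ltr0n.
  pose z := (k%:R / k.+1%:R) *: y; pose w := k.+1%:R^-1 *: y.
  have -> : y = w + z.
    rewrite /z /w -scalerDl -[in X in X + _](mul1r k.+1%:R^-1) -mulrDl.
    by rewrite -natr1 addrC divff ?scale1r// natr1 lt0r_neq0.
  have zk : `|z| <= k%:R * r.
    rewrite normrZ ger0_norm ?divr_ge0 ?ler0n// -mulrA ler_wpM2l ?ler0n//.
    by rewrite mulrC ler_pdivrMr// mulrC.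
  have wk : `|w| <= r.
    by rewrite normrZ ger0_norm ?invr_ge0 ?ler0n// mulrC ler_pdivrMr// mulrC.
  rewrite addrA; apply: le_trans (IH _ _ zk) _; rewrite -mulrA ler_pM2l//.
  by apply: hD; exact: enorm_le1.
have [m [C [nm C0 h]]] := H (Num.bound (`|M| / r)).
exists m, C; split=> // x y yM; apply: h; rewrite -ler_pdivrMr//.
apply: le_trans (_ : `|M| / r <= _); last first.
  by apply/ltW/archi_boundP; rewrite divr_ge0 ?normr_ge0 ?ltW.
by rewrite ler_pM2r ?invr_gt0// (le_trans yM)// ler_norm.
Qed.

Lemma wM_cube_bounded W n (M : R) : wM W -> exists2 B : R, 0 <= B & forall x, `|x| <= M -> W n x <= B.
Proof.
move=> wW; have [m [C [_ C0 h]]] := wM_large n M wW.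
exists `|C * W m 0| => [|x xM]; first exact: normr_ge0.
by apply: le_trans (ler_norm _); rewrite -[x]add0r; exact: h.
Qed.

End weight_growth.

(** * Solid spaces and restriction to test functions *)

Section solid_spaces.
Context {R : realType} {d : nat}.
Local Notation Rd := 'rV[R]_d.
Local Notation mu := (lebesgue_rV R d).
Local Notation lm := (@lebesgue_measurable R d).
Implicit Types (f g h : Rd -> R[i]).

Lemma int_fatou (v : nat -> Rd -> R) (w : Rd -> R) (B : R) : (forall n, lm (v n)) ->
  (forall n x, 0 <= v n x) -> (forall x, v n x @[n --> \oo] --> w x) ->
  (forall n, \int[mu]_x (v n x)%:E <= B%:E)%E -> (\int[mu]_x (w x)%:E <= B%:E)%E.
Proof.
move=> lv v0 vw iv.
have /choice[u hu] : forall n, exists u : Rd -> R, [/\ measurable_fun setT u, forall x, 0 <= u x &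
    {ae mu, forall x, v n x = u x}] by move=> n; exact: lm_ge0.
have uv : {ae mu, forall x, forall n, v n x = u n x} by apply: ae_foralln => n; case: (hu n).
have <- : (\int[mu]_x limn_einf (fun n => (u n x)%:E) = \int[mu]_x (w x)%:E)%E.
  apply: ae_eq_integralT; apply: filterS uv => x uvx.
  have cw : (u n x)%:E @[n --> \oo] --> (w x)%:E.
    apply: cvg_EFin; first exact: nearW.
    by rewrite (_ : fine \o _ = fun n => v n x)//; apply/funext => n /=; rewrite uvx.
  by rewrite (cvg_limn_einf_sup cw).1.
apply: le_trans (fatou _ _ _ _) _ => //.
- by move=> n; apply/measurable_EFinP; case: (hu n).
- by move=> n x _; rewrite lee_fin; case: (hu n).
rewrite (_ : (fun n => _) = fun n => (\int[mu]_x (v n x)%:E)%E); last first.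
  by apply/funext => n; apply: int_ae; case: (hu n) => _ _; apply: filterS => x ->.
rewrite limn_einf_lim; apply: lime_le; first exact: is_cvg_einfs.
by apply: nearW => n; apply: le_trans (iv n); apply: ereal_inf_lbound; exists n => /=.
Qed.

(** By Fatou's lemma, convergence to 0 in mean forces the pointwise limit to vanish almost
    everywhere; no subsequence has to be extracted. *)
Lemma int_fatou0 (v : nat -> Rd -> R) (w : Rd -> R) : (forall n, lm (v n)) ->
  (forall n x, 0 <= v n x) -> (forall x, v n x @[n --> \oo] --> w x) ->
  (forall e : R, 0 < e -> exists N, forall n, (N <= n)%N -> (\int[mu]_x (v n x)%:E <= e%:E)%E) ->
  {ae mu, forall x, w x = 0}.
Proof.
move=> lv v0 vw iv; have w0 x : 0 <= w x.
  by rewrite -(cvg_lim _ (vw x))//; apply: limr_ge; [exact: cvgP (vw x)|exact: nearW].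
apply: int_eq0 => //; first exact: lm_limit vw.
apply/eqP; rewrite eq_le int_ge0// andbT; apply/lee_addgt0Pr => e e0; rewrite add0e.
have [N hN] := iv e e0; apply: (@int_fatou (fun n => v (n + N)%N)) => //.
  by move=> x; rewrite (cvg_shiftn N (fun n => v n x)).
by move=> n; apply: hN; exact: leq_addl.
Qed.

Variables (E : set (Rd -> R[i])) (nE : (Rd -> R[i]) -> R).
Hypotheses (HE : TIBF_bounded_type E nE) (SE : solid E nE).

Let bE := tibf_bfs HE.

Lemma E_solid f g : E f -> cmeasurable g -> {ae mu, forall x, normc (g x) <= normc (f x)} ->
  E g /\ nE g <= nE f.
Proof.
move=> Ef mg gf; apply: SE => //; have /L1locP[mf fM] := bfs_L1loc bE Ef.
by apply: (@L1loc_dom _ _ _ (fun x => normc (f x))) => // x; exact: normc_ge0.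
Qed.

Lemma E_ae f g : E f -> {ae mu, forall x, f x = g x} -> E g /\ nE g = nE f.
Proof.
by move=> Ef /aeE fg; split; [exact: bfs_ae_mem bE _ _ Ef fg|exact: bfs_ae_norm bE _ _ Ef fg].
Qed.

Lemma E_sub f g : E f -> E g -> E (fun x => f x - g x) /\ nE (fun x => f x - g x) <= nE f + nE g.
Proof.
move=> Ef Eg; have EN := bfs_memZ bE (-1) Eg.
have -> : (fun x => f x - g x) = (fun x => f x + (-1) * g x) by apply/funext => x; rewrite mulN1r.
split; first exact: bfs_memD bE _ _ Ef EN.
apply: le_trans (bfs_normD bE Ef EN) _; rewrite (bfs_normZ bE (-1) Eg).
by rewrite -[-1]/(- 1) normc_opp -[normc 1]/(normc (1%:C)) normc_real normr1 mul1r.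
Qed.

Lemma E_subC f g : E f -> E g -> nE (fun x => f x - g x) = nE (fun x => g x - f x).
Proof.
move=> Ef Eg; have [EB _] := E_sub Ef Eg.
have -> : (fun x => g x - f x) = (fun x => (-1) * (f x - g x)).
  by apply/funext => x; rewrite mulN1r opprB.
by rewrite (bfs_normZ bE (-1) EB) normc_opp -[normc 1]/(normc (1%:C)) normc_real normr1 mul1r.
Qed.

Lemma E_sum (I : Type) (r : seq I) (F : I -> Rd -> R[i]) : (forall k, E (F k)) ->
  E (fun x => \sum_(k <- r) F k x) /\ nE (fun x => \sum_(k <- r) F k x) <= \sum_(k <- r) nE (F k).
Proof.
move=> EF; elim: r => [|k r [IH1 IH2]].
  under eq_fun do rewrite big_nil.
  split; first exact: bfs_mem0 bE.
  have := bfs_normZ bE 0 (bfs_mem0 bE); rewrite big_nil.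
  by under eq_fun do rewrite mulr0; rewrite (_ : normc 0 = 0) ?mul0r => [->//|]; exact: normc0.
under eq_fun do rewrite big_cons.
split; first exact: bfs_memD bE _ _ (EF k) IH1.
by rewrite big_cons; apply: le_trans (bfs_normD bE (EF k) IH1) _; rewrite lerD2l.
Qed.

Lemma nonzero_bounded_in_E : exists g : Rd -> R, [/\ lm g, forall x, 0 <= g x <= 1,
  E (fun x => (g x)%:C) & ~ {ae mu, forall x, g x = 0}].
Proof.
have [f Ef f0] := tibf_nontrivial HE.
have mf := L1loc_cmeasurable (bfs_L1loc bE Ef).
pose g x := Num.min (normc (f x)) 1.
have lg : lm g by apply: lm_min; [exact: cmeasurable_normc|exact: lm_cst].
have g01 x : 0 <= g x <= 1 by rewrite /g le_min normc_ge0 ler01 ge_min lexx orbT.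
exists g; split=> //.
  apply: (E_solid Ef _ _).1; first exact: cmeasurable_real.
  apply: aeW => x; rewrite normc_real ger0_norm; last by case/andP: (g01 x).
  by rewrite /g ge_min lexx.
move=> g0; apply: f0; apply/aeE; apply: filterS g0 => x.
rewrite /g; case: (lerP (normc (f x)) 1) => _ h; first exact: eq0_normc.
by move: h => /eqP; rewrite oner_eq0.
Qed.

Lemma cube_mass_gt0 (g : Rd -> R) : lm g -> (forall x, 0 <= g x) -> ~ {ae mu, forall x, g x = 0} ->
  exists2 M : R, 0 <= M & (0 < \int[mu]_x (g x * \1_(cube M) x)%:E)%E.
Proof.
move=> lg g0 gn; apply: contrapT => h; apply: gn.
suff H (M : nat) : {ae mu, forall x, g x * \1_(cube M%:R) x = 0}.
  have := ae_foralln H; apply: filterS => x /(_ (Num.bound `|x|)).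
  by rewrite indicE mem_set ?mulr1//; apply/ltW/archi_boundP.
have lI : lm (\1_(cube M%:R)) by apply: lm_indic; exact: measurable_cube.
apply: int_eq0; first exact: lmM.
  by move=> x; rewrite mulr_ge0.
apply/eqP; rewrite eq_le int_ge0 ?andbT//; last by move=> x; rewrite mulr_ge0.
by rewrite leNgt; apply/negP => h'; apply: h; exists M%:R.
Qed.

(** Truncating an element of [E] gives a nonzero [g] in [E] with values in the unit interval, of
    positive mass [c] on a cube of radius [L]. Its convolution with the indicator of the cube of
    radius M + L lies in [E] by the module property and is at least [c] on the cube of radius [M];
    solidity does the rest. *)
Lemma cube_in_E (M : R) : E (fun x => (\1_(cube M) x)%:C).
Proof.
have [M0|M0] := ltP M 0.
  apply: (E_ae (bfs_mem0 bE) _).1; apply: aeW => x; rewrite indicE memNset//= => xM.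
  by have := normr_ge0 x; rewrite leNgt (le_lt_trans xM).
have [g [lg g01 Eg gn]] := nonzero_bounded_in_E.
have g0 x : 0 <= g x by case/andP: (g01 x).
have g1 x : g x <= 1 by case/andP: (g01 x).
have [L L0 gL] := cube_mass_gt0 lg g0 gn; set K := M + L.
have lI (r : R) : lm (\1_(cube r)) by apply: lm_indic; exact: measurable_cube.
pose p (x : Rd) : R[i] := (\1_(cube K) x)%:C.
have Lp : L1 p.
  split; first exact: cmeasurable_real.
  apply: le_lt_trans (int_cube_lt K ler01); apply: int_le => [x|x|]; rewrite ?normc_ge0 ?mulr_ge0//.
  by apply: aeW => x; rewrite mul1r normc_real ger0_norm.
have [Ec _] := tibf_A3 HE Eg Lp.
pose c := \int[mu]_x (g x * \1_(cube L) x).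
have gI0 (r : R) x : 0 <= g x * \1_(cube r) x by rewrite mulr_ge0.
have foo (r : R) : (\int[mu]_x (g x * \1_(cube r) x)%:E < +oo)%E.
  apply: le_lt_trans (int_cube_lt r ler01); apply: int_le => [x|x|]; rewrite ?mulr_ge0//.
  by apply: aeW => x; rewrite ler_wpM2r.
have c0 : 0 < c by rewrite -lte_fin rint_fin.
(* For |x| <= M and |y| <= L the point x - y lies in the cube of radius [K = M + L], so all of the
   mass of [g] on the cube of radius [L] is seen from [x]. *)
have big x : cube M x -> c <= normc (convolution (fun x => (g x)%:C) p x).
  move=> xM; apply: le_trans _ (normc_Re _); apply: le_trans _ (ler_norm _).
  rewrite /convolution /= (_ : (fun y => _) = fun y => g (x - y) * \1_(cube K) y); last first.
    by apply/funext => y; rewrite /p /=; ring.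
  rewrite -(@rint_reflect _ _ (fun y => g (x - y) * \1_(cube K) y)); last first.
    apply: lmM => //; have := lm_reflect (lm_translate x lg).
    by under eq_fun do rewrite addrC.
  rewrite -(@rint_translate _ _ (- x) (fun y => g (x - - y) * \1_(cube K) (- y))); last first.
    apply: lmM; last exact: lm_reflect.
    by have := lm_translate x lg; under eq_fun do rewrite addrC; under [X in _ -> lm X]eq_fun do rewrite opprK.
  rewrite (_ : (fun y => _) = fun y => g y * \1_(cube K) (x - y)); last first.
    by apply/funext => y; rewrite opprK opprB addrC subrK.
  have lK : lm (fun y => \1_(cube K) (x - y) : R).
    by have := lm_reflect (lm_translate x (lI K)); under eq_fun do rewrite addrC.
  have K0 y : 0 <= g y * \1_(cube K) (x - y) by rewrite mulr_ge0.
  have Kle y : g y * \1_(cube K) (x - y) <= g y * \1_(cube (K + M)) y.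
    rewrite ler_wpM2l// !indicE ler_nat; case: (boolP (_ \in _)) => //; rewrite inE /cube /= => h.
    rewrite mem_set//=; have := ler_normB x (x - y); rewrite subKr => h'.
    by apply: le_trans h' _; rewrite addrC lerD.
  have Kfoo : (\int[mu]_y (g y * \1_(cube K) (x - y))%:E < +oo)%E.
    by apply: le_lt_trans (foo (K + M)); apply: int_le => //; exact: aeW.
  rewrite -lee_fin !rint_fin//; apply: int_le => //; apply: aeW => y.
  rewrite ler_wpM2l// !indicE ler_nat; case: (boolP (_ \in _)) => //; rewrite inE /cube /= => h.
  rewrite mem_set//=; apply: le_trans (ler_normB _ _) _; exact: lerD.
have Ec' := bfs_memZ bE (c^-1)%:C Ec.
apply: (E_solid Ec' _ _).1; first by apply: cmeasurable_real.
apply: aeW => x; rewrite normcM !normc_real indicE.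
case: (boolP (_ \in _)); rewrite ?normr0 ?mulr_ge0 ?normc_ge0// inE => xM.
rewrite normr1 gtr0_norm ?invr_gt0// -ler_pdivrMl ?invr_gt0// invrK mulr1.
exact: big.
Qed.

(** Completeness gives a limit in norm. It has to be the pointwise limit almost everywhere, since
    norm convergence implies convergence in mean on every cube and Fatou's lemma compares the two
    limits there. *)
Lemma E_limit (u : nat -> Rd -> R[i]) (w : Rd -> R[i]) : (forall n, E (u n)) ->
  (forall e : R, 0 < e -> exists N : nat, forall m n : nat,
      (N <= m)%N -> (N <= n)%N -> nE (fun x => u m x - u n x) < e) ->
  (forall x, normc (u n x - w x) @[n --> \oo] --> (0 : R)) ->
  E w /\ nE (fun x => u n x - w x) @[n --> \oo] --> (0 : R).
Proof.
move=> Eu cu uw; have [f Ef uf] := bfs_complete bE Eu cu.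
have mf := L1loc_cmeasurable (bfs_L1loc bE Ef).
have mu' n := L1loc_cmeasurable (bfs_L1loc bE (Eu n)).
have mB n : lm (fun x => normc (u n x - f x)) by exact/cmeasurable_normc/cmeasurableB.
have fw : {ae mu, forall x, f x = w x}.
  suff H (M : nat) : {ae mu, forall x, normc (w x - f x) * \1_(cube M%:R) x = 0}.
    have := ae_foralln H; apply: filterS => x /(_ (Num.bound `|x|)).
    rewrite indicE mem_set ?mulr1; last by apply/ltW/archi_boundP.
    by move=> /eq0_normc/eqP; rewrite subr_eq0 => /eqP.
  apply: (@int_fatou0 (fun n x => normc (u n x - f x) * \1_(cube M%:R) x)).
  - by move=> n; apply: lmM => //; apply: lm_indic; exact: measurable_cube.
  - by move=> n x; rewrite mulr_ge0 ?normc_ge0.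
  - move=> x; apply: cvgMl; apply/cvgrPdist_le => e e0.
    have /cvgrPdist_le /(_ _ e0) := uw x; apply: filterS => n.
    rewrite sub0r normrN ger0_norm ?normc_ge0// distrC; apply: le_trans.
    apply: le_trans (ler_dist_normc _ _) _.
    by rewrite (_ : _ - _ = u n x - w x)//; ring.
  have [C hC] := bfs_continuous bE (@compact_cube R d M%:R).
  have h n : (\int[mu]_x (normc (u n x - f x) * \1_(cube M%:R) x)%:E <=
      (C * nE (fun x => (u n x - f x)%R))%:E)%E.
    by rewrite -int_in; apply: hC; exact: (E_sub (Eu n) Ef).1.
  move=> e e0; have C1 : 0 < `|C| + 1 by rewrite ltr_wpDl.
  have /cvgrPdist_le /(_ _ (divr_gt0 e0 C1))[N _ hN] := uf; exists N => n /hN /= {}hN.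
  apply: le_trans (h n) _; rewrite lee_fin; have := bfs_norm_ge0 bE (E_sub (Eu n) Ef).1.
  rewrite sub0r normrN in hN => nE0; rewrite ger0_norm// in hN.
  apply: le_trans (_ : (`|C| + 1) * nE (fun x => u n x - f x) <= _).
    by rewrite ler_wpM2r//; apply: le_trans (ler_norm C) _; rewrite lerDl.
  by rewrite mulrC -ler_pdivlMr.
split; first exact: (E_ae Ef fw).1.
rewrite (_ : (fun n => _) = fun n => nE (fun x => u n x - f x))//.
apply/funext => n; apply: (E_ae (E_sub (Eu n) Ef).1 _).2.
by apply: filterS fw => x ->.
Qed.

Lemma cube_norm_gt0 (r : R) : 0 < r -> 0 < nE (fun x => (\1_(cube r) x)%:C).
Proof.
move=> r0; rewrite lt_neqAle (bfs_norm_ge0 bE (cube_in_E r)) andbT eq_sym.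
apply/negP => /eqP /(bfs_norm_eq0 bE (cube_in_E r)) /aeE h.
have : (\int[mu]_x (\1_(cube r) x)%:E = 0)%E.
  rewrite (@int_ae _ _ _ (fun=> 0)); last by apply: filterS h => x [].
  by rewrite integral0.
rewrite -lebesgue_rV_indic ?lebesgue_rV_cube//; [|exact: ltW|exact: measurable_cube].
by move=> [] /eqP; rewrite expf_eq0 mulrn_eq0 /= (gt_eqF r0) andbF.
Qed.

End solid_spaces.

(** * Restricting functionals from K^1 to test functions *)

Section restriction.
Context {R : realType} {d : nat}.
Local Notation Rd := 'rV[R]_d.
Local Notation mu := (lebesgue_rV R d).
Local Notation lm := (@lebesgue_measurable R d).
Implicit Types (f g p : Rd -> R[i]) (V W : nat -> Rd -> R).

Definition cube_bounded V := forall n (M : R), exists2 B : R, 0 <= B & forall x, `|x| <= M -> V n x <= B.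

Lemma wM_bounded V : wM V -> cube_bounded V.
Proof. by move=> wV n M; exact: wM_cube_bounded. Qed.

Lemma reflect_bounded V : cube_bounded V -> cube_bounded (fun n => Defs.reflect (V n)).
Proof.
move=> bV n M; have [B B0 hB] := bV n M; exists B => // x xM.
by apply: hB; rewrite normrN.
Qed.

Lemma reflect_weight_system V : weight_system V -> weight_system (fun n => Defs.reflect (V n)).
Proof.
move=> [wV mV]; split=> [n|n x]; last exact: mV.
have [V1 Vb lV] := wV n; split=> [x|x|]; first exact: V1; last exact: lm_reflect.
have [M hM] := Vb (- x); exists M.
case/nbhs_ballP: hM => e /= e0 h; apply/nbhs_ballP; exists e => // y xy; apply: h.
by move: xy; rewrite -!ball_normE /ball_ /= opprK -[X in X < _]normrN opprB addrC.
Qed.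

Lemma test_weighted_int V n f s (M B S : R) : weight_system V -> 0 <= M -> 0 <= B -> 0 <= S ->
  vanish_off M f -> (forall x, `|x| <= M -> V n x <= B) ->
  (forall x, normc (foldr pder f s x) <= S) ->
  (\int[mu]_x (normc (foldr pder f s x) * V n x)%:E <= (S * B * (M *+ 2) ^+ d)%:E)%E.
Proof.
move=> wV M0 B0 S0 fM VB fS; apply: int_le_cube => //.
- by move=> x; rewrite mulr_ge0 ?normc_ge0 ?weight_ge0.
- exact: mulr_ge0.
- by move=> x xM; apply: ler_pM; rewrite ?normc_ge0 ?weight_ge0 ?VB.
move=> x xM; rewrite (vanish_off_foldr s fM xM) (_ : normc 0 = 0) ?mul0r//; exact: normc0.
Qed.

Lemma test_K1 V f : weight_system V -> cube_bounded V -> is_test f -> K1 V f.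
Proof.
move=> wV bV tf; apply: smooth_K1 => //; first exact: test_smooth.
move=> n s; have [S S0 fS] := test_bounded (test_foldr s tf).
case: tf => sf [M /vanish_off_norm fM]; have [B B0 VB] := bV n `|M|.
by apply: le_lt_trans (test_weighted_int wV (normr_ge0 M) B0 S0 fM VB fS) _; rewrite ltry.
Qed.

Lemma normc_le_sup_norm f x : is_test f -> normc (f x) <= sup_norm f.
Proof.
move=> tf; have [B _ fB] := test_bounded tf; apply: ub_le_sup; last by exists x.
by exists B => _ [y _ <-].
Qed.

Lemma normc_foldr_max_order f s n x : is_test f -> (size s <= n)%N ->
  normc (foldr pder f s x) <= max_order n (fun a => sup_norm (mi_deriv a f)).
Proof.
move=> tf sn; have [fE ao] := foldr_partial_mi s (test_smooth tf); rewrite fE.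
apply: le_trans (normc_le_sup_norm x _) _; first by rewrite -fE; exact: test_foldr.
by apply: (@le_max_order _ _ n (fun a => sup_norm (mi_deriv a f))); rewrite ao.
Qed.

Lemma test_comb (c : R[i]) f g : is_test f -> is_test g -> is_test (fun x => c * f x + g x).
Proof. by move=> tf tg; apply: testD => //; exact: testZ. Qed.

Lemma conv_functionalE (T : functional) p x : conv_functional T p x = T (fun t => p (x - t)).
Proof. by rewrite /conv_functional /translate /Defs.reflect; congr T; apply/funext => t; rewrite opprB. Qed.

Lemma test_conv_argument p (x : Rd) : is_test p -> is_test (fun t => p (x - t)).
Proof.
move=> tp; have := test_translate (- x) (test_reflect tp).
by under eq_fun do rewrite opprD opprK addrC.
Qed.

(** The easy inclusion. On functions supported in a fixed cube the weights are bounded, so the norms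
    of K^1 are dominated by suprema of derivatives and a continuous functional restricts to a
    distribution. The convolution only evaluates it at test functions. *)
Lemma restrict_OC_K1 (E : set (Rd -> R[i])) V W (S T : functional) : weight_system V -> cube_bounded V ->
  OC_K1 V E W S -> (forall f, is_test f -> T f = S f) -> OC_D E W T.
Proof.
move=> wV bV [[Sl [n [C SC]]] SE] TS.
have wV' := reflect_weight_system wV; have bV' := reflect_bounded bV.
have tK f : is_test f -> K1 (fun n => Defs.reflect (V n)) f by exact: test_K1.
split; last first.
  move=> p /is_testP tp; have := SE p (test_K1 wV bV tp).
  suff -> : conv_functional S p = conv_functional T p by [].
  apply/funext => x; rewrite !conv_functionalE TS//.
  exact: test_conv_argument.
split.
  move=> c f g /is_testP tf /is_testP tg; rewrite !TS//; last exact: test_comb.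
  by apply: Sl; exact: tK.
move=> K /compact_sub_cube[M M0 KM]; have [B B0 VB] := bV' n M.
exists n, (`|C| * (B * (M *+ 2) ^+ d)) => f /is_testP tf fK.
have fM : vanish_off M f.
  move=> x xM; apply: contrapT => /eqP fx.
  have : tsupport f x by apply: subset_closure.
  by move=> /fK/KM; rewrite /cube /= leNgt xM.
rewrite TS//; apply: le_trans (SC f (tK f tf)) _.
set S0 := max_order _ _; have S00 : 0 <= S0 by exact: max_order_ge0.
have K0 : 0 <= K1norm (fun n => Defs.reflect (V n)) n f by exact: max_order_ge0.
apply: le_trans (ler_wpM2r K0 (ler_norm C)) _.
rewrite -mulrA ler_wpM2l ?normr_ge0//.
apply: (smooth_K1norm wV'); [exact: test_smooth|exact: tK|by rewrite !mulr_ge0// exprn_ge0// mulrn_wge0// ltW|].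
move=> s sn; have := test_weighted_int wV' (ltW M0) B0 S00 fM VB.
rewrite [X in _ -> (_ <= X%:E)%E](_ : _ = S0 * B * (M *+ 2) ^+ d); last by rewrite mulrC mulrA.
by apply => x; exact: normc_foldr_max_order.
Qed.

End restriction.

(** * Necessity of moderateness *)

Section complex_limits.
Context {R : realType}.
Implicit Types (u v : nat -> R[i]) (l z : R[i]) (e B : R).

Definition eventually_le (r : nat -> R) e := exists N, forall n, (N <= n)%N -> r n <= e.

Definition ccvg u l := forall e, 0 < e -> eventually_le (fun n => normc (u n - l)) e.

Definition ccauchy u := forall e, 0 < e ->
  exists N, forall m n, (N <= m)%N -> (N <= n)%N -> normc (u m - u n) <= e.

Lemma ccvg_cvg u l : ccvg u l -> normc (u n - l) @[n --> \oo] --> (0 : R).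
Proof.
move=> ul; apply/cvgrPdist_le => e e0; have [N hN] := ul e e0; exists N => // n /= Nn.
by rewrite sub0r normrN ger0_norm ?normc_ge0// hN.
Qed.

Lemma real_cauchy_cvg (r : nat -> R) : (forall e, 0 < e ->
  exists N, forall m n, (N <= m)%N -> (N <= n)%N -> `|r m - r n| <= e) ->
  exists l : R, forall e, 0 < e -> eventually_le (fun n => `|r n - l|) e.
Proof.
move=> h; have : cvgn r.
  apply: cauchy_cvg; apply/cauchy_ballP => e e0; have [N hN] := h _ (divr_gt0 e0 (ltr0n R 2)).
  exists ([set r n | n in [set n | (N <= n)%N]], [set r n | n in [set n | (N <= n)%N]]).
    by split; exists N => // n /= Nn; exists n.
  move=> [x y] /= [[m /= Nm <-] [n /= Nn <-]]; rewrite /ball /= distrC.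
  by apply: le_lt_trans (hN _ _ Nn Nm) _; rewrite ltr_pdivrMr// ltr_pMr// ltr1n.
move=> /cvg_ex[l rl]; exists l => e e0.
by have /cvgrPdist_le /(_ e e0)[N _ hN] := rl; exists N => n Nn; rewrite distrC hN.
Qed.

Lemma ccauchy_ccvg u : ccauchy u -> exists l, ccvg u l.
Proof.
move=> cu.
have [a ha] : exists a, forall e, 0 < e -> eventually_le (fun n => `|complex.Re (u n) - a|) e.
  apply: real_cauchy_cvg => e /cu[N hN]; exists N => m n Nm Nn.
  by rewrite -ReB; apply: le_trans (normc_Re _) _; exact: hN.
have [b hb] : exists b, forall e, 0 < e -> eventually_le (fun n => `|complex.Im (u n) - b|) e.
  apply: real_cauchy_cvg => e /cu[N hN]; exists N => m n Nm Nn.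
  by rewrite -ImB; apply: le_trans (normc_Im _) _; exact: hN.
exists (a +i* b) => e e0; have e2 : 0 < e / 2 by rewrite divr_gt0.
have [N hN] := ha _ e2; have [M hM] := hb _ e2; exists (maxn N M) => n; rewrite geq_max => /andP[Nn Mn].
apply: le_trans (normc_ReIm _) _; rewrite ReB ImB /= [e]splitr.
by rewrite lerD ?hN ?hM.
Qed.

Lemma ccvg_bound u l z B : ccvg u l -> (exists N, forall n, (N <= n)%N -> normc (u n - z) <= B) ->
  normc (l - z) <= B.
Proof.
move=> ul [M hM]; apply/ler_addgt0Pl => e e0; have [N hN] := ul e e0.
have -> : l - z = - (u (maxn M N) - l) + (u (maxn M N) - z) by ring.
apply: le_trans (ler_normcD _ _) _; rewrite normc_opp.
by rewrite lerD ?hN ?hM ?leq_maxr ?leq_maxl.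
Qed.

Lemma ccvg_normc_le u l B : ccvg u l -> (exists N, forall n, (N <= n)%N -> normc (u n) <= B) ->
  normc l <= B.
Proof.
move=> ul [M hM]; rewrite -[l]subr0; apply: ccvg_bound ul _; exists M => n Mn.
by rewrite subr0; exact: hM.
Qed.

Lemma ccvg_unique u l z : ccvg u l -> ccvg u z -> l = z.
Proof.
move=> ul uz; apply/eqP; rewrite -subr_eq0; apply/eqP/eq0_normc/eqP.
rewrite eq_le normc_ge0 andbT; apply/ler_addgt0Pl => e e0; rewrite addr0.
by have [N hN] := uz e e0; apply: ccvg_bound ul _; exists N.
Qed.

Lemma ccvg_ext u v l : (exists N, forall n, (N <= n)%N -> u n = v n) -> ccvg u l -> ccvg v l.
Proof.
move=> [M uv] ul e /ul[N hN]; exists (maxn N M) => n; rewrite geq_max => /andP[Nn Mn].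
by rewrite -uv// hN.
Qed.

Lemma ccvg_cst z : ccvg (fun=> z) z.
Proof. by move=> e e0; exists 0%N => n _; rewrite subrr (_ : normc 0 = 0) ?ltW//; exact: normc0. Qed.

Lemma ccvg_le u v l z (C : R) : 0 <= C -> (forall n, normc (u n - l) <= C * normc (v n - z)) ->
  ccvg v z -> ccvg u l.
Proof.
move=> C0 uv vz e e0; have C1 : 0 < C + 1 by rewrite ltr_wpDl.
have [N hN] := vz _ (divr_gt0 e0 C1); exists N => n Nn; apply: le_trans (uv n) _.
apply: le_trans (_ : (C + 1) * normc (v n - z) <= _); first by rewrite ler_wpM2r ?normc_ge0// lerDl.
by rewrite -ler_pdivlMl// mulrC hN.
Qed.

Lemma ccvgD u v l z : ccvg u l -> ccvg v z -> ccvg (fun n => u n + v n) (l + z).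
Proof.
move=> ul vz e e0; have e2 : 0 < e / 2 by rewrite divr_gt0.
have [N hN] := ul _ e2; have [M hM] := vz _ e2; exists (maxn N M) => n; rewrite geq_max => /andP[Nn Mn].
rewrite (_ : _ - _ = (u n - l) + (v n - z)); last by ring.
by apply: le_trans (ler_normcD _ _) _; rewrite [e]splitr lerD ?hN ?hM.
Qed.

Lemma ccvgZ c u l : ccvg u l -> ccvg (fun n => c * u n) (c * l).
Proof.
by apply: ccvg_le (normc_ge0 c) _ => n; rewrite -mulrBr normcM.
Qed.

Lemma ccvg_Re_ge u l (a : R) : ccvg u l -> (exists N, forall n, (N <= n)%N -> a <= complex.Re (u n)) ->
  a <= complex.Re l.
Proof.
move=> ul [M hM]; apply/ler_addgt0Pl => e e0; have [N hN] := ul e e0.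
have h := hN _ (leq_maxr M N); have := hM _ (leq_maxl M N).
have := normc_Re (u (maxn M N) - l); rewrite ReB => h1 h2.
have := le_trans (ler_norm _) (le_trans h1 h); lra.
Qed.

Definition half k : R := 2^-1 ^+ k.

Lemma half_gt0 k : 0 < half k. Proof. by rewrite exprn_gt0// invr_gt0. Qed.

Lemma half_ge0 k : 0 <= half k. Proof. exact/ltW/half_gt0. Qed.

Lemma halfS k : half k.+1 = half k / 2. Proof. by rewrite /half exprSr. Qed.

Lemma half_le m n : (m <= n)%N -> half n <= half m.
Proof. by move=> mn; rewrite ler_wiXn2l// ?invr_ge0// invf_le1// ler1n. Qed.

Lemma half_small e : 0 < e -> exists N, forall n, (N <= n)%N -> half n <= e.
Proof.
move=> e0; exists (Num.bound e^-1) => n Nn.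
rewrite /half exprVn invf_ple ?posrE ?exprn_gt0//.
apply/ltW/(lt_le_trans (archi_boundP _)); first by rewrite invr_ge0 ltW.
rewrite -natrX ler_nat; apply: leq_trans Nn _; exact/ltnW/ltn_expl.
Qed.

Lemma sum_half (r : nat -> R) m n B : 0 <= B -> (forall j, (m <= j)%N -> r j <= B * half j) ->
  \sum_(m <= j < n) r j <= B * (2 * half m).
Proof.
move=> B0 rB; suff : (m <= n)%N -> \sum_(m <= j < n) r j <= B * (2 * half m - 2 * half n).
  have [mn /(_ isT) h|nm _] := leqP m n.
    by apply: le_trans h _; rewrite ler_wpM2l// gerBl mulr_ge0 ?half_ge0.
  by rewrite big_geq ?mulr_ge0 ?half_ge0// ltnW.
move=> /subnK <-; elim: (n - m)%N => [|k IH]; first by rewrite add0n big_geq// subrr mulr0.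
rewrite addSn big_nat_recr ?leq_addl//=; apply: le_trans (lerD IH (rB _ (leq_addl _ _))) _.
by rewrite halfS le_eqVlt; apply/orP; left; apply/eqP; field.
Qed.

Lemma dyadic_series (c : nat -> R[i]) B : 0 <= B -> (forall j, normc (c j) <= B * half j) ->
  exists l, ccvg (fun n => \sum_(j < n) c j) l /\ forall n, normc (\sum_(j < n) c j - l) <= B * (2 * half n).
Proof.
move=> B0 cB.
have dif m n : (m <= n)%N -> normc (\sum_(j < n) c j - \sum_(j < m) c j) <= B * (2 * half m).
  move=> mn; rewrite -!(big_mkord xpredT c) (big_cat_nat (leq0n m) mn)//= addrAC subrr add0r.
  by apply: le_trans (normc_sum _ _ _) _; exact: sum_half.
have [l hl] : exists l, ccvg (fun n => \sum_(j < n) c j) l.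
  apply: ccauchy_ccvg => e e0.
  have C0 : 0 < B * 2 + 1 by rewrite ltr_wpDl// mulr_ge0.
  have [N hN] := half_small (divr_gt0 e0 C0).
  have bd m n : (N <= m)%N -> (m <= n)%N -> normc (\sum_(j < n) c j - \sum_(j < m) c j) <= e.
    move=> Nm /dif/le_trans; apply; have := hN m Nm; rewrite ler_pdivlMr// => h; apply: le_trans h.
    by rewrite mulrA mulrC ler_wpM2l ?half_ge0// lerDl.
  exists N => m n Nm Nn; have [mn|/ltnW nm] := leqP m n; last exact: bd.
  by rewrite normc_subC; exact: bd.
exists l; split=> // n; rewrite normc_subC; apply: ccvg_bound hl _.
by exists n => k; exact: dif.
Qed.

End complex_limits.

(** * Dyadic sums of point masses and of translates *)

Section dyadic_sums.
Context {R : realType} {d : nat}.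
Local Notation Rd := 'rV[R]_d.
Local Notation mu := (lebesgue_rV R d).
Local Notation lm := (@lebesgue_measurable R d).
Implicit Types (f g p : Rd -> R[i]) (V W : nat -> Rd -> R) (c : nat -> R) (z : nat -> Rd).

(** The measure sum_j c_j delta_(z_j) as a functional. It takes the default value 0 where the series
    diverges; for coefficients below 2^-j it converges on every bounded [f]. *)
Definition dseries c z f : R[i] := xget 0 [set l | ccvg (fun n => \sum_(j < n) (c j)%:C * f (z j)) l].

Section bounded_coefficients.
Variables (c : nat -> R) (z : nat -> Rd).
Hypothesis c0 : forall j, 0 <= c j <= half j.

Lemma dseries_cvg f (B : R) : (forall x, normc (f x) <= B) ->
  ccvg (fun n => \sum_(j < n) (c j)%:C * f (z j)) (dseries c z f).
Proof.
move=> fB; have B0 : 0 <= B by apply: le_trans (fB 0); exact: normc_ge0.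
have [|l [hl _]] := @dyadic_series R (fun j => (c j)%:C * f (z j)) B B0.
  move=> j; have /andP[cj0 cj] := c0 j; rewrite normcM normc_real ger0_norm// mulrC.
  by apply: ler_pM => //; exact: normc_ge0.
exact: (@xgetI _ _ _ l).
Qed.

Lemma dseries_le f (B : R) : (forall x, normc (f x) <= B) -> normc (dseries c z f) <= B * 2.
Proof.
move=> fB; have B0 : 0 <= B by apply: le_trans (fB 0); exact: normc_ge0.
apply: ccvg_normc_le (dseries_cvg fB) _; exists 0%N => n _.
apply: le_trans (normc_sum _ _ _) _; rewrite -(big_mkord xpredT (fun j => normc ((c j)%:C * f (z j)))).
apply: le_trans (sum_half (B := B) _ B0 _) _ => [j _|]; last by rewrite /half expr0 mulr1.
have /andP[cj0 cj] := c0 j; rewrite normcM normc_real ger0_norm// mulrC.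
by apply: ler_pM => //; exact: normc_ge0.
Qed.

Lemma dseries_comb (a : R[i]) f g (B : R) : (forall x, normc (f x) <= B) -> (forall x, normc (g x) <= B) ->
  dseries c z (fun x => a * f x + g x) = a * dseries c z f + dseries c z g.
Proof.
move=> fB gB; have h : ccvg (fun n => \sum_(j < n) (c j)%:C * (a * f (z j) + g (z j)))
    (a * dseries c z f + dseries c z g).
  apply: ccvg_ext (ccvgD (ccvgZ a (dseries_cvg fB)) (dseries_cvg gB)).
  exists 0%N => n _; rewrite mulr_sumr -big_split; apply: eq_bigr => j _.
  by rewrite mulrDr mulrCA.
apply: ccvg_unique h; apply: (@dseries_cvg _ (normc a * B + B)) => x.
apply: le_trans (ler_normcD _ _) _; rewrite normcM lerD//.
by rewrite ler_wpM2l ?normc_ge0.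
Qed.

Lemma dseries_distribution : Defs.distribution (dseries c z).
Proof.
split=> [a f g /is_testP /test_bounded[A A0 fA] /is_testP /test_bounded[B B0 gB]|K _].
  apply: (@dseries_comb a f g (A + B)) => x.
    by apply: le_trans (fA x) _; rewrite lerDl.
  by apply: le_trans (gB x) _; rewrite lerDr.
exists 0%N, 2 => f /is_testP tf _; rewrite mulrC; apply: dseries_le => x.
exact: (@normc_foldr_max_order R d f [::] 0%N x tf).
Qed.

End bounded_coefficients.

Definition bump : Rd -> R[i] := prod_fun (fun _ t => smooth_step (1 * t + 2) * smooth_step (-1 * t + 2)).

Lemma test_bump : is_test bump.
Proof.
split.
  apply: smooth_prod_fun => i; apply: smooth1M; apply: smooth1_affine; exact: smooth1_step.1.
exists 2; apply: vanish_off_prod_fun => // i t; rewrite lter_normr => /orP[t2|t2].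
  by rewrite [X in _ * X]smooth_step_le0 ?mulr0//; lra.
by rewrite smooth_step_le0 ?mul0r//; lra.
Qed.

Lemma Re_bump_ge0 x : 0 <= complex.Re (bump x).
Proof. by apply: prodr_ge0 => i _; rewrite mulr_ge0 ?smooth_step_ge0. Qed.

Lemma bump1 x : `|x| <= 1 -> bump x = 1.
Proof.
move=> x1; rewrite /bump /prod_fun big1// => i _.
have := le_trans (coord_le_norm x i) x1; rewrite ler_norml => /andP[h1 h2].
by rewrite !smooth_step_ge1 ?mulr1//; lra.
Qed.

Lemma foldr_conv f (x : Rd) s : is_smooth f ->
  foldr pder (fun t => f (x - t)) s = fun t => (-1) ^+ size s * foldr pder f s (x - t).
Proof.
move=> sf; elim: s => [|i s IH] /=; first by apply/funext => t; rewrite expr0 mul1r.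
rewrite IH; set g := foldr pder f s; have sg : is_smooth g by exact: smooth_foldr.
have st := smooth_translate x sg.
have E : (fun t => g (x - t)) = (fun t => g (- t + x)) by apply/funext => t; rewrite addrC.
rewrite partialZ; last by rewrite E; exact: smooth_reflect st.
apply/funext => t; rewrite E (reflect_partial i st) translate_partial//.
by rewrite exprS mulN1r mulNr mulrN addrC.
Qed.

Lemma smooth_conv_argument f (x : Rd) : is_smooth f -> is_smooth (fun t => f (x - t)).
Proof.
move=> sf; have := smooth_reflect (smooth_translate x sf).
by under eq_fun do rewrite addrC.
Qed.

Lemma foldr_translate f (a : Rd) s : is_smooth f ->
  foldr pder (fun t => f (t + a)) s = fun t => foldr pder f s (t + a).
Proof.
move=> sf; elim: s => [//|i s IH] /=; rewrite IH translate_partial//; exact: smooth_foldr.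
Qed.

Lemma foldr_comb (a : R[i]) f g s : is_smooth f -> is_smooth g ->
  foldr pder (fun x => a * f x + g x) s = fun x => a * foldr pder f s x + foldr pder g s x.
Proof.
move=> sf sg; elim: s => [//|i s IH] /=; rewrite IH.
have ss1 := smooth_foldr s sf; have ss2 := smooth_foldr s sg.
by rewrite partialD ?partialZ//; exact: smoothZ.
Qed.

Section dyadic_translates.
Variable p : Rd -> R[i].
Hypothesis tp : is_test p.
Variables (c : nat -> R) (z : nat -> Rd).
Hypothesis c0 : forall j, 0 <= c j <= half j.

(** The series of the translates of the derivative of [p] along [s]. The word is an argument so that
    the series form a [taylor_family], which makes the sum smooth with the expected derivatives. *)
Definition dtranslates s (x : Rd) : R[i] := dseries c z (fun y => foldr pder p s (x - y)).

Lemma dtranslates_family : taylor_family dtranslates.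
Proof.
have sp := test_smooth tp; split=> [s M|s i M].
  have [B B0 pB] := test_bounded (test_foldr s tp); exists (B * 2) => x _.
  by apply: dseries_le => // y; exact: pB.
have [A A0 fA] := test_bounded (test_foldr s tp).
have [B B0 fB] := test_bounded (test_foldr (i :: s) tp).
have [C C0 fC] := test_bounded (test_foldr (i :: i :: s) tp).
exists (2 * C * 2) => x t _ _; set f := foldr pder p s.
have AA : A <= A + A by rewrite lerDl.
have -> : dtranslates s (x + t *: uvec i) - dtranslates s x - t%:C * dtranslates (i :: s) x =
    dseries c z (fun y => (- t%:C) * pder i f (x - y) + ((-1) * f (x - y) + f (x + t *: uvec i - y))).
  rewrite (@dseries_comb c z c0 _ (fun y => pder i f (x - y)) _ (A + A + B)).
  - rewrite (@dseries_comb c z c0 (-1) (fun y => f (x - y)) _ A) => [|y|y]; try exact: fA.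
    by rewrite /dtranslates /=; ring.
  - by move=> y; apply: le_trans (fB _) _; rewrite lerDr addr_ge0.
  - move=> y; apply: le_trans (ler_normcD _ _) _; rewrite mulN1r normc_opp -[X in X <= _]addr0.
    by rewrite lerD// lerD// fA.
rewrite -[2 * C * 2 * _]mulrAC; apply: dseries_le => // y.
rewrite (_ : _ + _ = f (x - y + t *: uvec i) - f (x - y) - t%:C * pder i f (x - y)); last first.
  by rewrite addrAC; ring.
by apply: smooth_taylor_bound => [|u _]; [exact: smooth_foldr|exact: fC].
Qed.

Lemma dtranslates_smooth : is_smooth (dtranslates [::]).
Proof. exact: (taylor_family_smooth dtranslates_family).1. Qed.

Lemma dtranslates_foldr s : foldr pder (dtranslates [::]) s = dtranslates s.
Proof. exact: taylor_family_foldr dtranslates_family. Qed.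

End dyadic_translates.

Lemma translated_weight V N p : weight_system V -> wM V -> is_test p ->
  exists (m : nat) (K : R), 0 <= K /\ forall s y, (size s <= N)%N ->
    (\int[mu]_x (normc (foldr pder p s (x - y)) * V N x)%:E <= (K * V m y)%:E)%E.
Proof.
move=> wV mV tp; have sp := test_smooth tp; have [S S0 pS] := test_dsum_bounded N tp.
have [M' /vanish_off_norm pM] : exists M, vanish_off M p by case: tp.
set M := `|M'| in pM; have M0 : 0 <= M by exact: normr_ge0.
have [m [C [_ C0 VC]]] := wM_large N M mV.
exists m, (S * C * (M *+ 2) ^+ d); split=> [|s y sN].
  by rewrite !mulr_ge0 ?(ltW C0)// exprn_ge0// mulrn_wge0.
have lF : lm (fun x => normc (foldr pder p s (x - y)) * V N x).
  apply: lmM; last exact: weight_lm.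
  by apply: cmeasurable_normc; apply: cmeasurable_translate; exact/smooth_cmeasurable/smooth_foldr.
rewrite -(int_translate y lF) => [|x]; last by rewrite mulr_ge0 ?normc_ge0 ?weight_ge0.
under eq_integral do rewrite addrK.
rewrite [X in (_ <= X%:E)%E](_ : _ = S * (C * V m y) * (M *+ 2) ^+ d); last by ring.
apply: int_le_cube => //.
- by move=> x; rewrite mulr_ge0 ?normc_ge0 ?weight_ge0.
- by rewrite !mulr_ge0 ?weight_ge0// ltW.
- move=> x xM; apply: ler_pM; rewrite ?normc_ge0 ?weight_ge0//; last by rewrite addrC; exact: VC.
  by apply: le_trans (pS x); exact: normc_foldr_le.
by move=> x xM; rewrite (vanish_off_foldr s pM xM) (_ : normc 0 = 0) ?mul0r//; exact: normc0.
Qed.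

(** By [wM] the translate by z_j costs the factor V_m(z_j), and Fatou's lemma passes to the full
    series. The order of quantifiers matters: [m] and [K] serve all coefficients, hence also
    sequences whose first terms are set to 0. *)
Lemma dtranslates_int V N p z : weight_system V -> wM V -> is_test p ->
  exists (m : nat) (K : R), 0 <= K /\ forall c (L : R), (forall j, 0 <= c j <= half j) ->
    (forall n, \sum_(j < n) c j * V m (z j) <= L) -> forall s, (size s <= N)%N ->
    (\int[mu]_x (normc (foldr pder (dtranslates p c z [::]) s x) * V N x)%:E <= (K * L)%:E)%E.
Proof.
move=> wV mV tp; have [m [K [K0 hK]]] := translated_weight N wV mV tp.
exists m, K; split=> // c L c0 cL s sN; rewrite dtranslates_foldr//.
have [B B0 pB] := test_bounded (test_foldr s tp).
have lF j : lm (fun x => c j * (normc (foldr pder p s (x - z j)) * V N x)).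
  apply: lmZ; apply: lmM; last exact: weight_lm.
  by apply: cmeasurable_normc; apply: cmeasurable_translate; exact/smooth_cmeasurable/smooth_foldr/test_smooth.
have F0 j x : 0 <= c j * (normc (foldr pder p s (x - z j)) * V N x).
  by rewrite !mulr_ge0 ?normc_ge0 ?weight_ge0//; case/andP: (c0 j).
apply: (@int_fatou _ _ (fun n x => normc (\sum_(j < n) (c j)%:C * foldr pder p s (x - z j)) * V N x)).
- move=> n; apply: lmM; last exact: weight_lm.
  apply/cmeasurable_normc/smooth_cmeasurable.
  apply: (smooth_sum _ _).1 => j; apply: smoothZ; apply: smooth_translate.
  exact/smooth_foldr/test_smooth.
- by move=> n x; rewrite mulr_ge0 ?normc_ge0 ?weight_ge0.
- move=> x; apply: cvgMl; rewrite /dtranslates.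
  have /ccvg_cvg h := dseries_cvg z c0 (fun y => pB (x - y)).
  apply/cvgrPdist_le => e e0; have /cvgrPdist_le /(_ e e0)[M _ hM] := h; exists M => // n /hM.
  rewrite sub0r normrN ger0_norm ?normc_ge0// distrC; apply: le_trans; exact: ler_dist_normc.
move=> n; apply: le_trans (_ : \int[mu]_x
    (\sum_(j < n) c j * (normc (foldr pder p s (x - z j)) * V N x))%:E <= _)%E.
  apply: int_le => [x|x|]; first by rewrite mulr_ge0 ?normc_ge0 ?weight_ge0.
    by apply: sumr_ge0 => j _; exact: F0.
  apply: aeW => x.
  have -> : \sum_(j < n) c j * (normc (foldr pder p s (x - z j)) * V N x) =
      (\sum_(j < n) c j * normc (foldr pder p s (x - z j))) * V N x.
    by rewrite mulr_suml; apply: eq_bigr => j _; rewrite mulrA.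
  rewrite ler_wpM2r ?weight_ge0//; apply: le_trans (normc_sum _ _ _) _.
  by apply: ler_sum => j _; rewrite normcM normc_real ger0_norm//; case/andP: (c0 j).
have -> := @int_sum R d 'I_n (index_enum _) (fun (j : 'I_n) x => c j * (normc (foldr pder p s (x - z j)) * V N x))
  (fun j => lF j) (fun j => F0 j).
apply: le_trans (_ : (\sum_(j < n) (c j * (K * V m (z j)))%:E)%E <= _)%E.
  apply: lee_sum => j _; rewrite intZ; last 3 first.
  - apply: lmM; last exact: weight_lm.
    by apply: cmeasurable_normc; apply: cmeasurable_translate; exact/smooth_cmeasurable/smooth_foldr/test_smooth.
  - by case/andP: (c0 j).
  - by move=> x; rewrite mulr_ge0 ?normc_ge0 ?weight_ge0.
  by rewrite EFinM lee_wpmul2l ?lee_fin ?hK//; case/andP: (c0 j).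
rewrite sumEFin lee_fin; under eq_bigr do rewrite mulrCA.
by rewrite -mulr_sumr ler_wpM2l.
Qed.

End dyadic_sums.

(** * The convolutor and the element of K^1 that detect moderateness *)

Section necessity.
Context {R : realType} {d : nat}.
Local Notation Rd := 'rV[R]_d.
Local Notation mu := (lebesgue_rV R d).
Local Notation lm := (@lebesgue_measurable R d).
Implicit Types (f g p : Rd -> R[i]) (c : nat -> R) (z : nat -> Rd).

Lemma tail_sum_le (r : nat -> R) m : (forall j, 0 <= r j) -> (forall j, (m <= j)%N -> r j <= half j) ->
  forall n, \sum_(j < n) r j <= \sum_(j < m) r j + 2.
Proof.
move=> r0 rm n; rewrite -!(big_mkord xpredT r).
apply: le_trans (_ : \sum_(0 <= j < maxn m n) r j <= _).
  rewrite (big_cat_nat (leq0n n) (leq_maxr m n))//= lerDl; apply: sumr_ge0 => j _; exact: r0.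
rewrite (big_cat_nat (leq0n m) (leq_maxl m n))//= lerD2l.
apply: le_trans (@sum_half R r m _ 1 ler01 _) _ => [j mj|]; first by rewrite mul1r rm.
rewrite mul1r ler_piMr//; exact: (@half_le R 0 m).
Qed.

Definition smooth_weighted (V : nat -> Rd -> R) f := is_smooth f /\
  forall n s, (\int[mu]_x (normc (foldr pder f s x) * V n x)%:E < +oo)%E.

Lemma smooth_weighted_comb V (a : R[i]) f g : weight_system V -> smooth_weighted V f -> smooth_weighted V g ->
  smooth_weighted V (fun x => a * f x + g x).
Proof.
move=> wV [sf fV] [sg gV]; split; first by apply: smoothD => //; exact: smoothZ.
move=> n s; rewrite foldr_comb//.
have l h : is_smooth h -> lm (fun x => normc (foldr pder h s x) * V n x).
  move=> sh; apply: lmM; last exact: weight_lm.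
  by apply/cmeasurable_normc/smooth_cmeasurable/smooth_foldr.
have h0 h x : 0 <= normc (foldr pder h s x) * V n x by rewrite mulr_ge0 ?normc_ge0 ?weight_ge0.
apply: le_lt_trans (_ : \int[mu]_x (normc a * (normc (foldr pder f s x) * V n x) +
   normc (foldr pder g s x) * V n x)%:E < _)%E.
  apply: int_le => [x|x|].
  - by rewrite mulr_ge0 ?normc_ge0 ?weight_ge0.
  - by rewrite addr_ge0// mulr_ge0// normc_ge0.
  apply: aeW => x; rewrite mulrA -mulrDl ler_wpM2r ?weight_ge0//.
  by apply: le_trans (ler_normcD _ _) _; rewrite normcM.
rewrite intD ?intZ//; try exact: l.
- rewrite lte_add_pinfty//; apply: lte_mul_pinfty => //; first by rewrite lee_fin normc_ge0.
- exact: normc_ge0.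
- by apply: lmZ; exact: l.
- by move=> x; rewrite mulr_ge0 ?normc_ge0.
Qed.

Lemma smooth_weighted_K1 V f : weight_system V -> smooth_weighted V f -> K1 V f.
Proof. by move=> wV [sf fV]; exact: smooth_K1. Qed.

Lemma test_smooth_weighted V f : weight_system V -> cube_bounded V -> is_test f -> smooth_weighted V f.
Proof.
move=> wV bV tf; split; first exact: test_smooth.
move=> n s; have [S S0 fS] := test_bounded (test_foldr s tf).
case: tf => sf [M /vanish_off_norm fM]; have [B B0 VB] := bV n `|M|.
by apply: le_lt_trans (test_weighted_int wV (normr_ge0 M) B0 S0 fM VB fS) _; rewrite ltry.
Qed.

(** Passing from [f] to t |-> f (x - t) reflects the weight, which is why functionals are continuous
    for the reflected system. The remaining translation by the fixed [x] is absorbed by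
    [wM_large]. *)
Lemma conv_argument_int V n (x : Rd) : weight_system V -> wM V -> exists (m : nat) (C : R), 0 <= C /\
  forall f s, is_smooth f ->
  (\int[mu]_t (normc (foldr pder (fun t => f (x - t)) s t) * Defs.reflect (V n) t)%:E <=
   C%:E * \int[mu]_t (normc (foldr pder f s t) * V m t)%:E)%E.
Proof.
move=> wV mV; have [m [C [_ C0 VC]]] := wM_large n `|x| mV.
exists m, C; split=> [|f s sf]; first exact: ltW.
have lf : lm (fun t => normc (foldr pder f s t)).
  by apply/cmeasurable_normc/smooth_cmeasurable/smooth_foldr.
have lfV k : lm (fun t => normc (foldr pder f s t) * V k t).
  by apply: lmM => //; exact: weight_lm.
have fV0 k t : 0 <= normc (foldr pder f s t) * V k t by rewrite mulr_ge0 ?normc_ge0 ?weight_ge0.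
rewrite foldr_conv//.
have lF : lm (fun t => normc (foldr pder f s t) * V n (t - x)).
  apply: lmM => //; apply: lm_translate; exact: weight_lm.
have F0 t : 0 <= normc (foldr pder f s t) * V n (t - x) by rewrite mulr_ge0 ?normc_ge0 ?weight_ge0.
rewrite (_ : (\int[mu]_t _)%E = \int[mu]_t (normc (foldr pder f s (- t + x)) * V n (- t + x - x))%:E)%E; last first.
  apply: eq_integral => t _; rewrite normcM addrK [x - t]addrC.
  suff -> : normc ((-1) ^+ size s : R[i]) = 1 by rewrite mul1r.
  elim: (size s) => [|k IH]; first by rewrite expr0 -[1]/(1%:C) normc_real normr1.
  by rewrite exprS mulN1r normc_opp.
have lT := lm_translate x lF.
rewrite (@int_reflect _ _ (fun t => normc (foldr pder f s (t + x)) * V n (t + x - x)) lT) => [|t]; last exact: F0.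
rewrite (@int_translate _ _ x _ lF F0) -intZ//; last exact: ltW.
apply: int_le => [|t|]; [exact: F0|by rewrite mulr_ge0 ?(ltW C0)|apply: aeW => t].
rewrite mulrCA ler_wpM2l ?normc_ge0//; apply: VC; by rewrite normrN.
Qed.

Lemma conv_argument_weighted V f (x : Rd) : weight_system V -> wM V -> smooth_weighted V f ->
  smooth_weighted (fun n => Defs.reflect (V n)) (fun t => f (x - t)).
Proof.
move=> wV mV [sf fV]; split=> [|n s]; first exact: smooth_conv_argument.
have [m [C [C0 h]]] := conv_argument_int n x wV mV.
by apply: le_lt_trans (h f s sf) _; apply: lte_mul_pinfty; rewrite ?lee_fin.
Qed.

Lemma linear_on_sum V (S : functional) n c (F : nat -> Rd -> R[i]) g : weight_system V ->
  linear_on (K1 V) S -> (forall j, smooth_weighted V (F j)) -> smooth_weighted V g ->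
  smooth_weighted V (fun x => \sum_(j < n) (c j)%:C * F j x + g x) /\
  S (fun x => \sum_(j < n) (c j)%:C * F j x + g x) = \sum_(j < n) (c j)%:C * S (F j) + S g.
Proof.
move=> wV Sl FV gV; elim: n => [|n [IH1 IH2]].
  rewrite big_ord0 add0r (_ : (fun x => _) = g)//.
  by apply/funext => x; rewrite big_ord0 add0r.
have E : (fun x => \sum_(j < n.+1) (c j)%:C * F j x + g x) =
    (fun x => (c n)%:C * F n x + (\sum_(j < n) (c j)%:C * F j x + g x)).
  by apply/funext => x; rewrite big_ord_recr /= addrAC addrA addrC addrA.
rewrite E; split; first exact: smooth_weighted_comb.
rewrite Sl; [|exact: smooth_weighted_K1|exact: smooth_weighted_K1].
by rewrite IH2 big_ord_recr /= addrA addrAC addrC addrA.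
Qed.

Variables (E : set (Rd -> R[i])) (nE : (Rd -> R[i]) -> R).
Hypotheses (HE : TIBF_bounded_type E nE) (SE : solid E nE).
Variables V W : nat -> Rd -> R.
Hypotheses (wV : weight_system V) (wW : weight_system W) (mV : wM V) (mW : wM W).

Let bE := tibf_bfs HE.

Lemma weighted_space_intro f : cmeasurable f -> (forall n, E (weighted (W n) f)) -> weighted_space E W f.
Proof.
move=> mf fE; split=> //; have /L1locP[mw wM] := bfs_L1loc bE (fE 0%N).
apply: (@L1loc_dom _ _ _ (fun x => normc (weighted (W 0%N) f x))) => // [x|]; first exact: normc_ge0.
apply: aeW => x; rewrite normc_weighted// ler_peMr ?normc_ge0//; exact: weight_ge1.
Qed.

(** The bound is independent of the position [y] because translations are uniformly bounded on [E];
    this is how functions with moving supports are estimated. *)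
Lemma translated_in_E (M : R) : exists A : R, 0 <= A /\ forall f y (K : R), cmeasurable f -> 0 <= K ->
  (forall x, normc (f x) <= K * \1_(cube M) (x - y)) -> E f /\ nE f <= K * A.
Proof.
have [C0 C00 hC] := tibf_A2 HE; pose I (x : Rd) : R[i] := (\1_(cube M) x)%:C.
have EI : E I by exact: cube_in_E HE SE M.
exists (C0 * nE I); split; first by rewrite mulr_ge0 ?(ltW C00)//; exact: bfs_norm_ge0 bE _ EI.
move=> f y K mf K0 fK; have Et := tibf_A1 HE y EI.
have EK := bfs_memZ bE K%:C Et.
have [Ef nf] : E f /\ nE f <= nE (fun x => K%:C * translate y I x).
  apply: (E_solid HE SE EK mf); apply: aeW => x; apply: le_trans (fK x) _.
  by rewrite normcM !normc_real ger0_norm// ger0_norm.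
split=> //; apply: le_trans nf _; rewrite (bfs_normZ bE _ Et) normc_real ger0_norm//.
by rewrite ler_wpM2l// hC.
Qed.

Lemma E_series (F : nat -> Rd -> R[i]) (w : Rd -> R[i]) m (B : R) : (forall j, E (F j)) -> 0 <= B ->
  (forall j, (m <= j)%N -> nE (F j) <= B * half j) ->
  (forall x, ccvg (fun n => \sum_(j < n) F j x) (w x)) ->
  E w /\ nE (fun x => \sum_(j < n) F j x - w x) @[n --> \oo] --> (0 : R).
Proof.
move=> EF B0 nF Fw; apply: (E_limit HE (u := fun n x => \sum_(j < n) F j x)).
- by move=> n; exact: (E_sum HE _ (fun j : 'I_n => EF j)).1.
- have dif k n : (m <= k)%N -> (k <= n)%N ->
      nE (fun x => \sum_(j < n) F j x - \sum_(j < k) F j x) <= B * (2 * half k).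
    move=> mk kn; have -> : (fun x => \sum_(j < n) F j x - \sum_(j < k) F j x) =
        (fun x => \sum_(k <= j < n) F j x).
      apply/funext => x; rewrite -!(big_mkord xpredT (fun j => F j x)) (big_cat_nat (leq0n k) kn)//=.
      by rewrite addrAC subrr add0r.
    apply: le_trans (E_sum HE _ EF).2 _.
    by apply: sum_half => // j kj; apply: nF; exact: leq_trans kj.
  move=> e e0; have C0 : 0 < B * 2 + 1 by rewrite ltr_wpDl// mulr_ge0.
  have [N hN] := half_small (divr_gt0 (divr_gt0 e0 (ltr0n R 2)) C0).
  have bd k n : (maxn m N <= k)%N -> (k <= n)%N ->
      nE (fun x => \sum_(j < n) F j x - \sum_(j < k) F j x) < e.
    rewrite geq_max => /andP[mk Nk] kn; apply: le_lt_trans (dif k n mk kn) _.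
    have := hN k Nk; rewrite ler_pdivlMr// => h.
    have : B * (2 * half k) <= e / 2.
      by apply: le_trans h; rewrite mulrA mulrC ler_wpM2l ?half_ge0// lerDl.
    by move=> /le_lt_trans; apply; rewrite ltr_pdivrMr// ltr_pMr// ltr1n.
  exists (maxn m N) => k n Nk Nn; have [kn|/ltnW nk] := leqP k n; last exact: bd.
  rewrite (E_subC HE); first exact: bd.
    exact: (E_sum HE _ (fun j : 'I_k => EF j)).1.
  exact: (E_sum HE _ (fun j : 'I_n => EF j)).1.
by move=> x; apply: ccvg_cvg.
Qed.

(** Convolution with a test function gives the series of the translates c_j p(. - z_j), whose j-th
    term has weighted norm at most a constant times c_j W_m(z_j). The hypothesis has index n0 + j,
    so every fixed [m] is covered from the term j = m on, and one condition handles all the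
    weights. *)
Lemma dseries_OC_D c z n0 : (forall j, 0 <= c j <= half j) ->
  (forall j, c j * W (n0 + j)%N (z j) <= half j) -> OC_D E W (dseries c z).
Proof.
move=> c0 cW; split; first exact: dseries_distribution.
move=> p /is_testP tp; have sp := test_smooth tp.
have [B B0 pB] := test_bounded tp.
have [M pM] : exists M, vanish_off M p by case: tp.
have cv x : ccvg (fun n => \sum_(j < n) (c j)%:C * p (x - z j)) (conv_functional (dseries c z) p x).
  by rewrite conv_functionalE; apply: dseries_cvg => // t; exact: pB.
have mp j : cmeasurable (fun x => p (x - z j)).
  by apply: smooth_cmeasurable; exact: smooth_translate.
apply: weighted_space_intro.
  apply: (@cmeasurable_limit _ _ (fun n x => \sum_(j < n) (c j)%:C * p (x - z j))) => [n|x].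
    apply: smooth_cmeasurable; apply: (smooth_sum _ _).1 => j; apply: smoothZ.
    exact: smooth_translate.
  exact/ccvg_cvg/cv.
move=> N; have [m [C [_ C0 WC]]] := wM_large N M mW.
have [A [A0 hA]] := translated_in_E M.
pose F j x := (c j)%:C * p (x - z j) * (W N x)%:C.
have hF j : E (F j) /\ nE (F j) <= (c j * (B * (C * W m (z j)))) * A.
  apply: (hA _ (z j)).
  - apply: cmeasurableM; last exact/cmeasurable_real/weight_lm.
    by apply: cmeasurableZ.
  - by have /andP[? _] := c0 j; rewrite !mulr_ge0 ?(ltW C0) ?weight_ge0.
  move=> x; rewrite /F !normcM !normc_real; have /andP[cj _] := c0 j.
  rewrite ger0_norm// ger0_norm ?weight_ge0// -!mulrA ler_wpM2l// indicE.
  have [xM|xM] := leP `|x - z j| M.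
    rewrite mem_set// mulr1; apply: ler_pM; rewrite ?normc_ge0 ?weight_ge0//.
    by have := WC (z j) (x - z j) xM; rewrite addrC subrK.
  rewrite (pM _ xM) (_ : normc 0 = 0); last exact: normc0.
  by rewrite mul0r !mulr_ge0 ?(ltW C0) ?weight_ge0.
apply: (@E_series F _ m (B * C * A) _ _ _ _).1; first by move=> j; case: (hF j).
- by rewrite !mulr_ge0// ltW.
- move=> j mj; apply: le_trans (hF j).2 _.
  rewrite (_ : _ * A = B * C * A * (c j * W m (z j))); last by ring.
  rewrite ler_wpM2l ?mulr_ge0 ?(ltW C0)//; apply: le_trans (cW j); have /andP[cj _] := c0 j.
  rewrite ler_wpM2l//; apply: weight_mono => //; exact: leq_trans (leq_addl n0 j).
move=> x; rewrite /weighted; have := ccvgZ (W N x)%:C (cv x); rewrite mulrC.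
apply: ccvg_ext; exists 0%N => n _; rewrite mulr_sumr; apply: eq_bigr => j _.
by rewrite /F mulrC.
Qed.

Lemma dtranslates_weighted c z n0 p : (forall j, 0 <= c j <= half j) -> is_test p ->
  (forall j, c j * V (n0 + j)%N (z j) <= half j) -> smooth_weighted V (dtranslates p c z [::]).
Proof.
move=> c0 tp cV; split=> [|N s]; first exact: dtranslates_smooth.
have [m [K [K0 hK]]] := dtranslates_int (maxn N (size s)) z wV mV tp.
have r0 j : 0 <= c j * V m (z j) by have /andP[cj _] := c0 j; rewrite mulr_ge0 ?weight_ge0.
have tl := @tail_sum_le (fun j => c j * V m (z j)) m r0.
have cVm j : (m <= j)%N -> c j * V m (z j) <= half j.
  move=> mj; apply: le_trans (cV j); have /andP[cj _] := c0 j.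
  rewrite ler_wpM2l//; apply: weight_mono => //; exact: leq_trans (leq_addl n0 j).
have := hK c _ c0 (tl cVm) s (leq_maxr _ _); move=> h.
apply: le_lt_trans (le_trans _ h) (ltry _).
apply: int_le => [x|x|]; rewrite ?mulr_ge0 ?normc_ge0 ?weight_ge0//.
apply: aeW => x; rewrite ler_wpM2l ?normc_ge0//; apply: weight_mono => //; exact: leq_maxl.
Qed.

Lemma half_ccvg (u : nat -> R[i]) l m (D : R) : 0 <= D ->
  (forall J, (m <= J)%N -> normc (u J - l) <= D * half J) -> ccvg u l.
Proof.
move=> D0 h e e0; have D1 : 0 < D + 1 by rewrite ltr_wpDl.
have [N hN] := half_small (divr_gt0 e0 D1); exists (maxn m N) => J; rewrite geq_max => /andP[mJ NJ].
apply: le_trans (h J mJ) _; have := hN J NJ; rewrite ler_pdivlMr// => h'; apply: le_trans h'.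
by rewrite mulrC ler_wpM2l ?half_ge0// lerDl.
Qed.

Lemma Re_sum_ge c (f : nat -> R[i]) k n : (forall j, 0 <= c j) -> (forall j, 0 <= complex.Re (f j)) ->
  (k < n)%N -> c k * complex.Re (f k) <= complex.Re (\sum_(j < n) (c j)%:C * f j).
Proof.
move=> c0 f0 kn; have -> : complex.Re (\sum_(j < n) (c j)%:C * f j) = \sum_(j < n) c j * complex.Re (f j).
  elim: n {kn} => [|n IH]; first by rewrite !big_ord0.
  by rewrite !big_ord_recr /= ReD ReCM IH.
rewrite (bigD1 (Ordinal kn))//= lerDl; apply: sumr_ge0 => j _; exact: mulr_ge0.
Qed.

Lemma dseries_Re_ge c z f k (B : R) : (forall j, 0 <= c j <= half j) -> (forall x, normc (f x) <= B) ->
  (forall x, 0 <= complex.Re (f x)) -> c k * complex.Re (f (z k)) <= complex.Re (dseries c z f).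
Proof.
move=> c0 fB f0; apply: ccvg_Re_ge (dseries_cvg z c0 fB) _; exists k.+1 => n kn.
by apply: (@Re_sum_ge c (fun j => f (z j))) => // j; case/andP: (c0 j).
Qed.

(** The tail is written as the same series with its first [J] coefficients set to 0, so the bounds
    for the full series apply to it. *)
Lemma dtranslates_split p c z J x : is_test p -> (forall j, 0 <= c j <= half j) ->
  dtranslates p c z [::] x = \sum_(j < J) (c j)%:C * p (x - z j) +
    dtranslates p (fun j => if (j < J)%N then 0 else c j) z [::] x.
Proof.
move=> tp c0; have [B B0 pB] := test_bounded tp; set c' : nat -> R := fun j => if (j < J)%N then 0 else c j.
have c0' j : 0 <= c' j <= half j by rewrite /c'; case: ifP => // _; rewrite lexx half_ge0.
apply: ccvg_unique (dseries_cvg z c0 (fun y => pB (x - y))) _.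
apply: ccvg_ext (ccvgD (ccvg_cst _) (dseries_cvg z c0' (fun y => pB (x - y)))).
exists J => n Jn /=.
rewrite -(big_mkord xpredT (fun j => (c j)%:C * p (x - z j))).
rewrite -(big_mkord xpredT (fun j => (c' j)%:C * p (x - z j))).
rewrite -[RHS](big_mkord xpredT (fun j => (c j)%:C * p (x - z j))).
rewrite [in RHS](big_cat_nat (leq0n J) Jn)/= [in X in _ + X](big_cat_nat (leq0n J) Jn)/=.
have -> : \sum_(0 <= j < J) (c' j)%:C * p (x - z j) = 0.
  by rewrite big_nat_cond big1// => j; rewrite andbT => /andP[_ jJ]; rewrite /c' jJ mul0r.
rewrite add0r; congr (_ + _); rewrite big_nat_cond [RHS]big_nat_cond; apply: eq_bigr => j /andP[/andP[Jj _] _].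
by rewrite /c' ltnNge Jj.
Qed.

(** [S] is known on test functions, but the series is not one of them. Continuity of [S] bounds its
    value on the tail by the K^1 norm of the tail, which is of order 2^-J. *)
Lemma dual_series (S : functional) p c z n0 x : is_test p -> (forall j, 0 <= c j <= half j) ->
  (forall j, c j * V (n0 + j)%N (z j) <= half j) -> K1_dual (fun n => Defs.reflect (V n)) S ->
  ccvg (fun J => \sum_(j < J) (c j)%:C * S (fun t => p (x - t - z j)))
    (S (fun t => dtranslates p c z [::] (x - t))).
Proof.
move=> tp c0 cV [Sl [N [CS SC]]]; have wV' := reflect_weight_system wV.
have bV' := reflect_bounded (wM_bounded mV).
have [m [C [C0 hC]]] := conv_argument_int N x wV mV.
have [m2 [K [K0 hK]]] := dtranslates_int (maxn N m) z wV mV tp.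
(* From [J = m2] on, the coefficients beyond [J] satisfy c_j V_(m2)(z_j) <= 2^-j and add up to at
   most 2 2^-J. *)
apply: (@half_ccvg _ _ m2 (`|CS| * (C * (K * 2)))) => [|J mJ]; first by rewrite !mulr_ge0.
set c' := fun j => if (j < J)%N then 0 else c j.
have c0' j : 0 <= c' j <= half j by rewrite /c'; case: ifP => // _; rewrite lexx half_ge0.
have cV' j : c' j * V (n0 + j)%N (z j) <= half j.
  by rewrite /c'; case: ifP => // _; rewrite mul0r half_ge0.
have W' : smooth_weighted (fun n => Defs.reflect (V n)) (fun t => dtranslates p c' z [::] (x - t)).
  by apply: conv_argument_weighted => //; exact: dtranslates_weighted cV'.
have WF j : smooth_weighted (fun n => Defs.reflect (V n)) (fun t => p (x - t - z j)).
  apply: test_smooth_weighted => //.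
  have := test_conv_argument (x - z j) tp; under eq_fun do rewrite addrAC; by [].
have [_] := @linear_on_sum _ S J c (fun j t => p (x - t - z j)) _ wV' Sl WF W'.
rewrite (_ : (fun t => _) = (fun t => dtranslates p c z [::] (x - t))); last first.
  by apply/funext => t; rewrite (@dtranslates_split p c z J (x - t) tp c0).
move=> ->; rewrite opprD addrA subrr sub0r normc_opp.
apply: le_trans (SC _ (smooth_weighted_K1 wV' W')) _.
have K1n : 0 <= K1norm (fun n => Defs.reflect (V n)) N (fun t => dtranslates p c' z [::] (x - t)).
  exact: max_order_ge0.
apply: le_trans (ler_wpM2r K1n (ler_norm CS)) _; rewrite -!mulrA ler_wpM2l ?normr_ge0//.
apply: (smooth_K1norm wV'); first by case: W'.
- exact: smooth_weighted_K1.
- by rewrite !mulr_ge0 ?half_ge0.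
move=> s sN; apply: le_trans (hC _ s (dtranslates_smooth tp z c0')) _.
rewrite EFinM lee_wpmul2l ?lee_fin//.
have := hK c' (2 * half J) c0' _ s (leq_trans sN (leq_maxl _ _)); move=> h.
apply: le_trans (h _).
  apply: int_le => [t|t|]; rewrite ?mulr_ge0 ?normc_ge0 ?weight_ge0//.
  by apply: aeW => t; rewrite ler_wpM2l ?normc_ge0//; apply: weight_mono => //; exact: leq_maxr.
move=> n; have [Jn|nJ] := leqP J n; last first.
  rewrite big1 ?mulr_ge0 ?half_ge0// => j _.
  by rewrite /c' (ltn_trans (ltn_ord j) nJ) mul0r.
rewrite -(big_mkord xpredT (fun j => c' j * V m2 (z j))) (big_cat_nat (leq0n J) Jn)/=.
rewrite big_nat_cond big1 ?add0r => [|j]; last first.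
  by rewrite andbT => /andP[_ jJ]; rewrite /c' jJ mul0r.
rewrite -[2 * _]mul1r; apply: sum_half => // j Jj; rewrite mul1r.
apply: le_trans (cV' j); have /andP[cj _] := c0' j; rewrite ler_wpM2l//.
by apply: weight_mono => //; apply: leq_trans (leq_addl n0 j); exact: leq_trans Jj.
Qed.

Lemma necessity : OC_D E W `<=` restrict_to_D (OC_K1 V E W) -> moderate V W.
Proof.
move=> sub n0; apply: contrapT => nm.
have h2 k : 0 < half k * half k :> R by rewrite mulr_gt0 ?half_gt0.
have /choice[xy hxy] : forall k : nat, exists xy : Rd * Rd,
    (k.+1%:R / (half k * half k)) * W (n0 + k)%N xy.1 * V (n0 + k)%N xy.2 < W n0 (xy.1 + xy.2).
  move=> k; apply: contrapT => /forallNP h; apply: nm.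
  exists (n0 + k)%N, (k.+1%:R / (half k * half k)); split; first exact: leq_addr.
    by rewrite divr_gt0 ?ltr0n.
  by move=> x y; rewrite leNgt; apply/negP => h'; apply: (h (x, y)).
pose xs k := (xy k).1; pose ys k := (xy k).2.
have W1 k : 0 < W (n0 + k)%N (xs k) by apply: lt_le_trans (weight_ge1 wW _ _).
have V1 k : 0 < V (n0 + k)%N (ys k) by apply: lt_le_trans (weight_ge1 wV _ _).
pose a k : R := half k / W (n0 + k)%N (xs k); pose b k : R := half k / V (n0 + k)%N (ys k).
have a0 k : 0 <= a k <= half k.
  rewrite /a; apply/andP; split; first by apply: divr_ge0; [exact: half_ge0|exact: ltW].
  by rewrite ler_pdivrMr// ler_peMr ?half_ge0//; exact: weight_ge1.
have b0 k : 0 <= b k <= half k.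
  rewrite /b; apply/andP; split; first by apply: divr_ge0; [exact: half_ge0|exact: ltW].
  by rewrite ler_pdivrMr// ler_peMr ?half_ge0//; exact: weight_ge1.
have aW k : a k * W (n0 + k)%N (xs k) <= half k by rewrite /a divfK// gt_eqF.
have bV k : b k * V (n0 + k)%N (ys k) <= half k by rewrite /b divfK// gt_eqF.
have [S SO TS] := sub _ (dseries_OC_D a0 aW).
have [SD SE'] := SO; pose phi := dtranslates bump b ys [::].
have tb := @test_bump R d; have [B B0 bB] := test_bounded tb.
have phiW : smooth_weighted V phi by exact: dtranslates_weighted bV.
have tj x j : is_test (fun t => bump (x - t - ys j) : R[i]).
  have := test_conv_argument (x - ys j) tb; under eq_fun do rewrite addrAC; by [].
have ST x j : S (fun t => bump (x - t - ys j)) = dseries a xs (fun t => bump (x - t - ys j)).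
  by rewrite -TS// inE; apply/is_testP.
(* Near x_k + y_k the pair of k-th terms contributes b_k a_k since the bump equals 1 there; all the
   other contributions have nonnegative real part. *)
have low k x : `|x - (xs k + ys k)| <= 1 -> b k * a k <= complex.Re (conv_functional S phi x).
  move=> x1; rewrite conv_functionalE.
  apply: ccvg_Re_ge (dual_series x tb b0 bV SD) _; exists k.+1 => n kn.
  have R0 j : 0 <= complex.Re (S (fun t => bump (x - t - ys j))).
    (* Any single term bounds the series from below; the term of index 0 is enough to see that the
       real part is nonnegative. *)
    rewrite ST; apply: le_trans (@dseries_Re_ge a xs _ 0%N B a0 _ _) => [|t|t]; try exact: bB.
      by rewrite mulr_ge0 ?Re_bump_ge0//; case/andP: (a0 0%N).
    exact: Re_bump_ge0.
  apply: le_trans (@Re_sum_ge b (fun j => S (fun t => bump (x - t - ys j))) k n _ R0 kn); last first.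
    by move=> j; case/andP: (b0 j).
  rewrite ler_wpM2l//; first by case/andP: (b0 k).
  rewrite ST; apply: le_trans (@dseries_Re_ge a xs _ k B a0 _ _) => [|t|t]; try exact: bB.
    by rewrite bump1 /= ?mulr1// -addrA -opprD.
  exact: Re_bump_ge0.
have [m [C [_ C0 WC]]] := wM_large n0 1 mW.
have [_ /(_ m)] := SE' phi (smooth_weighted_K1 wV phiW); set h := weighted _ _ => Eh.
have [D D0 hD] := tibf_A2 HE; pose I (x : Rd) : R[i] := (\1_(cube 1) x)%:C.
have EI : E I by exact: cube_in_E HE SE 1.
have I0 : 0 < nE I by exact: (cube_norm_gt0 HE SE ltr01).
have key k : k.+1%:R / C * (nE I / D) <= nE h.
  pose zk := xs k + ys k; have Et := tibf_A1 HE zk EI.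
  have EK := bfs_memZ bE (k.+1%:R / C)%:C Et.
  have k0 : 0 <= k.+1%:R / C :> R by rewrite divr_ge0 ?ler0n// ltW.
  apply: le_trans (_ : nE (fun x => (k.+1%:R / C)%:C * translate zk I x) <= _).
    rewrite (bfs_normZ bE _ Et) normc_real ger0_norm// ler_wpM2l//.
    (* Translating back by [- zk] shows that moving the cube to [zk] divides its norm by at most
       [D]. *)
    rewrite ler_pdivrMr// mulrC; apply: le_trans (hD (- zk) _ Et).
    rewrite (_ : translate _ _ = I)//; apply/funext => x.
    by rewrite /translate opprK addrK.
  apply: (E_solid HE SE Eh _ _).2; first exact: L1loc_cmeasurable (bfs_L1loc bE EK).
  apply: aeW => x; rewrite normcM !normc_real normc_weighted// ger0_norm// indicE.
  have [x1|x1] := leP `|x - zk| 1; last first.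
    rewrite memNset ?normr0 ?mulr0 ?mulr_ge0 ?normc_ge0 ?weight_ge0//.
    by rewrite /cube /= => /(lt_le_trans x1); rewrite ltxx.
  rewrite mem_set// normr1 mulr1.
  apply: le_trans (_ : b k * a k * W m x <= _); last first.
    rewrite ler_wpM2r ?weight_ge0//; apply: le_trans (low k x x1) _.
    by apply: le_trans (ler_norm _) _; exact: normc_Re.
  have := WC x (zk - x); rewrite [x + _]addrC subrK -normrN opprB => /(_ x1) hW.
  rewrite ler_pdivrMr//; have -> : b k * a k * W m x * C = b k * a k * (C * W m x) by ring.
  have ab0 : 0 <= b k * a k by rewrite mulr_ge0//; [case/andP: (b0 k)|case/andP: (a0 k)].
  apply: le_trans (ler_wpM2l ab0 hW).
  have := ltW (hxy k); rewrite -/(xs k) -/(ys k) -/zk => hz; apply: le_trans (ler_wpM2l ab0 hz).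
  (* In a_k b_k = 4^-k / (w_(n+k)(x_k) v_(n+k)(y_k)) everything cancels except the factor k + 1. *)
  rewrite /a /b le_eqVlt; apply/orP; left; apply/eqP; field.
  by rewrite !gt_eqF ?half_gt0.
have q0 : 0 < nE I / D / C by rewrite !divr_gt0.
have := key (Num.bound (nE h / (nE I / D / C))).
have hb : nE h / (nE I / D / C) < (Num.bound (nE h / (nE I / D / C)))%:R.
  by apply: archi_boundP; rewrite divr_ge0 ?(bfs_norm_ge0 bE Eh)// ltW.
rewrite ltr_pdivrMr// in hb; move=> hk; have {hk hb} := le_lt_trans hk hb.
rewrite (_ : _ / C * _ = (Num.bound (nE h / (nE I / D / C))).+1%:R * (nE I / D / C)); last by ring.
by rewrite ltr_pM2r// ltr_nat ltnNge leqnSn.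
Qed.

End necessity.

(** * Convolution and Sobolev bounds *)

Section smoothing.
Context {R : realType} {d : nat}.
Local Notation Rd := 'rV[R]_d.
Local Notation mu := (lebesgue_rV R d).
Local Notation lm := (@lebesgue_measurable R d).
Implicit Types (f g p : Rd -> R[i]).

(** Tonelli requires joint Borel measurability, so [F] is first replaced by a Borel representative;
    [k] is continuous. *)
Lemma int_young (F k : Rd -> R) : lm F -> (forall x, 0 <= F x) -> continuous k -> (forall x, 0 <= k x) ->
  (\int[mu]_x \int[mu]_y (F y * k (x - y))%:E = (\int[mu]_y (F y)%:E) * \int[mu]_x (k x)%:E)%E.
Proof.
move=> lF F0 ck k0; have [G [mG G0 FG]] := lm_ge0 lF F0.
have mk := continuous_measurable_rV ck; have lk := continuous_lm ck.
have -> : (\int[mu]_x \int[mu]_y (F y * k (x - y))%:E = \int[mu]_x \int[mu]_y (G y * k (x - y))%:E)%E.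
  by apply: eq_integral => x _; apply: int_ae; apply: filterS FG => y ->.
have mh : measurable_fun setT (fun z : Rd * Rd => (G z.2 * k (z.1 - z.2))%:E).
  apply/measurable_EFinP; apply: measurable_funM.
    by apply: measurableT_comp => //; exact: measurable_snd.
  apply: (measurableT_comp mk); apply: measurable_fun_rV => i.
  under eq_fun do rewrite !mxE.
  apply: measurable_funB.
    by apply: (measurableT_comp (measurable_coord i)); exact: measurable_fst.
  by apply: (measurableT_comp (measurable_coord i)); exact: measurable_snd.
rewrite (@fubini_tonelli _ _ _ _ _ mu mu (fun z : Rd * Rd => (G z.2 * k (z.1 - z.2))%:E) mh)/=; last first.
  by move=> z; rewrite lee_fin mulr_ge0.
rewrite (int_ae FG).
have kfull y : (\int[mu]_x (G y * k (x - y))%:E = (G y)%:E * \int[mu]_x (k x)%:E)%E.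
  rewrite intZ//; last by exact: lm_translate.
  by congr (_ * _)%E; exact: int_translate.
under eq_integral do rewrite kfull.
rewrite ge0_integralZr//.
- exact/measurable_EFinP.
- by move=> y _; rewrite lee_fin.
- exact: int_ge0.
Qed.

(** The variable [x] sits in the second function, which is the smooth one, so that derivatives fall
    on it; [convolution] has the roles the other way round. *)
Definition conv f g : Rd -> R[i] := fun x => cintegral (fun y => f y * g (x - y)).

Lemma test_conv_shift g x : is_test g -> is_test (fun y => g (x - y)).
Proof. exact: test_conv_argument. Qed.

Lemma conv_bound f g x : L1loc f -> is_test g ->
  ((normc (conv f g x))%:E <= 2%:E * \int[mu]_y (normc (f y) * normc (g (x - y)))%:E)%E.
Proof.
move=> fL tg; apply: le_trans (cint_norm (L1loc_mul_test fL (test_conv_shift x tg))) _.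
by under eq_integral do rewrite normcM.
Qed.

(** A weighted Young inequality: the kernel joins only points at distance at most 1, where the
    weight at [x] may be replaced by [C w'] at [y] before Tonelli is applied. *)
Lemma conv_weighted_int f g (w w' : Rd -> R) (C : R) : L1loc f -> is_test g -> vanish_off 1 g ->
  (forall x, 0 <= w x) -> lm w' -> (forall x, 0 <= w' x) -> 0 <= C ->
  (forall x y, `|x - y| <= 1 -> w x <= C * w' y) ->
  (\int[mu]_x (normc (conv f g x) * w x)%:E <=
   (2 * C)%:E * (\int[mu]_y (normc (f y) * w' y)%:E) * \int[mu]_x (normc (g x))%:E)%E.
Proof.
move=> fL tg g1 w0 lw' w'0 C0 ww'; have mf := L1loc_cmeasurable fL.
have lf : lm (fun y => normc (f y) * w' y) by apply: lmM => //; exact: cmeasurable_normc.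
have f0 y : 0 <= normc (f y) * w' y by rewrite mulr_ge0 ?normc_ge0.
have cg := smooth_continuous_normc (test_smooth tg).
have lfg x : lm (fun y => normc (f y) * normc (g (x - y))).
  apply: lmM; first exact: cmeasurable_normc.
  by apply/cmeasurable_normc/smooth_cmeasurable/test_smooth/test_conv_shift.
rewrite -intZ//; last by rewrite mulr_ge0.
rewrite -int_young//; last 3 first.
- by apply: lmZ.
- by move=> y; rewrite !mulr_ge0 ?normc_ge0.
- by move=> x; exact: normc_ge0.
apply: ge0_le_integralT => x; first by rewrite lee_fin mulr_ge0 ?normc_ge0.
rewrite mulrC EFinM; apply: le_trans (lee_wpmul2l _ (conv_bound x fL tg)) _; first by rewrite lee_fin.
rewrite muleA -EFinM -intZ//; [|by rewrite mulr_ge0|by move=> y; rewrite mulr_ge0 ?normc_ge0].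
apply: int_le => [y|y|]; rewrite ?mulr_ge0 ?normc_ge0//; apply: aeW => y.
have [xy|xy] := leP `|x - y| 1; last first.
  by rewrite (g1 _ xy) (_ : normc 0 = 0) ?mulr0//; exact: normc0.
rewrite (_ : w x * 2 * _ = 2 * (normc (f y) * normc (g (x - y))) * w x); last by ring.
rewrite (_ : 2 * C * _ * _ = 2 * (normc (f y) * normc (g (x - y))) * (C * w' y)); last by ring.
by rewrite ler_wpM2l ?mulr_ge0 ?normc_ge0// ww'.
Qed.

Section conv_smooth.
Variables f g : Rd -> R[i].
Hypotheses (fL : L1 f) (tg : is_test g).

Let fLl := L1_L1loc fL.

Lemma conv_family : taylor_family (fun s => conv f (foldr pder g s)).
Proof.
pose I := \int[mu]_x normc (f x); have I0 : 0 <= I by apply: Rintegral_ge0 => x _; exact: normc_ge0.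
have IE : I%:E = (\int[mu]_x (normc (f x))%:E)%E by apply: rint_fin; [move=> x; exact: normc_ge0|case: fL].
have cb h (B : R) : cmeasurable h -> 0 <= B -> (forall y, normc (h y) <= B) ->
    normc (cintegral (fun y => f y * h y)) <= 2 * (B * I).
  move=> mh B0 hB; have L : L1 (fun y => f y * h y).
    apply: (@L1_dom _ _ _ (fun y => B * normc (f y))).
    - by apply: cmeasurableM => //; case: fL.
    - by move=> y; rewrite mulr_ge0 ?normc_ge0.
    - by apply: aeW => y; rewrite normcM mulrC ler_wpM2r ?normc_ge0.
    rewrite intZ//; [by apply: lte_mul_pinfty; rewrite ?lee_fin//; case: fL| |by move=> y; exact: normc_ge0].
    by apply: cmeasurable_normc; case: fL.
  rewrite -lee_fin; apply: le_trans (cint_norm L) _; rewrite [X in (_ <= X)%E]EFinM lee_wpmul2l//.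
  rewrite EFinM IE -intZ//; [|by apply: cmeasurable_normc; case: fL|by move=> y; exact: normc_ge0].
  apply: int_le => [y|y|]; rewrite ?mulr_ge0 ?normc_ge0//; apply: aeW => y.
  by rewrite normcM mulrC ler_wpM2r ?normc_ge0.
have mg s x : cmeasurable (fun y => foldr pder g s (x - y)).
  exact/smooth_cmeasurable/test_smooth/test_conv_shift/test_foldr.
have Lg s x : L1 (fun y => f y * foldr pder g s (x - y)).
  exact: L1loc_mul_test fLl (test_conv_shift x (test_foldr s tg)).
split=> [s M|s i M].
  have [B B0 gB] := test_bounded (test_foldr s tg); exists (2 * (B * I)) => x _.
  exact: cb.
have [B B0 gB] := test_bounded (test_foldr (i :: i :: s) tg).
exists (2 * (2 * B * I)) => x t _ _; set h := foldr pder g s.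
pose r y := h (x - y + t *: uvec i) - h (x - y) - t%:C * pder i h (x - y).
have shift y : x + t *: uvec i - y = x - y + t *: uvec i by rewrite addrAC.
have sh : is_smooth h by exact/smooth_foldr/test_smooth.
have -> : conv f h (x + t *: uvec i) - conv f h x - t%:C * conv f (foldr pder g (i :: s)) x =
    cintegral (fun y => f y * r y).
  rewrite /conv -cintZ; last exact: (Lg (i :: s)).
  rewrite -cintB; [|exact: Lg|exact: Lg].
  have L2 : L1 (fun y => f y * h (x + t *: uvec i - y) - f y * h (x - y)).
    apply: L1_ae (L1D (Lg s (x + t *: uvec i)) (L1Z (-1) (Lg s x))); apply: aeW => y.
    by rewrite mulN1r.
  rewrite -cintB//; last exact: (L1Z t%:C (Lg (i :: s) x)).
  by congr cintegral; apply/funext => y; rewrite /r shift /=; ring.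
have mr : cmeasurable r.
  apply: cmeasurableB; last by apply: cmeasurableZ; exact: (mg (i :: s)).
  apply: cmeasurableB; last exact: (mg s).
  by have := mg s (x + t *: uvec i); under eq_fun do rewrite shift.
rewrite (_ : 2 * (2 * B * I) * t ^+ 2 = 2 * (2 * B * t ^+ 2 * I)); last by ring.
apply: cb => //; first by apply: mulr_ge0; [exact: mulr_ge0|exact: sqr_ge0].
by move=> y; apply: smooth_taylor_bound => // u _; exact: gB.
Qed.

Lemma smooth_conv : is_smooth (conv f g).
Proof. exact: ((taylor_family_smooth conv_family).1 [::]). Qed.

Lemma foldr_conv_right s : foldr pder (conv f g) s = conv f (foldr pder g s).
Proof. exact: (taylor_family_foldr s conv_family). Qed.

End conv_smooth.

Lemma test_cint_norm_lt g : is_test g -> (\int[mu]_x (normc (g x))%:E < +oo)%E.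
Proof. by move=> /test_L1[]. Qed.

Lemma smooth1_scaled_step (r : R) : smooth1 (d := d) (fun t => smooth_step (r * t)).
Proof.
have := @smooth1_affine R d smooth_step r 0 smooth1_step.1.
by under eq_fun do rewrite addr0.
Qed.

Lemma mollifier_foldr K (s : seq 'I_d) : uniq s ->
  foldr pder (prod_fun (fun _ t => smooth_step (K.+1%:R * t))) s =
  prod_fun (fun j : 'I_d => if j \in s then mol1 K else fun t => smooth_step (K.+1%:R * t)) :> (Rd -> R[i]).
Proof.
have sH := smooth1_scaled_step K.+1%:R.
elim: s => [_ //|i s IH] /= /andP[is_ us]; rewrite IH//.
set h := fun j : 'I_d => if j \in s then _ else _.
have -> : pder i (prod_fun h) = prod_fun (fun j => if j == i then mol1 K else h j).
  apply: partial_prod_fun => [j|t]; first by rewrite /h; case: ifP => _ //; exact: smooth1_mol1.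
  rewrite /h (negbTE is_).
  have := is_derive_affine K.+1%:R 0 is_derive_smooth_step t; rewrite addr0.
  by under [X in is_derive _ _ X _]eq_fun do rewrite addr0.
by congr prod_fun; apply/funext => j; rewrite /h in_cons; case: eqP.
Qed.

(** The mollifier is the mixed derivative, once in every direction, of a product of steps with
    values between 0 and 1. Moving these [d] derivatives to [g] leaves a factor bounded by 1,
    uniformly in [K]. *)
Lemma conv_mollifier_bound g K x : is_test g ->
  ((normc (conv (mollifier K) g x))%:E <= 2%:E * \int[mu]_y (normc (foldr pder g (enum 'I_d) y))%:E)%E.
Proof.
move=> tg; set H : Rd -> R[i] := prod_fun (fun _ t => smooth_step (K.+1%:R * t)).
have H1 y : normc (H y) <= 1.
  rewrite normc_prod_fun; apply: prodr_ile1 => i _.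
  by rewrite normr_ge0 ger0_norm ?smooth_step_ge0// smooth_step_le1.
have sH : is_smooth H by apply: smooth_prod_fun => i; exact: smooth1_scaled_step.
have mE : mollifier K = foldr pder H (enum 'I_d).
  rewrite mollifier_foldr ?enum_uniq//; congr prod_fun; apply/funext => j.
  by rewrite mem_enum.
have tx := test_conv_shift x tg.
rewrite /conv mE integration_by_parts_foldr//.
rewrite normcM; have -> : normc ((-1) ^+ size (enum 'I_d) : R[i]) = 1.
  elim: (size _) => [|k IH]; first by rewrite expr0 -[1]/(1%:C) normc_real normr1.
  by rewrite exprS mulN1r normc_opp.
rewrite mul1r; apply: le_trans (cint_norm (L1loc_mul_test (smooth_L1loc sH) (test_foldr _ tx))) _.
rewrite lee_wpmul2l//.
set G := foldr pder g (enum 'I_d).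
have lG : lm (fun y => normc (G y)) by exact/cmeasurable_normc/smooth_cmeasurable/test_smooth/test_foldr.
have G0 y : 0 <= normc (G y) by exact: normc_ge0.
rewrite -(int_translate x lG G0) -(int_reflect (lm_translate x lG)); last by move=> y; exact: normc_ge0.
apply: int_le => [y|y|]; rewrite ?normc_ge0//; apply: aeW => y.
rewrite normcM foldr_conv; last exact: test_smooth.
rewrite normcM; have -> : normc ((-1) ^+ size (enum 'I_d) : R[i]) = 1.
  elim: (size _) => [|k IH]; first by rewrite expr0 -[1]/(1%:C) normc_real normr1.
  by rewrite exprS mulN1r normc_opp.
by rewrite mul1r addrC ler_piMl ?normc_ge0.
Qed.

Lemma cint_mollifier K : cintegral (mollifier K : Rd -> R[i]) = 1.
Proof.
have e1 : (fun x : Rd => complex.Re (mollifier K x : R[i])) = fun x => normc (mollifier K x : R[i]).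
  by apply/funext => x; rewrite [in LHS]mollifier_real.
have e2 : (fun x : Rd => complex.Im (mollifier K x : R[i])) = fun=> 0.
  by apply/funext => x; rewrite mollifier_real.
rewrite /cintegral e1 e2 /Rintegral int_mollifier integral0.
by [].
Qed.

Lemma conv_mollifier_cvg g : is_test g -> exists2 C : R, 0 <= C & forall K x,
  normc (conv (mollifier K) g x - g x) <= C * K.+1%:R^-1.
Proof.
move=> tg; have [B B0 gB] := test_dsum_bounded 1 tg; pose C := 2 * (d%:R * (2 * B)).
exists C => [|K x]; first by rewrite !mulr_ge0.
have tm := @test_mollifier R d K; have Lm := test_L1 tm.
have L1' : L1 (fun y => mollifier K y * g (x - y)).
  exact: L1loc_mul_test (L1_L1loc Lm) (test_conv_shift x tg).
have -> : conv (mollifier K) g x - g x = cintegral (fun y => mollifier K y * (g (x - y) - g x)).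
  rewrite -{1}[g x]mulr1 -(cint_mollifier K) -cintZ// /conv -cintB//; last exact: L1Z.
  by congr cintegral; apply/funext => y; rewrite mulrBr [g x * _]mulrC.
have L2 : L1 (fun y => mollifier K y * (g (x - y) - g x)).
  apply: L1_ae (L1D L1' (L1Z (- g x) Lm)); apply: aeW => y; ring.
rewrite -lee_fin; apply: le_trans (cint_norm L2) _.
rewrite -mulrA [X in (_ <= X)%E]EFinM lee_wpmul2l//.
have l0 : lm (fun y => normc (mollifier K y : R[i])) by apply: cmeasurable_normc; case: Lm.
rewrite -[X in (_ <= X)%E]mule1 -(@int_mollifier R d K) -intZ//; last 2 first.
- by rewrite !mulr_ge0 ?invr_ge0.
- by move=> y; exact: normc_ge0.
apply: int_le => [y|y|]; rewrite ?mulr_ge0 ?normc_ge0 ?invr_ge0//; apply: aeW => y.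
rewrite normcM mulrC; have [yK|yK] := leP `|y| K.+1%:R^-1; last first.
  by rewrite (mollifier_vanish yK) (_ : normc 0 = 0) ?mulr0//; exact: normc0.
rewrite ler_wpM2r ?normc_ge0//; apply: le_trans (smooth_lipschitz _ _ (test_smooth tg) gB) _.
by rewrite normrN ler_wpM2l ?mulr_ge0.
Qed.

(** The bound on the regularisations of [g] is independent of the scale, and they converge to
    [g]. *)
Lemma sobolev g x : is_test g ->
  ((normc (g x))%:E <= 2%:E * \int[mu]_y (normc (foldr pder g (enum 'I_d) y))%:E)%E.
Proof.
move=> tg; have [C C0 hC] := conv_mollifier_cvg tg.
have Goo := test_cint_norm_lt (test_foldr (enum 'I_d) tg).
pose G := \int[mu]_y normc (foldr pder g (enum 'I_d) y).
have GE : G%:E = (\int[mu]_y (normc (foldr pder g (enum 'I_d) y))%:E)%E.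
  by apply: rint_fin => // y; exact: normc_ge0.
rewrite -GE -EFinM lee_fin; apply/ler_addgt0Pl => e e0.
have C1 : 0 < C + 1 by rewrite ltr_wpDl.
pose K := Num.bound ((e / (C + 1))^-1).
have hK : C * K.+1%:R^-1 <= e.
  apply: le_trans (_ : (C + 1) * K.+1%:R^-1 <= _); first by rewrite ler_wpM2r ?invr_ge0 ?lerDl.
  rewrite -ler_pdivlMl// mulrC invf_ple ?posrE ?divr_gt0 ?ltr0n//.
  apply/ltW/(lt_le_trans (archi_boundP _)); first by rewrite invr_ge0 divr_ge0 ?ltW.
  by rewrite ler_nat leqnSn.
have -> : g x = - (conv (mollifier K) g x - g x) + conv (mollifier K) g x by ring.
apply: le_trans (ler_normcD _ _) _; rewrite normc_opp lerD ?(le_trans (hC K x))//.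
by rewrite -lee_fin EFinM GE; exact: conv_mollifier_bound.
Qed.

End smoothing.

(** * Sobolev bounds for sums of derivatives, and weak derivatives under convolution *)

Section sobolev_sums.
Context {R : realType} {d : nat}.
Local Notation Rd := 'rV[R]_d.
Local Notation mu := (lebesgue_rV R d).
Local Notation lm := (@lebesgue_measurable R d).
Implicit Types (f g p : Rd -> R[i]).

Lemma lm_dsum N f : is_smooth f -> lm (dsum N f).
Proof. by move=> sf; apply: continuous_lm; exact: dsum_continuous. Qed.

Lemma int_dsum_bound N f (w : Rd -> R) (B : R) : is_smooth f -> lm w -> (forall x, 0 <= w x) -> 0 <= B ->
  (forall s, (size s <= N)%N -> (\int[mu]_x (normc (foldr pder f s x) * w x)%:E <= B%:E)%E) ->
  (\int[mu]_x (dsum N f x * w x)%:E <= (wordcount (R := R) (d := d) N * B)%:E)%E.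
Proof.
move=> sf lw w0 B0; elim: N f sf => [|N IH] f sf fB /=.
  by rewrite mul1r; exact: (fB [::]).
have ls i : lm (fun x => dsum N (pder i f) x * w x).
  by apply: lmM => //; apply: lm_dsum; exact: smooth_partial.
have s0 i x : 0 <= dsum N (pder i f) x * w x by rewrite mulr_ge0 ?dsum_ge0.
under eq_integral do rewrite mulrDl mulr_suml.
rewrite intD; last 4 first.
- by apply: lmM => //; exact/cmeasurable_normc/smooth_cmeasurable.
- exact: lm_sum.
- by move=> x; rewrite mulr_ge0 ?normc_ge0.
- by move=> x; exact: sumr_ge0.
rewrite mulrDl mul1r EFinD; apply: leeD; first exact: (fB [::]).
rewrite (int_sum _ ls s0) -mulrA mulr_natl -[X in _ *+ X]card_ord -sumr_const -sumEFin.
apply: lee_sum => i _; apply: IH; first exact: smooth_partial.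
by move=> s sN; have := fB (rcons s i); rewrite foldr_rcons size_rcons; exact.
Qed.

Lemma test_dsum_int N f : is_test f -> (\int[mu]_x (dsum N f x)%:E < +oo)%E.
Proof.
move=> tf; have [B B0 fB] := test_dsum_bounded N tf; case: tf => sf [M /vanish_off_norm fM].
apply: le_lt_trans (int_le_cube _ B0 (normr_ge0 M) _ _) (ltry _) => x; first exact: dsum_ge0.
  by move=> _; exact: fB.
exact: vanish_off_dsum fM.
Qed.

Lemma sobolev_dsum N : exists2 C : R, 0 <= C & forall f x, is_test f ->
  ((dsum N f x)%:E <= C%:E * \int[mu]_y (dsum (N + d) f y)%:E)%E.
Proof.
exists (wordcount (R := R) (d := d) N * 2) => [|f x tf]; first by rewrite mulr_ge0 ?wordcount_ge0.
pose I := \int[mu]_y dsum (N + d) f y.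
have IE : I%:E = (\int[mu]_y (dsum (N + d) f y)%:E)%E.
  by apply: rint_fin; [move=> y; exact: dsum_ge0|exact: test_dsum_int].
rewrite -IE -EFinM lee_fin -mulrA; apply: dsum_bound => s sN.
rewrite -lee_fin EFinM IE; apply: le_trans (sobolev x (test_foldr s tf)) _.
rewrite lee_wpmul2l//; apply: int_le => [y|y|]; rewrite ?normc_ge0 ?dsum_ge0//; apply: aeW => y.
rewrite -foldr_cat; apply: normc_foldr_le; rewrite size_cat size_enum_ord addnC.
by rewrite leq_add2r.
Qed.

Definition vanish_in (r : R) f := forall x, `|x| < r -> f x = 0.

Lemma vanish_in_partial r f i : vanish_in r f -> vanish_in r (pder i f).
Proof.
move=> fr x xr; have e0 : 0 < (r - `|x|) / 2 by rewrite divr_gt0 ?subr_gt0.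
suff h t : `|t| <= (r - `|x|) / 2 -> normc (f (x + t *: uvec i) - f x - t%:C * 0) <= 0 * t ^+ 2.
  by have [_ _] := partial_of_quadratic e0 h.
move=> te; rewrite fr; last first.
  by apply: le_lt_trans (norm_addZ_delta _ _ _) _; move: te; lra.
by rewrite fr// mulr0 !subr0 mul0r (_ : normc 0 = 0)//; exact: normc0.
Qed.

Lemma vanish_in_dsum N r f x : vanish_in r f -> `|x| < r -> dsum N f x = 0.
Proof.
have z0 : normc (0 : R[i]) = 0 by exact: normc0.
elim: N f => [|N IH] f fr xr /=; rewrite fr// z0//.
by rewrite add0r big1// => i _; apply: IH => //; exact: vanish_in_partial.
Qed.

Lemma mi_order_count (s : seq 'I_d) : mi_order (fun i => count_mem i s) = size s.
Proof. exact: (foldr_partial_mi s (smooth_cst (0 : R[i]))).2. Qed.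

Lemma perm_mi_word_count (s : seq 'I_d) : perm_eq (mi_word (fun i => count_mem i s)) s.
Proof.
apply/allP => i _ /=; apply/eqP; rewrite /mi_word count_flatten -map_comp.
rewrite sumnE big_map big_enum /= (bigD1 i)//= count_nseq /= eqxx mul1n big1 ?addn0// => j ji.
by rewrite count_nseq /= (negbTE ji).
Qed.

Lemma foldr_mi_word_count f s : is_smooth f ->
  foldr pder f (mi_word (fun i => count_mem i s)) = foldr pder f s.
Proof. by move=> sf; apply: foldr_partial_perm => //; exact: perm_mi_word_count. Qed.

(** Weak derivatives are indexed by multi-indices; counting the letters of a word gives access to
    them by words, as for classical derivatives. *)
Definition weak_word f (s : seq 'I_d) : Rd -> R[i] := weak_deriv (fun i => count_mem i s) f.

(** One sign comes from the definition of weak derivatives, the other from differentiating y |-> p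
    (x - y), and they cancel. Derivatives of a regularisation are thus regularisations of weak
    derivatives. *)
Lemma conv_weak f g s p : weak_deriv_of (fun i => count_mem i s) f g -> is_test p ->
  conv f (foldr pder p s) = conv g p.
Proof.
move=> /weak_deriv_ofP[fL gL fg] tp; apply/funext => x.
have tx := test_conv_shift x tp; have := fg _ tx; rewrite mi_order_count -/(conv g p x) => <-.
rewrite foldr_mi_word_count; last exact: test_smooth.
rewrite foldr_conv; last exact: test_smooth.
rewrite /conv -cintZ.
  congr cintegral; apply/funext => y; rewrite mulrCA [X in _ = _ * X]mulrA -exprD addnn -mul2n exprM sqrrN.
  by rewrite expr1n expr1n mul1r.
have := L1loc_mul_test fL (test_foldr s tx).
by rewrite foldr_conv//; exact: test_smooth.
Qed.

Lemma weak_deriv0 f : L1loc f -> weak_deriv_of (fun=> 0%N) f f.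
Proof.
move=> fL; apply/weak_deriv_ofP; split=> // p _.
have o0 : mi_order (fun _ : 'I_d => 0%N) = 0%N by rewrite /mi_order big1.
have -> : mi_word (fun _ : 'I_d => 0%N) = [::] by apply: size0nil; rewrite size_mi_word.
by rewrite o0 expr0 mul1r.
Qed.

Variable U : nat -> Rd -> R.
Hypotheses (wU : weight_system U) (mU : wM U).

Lemma K1_L1 f : K1 U f -> L1 f.
Proof.
move=> fK; have [fw gL] := K1_weak_deriv wU (fun=> 0%N) 0%N fK.
have fL : L1loc f by case: fK.
have wf := weak_deriv_unique fw (weak_deriv0 fL).
apply: (@L1_dom _ _ _ (fun x => normc (weighted (U 0%N) (weak_deriv (fun=> 0%N) f) x))).
- exact: L1loc_cmeasurable.
- by move=> x; exact: normc_ge0.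
- by apply: filterS wf => x wx; rewrite normc_weighted// wx ler_peMr ?normc_ge0//; exact: weight_ge1.
by case: gL.
Qed.

Lemma weak_wordP f s : K1 U f -> weak_deriv_of (fun i => count_mem i s) f (weak_word f s).
Proof. by move=> fK; exact: (K1_weak_deriv wU _ 0%N fK).1. Qed.

Lemma weak_word_int f s n : K1 U f -> (size s <= n)%N ->
  (\int[mu]_x (normc (weak_word f s x) * U n x)%:E <= (K1norm U n f)%:E)%E.
Proof. by move=> fK sn; apply: K1norm_deriv; rewrite ?mi_order_count. Qed.

Definition tail (r : R) : set Rd := [set x | r <= `|x|].

Lemma measurable_tail r : measurable (tail r).
Proof.
rewrite (_ : tail r = ~` [set x : Rd | `|x| < r]); last first.
  by apply/seteqP; split => x; rewrite /tail /= leNgt => /negP.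
apply: measurableC; rewrite (_ : [set x : Rd | `|x| < r] = ball (0 : Rd) r); last first.
  by apply/seteqP; split => x; rewrite -ball_normE /= sub0r normrN.
apply: open_measurable_rV; exact: ball_open.
Qed.

Lemma int_tail (F : Rd -> R) (e : R) : lm F -> (forall x, 0 <= F x) -> (\int[mu]_x (F x)%:E < +oo)%E ->
  0 < e -> exists N : nat, forall r : R, N%:R <= r -> (\int[mu]_x (F x * \1_(tail r) x)%:E <= e%:E)%E.
Proof.
move=> lF F0 Foo e0.
have lI (r : R) : lm (\1_(tail r)) by apply: lm_indic; exact: measurable_tail.
have /fine_cvgP[_ h] : (\int[mu]_x (F x * \1_(tail n%:R) x)%:E)%E @[n --> \oo] --> 0%E.
  apply: (@int_dominated _ _ _ F) => //.
  - by move=> n; apply: lmM.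
  - by move=> n x; rewrite mulr_ge0.
  - by move=> n; apply: aeW => x; rewrite ler_piMr// indicE; case: (_ \in _).
  apply: aeW => x; apply/cvgrPdist_le => c c0; exists (Num.bound `|x|) => // n /= hn.
  rewrite sub0r normrN indicE memNset ?mulr0 ?normr0 ?ltW//= /tail/= => /le_lt_trans.
  by move=> /(_ _ (archi_boundP (normr_ge0 x))); rewrite ltr_nat ltnNge hn.
have foo (r : R) : (\int[mu]_x (F x * \1_(tail r) x)%:E < +oo)%E.
  apply: le_lt_trans Foo; apply: int_le => // [x|]; first by rewrite mulr_ge0.
  by apply: aeW => x; rewrite ler_piMr// indicE; case: (_ \in _).
have /cvgrPdist_le /(_ e e0)[N _ hN] := h; exists N => r Nr.
apply: le_trans (_ : (\int[mu]_x (F x * \1_(tail N%:R) x)%:E <= e%:E)%E).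
  apply: int_le => [x|x|]; rewrite ?mulr_ge0//; apply: aeW => x; rewrite ler_wpM2l// !indicE ler_nat.
  by case: (boolP (x \in tail r)) => //; rewrite inE => xr; rewrite mem_set//; exact: le_trans xr.
have := hN N (leqnn N); rewrite /= sub0r normrN => hN'.
rewrite -(@fineK _ (\int[mu]_x (F x * \1_(tail N%:R) x)%:E)%E) ?lee_fin; last first.
  by rewrite ge0_fin_numE//; apply: int_ge0 => x; rewrite mulr_ge0.
by apply: le_trans hN'; exact: ler_norm.
Qed.

(** The kernel lives on the unit cube, so values outside radius [r] depend on the weak derivative
    outside radius [r - 1] only. The factor [q] keeps track of the mass of the kernel. *)
Lemma conv_word_int n : exists (m : nat) (C : R), 0 <= C /\ forall f p s (r q : R), K1 U f -> is_test p ->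
  vanish_off 1 p -> (\int[mu]_x (normc (p x))%:E <= q%:E)%E ->
  (\int[mu]_x (normc (foldr pder (conv f p) s x) * (U n x * \1_(tail r) x))%:E <=
   (C * q)%:E * \int[mu]_x (normc (weak_word f s x) * (U m x * \1_(tail (r - 1)) x))%:E)%E.
Proof.
have [m [C [_ C0 hC]]] := wM_large n 1 mU; exists m, (2 * C); split=> [|f p s r q fK tp p1 pI].
  by rewrite mulr_ge0 ?ltW.
rewrite foldr_conv_right//; last exact: K1_L1.
have fw := weak_wordP s fK; rewrite (conv_weak fw tp); have [_ gL _] := fw.
apply: le_trans (@conv_weighted_int _ _ _ _ _ (fun x => U m x * \1_(tail (r - 1)) x) C gL tp p1 _ _ _ (ltW C0) _) _.
- by move=> x; rewrite mulr_ge0 ?weight_ge0.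
- by apply: lmM; [exact: weight_lm|apply: lm_indic; exact: (measurable_tail (r - 1))].
- by move=> x; rewrite mulr_ge0 ?weight_ge0.
- move=> x y xy; rewrite !indicE mulrA.
  have -> : U n x = U n (y + (x - y)) by rewrite addrC subrK.
  case: (boolP (x \in tail r)) => xr; last first.
    by rewrite mulr0 !mulr_ge0 ?weight_ge0// ltW.
  rewrite mem_set ?mulr1; first exact: hC.
  move: xr; rewrite inE /tail/= lerBlDr => xr; apply: le_trans xr _.
  have := ler_normD (x - y) y; rewrite subrK => h; apply: le_trans h _.
  by rewrite addrC lerD2l.
rewrite [X in (_ <= X * _)%E]EFinM [X in (_ <= X)%E]muleAC; apply: lee_pmul => //.
- rewrite mule_ge0 ?lee_fin ?mulr_ge0 ?(ltW C0)//.
  by apply: int_ge0 => x; rewrite !mulr_ge0 ?normc_ge0 ?weight_ge0.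
- by apply: int_ge0 => x; exact: normc_ge0.
Qed.

End sobolev_sums.

(** * Approximation in K^1 by cut-off regularisations *)

Section approximation.
Context {R : realType} {d : nat}.
Local Notation Rd := 'rV[R]_d.
Local Notation mu := (lebesgue_rV R d).
Local Notation lm := (@lebesgue_measurable R d).
Implicit Types (f g p : Rd -> R[i]).

(** Only finitely many words have length at most [N], so a monotone choice made word by word becomes
    uniform by taking maxima over letters. *)
Lemma words_uniform N (P : seq 'I_d -> nat -> Prop) : (forall s m n, (m <= n)%N -> P s m -> P s n) ->
  (forall s, exists m, P s m) -> exists m, forall s, (size s <= N)%N -> P s m.
Proof.
elim: N P => [|N IH] P Pm Pe.
  by have [m hm] := Pe [::]; exists m => s; rewrite leqn0 size_eq0 => /eqP ->.
have /choice[r hr] : forall i, exists m, forall s, (size s <= N)%N -> P (i :: s) m.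
  move=> i; apply: (IH (fun s => P (i :: s))) => [s m n mn|s]; last exact: Pe.
  exact: Pm.
have [m hm] := Pe [::]; exists (maxn m (\max_(i < d) r i)) => -[_|i s sN].
  by apply: Pm hm; exact: leq_maxl.
apply: Pm (hr i s sN); apply: leq_trans (leq_maxr _ _); exact: leq_bigmax.
Qed.

Definition small_kernel (q : R) p := [/\ is_test p, vanish_off 1 p &
  (\int[mu]_x (normc (p x))%:E <= q%:E)%E].

(* The decomposition of the differences into derivatives of small kernels gives
   a rate of convergence for the regularisations of a weakly differentiable
   function, without any density argument in L1. *)
Definition kernel_seq (kappa : nat -> Rd -> R[i]) := (forall j, small_kernel 1 (kappa j)) /\
  forall N K, (N <= K)%N -> exists e : 'I_d -> Rd -> R[i],
    (forall i, small_kernel N.+1%:R^-1 (e i)) /\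
    forall x, kappa N x - kappa K x = \sum_i pder i (e i) x.

Lemma mollifier_kernel : kernel_seq (@mollifier R d).
Proof.
split=> [j|N K NK].
  split; [exact: test_mollifier| |by rewrite int_mollifier].
  by apply: vanish_off_le (@mollifier_vanish R d j); exact: natSV_le1.
exists (eta N K); split=> [i|x]; last exact: mollifier_diff.
by split; [exact: test_eta|exact: eta_vanish|exact: int_eta].
Qed.

Lemma small_kernel_reflect q p : small_kernel q p -> small_kernel q (fun x => p (- x)).
Proof.
move=> [tp p1 pq]; split; [exact: test_reflect|exact: vanish_off_reflect|].
rewrite (@int_reflect _ _ (fun x => normc (p x)))// => [|x]; last exact: normc_ge0.
by apply/cmeasurable_normc/smooth_cmeasurable/test_smooth.
Qed.

Lemma small_kernelN q p : small_kernel q p -> small_kernel q (fun x => - p x).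
Proof.
move=> [tp p1 pq]; split; first exact: testN.
  by move=> x x1; rewrite p1// oppr0.
by under eq_integral do rewrite normc_opp.
Qed.

Lemma reflect_kernel kappa : kernel_seq kappa -> kernel_seq (fun j x => kappa j (- x)).
Proof.
move=> [k1 k2]; split=> [j|N K NK]; first exact: small_kernel_reflect.
have [e [e1 e2]] := k2 N K NK; exists (fun i x => - e i (- x)); split=> [i|x].
  exact/small_kernelN/small_kernel_reflect.
rewrite e2; apply: eq_bigr => i _; have [te _ _] := e1 i; have se := test_smooth te.
by rewrite partialN ?reflect_partial ?opprK//; exact: smooth_reflect.
Qed.

(** A multiplier that vanishes near the origin localises the integral to a tail; it is applied to
    differences of cutoffs. *)
Lemma int_dsum_mul N rho g (r D : R) (w : Rd -> R) : is_smooth rho -> is_smooth g -> vanish_in r rho ->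
  (forall x, dsum N rho x <= D) -> lm w -> (forall x, 0 <= w x) ->
  (\int[mu]_x (dsum N (fun x => rho x * g x)%R x * w x)%:E <=
   (3 ^+ N * D)%:E * \int[mu]_x (dsum N g x * (w x * \1_(tail r) x))%:E)%E.
Proof.
move=> sr sg rv rD lw w0; have D0 : 0 <= D by apply: le_trans (rD 0); exact: dsum_ge0.
have lI : lm (\1_(tail r)) by apply: lm_indic; exact: measurable_tail.
have n3 : 0 <= (3 : R) ^+ N by rewrite exprn_ge0.
rewrite -intZ//; last 3 first.
- by apply: lmM; [exact: lm_dsum|exact: lmM].
- exact: mulr_ge0.
- by move=> x; rewrite !mulr_ge0 ?dsum_ge0.
apply: int_le => [x|x|]; rewrite ?mulr_ge0 ?dsum_ge0//.
apply: aeW => x; have [xr|xr] := ltP `|x| r.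
  rewrite (@vanish_in_dsum _ _ N r) ?mul0r ?mulr_ge0 ?dsum_ge0//.
  by move=> y yr; rewrite rv// mul0r.
rewrite [\1_(tail r) x]indicE mem_set// mulr1 mulrA ler_wpM2r//.
apply: le_trans (dsumM N x sr sg) _; rewrite -mulrA ler_wpM2l//.
by rewrite ler_wpM2r ?dsum_ge0.
Qed.

Lemma int_dsum_mul0 N rho g (D : R) (w : Rd -> R) : is_smooth rho -> is_smooth g ->
  (forall x, dsum N rho x <= D) -> lm w -> (forall x, 0 <= w x) ->
  (\int[mu]_x (dsum N (fun x => rho x * g x)%R x * w x)%:E <=
   (3 ^+ N * D)%:E * \int[mu]_x (dsum N g x * w x)%:E)%E.
Proof.
move=> sr sg rD lw w0; have v0 : vanish_in 0 rho by move=> x; rewrite ltNge normr_ge0.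
have := int_dsum_mul sr sg v0 rD lw w0.
rewrite [X in (_ <= _ * X)%E -> _](_ : _ = (\int[mu]_x (dsum N g x * w x)%:E)%E)//.
by apply: eq_integral => x _; rewrite indicE mem_set ?mulr1//= /tail /=.
Qed.

Variable U : nat -> Rd -> R.
Hypotheses (wU : weight_system U) (mU : wM U).

Lemma conv_word_int0 n : exists (m : nat) (C : R), 0 <= C /\ forall f p s q k, K1 U f -> small_kernel q p ->
  0 <= q -> (size s <= k)%N -> (m <= k)%N ->
  (\int[mu]_x (normc (foldr pder (conv f p) s x) * U n x)%:E <= (C * q * K1norm U k f)%:E)%E.
Proof.
have [m [C [C0 hC]]] := conv_word_int wU mU n; exists m, C; split=> // f p s q k fK [tp p1 pq] q0 sk mk.
have := hC f p s 0 q fK tp p1 pq.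
rewrite (_ : (\int[mu]_x (normc (foldr pder (conv f p) s x) * (U n x * \1_(tail 0) x))%:E)%E =
  (\int[mu]_x (normc (foldr pder (conv f p) s x) * U n x)%:E)%E); last first.
  by apply: eq_integral => x _; rewrite indicE mem_set ?mulr1//= /tail /=.
move=> /le_trans; apply; rewrite [X in (_ <= X)%E]EFinM lee_wpmul2l ?lee_fin ?mulr_ge0//.
apply: le_trans (weak_word_int wU fK sk).
apply: int_le => [x|x|]; rewrite ?mulr_ge0 ?normc_ge0 ?weight_ge0//.
apply: aeW => x; rewrite ler_wpM2l ?normc_ge0//; apply: le_trans (weight_mono wU x mk).
by rewrite ler_piMr ?weight_ge0// indicE; case: (_ \in _).
Qed.

Lemma conv_dsum_int N n : exists (m : nat) (C : R), 0 <= C /\ forall f p, K1 U f -> small_kernel 1 p ->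
  (\int[mu]_x (dsum N (conv f p) x * U n x)%:E <= (C * K1norm U m f)%:E)%E.
Proof.
have [m [C [C0 hC]]] := conv_word_int0 n.
exists (maxn N m), (wordcount (R := R) (d := d) N * C); split; first by rewrite mulr_ge0 ?wordcount_ge0.
move=> f p fK kp; have [tp _ _] := kp; rewrite -mulrA; apply: int_dsum_bound.
- by apply: smooth_conv => //; exact: K1_L1 fK.
- exact: weight_lm.
- by move=> x; exact: weight_ge0.
- by rewrite mulr_ge0//; exact: max_order_ge0.
move=> s sN; have := hC f p s 1 (maxn N m) fK kp ler01 (leq_trans sN (leq_maxl _ _)) (leq_maxr _ _).
by rewrite mulr1.
Qed.

(** The tails are small uniformly over all kernels of mass at most 1, because they are controlled by
    the tails of the finitely many weak derivatives of [f]. *)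
Lemma conv_dsum_tail N n f (e : R) : K1 U f -> 0 < e -> exists r0 : nat, forall p (r : R), small_kernel 1 p ->
  r0%:R <= r -> (\int[mu]_x (dsum N (conv f p) x * (U n x * \1_(tail r) x))%:E <= e%:E)%E.
Proof.
move=> fK e0; pose w : R := wordcount (R := R) (d := d) N.
have w1 : 0 < w by apply: lt_le_trans (wordcount_ge1 N).
have ew : 0 < e / w by rewrite divr_gt0.
have [m [C [C0 hC]]] := conv_word_int wU mU n.
have [||r0 hr] := @words_uniform N (fun s k => forall p (r : R), small_kernel 1 p -> k%:R <= r ->
    (\int[mu]_x (normc (foldr pder (conv f p) s x) * (U n x * \1_(tail r) x))%:E <= (e / w)%:E)%E) _ _.
- by move=> s a b ab h p r kp br; apply: h => //; apply: le_trans br; rewrite ler_nat.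
- move=> s; have C1 : 0 < C + 1 by rewrite ltr_wpDl.
  have lF : lm (fun x => normc (weak_word f s x) * U m x).
    apply: lmM; last exact: weight_lm.
    by apply: cmeasurable_normc; have [_ gL _] := weak_wordP wU s fK; case: gL.
  have F0 x : 0 <= normc (weak_word f s x) * U m x by rewrite mulr_ge0 ?normc_ge0 ?weight_ge0.
  have Foo : (\int[mu]_x (normc (weak_word f s x) * U m x)%:E < +oo)%E.
    have := weak_word_int wU fK (leq_maxl (size s) m) => h.
    apply: le_lt_trans (le_trans _ h) (ltry _); apply: int_le => [x|x|]; rewrite ?F0 ?mulr_ge0 ?normc_ge0 ?weight_ge0//.
    by apply: aeW => x; rewrite ler_wpM2l ?normc_ge0//; apply: weight_mono => //; exact: leq_maxr.
  have [r1 hr1] := int_tail lF F0 Foo (divr_gt0 ew C1).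
  (* The additional 1 makes up for the tail moving inwards by the radius of the kernel. *)
  exists r1.+1 => p r [tp p1 pq] rr; have := hC f p s r 1 fK tp p1 pq; rewrite mulr1 => h.
  apply: le_trans h _; apply: le_trans (_ : C%:E * (e / w / (C + 1))%:E <= _)%E.
    rewrite lee_wpmul2l ?lee_fin//; have := hr1 (r - 1); rewrite lerBrDr natr1 => /(_ rr).
    by under eq_integral do rewrite -mulrA.
  rewrite -EFinM lee_fin mulrA ler_pdivrMr// mulrC ler_wpM2l ?(ltW ew)//.
  by rewrite lerDl.
exists r0 => p r kp rr; have [tp _ _] := kp; rewrite -[e](divfK (lt0r_neq0 w1)) mulrC.
have lI : lm (\1_(tail r)) by apply: lm_indic; exact: measurable_tail.
apply: int_dsum_bound.
- by apply: smooth_conv => //; exact: K1_L1 fK.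
- by apply: lmM => //; exact: weight_lm.
- by move=> x; rewrite mulr_ge0 ?weight_ge0.
- exact: ltW.
by move=> s sN; exact: hr.
Qed.

Lemma conv_sub f p q : L1 f -> is_test p -> is_test q ->
  (fun x => conv f p x - conv f q x) = conv f (fun x => p x - q x).
Proof.
move=> fL tp tq; apply/funext => x; rewrite /conv -cintB.
- by congr cintegral; apply/funext => y; rewrite mulrBr.
- by apply: L1loc_mul_test; [exact: L1_L1loc|exact: test_conv_shift].
- by apply: L1loc_mul_test; [exact: L1_L1loc|exact: test_conv_shift].
Qed.

Lemma conv_sum f (F : 'I_d -> Rd -> R[i]) : L1 f -> (forall i, is_test (F i)) ->
  conv f (fun x => \sum_i F i x) = (fun x => \sum_i conv f (F i) x).
Proof.
move=> fL tF; apply/funext => x; rewrite /conv.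
rewrite -(@cint_sum _ _ _ _ (fun i y => f y * F i (x - y)) _).2.
  by congr cintegral; apply/funext => y; rewrite mulr_sumr.
by move=> i; apply: L1loc_mul_test; [exact: L1_L1loc|exact: test_conv_shift].
Qed.

(** The difference of the kernels is a sum of derivatives of kernels of mass 1/(j+1). Handing this
    additional derivative to [f] yields a rate of convergence, at the price of weak derivatives of
    order N + 1. *)
Lemma conv_dsum_diff N n : exists (m : nat) (C : R), 0 <= C /\ forall f kappa J j k, K1 U f ->
  kernel_seq kappa -> (J <= j)%N -> (J <= k)%N ->
  (\int[mu]_x (dsum N (fun x => conv f (kappa j) x - conv f (kappa k) x)%R x * U n x)%:E <=
   (C * K1norm U m f * J.+1%:R^-1)%:E)%E.
Proof.
have [m [C [C0 hC]]] := conv_word_int0 n.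
pose w : R := wordcount (R := R) (d := d) N; have w0 : 0 <= w by exact: wordcount_ge0.
exists (maxn N.+1 m), (w * (d%:R * C)); split; first by rewrite !mulr_ge0.
move=> f kappa J j k fK [k1 k2]; have fL := K1_L1 wU fK.
set K := K1norm U _ f; have K0 : 0 <= K by exact: max_order_ge0.
have tk i : is_test (kappa i) by case: (k1 i).
(* [kernel_seq] decomposes differences with increasing indices only; changing the sign of the
   function leaves the integral unchanged. *)
wlog jk : j k / (j <= k)%N.
  move=> H Jj Jk; have [jk|/ltnW kj] := leqP j k; first exact: H.
  have := H k j kj Jk Jj.
  have sc : is_smooth (fun x => conv f (kappa k) x - conv f (kappa j) x).
    by apply: smoothB; exact: smooth_conv.
  have -> : (fun x => conv f (kappa j) x - conv f (kappa k) x) =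
      (fun x => - (conv f (kappa k) x - conv f (kappa j) x)) by apply/funext => x; rewrite opprB.
  by under [X in _ -> (X <= _)%E]eq_integral do rewrite (dsum_opp _ _ sc).
move=> Jj _; have [e [e1 e2]] := k2 j k jk.
have te i : is_test (e i) by case: (e1 i).
have E : (fun x => conv f (kappa j) x - conv f (kappa k) x) = (fun x => \sum_i pder i (conv f (e i)) x).
  rewrite conv_sub// (_ : (fun x => _) = (fun x => \sum_i pder i (e i) x)); last exact/funext/e2.
  rewrite conv_sum//; last by move=> i; exact: test_partial.
  apply/funext => x; apply: eq_bigr => i _.
  by have := @foldr_conv_right _ _ f (e i) fL (te i) [:: i] => /= ->.
have se i : is_smooth (conv f (e i)) by exact: smooth_conv.
have J0 : 0 <= J.+1%:R^-1 :> R by rewrite invr_ge0.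
rewrite E -!mulrA; apply: int_dsum_bound.
- by apply: (smooth_sum _ _).1 => i; exact: smooth_partial.
- exact: weight_lm.
- by move=> x; exact: weight_ge0.
- by rewrite !mulr_ge0.
move=> s sN.
have -> : foldr pder (fun x => \sum_i pder i (conv f (e i)) x) s =
    (fun x => \sum_i foldr pder (conv f (e i)) (rcons s i) x).
  elim: s {sN} => [//|a s IH] /=; rewrite IH.
  by rewrite (smooth_sum _ (fun i => smooth_foldr (rcons s i) (se i))).2.
have ls i : lm (fun x => normc (foldr pder (conv f (e i)) (rcons s i) x) * U n x).
  by apply: lmM; [exact/cmeasurable_normc/smooth_cmeasurable/smooth_foldr|exact: weight_lm].
have s0 i x : 0 <= normc (foldr pder (conv f (e i)) (rcons s i) x) * U n x.
  by rewrite mulr_ge0 ?normc_ge0 ?weight_ge0.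
apply: le_trans (_ : \int[mu]_x (\sum_i normc (foldr pder (conv f (e i)) (rcons s i) x) * U n x)%:E <= _)%E.
  apply: int_le => [x|x|]; first by rewrite mulr_ge0 ?normc_ge0 ?weight_ge0.
    by apply: sumr_ge0 => i _; exact: s0.
  by apply: aeW => x; rewrite -mulr_suml ler_wpM2r ?weight_ge0//; exact: normc_sum.
rewrite (int_sum _ ls s0) mulr_natl -[X in _ *+ X]card_ord -sumr_const -sumEFin.
apply: lee_sum => i _.
have sk : (size (rcons s i) <= maxn N.+1 m)%N.
  by rewrite size_rcons; apply: leq_trans (leq_maxl _ _).
have j0 : 0 <= j.+1%:R^-1 :> R by rewrite invr_ge0.
apply: le_trans (hC f (e i) (rcons s i) _ _ fK (e1 i) j0 sk (leq_maxr _ _)) _.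
rewrite lee_fin mulrA [X in _ <= X]mulrAC ler_wpM2r// ler_wpM2l//.
by rewrite lef_pV2 ?posrE ?ltr0n// ler_nat.
Qed.

Definition approx (kappa : nat -> Rd -> R[i]) f j : Rd -> R[i] := fun x => cutoff j x * conv f (kappa j) x.

Lemma test_approx kappa f j : kernel_seq kappa -> K1 U f -> is_test (approx kappa f j).
Proof.
move=> [k1 _] fK; apply: testM; first exact: (test_cutoff j).1.
by apply: smooth_conv; [exact: K1_L1 fK|case: (k1 j)].
Qed.

Lemma approx_bound N n : exists (m : nat) (C : R), 0 <= C /\ forall kappa f j, kernel_seq kappa -> K1 U f ->
  (\int[mu]_x (dsum N (approx kappa f j) x * U n x)%:E <= (C * K1norm U m f)%:E)%E.
Proof.
have [D D0 hD] := @dsum_cutoff_le R d N; have [m [C [C0 hC]]] := conv_dsum_int N n.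
exists m, (3 ^+ N * D * C); split; first by rewrite !mulr_ge0// exprn_ge0.
move=> kappa f j [k1 _] fK; have fL := K1_L1 wU fK.
have sc : is_smooth (conv f (kappa j)) by apply: smooth_conv => //; case: (k1 j).
have sX : is_smooth (cutoff j : Rd -> R[i]) by exact: test_smooth (test_cutoff j).1.
apply: le_trans (@int_dsum_mul0 N (cutoff j) _ D (U n) sX sc (hD j)
  (weight_lm wU n) (weight_ge0 wU n)) _.
rewrite -mulrA [X in (_ <= X)%E]EFinM lee_wpmul2l ?lee_fin ?mulr_ge0 ?exprn_ge0//.
exact: hC.
Qed.

Lemma int_dsumD N f g (w : Rd -> R) : is_smooth f -> is_smooth g -> lm w -> (forall x, 0 <= w x) ->
  (\int[mu]_x (dsum N (fun x => f x + g x)%R x * w x)%:E <=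
   \int[mu]_x (dsum N f x * w x)%:E + \int[mu]_x (dsum N g x * w x)%:E)%E.
Proof.
move=> sf sg lw w0; rewrite -intD.
- apply: int_le => [x|x|]; rewrite ?addr_ge0 ?mulr_ge0 ?dsum_ge0//.
  by apply: aeW => x; rewrite -mulrDl ler_wpM2r//; exact: dsumD.
- by apply: lmM => //; exact: lm_dsum.
- by apply: lmM => //; exact: lm_dsum.
- by move=> x; rewrite mulr_ge0 ?dsum_ge0.
- by move=> x; rewrite mulr_ge0 ?dsum_ge0.
Qed.

(** The difference splits into [cutoff j] times a difference of regularisations, small by the rate,
    and a difference of cutoffs times one regularisation. The latter factor vanishes on a large
    cube, so the uniform smallness of tails applies. *)
Lemma approx_cauchy N n kappa f (e : R) : kernel_seq kappa -> K1 U f -> 0 < e ->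
  exists J, forall j k, (J <= j)%N -> (J <= k)%N ->
  (\int[mu]_x (dsum N (fun x => approx kappa f j x - approx kappa f k x)%R x * U n x)%:E <= e%:E)%E.
Proof.
move=> kk fK e0; have [D D0 hD] := @dsum_cutoff_le R d N; have fL := K1_L1 wU fK.
have [m [C [C0 hC]]] := conv_dsum_diff N n.
have k1 j : small_kernel 1 (kappa j) by case: kk.
have sG j : is_smooth (conv f (kappa j)) by apply: smooth_conv => //; case: (k1 j).
have sX j : is_smooth (cutoff j : Rd -> R[i]) by exact: test_smooth (test_cutoff j).1.
pose A : R := 3 ^+ N * D; have A0 : 0 <= A by rewrite mulr_ge0 ?exprn_ge0.
pose B : R := 3 ^+ N * (D + D); have B0 : 0 <= B by rewrite mulr_ge0 ?exprn_ge0 ?addr_ge0.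
have e4 : 0 < e / 2 / (B + 1) by rewrite !divr_gt0// ltr_wpDl.
have [r0 hr0] := conv_dsum_tail N n fK e4.
pose K := A * (C * K1norm U m f); have K0 : 0 <= K by rewrite !mulr_ge0//; exact: max_order_ge0.
pose J1 := Num.bound (K / (e / 2)).
exists (maxn r0 J1) => j k; rewrite !geq_max => /andP[rj Jj] /andP[rk Jk].
have E : (fun x => approx kappa f j x - approx kappa f k x) =
    (fun x => cutoff j x * (conv f (kappa j) x - conv f (kappa k) x) +
      (cutoff j x - cutoff k x) * conv f (kappa k) x).
  by apply/funext => x; rewrite /approx; ring.
have sGG : is_smooth (fun x => conv f (kappa j) x - conv f (kappa k) x) by exact: smoothB.
have sXX : is_smooth (fun x : Rd => cutoff j x - cutoff k x : R[i]) by exact: smoothB.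
rewrite E [e]splitr EFinD.
apply: le_trans (@int_dsumD N (fun x => cutoff j x * (conv f (kappa j) x - conv f (kappa k) x))
  (fun x => (cutoff j x - cutoff k x) * conv f (kappa k) x) (U n)
  (smoothM (sX j) sGG) (smoothM sXX (sG k)) (weight_lm wU n) (weight_ge0 wU n)) _.
apply: leeD.
  apply: le_trans (@int_dsum_mul0 N (cutoff j) _ D (U n) (sX j) sGG (hD j)
    (weight_lm wU n) (weight_ge0 wU n)) _.
  apply: le_trans (lee_wpmul2l _ (hC f kappa J1 j k fK kk Jj Jk)) _; first by rewrite lee_fin.
  rewrite -EFinM lee_fin mulrA -/A -/K ler_pdivrMr ?ltr0n// mulrC -ler_pdivrMr ?divr_gt0//.
  apply/ltW/(lt_le_trans (archi_boundP _)); first by rewrite divr_ge0// ltW// divr_gt0.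
  by rewrite ler_nat leqnSn.
have vin : vanish_in r0%:R (fun x : Rd => cutoff j x - cutoff k x : R[i]).
  move=> x xr; have xj : `|x| <= j%:R by apply: le_trans (ltW xr) _; rewrite ler_nat.
  have xk : `|x| <= k%:R by apply: le_trans (ltW xr) _; rewrite ler_nat.
  by rewrite !cutoff_one// subrr.
have dX x : dsum N (fun x : Rd => cutoff j x - cutoff k x : R[i]) x <= D + D.
  by apply: le_trans (dsumB N x (sX j) (sX k)) _; rewrite lerD.
apply: le_trans (@int_dsum_mul N _ _ r0%:R (D + D) (U n) sXX (sG k) vin dX (weight_lm wU n) (weight_ge0 wU n)) _.
apply: le_trans (lee_wpmul2l _ (hr0 (kappa k) r0%:R (k1 k) (lexx _))) _; first by rewrite lee_fin.
rewrite -EFinM lee_fin -/B mulrA ler_pdivrMr; last by rewrite ltr_wpDl.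
by rewrite mulrC ler_wpM2l ?lerDl// ltW// divr_gt0.
Qed.

(** Cutting off before or after the reflection t |-> x - t makes a difference only far away, since
    both cutoffs are 1 on a cube smaller by |x|. This reconciles the two approximations met when the
    extension is convolved. *)
Lemma approx_shift N n kappa f (x : Rd) (e : R) : kernel_seq kappa -> K1 U f -> 0 < e ->
  exists J, forall j, (J <= j)%N ->
  (\int[mu]_t (dsum N (fun t => (cutoff j (x - t) - cutoff j t) * conv f (kappa j) t)%R t * U n t)%:E <= e%:E)%E.
Proof.
move=> kk fK e0; have [D D0 hD] := @dsum_cutoff_le R d N; have fL := K1_L1 wU fK.
have k1 j : small_kernel 1 (kappa j) by case: kk.
have sG j : is_smooth (conv f (kappa j)) by apply: smooth_conv => //; case: (k1 j).
have sX j : is_smooth (cutoff j : Rd -> R[i]) by exact: test_smooth (test_cutoff j).1.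
pose B : R := 3 ^+ N * (D + D); have B0 : 0 <= B by rewrite mulr_ge0 ?exprn_ge0 ?addr_ge0.
have e4 : 0 < e / (B + 1) by rewrite !divr_gt0// ltr_wpDl.
have [r0 hr0] := conv_dsum_tail N n fK e4.
exists (r0 + Num.bound `|x|)%N => j rj.
have xb : r0%:R + `|x| <= j%:R.
  apply: le_trans (_ : (r0 + Num.bound `|x|)%:R <= _); last by rewrite ler_nat.
  by rewrite natrD lerD2l; apply/ltW/archi_boundP.
have sXx : is_smooth (fun t : Rd => cutoff j (x - t) : R[i]) by exact: smooth_conv_argument.
have sXX : is_smooth (fun t : Rd => cutoff j (x - t) - cutoff j t : R[i]) by exact: smoothB.
have vin : vanish_in r0%:R (fun t : Rd => cutoff j (x - t) - cutoff j t : R[i]).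
  move=> t tr; rewrite !cutoff_one ?subrr//.
    by apply: le_trans xb; apply: le_trans (ltW tr) _; rewrite lerDl.
  by apply: le_trans (ler_normB _ _) _; apply: le_trans xb; rewrite addrC lerD2r ltW.
have dX t : dsum N (fun t : Rd => cutoff j (x - t) - cutoff j t : R[i]) t <= D + D.
  apply: le_trans (dsumB N t sXx (sX j)) _; rewrite lerD//.
  have st := smooth_translate x (sX j).
  rewrite (_ : (fun t => _) = (fun t : Rd => cutoff j (- t + x))); last by apply/funext => u; rewrite addrC.
  by rewrite (@dsum_reflect _ _ N _ t st) dsum_translate.
apply: le_trans (@int_dsum_mul N _ _ r0%:R (D + D) (U n) sXX (sG j) vin dX (weight_lm wU n) (weight_ge0 wU n)) _.
apply: le_trans (lee_wpmul2l _ (hr0 (kappa j) r0%:R (k1 j) (lexx _))) _; first by rewrite lee_fin.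
rewrite -EFinM lee_fin -/B mulrA ler_pdivrMr; last by rewrite ltr_wpDl.
by rewrite mulrC ler_wpM2l ?lerDl// ltW.
Qed.

End approximation.

(** * Continuity of convolutors *)

Section zabreiko.
Context {R : realType} {d : nat}.
Local Notation Rd := 'rV[R]_d.
Variable M : R.

Definition supported (phi : Rd -> R[i]) := is_smooth phi /\ vanish_off M phi.

Definition dsum_bdd N (phi : Rd -> R[i]) (r : R) := forall x, dsum N phi x <= r.

Lemma supported_test phi : supported phi -> is_test phi.
Proof. by move=> [sp pM]; split=> //; exists M. Qed.

Lemma supportedB phi psi : supported phi -> supported psi -> supported (fun x => phi x - psi x).
Proof. by move=> [s1 v1] [s2 v2]; split; [exact: smoothB|exact: vanish_offB]. Qed.

Lemma supportedD phi psi : supported phi -> supported psi -> supported (fun x => phi x + psi x).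
Proof. by move=> [s1 v1] [s2 v2]; split; [exact: smoothD|exact: vanish_offD]. Qed.

Lemma supportedZ c phi : supported phi -> supported (fun x => c * phi x).
Proof. by move=> [s1 v1]; split=> [|x xM]; [exact: smoothZ|rewrite v1// mulr0]. Qed.

Lemma supported0 : supported (fun=> 0).
Proof. by split; first exact: smooth_cst. Qed.

Lemma supported_sum (n : nat) (psi : nat -> Rd -> R[i]) : (forall k, supported (psi k)) ->
  supported (fun x => \sum_(k < n) psi k x).
Proof.
move=> sp; split; first by apply: (smooth_sum _ _).1 => k; case: (sp k).
by move=> x xM; rewrite big1// => k _; case: (sp k) => _ ->.
Qed.

(** The finitely many terms before [m] are absorbed by adding their bounds, divided by 2^-k, to the
    constant. *)
Lemma dominate_half (T : Type) (F : nat -> T -> R) m (B : R) : 0 <= B ->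
  (forall k, exists2 b : R, 0 <= b & forall x, F k x <= b) ->
  (forall k x, (m <= k)%N -> F k x <= B * half k) ->
  exists2 B' : R, 0 <= B' & forall k x, F k x <= B' * half k.
Proof.
move=> B0 h Fk; have /choice[b hb] : forall k, exists b : R, 0 <= b /\ forall x, F k x <= b.
  by move=> k; have [b b0 hb] := h k; exists b.
have h0 k : 0 < half k :> R by exact: half_gt0.
have s0 k : 0 <= b k / half k by rewrite divr_ge0 ?(ltW (h0 k))//; case: (hb k).
exists (B + \sum_(k < m) b k / half k) => [|k x]; first by rewrite addr_ge0// sumr_ge0.
have [mk|km] := leqP m k.
  apply: le_trans (Fk k x mk) _; rewrite ler_wpM2r ?(ltW (h0 k))// lerDl; exact: sumr_ge0.
apply: le_trans ((hb k).2 x) _; rewrite -ler_pdivrMr//.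
by rewrite (bigD1 (Ordinal km))//= addrCA lerDl addr_ge0// sumr_ge0.
Qed.

(** Completeness of the functions supported in a cube, for all orders at once: the k-th term is
    bounded together with its derivatives up to order [k], so each fixed word is controlled from its
    own length on. The limits along all words form a [taylor_family]. *)
Lemma supported_series (psi : nat -> Rd -> R[i]) (B : R) : 0 <= B -> (forall k, supported (psi k)) ->
  (forall k, dsum_bdd k (psi k) (B * half k)) ->
  exists2 phi, supported phi & forall N n, (N <= n)%N ->
    dsum_bdd N (fun x => phi x - \sum_(k < n) psi k x) (wordcount (R := R) (d := d) N * (B * (2 * half n))).
Proof.
move=> B0 sp pB; have sps k : is_smooth (psi k) by case: (sp k).
have big k s x : (size s <= k)%N -> normc (foldr pder (psi k) s x) <= B * half k.
  by move=> sk; apply: le_trans (pB k x); exact: normc_foldr_le.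
have dom s : exists2 B' : R, 0 <= B' & forall k x, normc (foldr pder (psi k) s x) <= B' * half k.
  apply: (@dominate_half _ (fun k x => normc (foldr pder (psi k) s x)) (size s) B) => // [k|k x].
    exact/test_bounded/test_foldr/supported_test.
  exact: big.
have /choice[G0 hG0] : forall sx : seq 'I_d * Rd, exists l : R[i],
    ccvg (fun n => \sum_(k < n) foldr pder (psi k) sx.1 sx.2) l.
  move=> [s x] /=; have [B' B'0 hB'] := dom s.
  by have [l [hl _]] := dyadic_series B'0 (fun k => hB' k x); exists l.
pose G s x := G0 (s, x); have hG s x := hG0 (s, x).
have Gt : taylor_family G.
  split=> [s L|s i L].
    have [B' B'0 hB'] := dom s; exists (B' * (2 * half 0)) => x _.
    apply: ccvg_normc_le (hG s x) _; exists 0%N => n _; apply: le_trans (normc_sum _ _ _) _.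
    rewrite -(big_mkord xpredT (fun k => normc (foldr pder (psi k) s x))).
    by apply: sum_half => // k _; exact: hB'.
  have [B' B'0 hB'] := dom (i :: i :: s); exists (2 * B' * (2 * half 0)) => x t _ _.
  have h := ccvgD (ccvgD (hG s (x + t *: uvec i)) (ccvgZ (-1) (hG s x))) (ccvgZ (- t%:C) (hG (i :: s) x)).
  rewrite (_ : _ - _ - _ = G s (x + t *: uvec i) + -1 * G s x + - t%:C * G (i :: s) x); last by ring.
  apply: ccvg_normc_le h _; exists 0%N => n _.
  rewrite !mulr_sumr -!big_split /=; apply: le_trans (normc_sum _ _ _) _.
  rewrite -(big_mkord xpredT (fun k => normc (foldr pder (psi k) s (x + t *: uvec i) +
    -1 * foldr pder (psi k) s x + - t%:C * foldr pder (psi k) (i :: s) x))).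
  rewrite mulrAC; apply: sum_half => [|k _]; first by apply: mulr_ge0; [exact: mulr_ge0|exact: sqr_ge0].
  rewrite mulN1r mulNr.
  apply: le_trans (_ : 2 * (B' * half k) * t ^+ 2 <= _); last first.
    by rewrite le_eqVlt; apply/orP; left; apply/eqP; ring.
  by apply: smooth_taylor_bound => [|u _]; [exact: smooth_foldr|exact: hB'].
have [sG _] := taylor_family_smooth Gt.
exists (G [::]).
  split=> // x xM; apply: ccvg_unique (hG [::] x) _; apply: ccvg_ext (ccvg_cst 0).
  by exists 0%N => n _; rewrite big1// => k _ /=; case: (sp k) => _ ->.
move=> N n Nn x; apply: dsum_bound => s sN.
have sS : is_smooth (fun x => \sum_(k < n) psi k x) by apply: (smooth_sum _ _).1.
rewrite (_ : foldr _ _ _ = (fun x => G s x - \sum_(k < n) foldr pder (psi k) s x)); last first.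
  rewrite -(taylor_family_foldr s Gt); elim: s {sN} => [//|i s IH] /=; rewrite IH.
  have s1 := smooth_foldr s (sG [::]).
  have s2 : forall k : 'I_n, is_smooth (foldr pder (psi k) s) by move=> k; exact: smooth_foldr.
  have [s3 e3] := smooth_sum (index_enum 'I_n) s2.
  by rewrite partialB// e3.
apply: ccvg_bound (hG s x) _; exists n => m nm.
rewrite -!(big_mkord xpredT (fun k => foldr pder (psi k) s x)) (big_cat_nat (leq0n n) nm)/=.
rewrite addrAC subrr add0r; apply: le_trans (normc_sum _ _ _) _.
by apply: sum_half => // k nk; apply: big; apply: leq_trans nk; exact: leq_trans Nn.
Qed.

Variable q : (Rd -> R[i]) -> R.
Hypothesis q_ge0 : forall phi, supported phi -> 0 <= q phi.
Hypothesis q_sub : forall phi psi, supported phi -> supported psi ->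
  q (fun x => phi x - psi x) <= q phi + q psi.
Hypothesis q_scale : forall (c : R) phi, supported phi -> q (fun x => c%:C * phi x) = `|c| * q phi.
Hypothesis q_series : forall (psi : nat -> Rd -> R[i]) phi (B : R), 0 <= B -> supported phi ->
  (forall k, supported (psi k)) -> (forall k, q (psi k) <= B * half k) ->
  (forall N (e : R), 0 < e -> exists n0, forall n, (n0 <= n)%N ->
     dsum_bdd N (fun x => phi x - \sum_(k < n) psi k x) e) -> q phi <= B * 2.

(** The closure of the set q <= k contains a ball of the single seminorm [dsum N]. Closure is meant
    in the full topology, hence the arbitrary [L] and [e]. *)
Let dense_ball (k : R) phi0 N (r : R) := forall phi, supported phi -> dsum_bdd N (fun x => phi x - phi0 x) r ->
  forall L (e : R), 0 < e -> exists2 psi, supported psi & q psi <= k /\ dsum_bdd L (fun x => phi x - psi x) e.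

(* Baire: otherwise one can build a Cauchy sequence that avoids, one after the
   other, neighbourhoods of all the sets [q <= k]. *)
Lemma exists_dense_ball : exists (k : nat) phi0 (N : nat) (r : R),
  [/\ supported phi0, 0 < r & dense_ball k%:R phi0 N r].
Proof.
apply: contrapT => nd.
pose st := ((Rd -> R[i]) * nat * R)%type.
(* If no ball is good, each ball with centre in the space contains a centre some neighbourhood of
   which misses the set q <= k. The conditions on the ball stay inside the choice, as arbitrary
   states need not satisfy them. *)
have /choice[step hstep] : forall kz : nat * st, exists z' : st, supported kz.2.1.1 -> 0 < kz.2.2 ->
    [/\ supported z'.1.1, dsum_bdd kz.2.1.2 (fun x => z'.1.1 x - kz.2.1.1 x) kz.2.2, 0 < z'.2 &
      forall psi, supported psi -> q psi <= kz.1%:R -> ~ dsum_bdd z'.1.2 (fun x => z'.1.1 x - psi x) z'.2].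
  move=> [k [[phi0 N] r]] /=; apply: contrapT => /forallNP h.
  have [sp [r0 _]] : supported phi0 /\ 0 < r /\ True.
    have /not_implyP[sp /not_implyP[r0 _]] := h (phi0, N, r); by [].
  apply: nd; exists k, phi0, N, r; split=> // phi sphi pr L e e0.
  apply: contrapT => ne; apply: (h (phi, L, e)) => _ _; split=> //= psi spsi qk pL.
  by apply: ne; exists psi.
(* Halving makes the centres a Cauchy sequence whose limit is within 2r of each centre, r being the
   radius at that stage; the factor 1/4 then leaves the limit inside the excluded neighbourhood. The
   order increases beyond [k], so that all derivatives converge. *)
pose next k (z : st) : st := let z' := step (k, z) in
  (z'.1.1, maxn z.1.2 (maxn z'.1.2 k.+1), Num.min (z.2 / 2) (z'.2 / 4)).
pose z := fix z k := if k is k'.+1 then next k' (z k') else ((fun=> 0) : Rd -> R[i], 0%N, 1 : R).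
have inv k : supported (z k).1.1 /\ 0 < (z k).2.
  elim: k => [|k [IH1 IH2]] /=; first by split; [exact: supported0|].
  have [s1 _ e0 _] := hstep (k, z k) IH1 IH2.
  by split=> //; rewrite lt_min !divr_gt0.
pose f k := (z k).1.1; pose Nk k := (z k).1.2; pose r k := (z k).2.
have sf k : supported (f k) by case: (inv k).
have r0 k : 0 < r k by case: (inv k).
have Nmon j k : (j <= k)%N -> (Nk j <= Nk k)%N.
  by move=> /subnK <-; elim: (k - j)%N => //= i IH; apply: leq_trans IH _; exact: leq_maxl.
have Nge k : (k <= Nk k)%N.
  by case: k => // k; rewrite /Nk /= !leq_max leqnn !orbT.
have rS k : r k.+1 <= r k / 2 by rewrite /r /= ge_min lexx.
have rh j i : r (j + i)%N <= r j * half i.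
  elim: i => [|i IH]; first by rewrite addn0 /half expr0 mulr1.
  rewrite addnS; apply: le_trans (rS _) _; rewrite halfS mulrA ler_wpM2r//.
have df k : dsum_bdd (Nk k) (fun x => f k.+1 x - f k x) (r k).
  by have [_ h _ _] := hstep (k, z k) (sf k) (r0 k).
pose psi k x := f k.+1 x - f k x.
have sps k : supported (psi k) by exact: supportedB.
have pk k : dsum_bdd k (psi k) (1 * half k).
  move=> x; apply: le_trans (_ : dsum (Nk k) (psi k) x <= _); first exact: dsum_le.
  by apply: le_trans (df k x) _; have := rh 0%N k.
have [phi sphi hphi] := supported_series ler01 sps pk.
have tele n x : \sum_(k < n) psi k x = f n x.
  rewrite -(big_mkord xpredT (fun k => f k.+1 x - f k x)) telescope_sumr//.
  by rewrite subr0.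
have lim j : dsum_bdd (Nk j) (fun x => phi x - f j x) (2 * r j).
  move=> x; apply/ler_addgt0Pl => e e0.
  pose w : R := wordcount (R := R) (d := d) (Nk j) * 2.
  have w0 : 0 <= w by rewrite mulr_ge0 ?wordcount_ge0.
  have w1 : 0 < w + 1 by rewrite ltr_wpDl.
  have [n0 hn0] := half_small (divr_gt0 e0 w1).
  pose n := maxn (maxn (Nk j) n0) j.
  have jn : (j <= n)%N by exact: leq_maxr.
  have Nn : (Nk j <= n)%N by rewrite /n !leq_max leqnn.
  have hn : half n <= e / (w + 1) by apply: hn0; rewrite /n !leq_max leqnn orbT.
  have -> : (fun x => phi x - f j x) = (fun x => (phi x - f n x) + (f n x - f j x)).
    by apply/funext => y; rewrite addrA subrK.
  have s1 : is_smooth (fun x => phi x - f n x) by exact: (supportedB sphi (sf n)).1.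
  have s2 : is_smooth (fun x => f n x - f j x) by exact: (supportedB (sf n) (sf j)).1.
  apply: le_trans (dsumD _ _ s1 s2) _; apply: lerD.
    have := hphi _ _ Nn x; under [X in dsum _ X]eq_fun do rewrite tele.
    move=> h; apply: le_trans h _; rewrite mul1r mulrA -/w.
    rewrite ler_pdivlMr// in hn; apply: le_trans hn; rewrite mulrC ler_wpM2l ?half_ge0//.
    by rewrite lerDl.
  have -> : (fun x => f n x - f j x) = (fun x => \sum_(i < n - j) psi (j + i)%N x).
    apply/funext => y; rewrite -(big_mkord xpredT (fun i => psi (j + i)%N y)).
    have -> : \sum_(0 <= i < n - j) psi (j + i)%N y = \sum_(j <= i < n) psi i y.
      by rewrite -[in RHS](add0n j) big_addn; apply: eq_bigr => i _; rewrite addnC.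
    by rewrite /psi (telescope_sumr (fun i => f i y) jn).
  apply: le_trans (dsum_sum _ _ _ _) _; first by move=> i; case: (sps (j + i)%N).
  rewrite -(big_mkord xpredT (fun i => dsum (Nk j) (psi (j + i)%N) x)).
  apply: le_trans (sum_half (B := r j) _ (ltW (r0 j)) _) _ => [i _|].
    apply: le_trans (rh j i); apply: le_trans (df (j + i)%N x).
    by apply: dsum_le; apply: Nmon; exact: leq_addr.
  by rewrite /half expr0 mulr1 mulrC.
(* The limit lies in the neighbourhood excluded for this [k], although q phi <= k. *)
pose k := Num.bound (q phi).
have [_ _ e0 hk] := hstep (k, z k) (sf k) (r0 k).
apply: (hk phi sphi); first exact/ltW/archi_boundP/q_ge0.
move=> x; have sB : is_smooth (fun x => phi x - f k.+1 x) by exact: (supportedB sphi (sf k.+1)).1.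
have -> : (fun x => (step (k, z k)).1.1 x - phi x) = (fun x => - (phi x - f k.+1 x)).
  by apply/funext => y; rewrite opprB.
rewrite dsum_opp//; apply: le_trans (_ : dsum (Nk k.+1) (fun x => phi x - f k.+1 x) x <= _).
  by apply: dsum_le; rewrite /Nk /= !leq_max leqnn !orbT.
apply: le_trans (lim k.+1 x) _.
have : r k.+1 <= (step (k, z k)).2 / 4 by rewrite /r /= ge_min lexx orbT.
by have := e0; rewrite /=; lra.
Qed.

(** Zabreiko's lemma: a countably subadditive seminorm on a Frechet space is continuous. Baire gives
    density in a ball, which is recentred, rescaled, and turned into a bound by successive
    approximation. *)
Lemma zabreiko : exists (N : nat) (C : R), 0 <= C /\
  forall phi (s : R), supported phi -> dsum_bdd N phi s -> q phi <= C * s.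
Proof.
have [k [phi0 [N [r [s0 r0 hd]]]]] := exists_dense_ball.
have k0 : (0 : R) <= k%:R by [].
(* Half the difference of approximations to phi0 + phi and phi0 - phi approximates phi, so the ball
   may be centred at 0. *)
have claim1 phi : supported phi -> dsum_bdd N phi r -> forall L (e : R), 0 < e ->
    exists2 psi, supported psi & q psi <= k%:R /\ dsum_bdd L (fun x => phi x - psi x) e.
  move=> sp pr L e e0.
  have [psi1 s1 [q1 h1]] : exists2 psi, supported psi & q psi <= k%:R /\
      dsum_bdd L (fun x => (phi0 x + phi x) - psi x) e.
    apply: hd => //; first exact: supportedD.
    by move=> x; under [X in dsum _ X]eq_fun do rewrite addrAC subrr add0r; exact: pr.
  have [psi2 s2 [q2 h2]] : exists2 psi, supported psi & q psi <= k%:R /\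
      dsum_bdd L (fun x => (phi0 x - phi x) - psi x) e.
    apply: hd => //; first exact: supportedB.
    move=> x; under [X in dsum _ X]eq_fun do rewrite addrAC subrr add0r.
    by rewrite dsum_opp; [exact: pr|case: sp].
  have sB := supportedB s1 s2.
  exists (fun x => (2^-1)%:C * (psi1 x - psi2 x)); first exact: supportedZ.
  have n2 : `|2^-1 : R| = 2^-1 by rewrite ger0_norm ?invr_ge0.
  split.
    rewrite (q_scale 2^-1 sB) n2 mulrC ler_pdivrMr//.
    by apply: le_trans (q_sub s1 s2) _; lra.
  move=> x.
  have a1 : is_smooth (fun x => phi0 x + phi x - psi1 x) by exact: (supportedB (supportedD s0 sp) s1).1.
  have a2 : is_smooth (fun x => phi0 x - phi x - psi2 x) by exact: (supportedB (supportedB s0 sp) s2).1.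
  rewrite (_ : (fun x => _) = (fun x => (2^-1)%:C *
    ((phi0 x + phi x - psi1 x) - (phi0 x - phi x - psi2 x)))); last first.
    apply/funext => y; rewrite (_ : phi0 y + phi y - psi1 y - _ = 2%:C * phi y - (psi1 y - psi2 y)).
      by rewrite [RHS]mulrBr [in RHS]mulrA -rmorphM mulVf ?mul1r.
    by rewrite -[2]/(1 + 1) rmorphD; ring.
  rewrite dsumZ; last exact: smoothB.
  rewrite normc_real n2 mulrC ler_pdivrMr//; apply: le_trans (dsumB _ _ a1 a2) _.
  by have := h1 x; have := h2 x; lra.
have claim2 phi (t : R) : 0 < t -> supported phi -> dsum_bdd N phi (r * t) -> forall L (e : R), 0 < e ->
    exists2 psi, supported psi & q psi <= k%:R * t /\ dsum_bdd L (fun x => phi x - psi x) e.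
  move=> t0 sp pr L e e0; have sp' := supportedZ (t^-1)%:C sp.
  have ti : `|t^-1| = t^-1 by rewrite gtr0_norm ?invr_gt0.
  have [||psi sps [qp hp]] := claim1 _ sp' _ L (e / t).
  - by move=> x; rewrite dsumZ ?normc_real ?ti; [rewrite mulrC ler_pdivrMr|case: sp].
  - exact: divr_gt0.
  exists (fun x => t%:C * psi x); first exact: supportedZ.
  split; first by rewrite (q_scale t sps) gtr0_norm// mulrC ler_wpM2r// ltW.
  move=> x; rewrite (_ : (fun x => _) = (fun x => t%:C * ((t^-1)%:C * phi x - psi x))); last first.
    by apply/funext => y; rewrite mulrBr mulrA -rmorphM mulfV ?mul1r// gt_eqF.
  rewrite dsumZ; last exact: (supportedB sp' sps).1.
  by rewrite normc_real gtr0_norm// mulrC -ler_pdivlMr.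
(* The error after j steps is at most r 2^-j for N + j derivatives and is approximated again, with q
   at most k 2^-j. Thus phi is the sum of a series to which [q_series] applies; letting the order
   grow makes the series converge for every number of derivatives. *)
have claim3 phi : supported phi -> dsum_bdd N phi r -> q phi <= k%:R * 2.
  move=> sp pr.
  have /choice[step hstep] : forall jz : nat * (Rd -> R[i]), exists psi, supported jz.2 ->
      dsum_bdd (N + jz.1) jz.2 (r * half jz.1) -> [/\ supported psi, q psi <= k%:R * half jz.1 &
      dsum_bdd (N + jz.1.+1) (fun x => jz.2 x - psi x) (r * half jz.1.+1)].
    move=> [j rho] /=; have [[sr hr]|nr] := pselect (supported rho /\ dsum_bdd (N + j) rho (r * half j)); last first.
      (* Dummy value for states that the iteration never reaches. *)
      by exists rho => sr hr; case: nr.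
    have [||psi s1 [q1 h1]] := @claim2 rho (half j) (half_gt0 j) sr _ (N + j.+1)%N (r * half j.+1).
    - by move=> x; apply: le_trans (hr x); apply: dsum_le; exact: leq_addr.
    - by rewrite mulr_gt0 ?half_gt0.
    by exists psi.
  pose rho := fix rho j := if j is j'.+1 then (fun x => rho j' x - step (j', rho j') x) else phi.
  have inv j : supported (rho j) /\ dsum_bdd (N + j) (rho j) (r * half j).
    elim: j => [|j [IH1 IH2]] /=; first by rewrite addn0 /half expr0 mulr1.
    by have [s1 _ h1] := hstep (j, rho j) IH1 IH2; split=> //; exact: supportedB.
  have hs j := hstep (j, rho j) (inv j).1 (inv j).2.
  apply: (@q_series (fun j => step (j, rho j))) => //.
  - by move=> j; case: (hs j).
  - by move=> j; case: (hs j).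
  move=> L e e0; have [n0 hn0] := half_small (divr_gt0 e0 r0).
  exists (maxn L n0) => n; rewrite geq_max => /andP[Ln n0n] x.
  have -> : (fun x => phi x - \sum_(j < n) step (nat_of_ord j, rho j) x) = rho n.
    apply/funext => y; elim: n {Ln n0n} => [|n IH]; first by rewrite big_ord0 subr0.
    by rewrite big_ord_recr /= opprD addrA IH.
  apply: le_trans (_ : dsum (N + n) (rho n) x <= _).
    by apply: dsum_le; apply: leq_trans Ln _; exact: leq_addl.
  apply: le_trans ((inv n).2 x) _; rewrite mulrC -ler_pdivlMr//; exact: hn0.
have C0 : 0 <= k%:R * 2 / r by apply: divr_ge0; [exact: mulr_ge0|exact: ltW].
exists N, (k%:R * 2 / r); split=> [//|phi s sp ps].
have s0' : 0 <= s by apply: le_trans (ps 0); exact: dsum_ge0.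
have pos (t : R) : 0 < t -> dsum_bdd N phi t -> q phi <= k%:R * 2 / r * t.
  move=> t0 pt; have sp' := supportedZ (r / t)%:C sp.
  have rt : `|r / t| = r / t by rewrite gtr0_norm ?divr_gt0.
  have := claim3 _ sp' _; rewrite (q_scale _ sp) rt => h.
  have {}h : r / t * q phi <= k%:R * 2.
    apply: h => x; rewrite dsumZ ?normc_real ?rt; last by case: sp.
    by rewrite mulrAC ler_pdivrMr// ler_pM2l//; exact: pt.
  rewrite mulrAC ler_pdivlMr// mulrC; move: h; rewrite mulrAC ler_pdivrMr//.
(* Rescaling needs a positive radius while [s] may be 0, hence the detour through
   [s + e / (C + 1)]. *)
apply/ler_addgt0Pl => e e0; pose C := k%:R * 2 / r.
have C1 : 0 < C + 1 by rewrite ltr_wpDl.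
have := pos (s + e / (C + 1)); rewrite -/C => h.
apply: le_trans (h _ _) _; first by rewrite ltr_wpDl// divr_gt0.
  by move=> x; apply: le_trans (ps x) _; rewrite lerDl ltW// divr_gt0.
rewrite mulrDr addrC lerD2r mulrCA; apply: le_trans (_ : e * 1 <= _); last by rewrite mulr1.
by rewrite ler_wpM2l ?(ltW e0)// ler_pdivrMr// mul1r lerDl.
Qed.

End zabreiko.

(** * Bounds of a convolutor by weighted integrals of derivatives *)

Section convolutor_bounds.
Context {R : realType} {d : nat}.
Local Notation Rd := 'rV[R]_d.
Local Notation mu := (lebesgue_rV R d).
Local Notation lm := (@lebesgue_measurable R d).
Implicit Types (phi psi g : Rd -> R[i]).

Lemma cube_indic (r : R) (x : Rd) : \1_(cube r) x = (`|x| <= r)%R%:R :> R.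
Proof.
rewrite indicE; case: (boolP (`|x| <= r)) => h; first by rewrite mem_set.
by rewrite memNset//=; exact/negP.
Qed.

Definition locint N g (k : Rd) : R := \int[mu]_x (dsum N g x * \1_(cube 1) (x - k)).

Lemma lm_cube_shift (k : Rd) : lm (fun x => \1_(cube 1) (x - k)).
Proof. by apply: (@lm_translate _ _ (- k) (\1_(cube 1))); apply: lm_indic; exact: measurable_cube. Qed.

Lemma locintE N g k : is_test g -> (locint N g k)%:E = (\int[mu]_x (dsum N g x * \1_(cube 1) (x - k))%:E)%E.
Proof.
move=> tg; apply: rint_fin => [x|]; first by rewrite mulr_ge0 ?dsum_ge0.
apply: le_lt_trans (test_dsum_int N tg); apply: int_le => [x|x|]; rewrite ?mulr_ge0 ?dsum_ge0//.
by apply: aeW => x; rewrite ler_piMr ?dsum_ge0// indicE; case: (_ \in _).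
Qed.

Lemma locint_ge0 N g k : 0 <= locint N g k.
Proof. by apply: Rintegral_ge0 => x _; rewrite mulr_ge0 ?dsum_ge0. Qed.

(** The part of [g] near [k], moved back to the origin: all pieces are supported in the same unit
    cube, so constants that depend on the support are uniform in [k]. *)
Definition piece (k : Rd) g : Rd -> R[i] := fun x => theta x * g (x + k).

Lemma supported_piece k g : is_smooth g -> supported 1 (piece k g).
Proof.
move=> sg; split; first by apply: smoothM; [exact: smooth_theta|exact: smooth_translate].
by move=> x x1; rewrite /piece (theta_vanish x1) mul0r.
Qed.

(** The Sobolev embedding trades the supremum of [N] derivatives for an integral of N + d
    derivatives, which [theta] confines to the cube around [k]. *)
Lemma piece_bound N : exists2 C : R, 0 <= C & forall g k, is_test g ->
  dsum_bdd N (piece k g) (C * locint (N + d) g k).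
Proof.
have [C C0 hC] := @sobolev_dsum R d N; have [D D0 hD] := test_dsum_bounded (N + d) (@test_theta R d).
exists (C * (3 ^+ (N + d) * D)) => [|g k tg y].
  by rewrite !mulr_ge0// exprn_ge0.
have tp := supported_test (supported_piece k (test_smooth tg)).
rewrite -lee_fin; apply: le_trans (hC _ y tp) _.
rewrite -mulrA EFinM lee_wpmul2l ?lee_fin// EFinM locintE//.
have lg : lm (fun x => dsum (N + d) g x * \1_(cube 1) (x - k)).
  by apply: lmM; [exact/lm_dsum/test_smooth|exact: lm_cube_shift].
have g0 x : 0 <= dsum (N + d) g x * \1_(cube 1) (x - k) by rewrite mulr_ge0 ?dsum_ge0.
rewrite -(int_translate k lg g0) -intZ//; last 2 first.
- exact: (lm_translate k lg).
- by rewrite mulr_ge0// exprn_ge0.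
apply: int_le => [x|x|]; rewrite ?dsum_ge0 ?mulr_ge0 ?exprn_ge0 ?dsum_ge0//.
apply: aeW => x; rewrite addrK cube_indic; have [x1|x1] := leP `|x| 1; last first.
  rewrite (vanish_off_dsum _ (supported_piece k (test_smooth tg)).2 x1).
  by rewrite !mulr_ge0 ?exprn_ge0 ?dsum_ge0.
rewrite mulr1; apply: le_trans (dsumM _ _ smooth_theta (smooth_translate k (test_smooth tg))) _.
rewrite -mulrA ler_wpM2l ?exprn_ge0// dsum_translate; last exact: test_smooth.
by rewrite ler_wpM2r ?dsum_ge0.
Qed.

Lemma pieces_sum g M x : vanish_off M%:R g -> g x = \sum_k piece (lattice k) g (x - lattice (M := M) k).
Proof.
move=> gM; under eq_bigr do rewrite /piece subrK.
rewrite -mulr_suml -/(cutoff M x); have [xM|xM] := leP `|x| M%:R.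
  by rewrite cutoff_one// mul1r.
by rewrite gM// mulr0.
Qed.

(** Passing from [n] to [m] absorbs the variation of the weight on a unit cube, and at most 3^d of
    the cubes meet a point. The constant is therefore independent of the size [M] of the lattice. *)
Lemma sum_locint (U : nat -> Rd -> R) N n : weight_system U -> wM U -> exists (m : nat) (C : R), 0 <= C /\
  forall g M, is_test g -> ((\sum_k U n (lattice (M := M) k) * locint N g (lattice k))%:E <=
    C%:E * \int[mu]_x (dsum N g x * U m x)%:E)%E.
Proof.
move=> wU mU; have [m [C [_ C0 hC]]] := wM_large n 1 mU.
exists m, (C * 3 ^+ d); split; first by rewrite mulr_ge0 ?exprn_ge0 ?ltW.
move=> g M tg; have lg := lm_dsum N (test_smooth tg).
have lk k : lm (fun x => U n (lattice (M := M) k) * (dsum N g x * \1_(cube 1) (x - lattice k))).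
  by apply: lmZ; apply: lmM => //; exact: lm_cube_shift.
have k0 k x : 0 <= U n (lattice (M := M) k) * (dsum N g x * \1_(cube 1) (x - lattice k)).
  by rewrite !mulr_ge0 ?weight_ge0 ?dsum_ge0.
rewrite -sumEFin.
have -> : (\sum_k (U n (lattice (M := M) k) * locint N g (lattice k))%:E =
    \sum_k \int[mu]_x (U n (lattice (M := M) k) * (dsum N g x * \1_(cube 1) (x - lattice k)))%:E)%E.
  apply: eq_bigr => k _; rewrite EFinM locintE// intZ ?weight_ge0//.
    by apply: lmM => //; exact: lm_cube_shift.
  by move=> x; rewrite mulr_ge0 ?dsum_ge0.
rewrite -(int_sum _ lk k0) -intZ//; last 3 first.
- by apply: lmM => //; exact: weight_lm.
- by rewrite mulr_ge0 ?exprn_ge0 ?ltW.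
- by move=> x; rewrite mulr_ge0 ?dsum_ge0 ?weight_ge0.
apply: int_le => [x|x|]; first by apply: sumr_ge0 => k _; exact: k0.
  by rewrite !mulr_ge0 ?exprn_ge0 ?dsum_ge0 ?weight_ge0// ltW.
apply: aeW => x.
apply: le_trans (_ : \sum_k (C * U m x * dsum N g x) * (`|x - lattice (M := M) k| <= 1)%R%:R <= _).
  apply: ler_sum => k _; rewrite cube_indic; have [xk|xk] := leP `|x - lattice k| 1; last by rewrite !mulr0.
  rewrite !mulr1 ler_wpM2r ?dsum_ge0//.
  by have := hC x (lattice k - x); rewrite [x + _]addrC subrK -normrN opprB; apply.
rewrite -mulr_sumr; apply: le_trans (ler_wpM2l _ (lattice_overlap M x)) _.
  by rewrite !mulr_ge0 ?dsum_ge0 ?weight_ge0// ltW.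
by rewrite le_eqVlt; apply/orP; left; apply/eqP; ring.
Qed.

Variables (E : set (Rd -> R[i])) (nE : (Rd -> R[i]) -> R).
Hypotheses (HE : TIBF_bounded_type E nE) (SE : solid E nE).
Variable W : nat -> Rd -> R.
Hypotheses (wW : weight_system W) (mW : wM W).
Variable T : (Rd -> R[i]) -> R[i].
Hypothesis TO : OC_D E W T.

Let bE := tibf_bfs HE.
Let u phi := conv_functional T phi.

Lemma uE phi x : u phi x = T (fun t => phi (x - t)). Proof. exact: conv_functionalE. Qed.

Lemma T_comb c phi psi : is_test phi -> is_test psi ->
  T (fun x => c * phi x + psi x) = c * T phi + T psi.
Proof. by move=> t1 t2; apply: TO.1.1; exact/is_testP. Qed.

Lemma T0 : T (fun=> 0) = 0.
Proof.
have := T_comb 1 test_zero test_zero.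
under [X in T X]eq_fun do rewrite mulr0 addr0.
by rewrite mul1r => h; apply: (addrI (T (fun=> 0))); rewrite -h addr0.
Qed.

Lemma T_sum (I : Type) (r : seq I) (F : I -> Rd -> R[i]) : (forall k, is_test (F k)) ->
  T (fun x => \sum_(k <- r) F k x) = \sum_(k <- r) T (F k).
Proof.
move=> tF; elim: r => [|k r IH]; first by rewrite big_nil; under [X in T X]eq_fun do rewrite big_nil; exact: T0.
rewrite big_cons -IH; have := T_comb 1 (tF k) (test_sum r tF); rewrite mul1r => <-.
by congr T; apply/funext => x; rewrite big_cons mul1r.
Qed.

Lemma u_comb c phi psi x : is_test phi -> is_test psi ->
  u (fun x => c * phi x + psi x) x = c * u phi x + u psi x.
Proof. by move=> t1 t2; rewrite !uE -T_comb//; exact: test_conv_argument. Qed.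

Lemma u_sum n (F : nat -> Rd -> R[i]) x : (forall k, is_test (F k)) ->
  u (fun x => \sum_(k < n) F k x) x = \sum_(k < n) u (F k) x.
Proof.
move=> tF; rewrite uE (@T_sum _ (index_enum 'I_n) (fun (k : 'I_n) t => F k (x - t))).
  by apply: eq_bigr => k _; rewrite uE.
by move=> k; exact: test_conv_argument.
Qed.

Lemma u_bound M X : exists N (C : R), 0 <= C /\ forall phi (s : R) x, supported M phi ->
  dsum_bdd N phi s -> `|x| <= X -> normc (u phi x) <= C * s.
Proof.
have [N [C [C0 hC]]] := distribution_bound (M + X) TO.1; exists N, C; split=> // phi s x [sp pM] ps xX.
rewrite uE; apply: hC; first exact: smooth_conv_argument.
  move=> t; rewrite -ltrBrDr => h; apply: pM; apply: lt_le_trans h _.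
  have := ler_normB x (x - t); rewrite subKr => h; rewrite lerBlDr addrC.
  by apply: le_trans h _; rewrite lerD2r.
move=> t; have st := smooth_translate x sp.
rewrite (_ : (fun t => _) = (fun t : Rd => phi (- t + x))); last by apply/funext => y; rewrite addrC.
by rewrite (@dsum_reflect _ _ N _ t st) dsum_translate.
Qed.

Lemma E_weighted_u n phi : is_test phi -> E (weighted (W n) (u phi)).
Proof. by move=> /is_testP tp; have [_ /(_ n)] := TO.2 phi tp. Qed.

(** The weighted norm of T * phi is a seminorm that is finite because T is a convolutor; [zabreiko]
    turns finiteness into continuity on functions supported in a fixed cube. *)
Lemma oc_norm_bound n M : exists N (C : R), 0 <= C /\ forall phi (s : R), supported M phi ->
  dsum_bdd N phi s -> nE (weighted (W n) (u phi)) <= C * s.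
Proof.
pose q phi := nE (weighted (W n) (u phi)).
have wE phi : supported M phi -> E (weighted (W n) (u phi)).
  by move=> sp; apply: E_weighted_u; exact: supported_test sp.
apply: (@zabreiko R d M q).
- by move=> phi sp; apply: bfs_norm_ge0 bE _ (wE _ sp).
- move=> phi psi s1 s2; have t1 := supported_test s1; have t2 := supported_test s2.
  rewrite /q (_ : weighted _ _ = (fun x => weighted (W n) (u phi) x - weighted (W n) (u psi) x)).
    exact: (E_sub HE (wE _ s1) (wE _ s2)).2.
  apply/funext => x; rewrite /weighted -mulrBl; congr (_ * _).
  have := u_comb (-1) x t2 t1; rewrite mulN1r addrC => <-.
  by rewrite /u; congr conv_functional; apply/funext => y; rewrite mulN1r addrC.
- move=> c phi sp; have tp := supported_test sp.
  rewrite /q (_ : weighted _ _ = (fun x => c%:C * weighted (W n) (u phi) x)).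
    by rewrite (bfs_normZ bE _ (wE _ sp)) normc_real.
  apply/funext => x; rewrite /weighted mulrA; congr (_ * _).
  have := u_comb c%:C x tp test_zero.
  have -> : u (fun=> 0) x = 0 by rewrite uE T0.
  by rewrite addr0 => <-; rewrite /u; congr conv_functional; apply/funext => y; rewrite addr0.
move=> psi phi B B0 sp sps qB pc.
have tp := supported_test sp; have tps k := supported_test (sps k).
pose F k := weighted (W n) (u (psi k)); have EF k : E (F k) by exact: wE.
(* Pointwise convergence follows from the continuity of the distribution [T]; [E_series] then
   recognises the same limit in the norm of [E]. *)
have cv x : ccvg (fun m => \sum_(k < m) F k x) (weighted (W n) (u phi) x).
  move=> e e0; have [N [C [C0 hC]]] := u_bound M `|x|.
  have A0 : 0 < C * W n x + 1 by rewrite ltr_wpDl// mulr_ge0 ?weight_ge0.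
  have [n0 hn0] := pc N _ (divr_gt0 e0 A0); exists n0 => m mn.
  have sS : supported M (fun x => \sum_(k < m) psi k x) by exact: supported_sum.
  have -> : \sum_(k < m) F k x - weighted (W n) (u phi) x =
      - (u (fun x => phi x - \sum_(k < m) psi k x) x * (W n x)%:C).
    rewrite /F /weighted -mulr_suml -mulrBl -mulNr; congr (_ * _).
    have := u_comb (-1) x (supported_test sS) tp; rewrite (u_sum _ _ tps) mulN1r => h.
    rewrite -[LHS]opprB; congr (- _); rewrite addrC -h /u; congr conv_functional.
    by apply/funext => y; rewrite mulN1r addrC.
  rewrite normc_opp normcM normc_real ger0_norm ?weight_ge0//.
  have := hC _ _ x (supportedB sp sS) (hn0 m mn) (lexx _) => h.
  apply: le_trans (ler_wpM2r (weight_ge0 wW n x) h) _.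
  rewrite (_ : C * _ * _ = e * (C * W n x / (C * W n x + 1))); last by ring.
  by rewrite ler_piMr ?(ltW e0)// ler_pdivrMr// mul1r lerDl.
have [Ew lim] := E_series HE (m := 0) EF B0 (fun k _ => qB k) cv.
(* The limit is a partial sum, of norm at most 2B, minus an error of norm at most [e]. *)
apply/ler_addgt0Pl => e e0; have /cvgrPdist_le /(_ e e0)[m _ hm] := lim.
have := hm m (leqnn m); rewrite /= sub0r normrN.
have [ES nS] := E_sum HE (index_enum 'I_m) (fun k : 'I_m => EF k).
have [EB _] := E_sub HE ES Ew; rewrite ger0_norm ?(bfs_norm_ge0 bE EB)// => hme.
have [_] := E_sub HE ES EB.
rewrite (_ : (fun x => _) = weighted (W n) (u phi)); last by apply/funext => x; rewrite subKr.
move=> h; apply: le_trans h _; rewrite addrC lerD//; apply: le_trans nS _.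
rewrite -(big_mkord xpredT (fun k => nE (F k))); apply: le_trans (sum_half _ B0 (fun k _ => qB k)) _.
by rewrite /half expr0 mulr1.
Qed.

(** [T] is continuous on functions supported in a slightly larger cube, so it sends the quadratic
    Taylor remainders of phi to quadratic remainders of T * phi. *)
Lemma u_family phi : is_test phi -> taylor_family (fun s => u (foldr pder phi s)).
Proof.
move=> tp; case: (tp) => sp [M pM].
have sM s : supported M (foldr pder phi s) by split; [exact: smooth_foldr|exact: vanish_off_foldr].
split=> [s X|s i X].
  have [N [C [C0 hC]]] := u_bound M X; have [B B0 hB] := test_dsum_bounded N (test_foldr s tp).
  by exists (C * B) => x xX; apply: (hC _ B) => // y; exact: hB.
have [N [C [C0 hC]]] := u_bound (M + 1) X; set f := foldr pder phi s.
have tf : is_test f by exact: test_foldr.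
have [B B0 hB] := test_dsum_bounded N.+2 tf.
exists (C * (wordcount (R := R) (d := d) N * (2 * B))) => x t xX t1.
have sf := test_smooth tf.
pose r y := f (y + t *: uvec i) - f y - t%:C * pder i f y.
have s1 : is_smooth (fun y => f (y + t *: uvec i)) by exact: smooth_translate.
have sr : supported (M + 1) r.
  split; first by apply: smoothB; [exact: smoothB|apply: smoothZ; exact: smooth_partial].
  move=> y yM; have y1 : M < `|y| by apply: lt_trans yM; rewrite ltrDl.
  have y2 : M < `|y + t *: uvec i|.
    have := ler_normB (y + t *: uvec i) (t *: uvec i); rewrite addrK.
    by rewrite normrZ norm_uvec mulr1; lra.
  have fM : vanish_off M f := (sM s).2; rewrite /r !fM// (vanish_off_partial i fM y1) mulr0 !subr0.
  by [].
have -> : u f (x + t *: uvec i) - u f x - t%:C * u (foldr pder phi (i :: s)) x = u r x.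
  have ta := test_conv_argument (x + t *: uvec i) tf; have tb := test_conv_argument x tf.
  have tc := test_conv_argument x (test_partial i tf).
  have h1 := T_comb (-1) tb ta; have h2 := T_comb (- t%:C) tc (test_comb (-1) tb ta).
  rewrite !uE /=.
  rewrite (_ : T (fun t0 => r (x - t0)) = T (fun t0 => - t%:C * pder i f (x - t0) +
     (-1 * f (x - t0) + f (x + t *: uvec i - t0)))); last first.
    congr T; apply/funext => y; rewrite /r (_ : x - y + t *: uvec i = x + t *: uvec i - y); last by rewrite addrAC.
    by ring.
  by rewrite h2 h1; ring.
rewrite -mulrA; apply: hC => // y.
have := @dsum_taylor R d N f i B t y sf hB; rewrite mulrA; apply.
Qed.

Lemma u_smooth phi s : is_test phi -> is_smooth (u phi) /\ foldr pder (u phi) s = u (foldr pder phi s).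
Proof.
move=> tp; have fam := u_family tp.
by split; [exact: ((taylor_family_smooth fam).1 [::])|exact: (taylor_family_foldr s fam)].
Qed.

Lemma E_u phi : is_test phi -> E (u phi) /\ nE (u phi) <= nE (weighted (W 0%N) (u phi)).
Proof.
move=> tp; apply: (E_solid HE SE (E_weighted_u 0 tp)).
  by apply: smooth_cmeasurable; exact: (u_smooth [::] tp).1.
by apply: aeW => x; rewrite normc_weighted// ler_peMr ?normc_ge0//; exact: weight_ge1.
Qed.

(** Sobolev on the unit cube around [x] reduces the value to local integrals of derivatives. These
    are bounded by the norm of [E], and moving the cube to the origin costs only the uniform bound
    on translations; hence a bound valid for all [x]. *)
Lemma u_uniform M : exists N (C : R), 0 <= C /\ forall phi (s : R) x, supported M phi ->
  dsum_bdd N phi s -> normc (u phi x) <= C * s.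
Proof.
have [N [A [A0 hA]]] := oc_norm_bound 0 M.
have [C0 C00 hC0] := tibf_A2 HE.
have [B' hB'] := bfs_continuous bE (@compact_cube R d 1); pose B := `|B'|.
have [D D0 hD] := test_dsum_bounded d (@test_theta R d).
pose w : R := wordcount (R := R) (d := d) d; have w0 : 0 <= w by exact: wordcount_ge0.
pose K := 2 * (3 ^+ d * D * (w * (B * (C0 * A)))).
have n3 : 0 <= (3 : R) ^+ d by rewrite exprn_ge0.
have B0 : 0 <= B by exact: normr_ge0.
have CA : 0 <= C0 * A by rewrite mulr_ge0// ltW.
exists (d + N)%N, K; split; first by do !apply: mulr_ge0 => //.
move=> phi s x sp ps; have tp := supported_test sp; have [su fu] := u_smooth [::] tp.
have s0 : 0 <= s by apply: le_trans (ps 0); exact: dsum_ge0.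
pose h z := u phi (z + x); have sh : is_smooth h by exact: smooth_translate.
have spG := supported_piece x su; have tg := supported_test spG.
(* The cut-off function coincides with T * phi at the point of interest because [tent] is 1 at 0. *)
have th0 : theta (0 : Rd) = 1 :> R[i].
  rewrite /theta /prod_fun big1// => i _; rewrite mxE /tent add0r smooth_step_ge1// smooth_step_le0//.
  by rewrite subr0.
have gx : piece x (u phi) 0 = u phi x by rewrite /piece th0 mul1r add0r.
rewrite -gx -lee_fin; apply: le_trans (sobolev 0 tg) _.
have -> : K * s = 2 * (3 ^+ d * D * (w * (B * (C0 * (A * s))))) by rewrite /K; ring.
rewrite EFinM lee_wpmul2l//.
have lI : lm (\1_(cube 1)) by apply: lm_indic; exact: measurable_cube.
apply: le_trans (_ : (3 ^+ d * D)%:E * \int[mu]_y (dsum d h y * \1_(cube 1) y)%:E <= _)%E.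
  rewrite -intZ//; last 3 first.
  - by apply: lmM => //; exact: lm_dsum.
  - exact: mulr_ge0.
  - by move=> y; rewrite mulr_ge0 ?dsum_ge0.
  apply: int_le => [y|y|]; first exact: normc_ge0.
    by apply: mulr_ge0; [exact: mulr_ge0|apply: mulr_ge0 => //; exact: dsum_ge0].
  apply: aeW => y; apply: le_trans (_ : dsum d (piece x (u phi)) y <= _).
    by apply: normc_foldr_le; rewrite size_enum_ord.
  rewrite cube_indic; have [y1|y1] := leP `|y| 1; last by rewrite (vanish_off_dsum _ spG.2 y1) !mulr0.
  rewrite mulr1; apply: le_trans (dsumM d y smooth_theta sh) _.
  by rewrite -mulrA ler_wpM2l// ler_wpM2r ?dsum_ge0.
rewrite [X in (_ <= X)%E]EFinM lee_wpmul2l ?lee_fin ?mulr_ge0//.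
apply: int_dsum_bound => //; first by do !apply: mulr_ge0 => //; exact: ltW.
move=> r rd; rewrite foldr_translate// (u_smooth r tp).2.
have tr := test_foldr r tp; have [Eh nh] := E_u tr.
have Et := tibf_A1 HE (- x) Eh.
have := hB' _ Et; rewrite int_in; under [X in (X <= _)%E -> _]eq_integral do rewrite /translate opprK.
move=> hh; apply: le_trans hh _; rewrite lee_fin.
have nt : 0 <= nE (translate (- x) (u (foldr pder phi r))) by exact: bfs_norm_ge0 bE _ Et.
apply: le_trans (ler_wpM2r nt (ler_norm B')) _; rewrite ler_wpM2l//.
apply: le_trans (hC0 _ _ Eh) _; rewrite ler_wpM2l ?(ltW C00)//.
apply: le_trans nh _; apply: hA.
  by split; [exact: smooth_foldr (test_smooth tp)|exact: vanish_off_foldr sp.2].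
move=> y; apply: le_trans (dsum_foldr _ _ _ _) _; apply: le_trans (ps y).
by apply: dsum_le; rewrite leq_add2r.
Qed.

Lemma T_local k g x : is_test g -> T (fun x => piece k g (x - k)) = u (fun x => piece k g (- x)) k /\
  u (fun x => piece k g (x - k)) x = u (piece k g) (x - k).
Proof.
move=> tg; split; rewrite !uE; congr T; apply/funext => t; first by rewrite opprB.
by rewrite addrAC.
Qed.

(** [T] on the piece at [k] is the value at [k] of the convolution with a reflected piece supported
    in the unit cube, so [u_uniform] bounds it by a local integral. Summing over the lattice with
    weights at least 1 gives the integral. *)
Lemma T_int_bound (U : nat -> Rd -> R) : weight_system U -> wM U ->
  exists (N m : nat) (C : R), 0 <= C /\ forall g, is_test g ->
    ((normc (T g))%:E <= C%:E * \int[mu]_x (dsum N g x * U m x)%:E)%E.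
Proof.
move=> wU mU; have [N [A [A0 hA]]] := u_uniform 1.
have [B B0 hB] := piece_bound N; have [m [C [C0 hC]]] := sum_locint (N + d) 0 wU mU.
exists (N + d)%N, m, (A * B * C); split=> [|g tg]; first by rewrite !mulr_ge0.
case: (tg) => sg [M' gM']; pose M := Num.bound `|M'|.
have gM : vanish_off M%:R g.
  apply: vanish_off_le gM'; apply: le_trans (ler_norm _) _; exact/ltW/archi_boundP.
have tpk k : is_test (fun x => piece (lattice k) g (x - lattice (M := M) k)).
  apply: (@test_translate _ _ (piece (lattice k) g)); exact: supported_test (supported_piece _ sg).
have -> : T g = \sum_k T (fun x => piece (lattice k) g (x - lattice (M := M) k)).
  by rewrite -T_sum//; congr T; apply/funext => x; exact: pieces_sum.
rewrite EFinM -muleA; apply: le_trans (lee_wpmul2l _ (hC g M tg)); last by rewrite lee_fin mulr_ge0.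
rewrite -EFinM lee_fin mulr_sumr; apply: le_trans (normc_sum _ _ _) _; apply: ler_sum => k _.
rewrite (T_local _ 0 tg).1; have [sp1 sp2] := supported_piece (lattice k) sg.
have sr : supported 1 (fun x => piece (lattice (M := M) k) g (- x)).
  by split; [exact: smooth_reflect|exact: vanish_off_reflect].
apply: le_trans (hA _ (B * locint (N + d) g (lattice k)) _ sr _) _.
  by move=> y; rewrite dsum_reflect//; exact: hB.
rewrite mulrA ler_wpM2l ?mulr_ge0// ler_peMl ?locint_ge0//; exact: weight_ge1.
Qed.

Variable V : nat -> Rd -> R.
Hypotheses (wV : weight_system V) (mV : wM V) (mod : moderate V W).

(** This is where moderateness enters: W_n(x) <= D W_p(x - k) V_p(k) bounds the contribution of the
    piece at [k] by V_p(k) times a translate of the weighted convolution with a piece at the origin.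
    The factors V_p(k) then turn the lattice sum into a V-weighted integral. *)
Lemma u_norm_int_bound n : exists (N m : nat) (C : R), 0 <= C /\ forall g, is_test g ->
    ((nE (weighted (W n) (u g)))%:E <= C%:E * \int[mu]_x (dsum N g x * V m x)%:E)%E.
Proof.
have [p [D [_ D0 hD]]] := mod n; have [N [A [A0 hA]]] := oc_norm_bound p 1.
have [C0 C00 hC0] := tibf_A2 HE.
have [B B0 hB] := piece_bound N; have [m [C [C1 hC]]] := sum_locint (N + d) p wV mV.
pose K := D * (C0 * (A * B)); have K0 : 0 <= K by rewrite !mulr_ge0// ltW.
exists (N + d)%N, m, (K * C); split=> [|g tg]; first exact: mulr_ge0.
case: (tg) => sg [M' gM']; pose M := Num.bound `|M'|.
have gM : vanish_off M%:R g.
  apply: vanish_off_le gM'; apply: le_trans (ler_norm _) _; exact/ltW/archi_boundP.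
have tpk k : is_test (fun x => piece (lattice k) g (x - lattice (M := M) k)).
  apply: (@test_translate _ _ (piece (lattice k) g)); exact: supported_test (supported_piece _ sg).
have Ek k := E_weighted_u n (tpk k).
have -> : weighted (W n) (u g) =
    (fun x => \sum_k weighted (W n) (u (fun x => piece (lattice k) g (x - lattice (M := M) k))) x).
  apply/funext => x; rewrite /weighted -mulr_suml; congr (_ * _).
  rewrite uE -(eq_bigr _ (fun k _ => esym (uE (fun x => piece (lattice k) g (x - lattice (M := M) k)) x))).
  rewrite -(@T_sum _ (index_enum _) (fun k t => piece (lattice k) g (x - t - lattice (M := M) k))); last first.
    by move=> k; exact: test_conv_argument x (tpk k).
  by congr T; apply/funext => t; exact: pieces_sum.
rewrite EFinM -muleA; apply: le_trans (lee_wpmul2l _ (hC g M tg)); last by rewrite lee_fin.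
rewrite -EFinM lee_fin mulr_sumr; apply: le_trans (E_sum HE _ Ek).2 _; apply: ler_sum => k _.
set z := lattice k; have sp := supported_piece z sg.
have Ep := E_weighted_u p (supported_test sp); have Et := tibf_A1 HE z Ep.
have EK := bfs_memZ bE (D * V p z)%:C Et.
have DV : 0 <= D * V p z by rewrite mulr_ge0 ?weight_ge0// ltW.
apply: le_trans (_ : nE (fun x => (D * V p z)%:C * translate z (weighted (W p) (u (piece z g))) x) <= _).
  apply: (E_solid HE SE EK _ _).2; first exact: L1loc_cmeasurable (bfs_L1loc bE (Ek k)).
  apply: aeW => x; rewrite [leRHS]normcM [X in _ <= X * _]normc_real (ger0_norm DV) /translate !normc_weighted//.
  rewrite (T_local _ x tg).2 -/z mulrCA ler_wpM2l ?normc_ge0//.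
  by have := hD (x - z) z; rewrite subrK mulrAC.
rewrite (bfs_normZ bE _ Et) normc_real (ger0_norm DV).
rewrite (_ : K * _ = D * V p z * (C0 * (A * (B * locint (N + d) g z)))); last by rewrite /K; ring.
rewrite ler_wpM2l//; apply: le_trans (hC0 _ _ Ep) _; rewrite ler_wpM2l ?(ltW C00)//.
by apply: hA => // y; exact: hB.
Qed.

End convolutor_bounds.

(** * Extension of convolutors *)

Section extension.
Context {R : realType} {d : nat}.
Local Notation Rd := 'rV[R]_d.
Local Notation mu := (lebesgue_rV R d).
Local Notation lm := (@lebesgue_measurable R d).
Implicit Types (phi psi f g p : Rd -> R[i]).

Lemma cint_sub (F : Rd -> R[i]) (x : Rd) : cmeasurable F -> cintegral (fun y => F (x - y)) = cintegral F.
Proof.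
move=> mF; have mT := cmeasurable_translate x mF.
rewrite -[RHS](cint_translate x mF) -[RHS](cint_reflect mT).
by congr cintegral; apply/funext => y; rewrite addrC.
Qed.

Lemma conv_comm f g x : L1loc f -> is_test g -> conv f g x = conv g f x.
Proof.
move=> fL tg; have L := L1loc_mul_test fL (test_conv_shift x tg).
rewrite /conv -(cint_sub x (L1_cmeasurable L)).
by congr cintegral; apply/funext => y; rewrite subKr mulrC.
Qed.

Lemma reflect_wM (V : nat -> Rd -> R) : wM V -> wM (fun n => Defs.reflect (V n)).
Proof.
move=> mV n; have [m [C [nm C0 h]]] := mV n; exists m, C; split=> // x y y1.
rewrite /Defs.reflect opprD; apply: h; rewrite /enorm.
by under eq_bigr do rewrite mxE sqrrN.
Qed.

Lemma L1_sub f (x : Rd) : L1 f -> L1 (fun t => f (x - t)).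
Proof.
move=> [mf foo]; have lf := cmeasurable_normc mf.
have mT := cmeasurable_reflect (cmeasurable_translate x mf).
split; first by move: mT; under eq_fun do rewrite addrC.
have lT := lm_translate x lf.
rewrite (_ : (\int[mu]_t _)%E = (\int[mu]_t (normc (f (- t + x)))%:E)%E); last first.
  by apply: eq_integral => t _; rewrite addrC.
rewrite (int_reflect lT) => [|t]; last exact: normc_ge0.
by rewrite (@int_translate _ _ x (fun t => normc (f t)) lf)// => t; exact: normc_ge0.
Qed.

Lemma weak_deriv_sub a f g (x : Rd) : L1 f -> L1 g -> weak_deriv_of a f g ->
  weak_deriv_of a (fun t => f (x - t)) (fun t => (-1) ^+ mi_order a * g (x - t)).
Proof.
move=> fL gL /weak_deriv_ofP[_ _ fg]; apply/weak_deriv_ofP; split.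
- exact/L1_L1loc/L1_sub.
- exact/L1_L1loc/L1Z/L1_sub.
move=> p tp; have tx := test_conv_shift x tp; have := fg _ tx.
rewrite foldr_conv; last exact: test_smooth.
rewrite size_mi_word => h.
have L1' := L1loc_mul_test (L1_L1loc fL) (test_conv_shift x (test_foldr (mi_word a) tp)).
have L2' := L1loc_mul_test (L1_L1loc gL) tx.
have e1 : cintegral (fun t => f (x - t) * foldr pder p (mi_word a) t) =
    cintegral (fun y => f y * foldr pder p (mi_word a) (x - y)).
  rewrite -(cint_sub x (L1_cmeasurable L1')).
  by congr cintegral; apply/funext => y; rewrite subKr.
have e2 : cintegral (fun t => (-1) ^+ mi_order a * g (x - t) * p t) =
    (-1) ^+ mi_order a * cintegral (fun y => g y * p (x - y)).
  rewrite -cintZ// -(cint_sub x (L1_cmeasurable (L1Z _ L2'))).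
  by congr cintegral; apply/funext => y; rewrite subKr mulrA.
have e3 : cintegral (fun y => f y * ((-1) ^+ mi_order a * foldr pder p (mi_word a) (x - y))) =
    (-1) ^+ mi_order a * cintegral (fun y => f y * foldr pder p (mi_word a) (x - y)).
  by rewrite -cintZ//; congr cintegral; apply/funext => y; rewrite mulrCA.
by rewrite e1 e2 -h e3 signrMK.
Qed.

(** The convolution evaluates the functional at t |-> f (x - t). This argument lies in the K^1 space
    of the reflected weights, [wM_large] absorbing the fixed shift [x]. *)
Lemma K1_sub V f (x : Rd) : weight_system V -> wM V -> K1 V f ->
  K1 (fun n => Defs.reflect (V n)) (fun t => f (x - t)).
Proof.
move=> wV mV fK; have fL := K1_L1 wV fK; split; first exact/L1_L1loc/L1_sub.
move=> n a _; have [m [C [_ C0 hC]]] := wM_large n `|x| mV.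
have [fw gL] := K1_weak_deriv wV a m fK; set g := weak_deriv a f in fw gL.
have lg : cmeasurable g by have [_ /L1loc_cmeasurable] := fw.
have g1 : L1 g.
  apply: (@L1_dom _ _ _ (fun x => normc (weighted (V m) g x))) => // [y||]; first exact: normc_ge0.
    by apply: aeW => y; rewrite normc_weighted// ler_peMr ?normc_ge0//; exact: weight_ge1.
  by case: gL.
exists (fun t => (-1) ^+ mi_order a * g (x - t)); first exact: weak_deriv_sub.
have wV' := reflect_weight_system wV.
have gs := L1Z ((-1) ^+ mi_order a) (L1_sub x g1).
have lF : lm (fun y => C * normc (weighted (V m) g y)).
  by apply: lmZ; apply: cmeasurable_normc; case: gL.
have F0 y : 0 <= C * normc (weighted (V m) g y) by rewrite mulr_ge0 ?normc_ge0 ?ltW.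
have Foo : (\int[mu]_y (C * normc (weighted (V m) g y))%:E < +oo)%E.
  rewrite intZ ?(ltW C0)//; last 2 first.
  - by apply: cmeasurable_normc; case: gL.
  - by move=> y; exact: normc_ge0.
  by apply: lte_mul_pinfty; rewrite ?lee_fin ?(ltW C0)//; case: gL.
apply: (@L1_dom _ _ _ (fun t => C * normc (weighted (V m) g (- t + x)))).
- by apply: (@weighted_cmeasurable _ _ (fun n => Defs.reflect (V n)) wV' n); case: gs.
- by move=> t; exact: F0.
- apply: aeW => t; rewrite (normc_weighted wV' n) (normc_weighted wV m) normcM addrC.
  have -> : normc ((-1) ^+ mi_order a : R[i]) = 1.
    elim: (mi_order a) => [|k IH]; first by rewrite expr0 -[1]/(1%:C) normc_real normr1.
    by rewrite exprS mulN1r normc_opp.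
  rewrite mul1r [leRHS]mulrCA ler_wpM2l ?normc_ge0//.
  have := hC (- t + x) (- x); rewrite normrN lexx => /(_ isT).
  by rewrite addrK.
rewrite (@int_reflect _ _ (fun t => C * normc (weighted (V m) g (t + x))))//; last exact: (lm_translate x lF).
by rewrite (@int_translate _ _ x _ lF F0).
Qed.

Lemma conv_comb c f g p : L1 f -> L1 g -> is_test p ->
  conv (fun x => c * f x + g x) p = (fun x => c * conv f p x + conv g p x).
Proof.
move=> fL gL tp; apply/funext => x; have tx := test_conv_shift x tp.
have L1' := L1loc_mul_test (L1_L1loc fL) tx; have L2' := L1loc_mul_test (L1_L1loc gL) tx.
rewrite /conv -cintZ// -cintD//; last exact: L1Z.
by congr cintegral; apply/funext => y; rewrite mulrDl mulrA.
Qed.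

Variables (E : set (Rd -> R[i])) (nE : (Rd -> R[i]) -> R).
Hypotheses (HE : TIBF_bounded_type E nE) (SE : solid E nE).
Variables V W : nat -> Rd -> R.
Hypotheses (wV : weight_system V) (wW : weight_system W) (mV : wM V) (mW : wM W).
Variable T : (Rd -> R[i]) -> R[i].
Hypotheses (TO : OC_D E W T) (mod : moderate V W).

Let V' n := Defs.reflect (V n).
Let wV' : weight_system V' := reflect_weight_system wV.
Let mV' : wM V' := reflect_wM mV.
Let mol := @mollifier R d.
Let mk : kernel_seq mol := @mollifier_kernel R d.
Let rmol j (x : Rd) := mol j (- x).
Let rk : kernel_seq rmol := reflect_kernel mk.

(** Defined as a limit for each phi separately, with default value 0; linearity and continuity are
    read off from the approximants. *)
Definition extension phi : R[i] := xget 0 [set l | ccvg (fun j => T (approx mol phi j)) l].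

Lemma T_sub f g : is_test f -> is_test g -> T (fun x => f x - g x) = T f - T g.
Proof.
move=> tf tg; have := T_comb TO (-1) tg tf; rewrite mulN1r addrC => <-.
by congr T; apply/funext => x; rewrite mulN1r addrC.
Qed.

Lemma conv_functional_sub f g x : is_test f -> is_test g ->
  conv_functional T (fun x => f x - g x) x = conv_functional T f x - conv_functional T g x.
Proof.
move=> tf tg; have t1 := test_conv_argument x tf; have t2 := test_conv_argument x tg.
by rewrite !conv_functionalE (T_sub t1 t2).
Qed.

Lemma extension_cvg phi : K1 V' phi -> ccvg (fun j => T (approx mol phi j)) (extension phi).
Proof.
move=> pK; suff [l hl] : exists l, ccvg (fun j => T (approx mol phi j)) l by exact: (@xgetI _ _ _ l).
have [N [m [C [C0 hC]]]] := T_int_bound HE SE wW TO wV' mV'.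
apply: ccauchy_ccvg => e e0; have C1 : 0 < C + 1 by rewrite ltr_wpDl.
have [J hJ] := approx_cauchy wV' mV' N m mk pK (divr_gt0 e0 C1).
exists J => j k Jj Jk; have tj := test_approx wV' j mk pK; have tk := test_approx wV' k mk pK.
rewrite -T_sub// -lee_fin; apply: le_trans (hC _ (testB tj tk)) _.
apply: le_trans (lee_wpmul2l _ (hJ j k Jj Jk)) _; first by rewrite lee_fin.
rewrite -EFinM lee_fin mulrCA -[leRHS]mulr1 ler_wpM2l ?(ltW e0)// ler_pdivrMr// mul1r lerDl.
by [].
Qed.

Lemma extension_linear : linear_on (K1 V') extension.
Proof.
move=> c f g fK gK; have h : ccvg (fun j => T (approx mol (fun x => c * f x + g x) j))
    (c * extension f + extension g).
  apply: ccvg_ext (ccvgD (ccvgZ c (extension_cvg fK)) (extension_cvg gK)); exists 0%N => j _.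
  have tf := test_approx wV' j mk fK; have tg := test_approx wV' j mk gK.
  rewrite -(T_comb TO c tf tg); congr T; apply/funext => x.
  rewrite /approx conv_comb; [by ring|exact: K1_L1 fK|exact: K1_L1 gK|].
  by case: (mk.1 j).
have h' : ccvg (fun j => T (approx mol (fun x => c * f x + g x) j)) (extension (fun x => c * f x + g x)).
  exact: (@xgetI _ _ _ _ h).
exact: ccvg_unique h' h.
Qed.

Lemma extension_dual : K1_dual V' extension.
Proof.
split; first exact: extension_linear.
have [N [m [C [C0 hC]]]] := T_int_bound HE SE wW TO wV' mV'.
have [m2 [D [D0 hD]]] := approx_bound wV' mV' N m.
exists m2, (C * D) => f fK; apply: ccvg_normc_le (extension_cvg fK) _; exists 0%N => j _.
rewrite -lee_fin; apply: le_trans (hC _ (test_approx wV' j mk fK)) _.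
by rewrite -mulrA EFinM lee_wpmul2l ?lee_fin//; exact: hD.
Qed.

(** For a test function the cutoffs eventually do nothing, and the regularisations stay in a fixed
    cube while all derivatives converge uniformly; continuity of the distribution [T] identifies the
    limit. *)
Lemma extension_test f : is_test f -> extension f = T f.
Proof.
move=> tf; case: (tf) => sf [M' /vanish_off_norm fM]; set M := `|M'| in fM.
have fL := test_L1 tf.
have [N [C [C0 hC]]] := distribution_bound (M + 1) TO.1.
pose w : R := wordcount (R := R) (d := d) N.
have w0 : 0 <= w by exact: wordcount_ge0.
have fK : K1 V' f by apply: test_K1 => //; exact: reflect_bounded (wM_bounded mV).
apply: ccvg_unique (extension_cvg fK) _ => e e0.
have A0 : 0 < C * w + 1 by rewrite ltr_wpDl// mulr_ge0.
pose q := e / (C * w + 1); have q0 : 0 < q by rewrite divr_gt0.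
have tm j : is_test (mol j) by exact: test_mollifier.
have [||J hJ] := @words_uniform d N (fun s m => forall j x, (m <= j)%N ->
    normc (foldr pder (conv f (mol j)) s x - foldr pder f s x) <= q) _ _.
- by move=> s m n mn h j x nj; apply: h; exact: leq_trans nj.
- move=> s; have ts := test_foldr s tf; have [B B0 hB] := conv_mollifier_cvg ts.
  exists (Num.bound (B / q)) => j x bj; rewrite foldr_conv_right//.
  have sw : weak_deriv_of (fun i => count_mem i s) f (foldr pder f s).
    by rewrite -(foldr_mi_word_count s sf); exact: smooth_weak_deriv.
  rewrite (conv_weak sw (tm j)) conv_comm//; last exact: smooth_L1loc (test_smooth ts).
  apply: le_trans (hB j x) _; rewrite ler_pdivrMr// mulrC -ler_pdivrMr//.
  apply/ltW/(lt_le_trans (archi_boundP _)); first by rewrite divr_ge0// ltW.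
  by rewrite ler_nat; apply: leq_trans bj (leqnSn j).
exists (maxn J (Num.bound (M + 1))) => j; rewrite geq_max => /andP[Jj Mj].
have sc : is_smooth (conv f (mol j)) by exact: smooth_conv.
have cv : vanish_off (M + 1) (conv f (mol j)).
  move=> x xM; rewrite /conv (_ : (fun y => _) = fun=> 0) ?cint0//; apply/funext => y.
  have [yM|yM] := leP `|y| M; last by rewrite fM// mul0r.
  have [_ m1 _] := mk.1 j; rewrite m1 ?mulr0//.
  have := ler_normD (x - y) y; rewrite subrK; lra.
have aE : approx mol f j = conv f (mol j).
  apply/funext => x; rewrite /approx; have [xM|xM] := leP `|x| (M + 1); last by rewrite cv// mulr0.
  rewrite cutoff_one ?mul1r//; apply: le_trans xM _.
  apply/ltW/(lt_le_trans (archi_boundP _)); first by rewrite addr_ge0 ?normr_ge0.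
  by rewrite ler_nat.
rewrite aE -T_sub//; last by split=> //; exists (M + 1).
have sB : is_smooth (fun x => conv f (mol j) x - f x) by exact: smoothB.
apply: le_trans (hC _ (w * q) sB _ _) _.
- apply: vanish_offB => //; apply: vanish_off_le fM; by rewrite lerDl.
- move=> x; apply: dsum_bound => s sN.
  rewrite (_ : foldr _ _ _ = (fun x => foldr pder (conv f (mol j)) s x - foldr pder f s x)); first exact: hJ.
  elim: s {sN} => [//|i s IH] /=; rewrite IH partialB//; exact: smooth_foldr.
rewrite (_ : C * (w * q) = e * (C * w / (C * w + 1))); last by rewrite /q; ring.
by rewrite ler_piMr ?(ltW e0)// ler_pdivrMr// mul1r lerDl.
Qed.

(** Regularising the reflected function amounts to regularising phi with the reflected kernel, which
    is why both [mol] and [rmol] occur. *)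
Lemma approx_conv_argument phi j x t : K1 V phi ->
  conv (fun t => phi (x - t)) (mol j) t = conv phi (rmol j) (x - t).
Proof.
move=> pK; have pL := K1_L1 wV pK; have [tr _ _] := rk.1 j.
have L := L1loc_mul_test (L1_L1loc pL) (test_conv_shift (x - t) tr).
rewrite /conv -(cint_sub x (L1_cmeasurable L)); congr cintegral; apply/funext => y.
by rewrite /rmol; congr (_ * mol j _); apply/rowP => i; rewrite !mxE; ring.
Qed.

(** The value at [x] is defined by approximating t |-> phi (x - t), whereas convolving an
    approximation of phi reflects its cutoff as well. The two arguments of [T] differ by the cutoffs
    only, and [approx_shift] makes that difference vanish in the limit. *)
Lemma extension_conv_cvg phi x : K1 V phi ->
  ccvg (fun j => conv_functional T (approx rmol phi j) x) (conv_functional extension phi x).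
Proof.
move=> pK; have pK' : K1 V' (fun t => phi (x - t)) by exact: K1_sub.
rewrite [conv_functional extension _ _]conv_functionalE.
have [N [m [C [C0 hC]]]] := T_int_bound HE SE wW TO wV' mV'.
have dif : ccvg (fun j => conv_functional T (approx rmol phi j) x -
    T (approx mol (fun t => phi (x - t)) j)) 0.
  move=> e e0; have C1 : 0 < C + 1 by rewrite ltr_wpDl.
  have [J hJ] := approx_shift wV' mV' N m x mk pK' (divr_gt0 e0 C1).
  exists J => j Jj; rewrite subr0 conv_functionalE.
  have t1 := test_conv_argument x (test_approx wV j rk pK).
  have t2 := test_approx wV' j mk pK'.
  rewrite -T_sub// -lee_fin; apply: le_trans (hC _ (testB t1 t2)) _.
  have -> : (fun t => approx rmol phi j (x - t) - approx mol (fun t => phi (x - t)) j t) =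
      (fun t => (cutoff j (x - t) - cutoff j t) * conv (fun t => phi (x - t)) (mol j) t).
    by apply/funext => t; rewrite /approx -approx_conv_argument// mulrBl.
  apply: le_trans (lee_wpmul2l _ (hJ j Jj)) _; first by rewrite lee_fin.
  rewrite -EFinM lee_fin mulrCA -[leRHS]mulr1 ler_wpM2l ?(ltW e0)// ler_pdivrMr// mul1r lerDl.
  by [].
have := ccvgD dif (extension_cvg pK'); rewrite add0r; apply: ccvg_ext.
by exists 0%N => j _; rewrite subrK.
Qed.

(** The approximants are Cauchy in the integrals that bound the weighted norms in [E], and they
    converge pointwise, so [E_limit] places the pointwise limit in the weighted space. *)
Lemma extension_weighted phi : K1 V phi -> weighted_space E W (conv_functional extension phi).
Proof.
move=> pK; have ta j : is_test (approx rmol phi j) by exact: test_approx rk pK.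
have cv x := extension_conv_cvg x pK.
apply: (weighted_space_intro HE wW) => [|n].
  apply: (@cmeasurable_limit _ _ (fun j => conv_functional T (approx rmol phi j))) => [j|x].
    by apply: smooth_cmeasurable; exact: (u_smooth TO [::] (ta j)).1.
  exact/ccvg_cvg/cv.
have [N [m [C [C0 hC]]]] := u_norm_int_bound HE SE wW TO wV mV mod n.
apply: (E_limit HE (u := fun j => weighted (W n) (conv_functional T (approx rmol phi j))) _ _ _).1.
- by move=> j; exact: (E_weighted_u TO n (ta j)).
- move=> e e0; have C1 : 0 < C + 1 by rewrite ltr_wpDl.
  have [J hJ] := approx_cauchy wV mV N m rk pK (divr_gt0 e0 C1).
  exists J => j k Jj Jk.
  have -> : (fun x => weighted (W n) (conv_functional T (approx rmol phi j)) x -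
       weighted (W n) (conv_functional T (approx rmol phi k)) x) =
     weighted (W n) (conv_functional T (fun x => approx rmol phi j x - approx rmol phi k x)).
    apply/funext => x; rewrite /weighted -mulrBl; congr (_ * _).
    by rewrite conv_functional_sub.
  rewrite -lte_fin; apply: le_lt_trans (hC _ (testB (ta j) (ta k))) _.
  apply: le_lt_trans (lee_wpmul2l _ (hJ j k Jj Jk)) _; first by rewrite lee_fin.
  rewrite -EFinM lte_fin mulrCA -[ltRHS]mulr1 ltr_pM2l// ltr_pdivrMr// mul1r ltrDl.
  by [].
move=> x; apply: ccvg_cvg; apply: ccvg_le (weight_ge0 wW n x) _ (cv x) => j.
by rewrite /weighted -mulrBl normcM normc_real ger0_norm ?weight_ge0// mulrC.
Qed.

Lemma sufficiency : restrict_to_D (OC_K1 V E W) T.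
Proof.
exists extension; first by split; [exact: extension_dual|move=> p; exact: extension_weighted].
by move=> p; rewrite inE => /is_testP tp; rewrite extension_test.
Qed.

End extension.

Theorem theorem5p4 (R : realType) (d : nat)
    (E : set ('rV[R]_d -> R[i])) (nE : ('rV[R]_d -> R[i]) -> R)
    (V W : nat -> 'rV[R]_d -> R) :
  TIBF_bounded_type E nE -> solid E nE ->
  weight_system V -> weight_system W -> wM V -> wM W ->
  restrict_to_D (OC_K1 V E W) = OC_D E W <-> moderate V W.
Proof.
move=> HE SE wV wW mV mW; split=> [eqD|mod].
  by apply: (necessity HE SE wV wW mV mW); rewrite -eqD.
apply/seteqP; split=> T; last by move=> TO; exact: (sufficiency HE SE wV wW mV TO mod).
move=> [S SO TS]; apply: (restrict_OC_K1 wV (wM_bounded mV) SO) => f tf.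
by apply: TS; rewrite inE; exact/is_testP.
Qed.
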